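(* Let $s\in(0,1)$, $n,m\ge 1$, and let $u:\mathbb{R}^n\times(-1,1]\to\mathbb{R}^m$ be a weak solution of $$u_t+(-\Delta)^s u=u\,\mathcal{B}(u,u)\quad\text{in }\mathbb{R}^n\times(-1,1]$$ such that $\|u\|_\infty<1$ in $\mathbb{R}^n\times(-1,1)$. Then $u\in C^{\alpha}_{loc}(\mathbb{R}^n\times(-1,1])$ for some $\alpha\in(0,1)$.
   Context: The fractional Laplacian $(-\Delta)^s$ acts componentwise in the space variable $x$ and is the Fourier multiplier of symbol $|\xi|^{2s}$; equivalently, $$(-\Delta)^s u(x)=(1-s)c_n\,\mathrm{P.V.}\int_{\mathbb{R}^n}\frac{u(x)-u(y)}{|x-y|^{n+2s}}\,dy,$$ where $(1-s)c_n>0$ denotes the corresponding normalization constant. With the same constant, for maps $u,w:\mathbb{R}^n\to\mathbb{R}^m$, $$\mathcal{B}(u,w)(x)=\frac{(1-s)c_n}{2}\int_{\mathbb{R}^n}\frac{(u(x)-u(y))\cdot(w(x)-w(y))}{|x-y|^{n+2s}}\,dy,$$ applied at each fixed time $t$; in particular $(-\Delta)^s\big(\tfrac12|u|^2\big)=u\cdot(-\Delta)^s u-\mathcal{B}(u,u)$. $\|u\|_\infty$ is the $L^\infty$ norm of $|u|$. Weak solution is understood in the standard sense: $\mathcal{B}(u,u)$ is locally integrable and the equation holds in the sense of distributions. *)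

(* Defs.v *)
From HB Require Import structures.
From mathcomp Require Import all_boot all_order all_algebra.
From mathcomp Require Import all_classical all_reals all_analysis.

Set Implicit Arguments.
Unset Strict Implicit.
Unset Printing Implicit Defensive.
Import Order.TTheory GRing.Theory Num.Theory.
Import numFieldNormedType.Exports.
Local Open Scope classical_set_scope.
Local Open Scope ring_scope.

(* 'rV[R]_n carries the sigma-algebra generated by the coordinates, which is
   the Borel one. *)
Section measurable_rV.
Context {R : realType} {n : nat}.

Let coor (i : 'I_n) (x : 'rV[R]_n) : R := x 0 i.

Let rV_set0 : g_sigma_preimage coor set0.
Proof. exact: sigma_algebra0. Qed.

Let rV_setC A : g_sigma_preimage coor A -> g_sigma_preimage coor (~` A).
Proof. exact: sigma_algebraC. Qed.

Let rV_bigcup (F : _^nat) : (forall i, g_sigma_preimage coor (F i)) ->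
  g_sigma_preimage coor (\bigcup_i (F i)).
Proof. exact: sigma_algebra_bigcup. Qed.

HB.instance Definition _ := @isMeasurable.Build default_measure_display
  'rV[R]_n (g_sigma_preimage coor) rV_set0 rV_setC rV_bigcup.

Lemma measurable_coord (i : 'I_n) :
  measurable_fun [set: 'rV[R]_n] (fun x => x 0 i).
Proof.
move=> _ Y mY; rewrite setTI; apply: sub_sigma_algebra => /=.
rewrite -bigcup_seq/=; exists i => /=; first by rewrite mem_index_enum.
by exists Y => //; rewrite setTI.
Qed.

Lemma measurable_fun_rV d (T : measurableType d) (f : T -> 'rV[R]_n) :
  (forall i, measurable_fun [set: T] (fun x => f x 0 i)) ->
  measurable_fun [set: T] f.
Proof.
move=> mf _ Y mY; rewrite setTI.
suff : g_sigma_preimage coor `<=` [set A | measurable (f @^-1` A)] by exact.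
apply: smallest_sub.
- split => /=; first by rewrite preimage_set0.
  + by move=> A mA; rewrite setTD preimage_setC; exact: measurableC.
  + by move=> F mF; rewrite preimage_bigcup; exact: bigcup_measurable.
- rewrite -bigcup_seq => A [i _ [B mB <-]] /=; rewrite setTI.
  by rewrite -[X in measurable X]setTI; exact: mf.
Qed.

End measurable_rV.

Section lebesgue_rV_step.
Context {R : realType} {n : nat}.

Definition cons_rV (p : R * 'rV[R]_n) : 'rV[R]_n.+1 :=
  \row_i oapp (p.2 0) p.1 (unlift ord0 i).

Definition uncons_rV (x : 'rV[R]_n.+1) : R * 'rV[R]_n :=
  (x 0 ord0, \row_i x 0 (lift ord0 i)).

Lemma cons_rVK : cancel cons_rV uncons_rV.
Proof.
case=> a v; congr pair; first by rewrite mxE unlift_none.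
by apply/rowP => i; rewrite !mxE liftK.
Qed.

Lemma uncons_rVK : cancel uncons_rV cons_rV.
Proof.
move=> x; apply/rowP => i; rewrite mxE.
by case: unliftP => [j|] -> /=; rewrite ?mxE.
Qed.

Lemma measurable_cons_rV : measurable_fun setT cons_rV.
Proof.
apply: measurable_fun_rV => i.
under eq_fun do rewrite mxE.
case: unliftP => [j|] _ //=.
- apply: (@measurableT_comp _ _ _ _ _ _ (fun x : 'rV[R]_n => x 0 j)) => //.
  exact: measurable_coord.
- exact: measurable_fst.
Qed.

Lemma measurable_uncons_rV : measurable_fun setT uncons_rV.
Proof.
apply: measurable_fun_pair; first exact: measurable_coord.
apply: measurable_fun_rV => i.
under eq_fun do rewrite mxE.
exact: measurable_coord.
Qed.

Variable mu : {sigma_finite_measure set 'rV[R]_n -> \bar R}.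

Definition lebesgue_cons : set 'rV[R]_n.+1 -> \bar R :=
  pushforward (@lebesgue_measure R \x mu)%E cons_rV.

Let lebesgue_cons0 : lebesgue_cons set0 = 0%E.
Proof. by rewrite /lebesgue_cons /pushforward preimage_set0 measure0. Qed.

Let lebesgue_cons_ge0 A : (0 <= lebesgue_cons A)%E.
Proof. by rewrite /lebesgue_cons /pushforward measure_ge0. Qed.

Let lebesgue_cons_sigma_additive : semi_sigma_additive lebesgue_cons.
Proof.
pose m : {measure set 'rV[R]_n.+1 -> \bar R} :=
  measure_function_pushforward__canonical__measure_function_Measure
    (@lebesgue_measure R \x mu)%E measurable_cons_rV.
exact: (@measure_semi_sigma_additive _ _ _ m).
Qed.

HB.instance Definition _ := isMeasure.Build _ _ _ lebesgue_cons
  lebesgue_cons0 lebesgue_cons_ge0 lebesgue_cons_sigma_additive.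

Let lebesgue_cons_sigma_finite : sigma_finite setT lebesgue_cons.
Proof.
have /sigma_finiteP[F [TF ndF Foo]] := sigma_finiteT (@lebesgue_measure R).
have /sigma_finiteP[G [TG ndG Goo]] := sigma_finiteT mu.
exists (fun k => uncons_rV @^-1` (F k `*` G k)).
  rewrite -preimage_bigcup (_ : \bigcup_i _ = setT) ?preimage_setT//.
  rewrite -setXTT TF TG predeqE => -[x y]; split.
    by move=> [k _ []/= ? ?]; split; exists k.
  move=> [/= [k _ Fkx] [l _ Gly]]; exists (maxn k l) => //; split.
  - by move: x Fkx; exact/subsetPset/ndF/leq_maxl.
  - by move: y Gly; exact/subsetPset/ndG/leq_maxr.
move=> k; have [mF Fk] := Foo k; have [mG Gk] := Goo k.
have mFG : measurable (F k `*` G k) by exact: measurableX.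
split; first by rewrite -[X in measurable X]setTI; exact: measurable_uncons_rV.
rewrite /lebesgue_cons /pushforward -comp_preimage.
rewrite (_ : uncons_rV \o cons_rV = id); last exact/funext/cons_rVK.
by rewrite preimage_id product_measure1E// lte_mul_pinfty// ge0_fin_numE.
Qed.

HB.instance Definition _ := Measure_isSigmaFinite.Build _ _ _ lebesgue_cons
  lebesgue_cons_sigma_finite.

End lebesgue_rV_step.

(* 'rV[R]_0 is a point, of mass 1. *)
Fixpoint lebesgue_rV {R : realType} (n : nat) :
    {sigma_finite_measure set 'rV[R]_n -> \bar R} :=
  match n with
  | 0 => dirac (0 : 'rV[R]_0)
  | n'.+1 => lebesgue_cons (lebesgue_rV n')
  end.

Definition lebesgue_rVT {R : realType} (n : nat) :
    {measure set ('rV[R]_n * measurableTypeR R) -> \bar R} :=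
  (lebesgue_rV n \x @lebesgue_measure R)%E.

Section euclidean.
Context {R : realType} {n : nat}.
Implicit Types x y : 'rV[R]_n.

Definition dotp x y : R := \sum_i x 0 i * y 0 i.

(* The library's norm on 'rV[R]_n is the sup norm. *)
Definition enorm x : R := Num.sqrt (dotp x x).

End euclidean.

Section fractional.
Context {R : realType} {n : nat}.
Implicit Types (s : R) (x y z : 'rV[R]_n.+1).

Definition fkernel s z : R := (enorm z `^ (n.+1%:R + 2 * s))^-1.

(* The constant written (1 - s) c_n: applying c * P.V. int to e^(i xi.x) gives
   c * (int (1 - cos (xi.z)) / |z|^(n + 2s) dz) e^(i xi.x), and the integral is
   |xi|^(2s) times its value at a unit vector xi (here the first one), so that
   this choice of c makes the symbol exactly |xi|^(2s). *)
Definition fconst s : R :=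
  (\int[lebesgue_rV n.+1]_z ((1 - cos (z 0 ord0)) * fkernel s z))^-1.

Definition fraclap s (f : 'rV[R]_n.+1 -> R) x : R :=
  fconst s *
  lim ((fun e : R => \int[lebesgue_rV n.+1]_(y in [set y | e < enorm (x - y)])
    ((f x - f y) * fkernel s (x - y))) @ 0^'+).

(* Valued in \bar R: for u = w the integrand is nonnegative and the integral may
   be infinite at some points. *)
Definition calB m s (u w : 'rV[R]_n.+1 -> 'rV[R]_m) x : \bar R :=
  ((fconst s / 2)%:E * \int[lebesgue_rV n.+1]_y
    (dotp (u x - u y) (w x - w y) * fkernel s (x - y))%:E)%E.

End fractional.

Section smooth.
Context {R : realType} {V : normedModType R}.

Fixpoint iter_derive (vs : seq V) (f : V -> R) : V -> R :=
  if vs is v :: vs' then 'D_v (iter_derive vs' f) else f.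

Definition smooth (f : V -> R) := forall vs : seq V,
  continuous (iter_derive vs f) /\
  forall x v, derivable (iter_derive vs f) x v.

Definition test_function (Omega : set V) (f : V -> R) :=
  [/\ smooth f, compact (closure [set x | f x != 0]) &
      closure [set x | f x != 0] `<=` Omega].

End smooth.

Section flow.
Context {R : realType} {n m : nat}.
Implicit Types u v : 'rV[R]_n.+1 * R -> 'rV[R]_m.

Definition strip (I : interval R) : set ('rV[R]_n.+1 * R) :=
  [set: 'rV[R]_n.+1] `*` [set` I].

Definition calBt s u (z : 'rV[R]_n.+1 * R) : \bar R :=
  calB s (fun x => u (x, z.2)) (fun x => u (x, z.2)) z.1.

Definition locally_integrable (D : set ('rV[R]_n.+1 * R))
    (f : 'rV[R]_n.+1 * R -> \bar R) :=
  forall K, compact K -> K `<=` D -> (lebesgue_rVT n.+1).-integrable K f.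

(* The time t = 1 is included in the local integrability, whereas the test
   functions live on the open set, where distributions are defined. The
   left-hand integrand is integrable as soon as u is bounded. *)
Definition weak_solution (s : R) u :=
  [/\ measurable_fun (strip `]-1, 1]) u,
      locally_integrable (strip `]-1, 1]) (calBt s u) &
      forall phi : 'rV[R]_n.+1 * R -> R,
        test_function (strip `]-1, 1[) phi ->
        forall i : 'I_m,
        (\int[lebesgue_rVT n.+1]_(z in strip `]-1, 1[%R)
           (u z 0 i * (fraclap s (fun x => phi (x, z.2)) z.1
                       - derive1 (fun t => phi (z.1, t)) z.2))%:E =
         \int[lebesgue_rVT n.+1]_(z in strip `]-1, 1[%R)
           ((u z 0 i * phi z)%:E * calBt s u z))%E].

Definition supnorm (D : set ('rV[R]_n.+1 * R)) u : \bar R :=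
  'N[lebesgue_rVT n.+1]_+oo[(fun z => (enorm (u z))%:E) \_ D]%E.

(* Stated with the sup norms of the library; passing to Euclidean norms only
   changes C. *)
Definition holder_loc (alpha : R) (D : set ('rV[R]_n.+1 * R)) v :=
  forall K, compact K -> K `<=` D ->
    exists C : R, forall z w, K z -> K w ->
      `|v z - v w| <= C * `|z - w| `^ alpha.

End flow.

(* Main.v *)
Require Import Defs.
From HB Require Import structures.
From mathcomp Require Import all_boot all_order all_algebra.
From mathcomp Require Import all_classical all_reals all_analysis.
From mathcomp Require Import measurable_realfun ess_sup_inf ring lra.

Set Implicit Arguments.
Unset Strict Implicit.
Unset Printing Implicit Defensive.
Import Order.TTheory GRing.Theory Num.Theory.
Import numFieldNormedType.Exports.
Local Open Scope classical_set_scope.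
Local Open Scope ring_scope.

(** Fix a constant vector $b$ and put $h=|u-b|^2$, $L=\partial_t+(-\Delta)^s$. The product rule for
    $(-\Delta)^s$ turns the system into $Lh=2\,((u-b)\cdot u-1)\,\mathcal{B}(u,u)$. Where $h\le k$
    and $|u|^2\le 1/k$ the bracket is nonpositive, so $k-h$ is a nonnegative supersolution of a
    scalar linear equation. Since $|u|\le M<1$, this remains available when $b$ is displaced by a
    fixed fraction of the radius of a ball that contains the values of $u$.

    The equation holds only in the sense of distributions, so the computation is made on
    mollifications. [Lop e] is a discrete $L$: the kernel is cut at distance $e$ and $\partial_t$ is
    a backward difference quotient. It acts on all bounded measurable functions, commutes with
    convolutions, and satisfies the product rule with an error of good sign ([Lop_sqr_le]). One
    mollifies $u$ at scale $\varepsilon$ (Jensen keeps the bound on $|u-b|^2$), applies [Lop e] to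
    the square, tests with a second, fixed mollifier, lets $e$ and $\varepsilon$ tend to $0$ while
    the quadratic term is cut at a fixed $\rho$, and finally lets $\rho\to0$, when that term tends
    to $2\mathcal{B}(u,u)$. The result is [conv_Linf_subsol]. Mollifiers supported in the past make
    everything work up to $t=1$.

    The scalar tool is a weak Harnack inequality ([harnack_step], [harnack_ae]): a supersolution
    that is nonnegative on a cylinder is bounded below, on a later cylinder, by a multiple of its
    integral over an earlier one, up to a tail term. It comes from a barrier
    $m(t)\varphi(x)-K(t-t_0+T)$, where $m'$ is proportional to the current mass of the supersolution
    in a ball: at a contact point the nonlocal operator sees that mass, and this pays for $m'$.

    The decay of oscillation ([oscillation]) is geometric. If $|u-c|\le d$ on a cylinder, consider
    the functions $|u-b|^2$ for $b=c\pm k'd\,e_i$ and lower their upper bounds by small fixed steps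
    while the cylinder shrinks. This stops after boundedly many steps ([descent]). Either one bound
    reaches $0$ and $u$ is constant there, or none can be lowered further; then, by the Harnack
    inequality, each function is close to its bound on average over an early cylinder, hence all of
    them are so at one common point $z$ ([osc_point]). Thus $|u-b|^2\le|u(z)-b|^2$ up to a small
    error for all these $b$, and the difference of the two sides is affine in $b$; a suitable $b$ in
    the convex hull is the centre of a strictly smaller ball that contains the values of $u$
    ([osc_alg]).

    Iterating on cylinders of size $r\times r^{2s}$, with the tails controlled by the previous
    scales ([centers]), gives a limit value at every point ([limit_value]). These values are Hölder
    continuous ([holder_bound]) and agree with $u$ almost everywhere ([value_ae]). *)

(** * Measure-preserving reflections and Lebesgue measure on space-time *)

Section preserves.
Context d (T : measurableType d) (R : realType).
Implicit Type (mu : {measure set T -> \bar R}) (phi : T -> T).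

Definition preserves mu phi :=
  measurable_fun setT phi /\
  forall A, measurable A -> mu (phi @^-1` A) = mu A.

Lemma preserves_integral mu phi (f : T -> \bar R) : preserves mu phi ->
  measurable_fun setT f -> (forall x, 0 <= f x)%E ->
  (\int[mu]_x f (phi x) = \int[mu]_x f x)%E.
Proof.
move=> [mphi mp] mf f0.
rewrite -[LHS]/(\int[mu]_(x in phi @^-1` setT) (f \o phi) x)%E.
rewrite -ge0_integral_pushforward//.
by apply: eq_measure_integral => A mA _; rewrite /= /pushforward mp.
Qed.

End preserves.

(** The image of the product measure has the right values on rectangles, and these determine a
    product measure. *)
Lemma preserves_prod d1 d2 (T1 : measurableType d1) (T2 : measurableType d2)
    (R : realType) (m1 : {sigma_finite_measure set T1 -> \bar R})
    (m2 : {sigma_finite_measure set T2 -> \bar R}) phi1 phi2 :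
  preserves m1 phi1 -> preserves m2 phi2 ->
  preserves (m1 \x m2)%E (fun p => (phi1 p.1, phi2 p.2)).
Proof.
move=> [mphi1 p1] [mphi2 p2].
have mphi : measurable_fun setT (fun p : T1 * T2 => (phi1 p.1, phi2 p.2)).
  by apply: measurable_fun_pair; apply: measurableT_comp.
split => // A mA.
pose m' : {measure set (T1 * T2) -> \bar R} :=
  measure_function_pushforward__canonical__measure_function_Measure
    (m1 \x m2)%E mphi.
apply/esym/(product_measure_unique (m' := m')) => // B C mB mC.
rewrite /m' /= /pushforward.
rewrite -p1// -p2// -product_measure1E//.
- by rewrite -[X in measurable X]setTI; exact: mphi1.
- by rewrite -[X in measurable X]setTI; exact: mphi2.
Qed.

(** Reflections $x\mapsto a-x$ are taken as the basic symmetry because they also give the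
    translations, as compositions of two of them. *)
Lemma lebesgue_measure_subl (R : realType) (a : R) :
  preserves (@lebesgue_measure R) (fun x : measurableTypeR R => a - x : measurableTypeR R).
Proof.
have mphi : measurable_fun setT (fun x : measurableTypeR R => a - x : measurableTypeR R).
  exact: measurable_funB.
split => // A mA.
pose m' : {measure set (measurableTypeR R) -> \bar R} :=
  measure_function_pushforward__canonical__measure_function_Measure
    (@lebesgue_measure R) mphi.
apply/esym/(lebesgue_measure_unique (mu := m')) => // _ [[b c] _ <-] /=.
rewrite /m' /= /pushforward.
rewrite (_ : _ @^-1` _ = `[a - c, a - b[%classic); last first.
  apply/seteqP; split => x /=; rewrite !in_itv/= => /andP[? ?]; apply/andP; split; lra.
rewrite !lebesgue_measure_itv/= !lte_fin ltrD2l ltrN2.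
case: ifP => // _; rewrite -!EFinD; congr (_%:E); ring.
Qed.

Section lebesgue_rV_subl.
Context {R : realType}.

Lemma lebesgue_rV_subl n (a : 'rV[R]_n) :
  preserves (lebesgue_rV n) (fun x => a - x).
Proof.
have mphi k (b : 'rV[R]_k) : measurable_fun setT (fun x : 'rV[R]_k => b - x).
  apply: measurable_fun_rV => i; under eq_fun do rewrite !mxE.
  by apply: measurable_funB => //; exact: measurable_coord.
elim: n a => [|n IH] a; split; try exact: mphi; move=> A mA.
  rewrite (_ : _ @^-1` A = A)//; apply/seteqP.
  by split => x /=; rewrite (_ : a - x = x)//; apply/rowP; case.
rewrite /= /lebesgue_cons /pushforward.
have [_ /(_ (cons_rV @^-1` A)) <-] :=
  preserves_prod (lebesgue_measure_subl (uncons_rV a).1) (IH (uncons_rV a).2).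
  rewrite (_ : cons_rV @^-1` (_ @^-1` A) =
    (fun p => ((uncons_rV a).1 - p.1, (uncons_rV a).2 - p.2)) @^-1` (cons_rV @^-1` A))//.
  apply/seteqP; split => -[x y] /=;
    rewrite (_ : a - _ = cons_rV (a 0 ord0 - x, (\row_i a 0 (lift ord0 i)) - y))//;
    apply/rowP => i; rewrite !mxE; case: unliftP => [j|] -> //=; by rewrite !mxE.
by rewrite -[X in measurable X]setTI; exact: measurable_cons_rV.
Qed.

(** The same measure as [lebesgue_rVT], under a name on which the sigma-finite structure needed for
    Fubini can be declared. *)
Definition lebT n : set ('rV[R]_n * measurableTypeR R) -> \bar R :=
  (lebesgue_rV n \x @lebesgue_measure R)%E.

HB.instance Definition _ n := Measure.on (@lebT n).

Lemma lebT_sigma_finite n : sigma_finite setT (@lebT n).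
Proof.
have /sigma_finiteP[F [TF ndF Foo]] := sigma_finiteT (@lebesgue_rV R n).
have /sigma_finiteP[G [TG ndG Goo]] := sigma_finiteT (@lebesgue_measure R).
exists (fun k => F k `*` G k).
  rewrite -setXTT TF TG predeqE => -[x y]; split.
    move=> [/= [i _ Fnx] [k _ Gky]]; exists (maxn i k) => //; split.
    - by move: x Fnx; exact/subsetPset/ndF/leq_maxl.
    - by move: y Gky; exact/subsetPset/ndG/leq_maxr.
  by move=> [i _ []/= ? ?]; split; exists i.
move=> k; have [? ?] := Foo k; have [? ?] := Goo k.
split; first exact: measurableX.
by rewrite /lebT product_measure1E// lte_mul_pinfty// ge0_fin_numE.
Qed.

HB.instance Definition _ n := Measure_isSigmaFinite.Build _ _ _ (@lebT n)
  (@lebT_sigma_finite n).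

Definition leb_rVT n : {sigma_finite_measure set ('rV[R]_n * measurableTypeR R)%type -> \bar R} :=
  @lebT n.

Lemma leb_rVT_subl n (a : ('rV[R]_n * measurableTypeR R)%type) :
  preserves (leb_rVT n) (fun z => a - z).
Proof.
have := preserves_prod (lebesgue_rV_subl a.1) (lebesgue_measure_subl a.2).
by rewrite (_ : (fun p => _) = (fun z => a - z))//; apply/funext => -[].
Qed.

Lemma lebesgue_rV_box n (a b : 'rV[R]_n) : (forall i, a 0 i <= b 0 i) ->
  measurable [set x : 'rV[R]_n | forall i, a 0 i < x 0 i < b 0 i] /\
  lebesgue_rV n [set x | forall i, a 0 i < x 0 i < b 0 i] =
  (\prod_i (b 0 i - a 0 i))%:E.
Proof.
move=> ab; split.
  rewrite (_ : mkset _ = \bigcap_(i in [set: 'I_n]) ((fun x : 'rV[R]_n => x 0 i) @^-1` `]a 0 i, b 0 i[%classic)).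
    apply: fin_bigcap_measurable => // i _.
    by rewrite -[X in measurable X]setTI; exact: measurable_coord.
  by apply/seteqP; split => x /= H i; have := H i; rewrite /= in_itv/=; last apply.
elim: n a b ab => [|n IH] a b ab.
  rewrite big_ord0 /= diracE mem_set//= => -[//].
rewrite /= /lebesgue_cons /pushforward.
pose a' : 'rV[R]_n := \row_i a 0 (lift ord0 i).
pose b' : 'rV[R]_n := \row_i b 0 (lift ord0 i).
rewrite (_ : cons_rV @^-1` _ = `]a 0 ord0, b 0 ord0[%classic `*`
  [set x : 'rV[R]_n | forall i, a' 0 i < x 0 i < b' 0 i]); last first.
  apply/seteqP; split => -[x y] /=.
    move=> H; rewrite in_itv /=; split.
      by have := H ord0; rewrite mxE unlift_none.
    by move=> i; have := H (lift ord0 i); rewrite !mxE liftK.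
  rewrite in_itv /= => -[H1 H2] i; rewrite mxE.
  by case: unliftP => [j|] -> //=; have := H2 j; rewrite !mxE.
rewrite product_measure1E//.
- rewrite IH; last by move=> i; rewrite !mxE.
  rewrite [X in (X * _)%E](lebesgue_measure_itv `]a 0 ord0, b 0 ord0[) /= lte_fin big_ord_recl.
  under eq_bigr do rewrite !mxE.
  case: ifP => [//|/negbT]; rewrite -leNgt => ba.
  by rewrite (_ : a 0 ord0 = b 0 ord0) ?subrr ?mul0r ?mul0e//; apply/eqP; rewrite eq_le ba ab.
- rewrite (_ : mkset _ = \bigcap_(i in [set: 'I_n]) ((fun x : 'rV[R]_n => x 0 i) @^-1` `]a 0 (lift ord0 i), b 0 (lift ord0 i)[%classic)).
    apply: fin_bigcap_measurable => // i _.
    by rewrite -[X in measurable X]setTI; exact: measurable_coord.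
  by apply/seteqP; split => x /= H i; have := H i; rewrite /= ?mxE in_itv/=; last apply.
Qed.

End lebesgue_rV_subl.

(** * Calculus of integrals of real-valued functions *)

Section ible.
Context d (T : measurableType d) (R : realType) (mu : {measure set T -> \bar R}).
Implicit Types (f g h : T -> R) (a b c : R).

(** Integrability over the whole space; integration over a subset is mostly expressed by an
    indicator as a factor of the integrand. *)
Definition ible f := mu.-integrable setT (EFin \o f).

Lemma ible_meas f : ible f -> measurable_fun setT f.
Proof. by move=> /measurable_int/measurable_EFinP. Qed.

Lemma ible_cvt f (F : T -> \bar R) : (forall x, F x = (f x)%:E) ->
  mu.-integrable setT F -> ible f.
Proof. by move=> /funext -> ?. Qed.

Lemma ibleD f g : ible f -> ible g -> ible (fun x => f x + g x).
Proof. by move=> fi gi; exact: (integrableD measurableT fi gi). Qed.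

Lemma ibleB f g : ible f -> ible g -> ible (fun x => f x - g x).
Proof. by move=> fi gi; exact: (integrableB measurableT fi gi). Qed.

Lemma ibleZ c f : ible f -> ible (fun x => c * f x).
Proof. by move=> fi; exact: (integrableZl measurableT c fi). Qed.

Lemma ible0 : ible (fun=> 0).
Proof. exact: integrable0. Qed.

Lemma ible_sum I (s : seq I) (F : I -> T -> R) :
  (forall i, ible (F i)) -> ible (fun x => \sum_(i <- s) F i x).
Proof.
move=> H; elim: s => [|i s IH].
  by apply: ible_cvt ible0 => x; rewrite big_nil.
by apply: ible_cvt (ibleD (H i) IH) => x; rewrite big_cons.
Qed.

Lemma ible_abs f : ible f -> ible (fun x => `|f x|).
Proof. by move=> ?; exact: integrable_norm. Qed.

Lemma ible_le g f : measurable_fun setT f -> (forall x, `|f x| <= g x) ->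
  ible g -> ible f.
Proof.
move=> mf fg ig; apply: (le_integrable measurableT _ _ ig).
  exact/measurable_EFinP.
by move=> x _; rewrite lee_fin (le_trans (fg x)) ?ler_norm.
Qed.

Lemma ibleM C f g : measurable_fun setT f -> (forall x, `|f x| <= C) ->
  ible g -> ible (fun x => f x * g x).
Proof.
move=> mf fC ig; apply: (@ible_le (fun x => C * `|g x|)).
- by apply: measurable_funM => //; exact: ible_meas.
- by move=> x; rewrite normrM ler_wpM2r.
- exact/ibleZ/ible_abs.
Qed.

Lemma ible_fin f : ible f -> (\int[mu]_x (f x)%:E)%E = (\int[mu]_x f x)%:E.
Proof. by move=> fi; rewrite /Rintegral fineK//; exact: integrable_fin_num. Qed.

Lemma ible_ge0 f (C : \bar R) : measurable_fun setT f -> (forall x, 0 <= f x) ->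
  (\int[mu]_x (f x)%:E <= C)%E -> (C < +oo)%E -> ible f.
Proof.
move=> mf f0 fC Cy; apply/integrableP; split; first exact/measurable_EFinP.
under eq_integral do rewrite /= ger0_norm//.
exact: le_lt_trans Cy.
Qed.

Lemma int_ge0_le f C : measurable_fun setT f -> (forall x, 0 <= f x) ->
  (\int[mu]_x (f x)%:E <= C%:E)%E -> ible f /\ \int[mu]_x f x <= C.
Proof.
move=> mf f0 fC; have fi : ible f by apply: ible_ge0 fC _ => //; rewrite ltry.
by split => //; rewrite -lee_fin -ible_fin.
Qed.

Lemma intD f g : ible f -> ible g ->
  \int[mu]_x (f x + g x) = \int[mu]_x f x + \int[mu]_x g x.
Proof. exact: RintegralD. Qed.

Lemma intB f g : ible f -> ible g ->
  \int[mu]_x (f x - g x) = \int[mu]_x f x - \int[mu]_x g x.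
Proof. exact: RintegralB. Qed.

Lemma intZ c f : ible f -> \int[mu]_x (c * f x) = c * \int[mu]_x f x.
Proof. exact: RintegralZl. Qed.

Lemma int0 : \int[mu]_x (0 : R) = 0.
Proof. by rewrite /Rintegral integral0. Qed.

Lemma eq_int f g : f =1 g -> \int[mu]_x f x = \int[mu]_x g x.
Proof. by move=> /funext ->. Qed.

Lemma int_sum I (s : seq I) (F : I -> T -> R) : (forall i, ible (F i)) ->
  \int[mu]_x (\sum_(i <- s) F i x) = \sum_(i <- s) \int[mu]_x F i x.
Proof.
move=> H; elim: s => [|i s IH].
  by rewrite big_nil -[RHS]int0; apply: eq_int => x; rewrite big_nil.
rewrite big_cons -IH -intD//; last exact: ible_sum.
by apply: eq_int => x; rewrite big_cons.
Qed.

Lemma int_le f g : ible f -> ible g -> (forall x, f x <= g x) ->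
  \int[mu]_x f x <= \int[mu]_x g x.
Proof. by move=> ? ? ?; exact: le_Rintegral. Qed.

Lemma int_ge0 f : (forall x, 0 <= f x) -> 0 <= \int[mu]_x f x.
Proof. by move=> ?; exact: Rintegral_ge0. Qed.

Lemma int_abs f : ible f -> `|\int[mu]_x f x| <= \int[mu]_x `|f x|.
Proof. by move=> ?; exact: le_normr_Rintegral. Qed.

Lemma int_bound f g : ible f -> ible g -> (forall x, `|f x| <= g x) ->
  `|\int[mu]_x f x| <= \int[mu]_x g x.
Proof.
by move=> fi gi fg; apply: le_trans (int_abs fi) (int_le (ible_abs fi) gi fg).
Qed.

Lemma int_ae f g : measurable_fun setT f -> measurable_fun setT g ->
  {ae mu, forall x, f x = g x} -> \int[mu]_x f x = \int[mu]_x g x.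
Proof.
move=> mf mg fg; congr fine; apply: ae_eq_integral => //; try exact/measurable_EFinP.
by apply: filterS fg => x /= -> _.
Qed.

Lemma ible_ae f g : measurable_fun setT g -> {ae mu, forall x, f x = g x} ->
  ible f -> ible g.
Proof.
move=> mg fg /integrableP[mf fy]; apply/integrableP; split; first exact/measurable_EFinP.
apply: le_lt_trans fy; rewrite le_eqVlt; apply/orP; left; apply/eqP.
apply: ae_eq_integral => //; try by apply: measurableT_comp => //; exact/measurable_EFinP.
by apply: filterS fg => x /= -> _.
Qed.

Lemma int_le_ae f g : ible f -> ible g -> {ae mu, forall x, f x <= g x} ->
  \int[mu]_x f x <= \int[mu]_x g x.
Proof.
move=> fi gi fg.
pose g' x := Num.max (f x) (g x).
have mg' : measurable_fun setT g' by apply: measurable_maxr; exact: ible_meas.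
have E : {ae mu, forall x, g x = g' x}.
  by apply: filterS fg => x fgx; rewrite /g' (max_idPr _).
rewrite (int_ae (ible_meas gi) mg' E); apply: int_le => //.
- exact: ible_ae E gi.
- by move=> x; rewrite /g' le_max lexx.
Qed.

Lemma int_gt0_ex f : ible f -> (forall x, 0 <= f x) -> \int[mu]_x f x = 0 ->
  {ae mu, forall x, f x = 0}.
Proof.
move=> fi f0 If0.
have : ae_eq mu setT (EFin \o f) (cst 0%E).
  apply/ae_eq_integral_abs => //; first by case/integrableP : fi.
  under eq_integral do rewrite /= ger0_norm//.
  by rewrite ible_fin// If0.
by apply: filterS => x /(_ I) [].
Qed.

Lemma dct (F : nat -> T -> R) f g : (forall n, measurable_fun setT (F n)) ->
  (forall n x, `|F n x| <= g x) -> ible g -> (forall x, F ^~ x @ \oo --> f x) ->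
  ible f /\ (fun n => \int[mu]_x F n x) @ \oo --> \int[mu]_x f x.
Proof.
move=> mF Fg gi Ff.
have mf : measurable_fun setT f by exact: measurable_fun_cvg mF _.
have := @dominated_convergence _ _ _ mu setT measurableT (fun n => EFin \o F n)
  (EFin \o f) (EFin \o g).
case.
- by move=> n; exact/measurable_EFinP.
- exact/measurable_EFinP.
- by apply: aeW => x _; apply/cvg_EFin; [exact: nearW|exact: Ff].
- exact: gi.
- by apply: aeW => x n _ /=; rewrite lee_fin.
move=> fi _ C; split => //.
have iF n : ible (F n) by exact: ible_le (mF n) (Fg n) gi.
have C' : (fun n => (\int[mu]_x F n x)%:E) @ \oo --> (\int[mu]_x f x)%:E.
  rewrite -ible_fin//; apply: cvg_trans C; apply: near_eq_cvg.
  by apply: nearW => n /=; rewrite ible_fin.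
exact: (fine_cvg C').
Qed.

End ible.

(** * Fubini for a bounded kernel between two integrable weights *)

Section int_swap.
Context d1 d2 (X : measurableType d1) (Y : measurableType d2) (R : realType).
Variables (m1 : {sigma_finite_measure set X -> \bar R}).
Variables (m2 : {sigma_finite_measure set Y -> \bar R}).
Variables (a : X -> R) (b : Y -> R) (f : X -> Y -> R) (C : R).
Hypotheses (ia : ible m1 a) (ib : ible m2 b).
Hypothesis mf : measurable_fun setT (fun p : X * Y => f p.1 p.2).
Hypothesis fC : forall x y, `|f x y| <= C.

Let mfx x : measurable_fun setT (f x).
Proof.
rewrite (_ : f x = (fun p : X * Y => f p.1 p.2) \o (fun y => (x, y)))//.
by apply: measurableT_comp => //; exact: measurable_fun_pair.
Qed.

Let mfy y : measurable_fun setT (f ^~ y).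
Proof.
rewrite (_ : f ^~ y = (fun p : X * Y => f p.1 p.2) \o (fun x => (x, y)))//.
by apply: measurableT_comp => //; exact: measurable_fun_pair.
Qed.

Let mab : measurable_fun setT (fun p : X * Y => a p.1 * (f p.1 p.2 * b p.2)).
Proof.
apply: measurable_funM; first by apply: measurableT_comp => //; exact: ible_meas ia.
apply: measurable_funM => //; apply: measurableT_comp => //; exact: ible_meas ib.
Qed.

Lemma ible_swapl x : ible m2 (fun y => f x y * b y).
Proof. exact: ibleM. Qed.

Lemma ible_swapr y : ible m1 (fun x => f x y * a x).
Proof. exact: (@ibleM _ _ _ _ C). Qed.

Lemma ible_prod : ible (m1 \x m2)%E (fun p => a p.1 * (f p.1 p.2 * b p.2)).
Proof.
apply/integrable12ltyP; first exact/measurable_EFinP.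
have Ib : ible m2 (fun y => `|b y|) by exact: ible_abs.
apply: (@le_lt_trans _ _ (\int[m1]_x (C * \int[m2]_y `|b y| * `|a x|)%:E)%E).
  apply: ge0_le_integral => //.
  - by move=> x _; exact: integral_ge0.
  - have mm : measurable_fun setT (fun p : X * Y => `|(a p.1 * (f p.1 p.2 * b p.2))%:E|%E).
      by apply: measurableT_comp => //; exact/measurable_EFinP.
    by have := measurable_fun_fubini_tonelli_F (m2 := m2) _ mm; apply.
  - apply/measurable_EFinP; apply: measurable_funM => //.
    by apply: measurableT_comp => //; exact: ible_meas ia.
  move=> x _ /=.
  have -> : (\int[m2]_y `|a x * (f x y * b y)|%:E = (\int[m2]_y `|a x * (f x y * b y)|%R)%:E)%E.
    by rewrite ible_fin//; apply: ible_abs; apply: ibleZ; exact: ible_swapl.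
  rewrite lee_fin -intZ// mulrC -intZ; last exact: ibleZ.
  apply: int_le; [by apply: ible_abs; apply: ibleZ; exact: ible_swapl|by do 2 apply: ibleZ|].
  by move=> y; rewrite !normrM ler_wpM2l// ler_wpM2r.
rewrite ible_fin ?ltry//.
exact/ibleZ/ible_abs.
Qed.

(** The measurability part of Tonelli concerns nonnegative functions, hence the splitting into
    positive and negative parts. *)
Lemma meas_int2 : measurable_fun setT (fun x => \int[m2]_y (f x y * b y)).
Proof.
have mm : measurable_fun setT (fun p : X * Y => f p.1 p.2 * b p.2).
  by apply: measurable_funM => //; apply: measurableT_comp => //; exact: ible_meas ib.
pose g1 (p : X * Y) := Num.max (f p.1 p.2 * b p.2) 0.
pose g2 (p : X * Y) := Num.max (- (f p.1 p.2 * b p.2)) 0.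
have mg1 : measurable_fun setT g1 by exact: measurable_maxr.
have mg2 : measurable_fun setT g2.
  by apply: measurable_maxr => //; apply: measurableT_comp.
have M (g : X * Y -> R) : measurable_fun setT g -> (forall p, 0 <= g p) ->
    measurable_fun setT (fun x => \int[m2]_y g (x, y)).
  move=> mg g0; apply: measurableT_comp => //.
  apply: (measurable_fun_fubini_tonelli_F (m2 := m2) (fun p => (g p)%:E)).
    exact/measurable_EFinP.
  by move=> p; rewrite lee_fin.
have mfb x : measurable_fun setT (fun y => f x y * b y).
  by apply: ible_meas; exact: ible_swapl.
have i1 x : ible m2 (fun y => g1 (x, y)).
  apply: (ible_le _ _ (ible_abs (ible_swapl x))).
    exact: (measurable_maxr (mfb x) (measurable_cst _)).
  by move=> y; rewrite /g1 /=; case: (lerP _ 0) => h; rewrite ?normr0 ?normr_ge0.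
have i2 x : ible m2 (fun y => g2 (x, y)).
  apply: (ible_le _ _ (ible_abs (ible_swapl x))).
    apply: (measurable_maxr _ (measurable_cst _)).
    by apply: measurableT_comp => //; exact: mfb.
  by move=> y; rewrite /g2 /=; case: (lerP _ 0) => h; rewrite ?normr0 ?normr_ge0 ?normrN.
rewrite (_ : (fun x => _) = (fun x => \int[m2]_y g1 (x, y) - \int[m2]_y g2 (x, y))).
  apply: measurable_funB; apply: M => // p; rewrite /g1 /g2 le_max lexx orbT //.
apply/funext => x; rewrite -intB//; apply: eq_int => y; rewrite /g1 /g2 /=.
by case: (lerP (f x y * b y) 0); case: (lerP (- _) 0); lra.
Qed.

Lemma int2_bound x : `|\int[m2]_y (f x y * b y)| <= C * \int[m2]_y `|b y|.
Proof.
rewrite -intZ; last exact: ible_abs.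
apply: int_bound; [exact: ible_swapl|exact/ibleZ/ible_abs|].
by move=> y; rewrite normrM ler_wpM2r.
Qed.

Lemma int_prod : \int[(m1 \x m2)%E]_p (a p.1 * (f p.1 p.2 * b p.2)) =
  \int[m1]_x (a x * \int[m2]_y (f x y * b y)).
Proof.
rewrite /Rintegral -integral12_prod_meas1; last exact: ible_prod.
congr fine; apply: eq_integral => x _; rewrite /fubini_F/=.
by rewrite -intZ; [rewrite ible_fin//; apply: ibleZ|]; exact: ible_swapl.
Qed.

Lemma int_prod2 : \int[(m1 \x m2)%E]_p (a p.1 * (f p.1 p.2 * b p.2)) =
  \int[m2]_y (b y * \int[m1]_x (f x y * a x)).
Proof.
rewrite /Rintegral -integral21_prod_meas1; last exact: ible_prod.
congr fine; apply: eq_integral => y _; rewrite /fubini_G/=.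
rewrite -intZ; last exact: ible_swapr.
rewrite -ible_fin; last exact/ibleZ/ible_swapr.
by apply: eq_integral => x _; congr (_%:E); ring.
Qed.

(** The form in which Fubini is applied to convolutions: the integrand is dominated by
    $C|a(x)||b(y)|$, so no further integrability has to be checked. *)
Lemma int_swap : \int[m1]_x (a x * \int[m2]_y (f x y * b y)) =
  \int[m2]_y (b y * \int[m1]_x (f x y * a x)).
Proof. by rewrite -int_prod int_prod2. Qed.

End int_swap.

Section preserves_real.
Context d (T : measurableType d) (R : realType) (mu : {measure set T -> \bar R}).
Variables (phi : T -> T) (pphi : preserves mu phi).

Lemma ible_preserves (f : T -> R) : ible mu f -> ible mu (fun x => f (phi x)).
Proof.
move=> fi; have mf := ible_meas fi; have mphi := pphi.1.
apply/integrableP; split; first exact/measurable_EFinP/measurableT_comp.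
rewrite (preserves_integral pphi (f := fun x => `|(f x)%:E|%E))//.
- by case/integrableP : fi.
- by apply: measurableT_comp => //; exact/measurable_EFinP.
Qed.

Lemma int_preserves (f : T -> R) : ible mu f ->
  \int[mu]_x f (phi x) = \int[mu]_x f x.
Proof.
move=> fi; have mf := ible_meas fi; have mphi := pphi.1.
have mg1 : measurable_fun setT (fun x => Num.max (f x) 0).
  exact: (measurable_maxr mf (measurable_cst _)).
have mg2 : measurable_fun setT (fun x => Num.max (- f x) 0).
  by apply: (measurable_maxr _ (measurable_cst _)); exact: measurableT_comp.
have ig1 : ible mu (fun x => Num.max (f x) 0).
  apply: (ible_le mg1 _ (ible_abs fi)) => x.
  by case: (lerP _ 0) => h; rewrite ?normr0 ?normr_ge0.
have ig2 : ible mu (fun x => Num.max (- f x) 0).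
  apply: (ible_le mg2 _ (ible_abs fi)) => x.
  by case: (lerP _ 0) => h; rewrite ?normr0 ?normr_ge0 ?normrN.
have E x : f x = Num.max (f x) 0 - Num.max (- f x) 0.
  by case: (lerP (f x) 0); case: (lerP (- _) 0); lra.
rewrite (eq_int mu E) intB// (eq_int mu (fun x => E (phi x))) intB; last 2 first.
- exact: ible_preserves ig1.
- exact: ible_preserves ig2.
congr (_ - _); congr fine.
- apply: (preserves_integral pphi (f := fun x => (Num.max (f x) 0)%:E)).
    exact/measurable_EFinP.
  by move=> x; rewrite lee_fin le_max lexx orbT.
- apply: (preserves_integral pphi (f := fun x => (Num.max (- f x) 0)%:E)).
    exact/measurable_EFinP.
  by move=> x; rewrite lee_fin le_max lexx orbT.
Qed.

End preserves_real.

(** * Comparison of the sup norm and the Euclidean norm *)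

Section rV_norms.
Context {R : realType} {n : nat}.
Implicit Types (x y : 'rV[R]_n) (r : R).

Lemma rV_norm_le x r : 0 <= r -> (`|x| <= r) <-> (forall i, `|x 0 i| <= r).
Proof.
move=> r0; rewrite /Num.norm/= mx_normrE; split.
  move=> H i; apply: le_trans H.
  by rewrite (le_bigmax_cond _ (fun ij : 'I_1 * 'I_n => `|x ij.1 ij.2|) (j := (0, i))).
by move=> H; apply/bigmax_leP; split => //= -[i j] _ /=; rewrite (ord1 i); exact: H.
Qed.

Lemma rV_norm_lt x r : 0 < r -> (`|x| < r) <-> (forall i, `|x 0 i| < r).
Proof.
move=> r0; rewrite /Num.norm/= mx_normrE; split.
  move=> H i; apply: le_lt_trans H.
  by rewrite (le_bigmax_cond _ (fun ij : 'I_1 * 'I_n => `|x ij.1 ij.2|) (j := (0, i))).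
by move=> H; apply/bigmax_ltP; split => //= -[i j] _ /=; rewrite (ord1 i); exact: H.
Qed.

Lemma rV_coord_le x i : `|x 0 i| <= `|x|.
Proof. by move: i; apply/rV_norm_le. Qed.

Lemma dotpE x : dotp x x = \sum_i x 0 i ^+ 2.
Proof. by apply: eq_bigr => i _; rewrite expr2. Qed.

Lemma dotp_ge0 x : 0 <= dotp x x.
Proof. by rewrite dotpE; apply: sumr_ge0 => i _; exact: sqr_ge0. Qed.

Lemma norm_le_enorm x : `|x| <= enorm x.
Proof.
apply/rV_norm_le; first exact: sqrtr_ge0.
move=> i; rewrite -sqrtr_sqr ler_sqrt ?dotp_ge0// dotpE (bigD1 i)//= lerDl.
by apply: sumr_ge0 => j _; exact: sqr_ge0.
Qed.

Lemma dotp_le_norm x : dotp x x <= n%:R * `|x| ^+ 2.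
Proof.
rewrite dotpE; apply: (@le_trans _ _ (\sum_(i < n) `|x| ^+ 2)).
  by apply: ler_sum => i _; rewrite -(real_normK (num_real (x 0 i))) lerXn2r ?nnegrE// rV_coord_le.
by rewrite sumr_const card_ord mulr_natl.
Qed.

Lemma enorm_le_norm x : enorm x <= n%:R * `|x|.
Proof.
rewrite -[leRHS]ger0_norm ?mulr_ge0// -sqrtr_sqr ler_sqrt ?sqr_ge0//.
apply: (le_trans (dotp_le_norm x)); rewrite exprMn ler_wpM2r ?sqr_ge0//.
by rewrite -natrX ler_nat; case: n => // k; rewrite expnS leq_pmulr// expn_gt0.
Qed.

Lemma enorm0 : enorm (0 : 'rV[R]_n) = 0.
Proof. by rewrite /enorm dotpE big1 ?sqrtr0// => i _; rewrite mxE expr0n. Qed.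

Lemma enormN x : enorm (- x) = enorm x.
Proof. by rewrite /enorm !dotpE; congr Num.sqrt; apply: eq_bigr => i _; rewrite mxE sqrrN. Qed.

Lemma enorm_gt0 x : x != 0 -> 0 < enorm x.
Proof. by move=> x0; apply: lt_le_trans (norm_le_enorm x); rewrite normr_gt0. Qed.

Lemma measurable_dotp : measurable_fun setT (fun x => dotp x x).
Proof.
apply: measurable_sum => i; apply: measurable_funM; exact: measurable_coord.
Qed.

Lemma measurable_enorm : measurable_fun setT (@enorm R n).
Proof.
have ms : measurable_fun setT (@Num.sqrt R).
  by apply: continuous_measurable_fun; exact: sqrt_continuous.
exact: measurableT_comp ms measurable_dotp.
Qed.

Lemma measurable_norm_rV : measurable_fun setT (fun x => `|x|).
Proof.
have -> : (fun x : 'rV[R]_n => `|x|) =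
    (fun x => \big[Num.max/0]_(ij : 'I_1 * 'I_n) `|x ij.1 ij.2|).
  by apply/funext => x; rewrite /Num.norm/= mx_normrE.
elim: (index_enum _) => [|ij s IH].
  by under eq_fun do rewrite big_nil; exact: measurable_cst.
under eq_fun do rewrite big_cons.
apply: measurable_maxr => //; apply: measurableT_comp => //.
by rewrite (ord1 ij.1); exact: measurable_coord.
Qed.

End rV_norms.

(** * Integrability of the singular kernel *)

Section series_bound.
Context d (T : measurableType d) (R : realType) (mu : {measure set T -> \bar R}).

Lemma sum_geo_le (q : R) n : 0 <= q < 1 -> \sum_(0 <= k < n) q ^+ k <= (1 - q)^-1.
Proof.
move=> /andP[q0 q1]; have q1' : 0 < 1 - q by rewrite subr_gt0.
have E : (1 - q) * \sum_(0 <= k < n) q ^+ k = 1 - q ^+ n.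
  elim: n => [|n IH]; first by rewrite big_geq// mulr0 expr0 subrr.
  by rewrite big_nat_recr//= mulrDr IH exprS; ring.
by rewrite -(ler_pM2l q1') E mulfV ?gt_eqF// gerBl exprn_ge0.
Qed.

(** Each value of $f$ is below one term of the series, hence below its sum, and the sum is
    integrated term by term. *)
Lemma ible_series (f : T -> R) (u : nat -> T -> R) (C1 q1 C2 q2 : R) :
  0 <= q1 < 1 -> 0 <= q2 < 1 -> 0 <= C1 -> 0 <= C2 ->
  measurable_fun setT f -> (forall k, measurable_fun setT (u k)) ->
  (forall k x, 0 <= u k x) -> (forall x, 0 <= f x) ->
  (forall x, exists k, f x <= u k x) ->
  (forall k, (\int[mu]_x (u k x)%:E <= (C1 * q1 ^+ k + C2 * q2 ^+ k)%:E)%E) ->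
  ible mu f /\ \int[mu]_x f x <= C1 / (1 - q1) + C2 / (1 - q2).
Proof.
move=> q1P q2P C10 C20 mf mu_ u0 f0 fu Iu; apply: int_ge0_le => //.
apply: (@le_trans _ _ (\int[mu]_x (\sum_(k <oo) (u k x)%:E))%E).
  apply: ge0_le_integral => //.
  - by move=> x _; rewrite lee_fin.
  - exact/measurable_EFinP.
  - by apply: ge0_emeasurable_sum => k *; rewrite ?lee_fin//; exact/measurable_EFinP.
  - move=> x _; have [k fk] := fu x.
    apply: (@le_trans _ _ (u k x)%:E); first by rewrite lee_fin.
    apply: le_trans (nneseries_lim_ge (u_ := fun k => (u k x)%:E) (P := xpredT) (m := 0) k.+1 _); last first.
      by move=> *; rewrite lee_fin.
    by rewrite big_nat_recr//= leeDr// sume_ge0// => *; rewrite lee_fin.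
rewrite integral_nneseries//; first last.
- by move=> k x _; rewrite lee_fin.
- by move=> k; exact/measurable_EFinP.
apply: lime_le.
  by apply: is_cvg_nneseries => k _ _; apply: integral_ge0 => x _; rewrite lee_fin.
apply: nearW => N; apply: (@le_trans _ _ (\sum_(0 <= k < N) (C1 * q1 ^+ k + C2 * q2 ^+ k)%:E)%E).
  by apply: lee_sum => k _.
rewrite sumEFin lee_fin big_split/= -!mulr_sumr lerD// ler_wpM2l// sum_geo_le//.
Qed.

End series_bound.

Section kernel.
Context {R : realType} {n : nat} (s : R).
Hypothesis s01 : 0 < s < 1.
Local Notation N := n.+1.
Local Notation lam := (@lebesgue_rV R N).
Local Notation K := (@fkernel R n s).
Implicit Types (x y : 'rV[R]_N) (r : R).

Let s0 : 0 < s. Proof. by case/andP: s01. Qed.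
Let s1 : s < 1. Proof. by case/andP: s01. Qed.
Let s20 : 2 * s != 0. Proof. by rewrite mulf_neq0 ?gt_eqF. Qed.

Lemma rV_ball_measure a r : 0 < r ->
  measurable [set x : 'rV[R]_N | `|a - x| < r] /\
  lam [set x | `|a - x| < r] = ((2 * r) ^+ N)%:E.
Proof.
move=> r0.
have E : [set x : 'rV[R]_N | `|a - x| < r] =
    [set x | forall i, (a - const_mx r) 0 i < x 0 i < (a + const_mx r) 0 i].
  apply/seteqP; split => x /=.
    move/(rV_norm_lt _ r0) => H i; have := H i; rewrite !mxE ltr_norml.
    by move=> /andP[? ?]; apply/andP; split; lra.
  move=> H; apply/rV_norm_lt => // i; have := H i; rewrite !mxE ltr_norml.
  by move=> /andP[? ?]; apply/andP; split; lra.
rewrite E.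
have [|? ->] := @lebesgue_rV_box R N (a - const_mx r) (a + const_mx r).
  by move=> i; rewrite !mxE; lra.
split => //; congr (_%:E).
rewrite -[in RHS](card_ord N) -prodr_const.
by apply: eq_bigr => i _; rewrite !mxE; ring.
Qed.

Lemma fkernelE x r : 0 < r -> enorm x = r -> K x = (r ^+ N * r `^ (2 * s))^-1.
Proof.
move=> r0 xr; rewrite /fkernel xr powRD; last by rewrite (gt_eqF r0) implybT.
by rewrite powR_mulrn ?ltW.
Qed.

Lemma fkernel_ge0 x : 0 <= K x.
Proof. by rewrite invr_ge0 powR_ge0. Qed.

Lemma fkernelN x : K (- x) = K x.
Proof. by rewrite /fkernel enormN. Qed.

Lemma fkernel0 : K 0 = 0.
Proof.
rewrite /fkernel enorm0 powR0 ?invr0// gt_eqF// addr_gt0 ?mulr_gt0//.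
Qed.

Lemma fkernel_le x r : 0 < r -> r <= `|x| -> K x <= (r ^+ N * r `^ (2 * s))^-1.
Proof.
move=> r0 rx; have re : r <= enorm x by exact: le_trans rx (norm_le_enorm x).
have e0 : 0 < enorm x by exact: lt_le_trans re.
rewrite (fkernelE e0 erefl) lef_pV2 ?posrE ?mulr_gt0 ?exprn_gt0 ?powR_gt0//.
apply: ler_pM; rewrite ?exprn_ge0 ?powR_ge0 ?(ltW r0)//.
- by rewrite lerXn2r ?nnegrE ?(ltW r0) ?(ltW e0).
- by rewrite ge0_ler_powR ?nnegrE ?(ltW r0) ?(ltW e0)// mulr_ge0 ?ltW.
Qed.

Lemma fkernel_ge x r : x != 0 -> `|x| <= r ->
  ((N%:R * r) ^+ N * (N%:R * r) `^ (2 * s))^-1 <= K x.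
Proof.
move=> x0 xr; have e0 := enorm_gt0 x0.
have er : enorm x <= N%:R * r.
  by apply: le_trans (enorm_le_norm x) _; rewrite ler_wpM2l.
have r0 : 0 < N%:R * r by exact: lt_le_trans er.
rewrite (fkernelE e0 erefl) lef_pV2 ?posrE ?mulr_gt0 ?exprn_gt0 ?powR_gt0//.
apply: ler_pM; rewrite ?exprn_ge0 ?powR_ge0 ?(ltW e0)//.
- by rewrite lerXn2r ?nnegrE ?(ltW r0) ?(ltW e0).
- by rewrite ge0_ler_powR ?nnegrE ?(ltW r0) ?(ltW e0)// mulr_ge0 ?ltW.
Qed.

Lemma measurable_fkernel : measurable_fun setT K.
Proof.
rewrite (_ : K = (fun t => t `^ (- (N%:R + 2 * s))) \o @enorm R N); last first.
  by apply/funext => x; rewrite /= powRN.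
exact: measurableT_comp (measurable_powR _) measurable_enorm.
Qed.

(** The factor gained by $r^{2s}$ when $r$ doubles. It lies strictly between $1$ and $4$ exactly
    because $0<s<1$: the lower bound sums the far shells, the upper one the near shells. *)
Definition kw : R := 2 `^ (2 * s).

Lemma kw_gt1 : 1 < kw.
Proof.
rewrite -[ltLHS](_ : 1 `^ (2 * s) = 1); last by rewrite powR1.
by apply: gt0_ltr_powR; rewrite ?nnegrE ?mulr_gt0// ltr1n.
Qed.

Lemma kw_lt4 : kw < 4.
Proof.
have -> : 4 = kw * 2 `^ (2 - 2 * s).
  rewrite /kw -powRD; last by rewrite pnatr_eq0 implybT.
  by rewrite addrCA subrr addr0 powR_mulrn// expr2; ring.
rewrite ltr_pMr ?powR_gt0//.
rewrite -[ltLHS](_ : 1 `^ (2 - 2 * s) = 1); last by rewrite powR1.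
by apply: gt0_ltr_powR; rewrite ?nnegrE ?ltr1n//; have := s1; lra.
Qed.

Lemma kw_pow r k : 0 < r -> (2 ^+ k * r) `^ (2 * s) = kw ^+ k * r `^ (2 * s).
Proof.
move=> r0; rewrite powRM ?exprn_ge0 ?(ltW r0)//; congr (_ * _).
by rewrite -powR_mulrn// powRAC powR_mulrn ?powR_ge0.
Qed.

(** The kernel weighted by $\min(1,|x|^2/r^2)$. It dominates both the kernel away from the origin
    and the second differences of a $C^2$ function near it. *)
Definition kJ r x : R := Num.min 1 (`|x| ^+ 2 / r ^+ 2) * K x.

(** Sum of two geometric series, of ratio $1/$[kw] for the shells outside the ball of radius $r$ and
    [kw]$/4$ for the shells inside. *)
Definition kC : R := 4 ^+ N / (1 - kw^-1) + (4 ^+ N * kw) / (1 - kw / 4).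

Lemma kC_gt0 : 0 < kC.
Proof.
have := kw_gt1; have := kw_lt4 => w4 w1.
have w0 : 0 < kw by exact: lt_trans w1.
have i1 : kw^-1 < 1 by rewrite invf_lt1.
rewrite addr_gt0// divr_gt0 ?exprn_gt0 ?mulr_gt0 ?exprn_gt0//; lra.
Qed.

Lemma kJ_ge0 r x : 0 <= kJ r x.
Proof. by rewrite mulr_ge0 ?fkernel_ge0// le_min ler01 divr_ge0 ?sqr_ge0. Qed.

Lemma measurable_kJ r : measurable_fun setT (kJ r).
Proof.
apply: measurable_funM; last exact: measurable_fkernel.
apply: measurable_minr => //; apply: measurable_funM => //.
by apply: measurable_funX; exact: measurable_norm_rV.
Qed.

(** Dyadic shells replace polar coordinates. On the shell between $2^kr$ and $2^{k+1}r$ the weight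
    is at most [A k], on the one between $r/2^{k+1}$ and $r/2^k$ at most [B k], and each shell is
    enlarged to a ball of known volume. *)
Lemma kJ_int r : 0 < r -> ible lam (kJ r) /\
  \int[lam]_x kJ r x <= kC / r `^ (2 * s).
Proof.
move=> r0.
have w1 := kw_gt1; have w4 := kw_lt4.
have w0 : 0 < kw by exact: lt_trans w1.
have i1 : kw^-1 < 1 by rewrite invf_lt1.
have P0 : 0 < r `^ (2 * s) by exact: powR_gt0.
have e2 k : 0 < 2 ^+ k :> R by rewrite exprn_gt0.
pose A k : R := ((2 ^+ k * r) ^+ N * (2 ^+ k * r) `^ (2 * s))^-1.
pose B k : R := (4 ^+ k)^-1 * ((r / 2 ^+ k.+1) ^+ N * (r / 2 ^+ k.+1) `^ (2 * s))^-1.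
have A0 k : 0 < A k by rewrite invr_gt0 mulr_gt0 ?exprn_gt0 ?powR_gt0 ?mulr_gt0.
have B0 k : 0 < B k.
  by rewrite mulr_gt0 ?invr_gt0 ?exprn_gt0 ?mulr_gt0 ?exprn_gt0 ?powR_gt0 ?divr_gt0.
pose SA k := [set x : 'rV[R]_N | `|0 - x| < 2 ^+ k.+1 * r].
pose SB k := [set x : 'rV[R]_N | `|0 - x| < r / 2 ^+ k].
have SAm k := @rV_ball_measure 0 (2 ^+ k.+1 * r) (mulr_gt0 (e2 _) r0).
have SBm k := @rV_ball_measure 0 (r / 2 ^+ k) (divr_gt0 r0 (e2 _)).
pose u k x := A k * \1_(SA k) x + B k * \1_(SB k) x.
rewrite (_ : kC / _ = (4 ^+ N / r `^ (2 * s)) / (1 - kw^-1) + (4 ^+ N * kw / r `^ (2 * s)) / (1 - kw / 4)); last first.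
  by rewrite /kC mulrDl; congr (_ + _); rewrite mulrAC.
apply: (@ible_series _ _ _ _ _ u).
- by rewrite invr_ge0 ltW.
- by apply/andP; split; lra.
- by rewrite divr_ge0 ?exprn_ge0 ?ltW.
- by rewrite divr_ge0 ?mulr_ge0 ?exprn_ge0 ?ltW.
- exact: measurable_kJ.
- move=> k; apply: measurable_funD; apply: measurable_funM => //; apply: measurable_indic.
    by have [] := SAm k.
  by have [] := SBm k.
- by move=> k x; rewrite addr_ge0// mulr_ge0 ?(ltW (A0 _)) ?(ltW (B0 _))// indicE.
- by move=> x; exact: kJ_ge0.
- move=> x; have [->|x0] := eqVneq x 0.
    exists 0%N; rewrite /kJ fkernel0 mulr0.
    by rewrite addr_ge0// mulr_ge0 ?(ltW (A0 _)) ?(ltW (B0 _))// indicE.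
  have nx0 : 0 < `|x| by rewrite normr_gt0.
  have [xr|rx] := ltP `|x| r.
    (* The least such index locates the dyadic shell of $x$. *)
    have ex : exists k, r / 2 ^+ k.+1 <= `|x|.
      exists (Num.Def.archi_bound (r / `|x|)).
      rewrite ler_pdivrMr// mulrC -ler_pdivrMr//.
      by apply/ltW/upper_nthrootP; exact: leqnSn.
    case: (ex_minnP ex) => k Hk mk; exists k.
    have xk : `|x| < r / 2 ^+ k.
      case: k Hk mk => [|k] Hk mk; first by rewrite expr0 divr1.
      by rewrite ltNge; apply/negP => H; have := mk k H; rewrite ltnn.
    rewrite /u [X in _ + _ * X](_ : _ = 1); last by rewrite indicE mem_set//= /SB /= sub0r normrN.
    rewrite mulr1; apply: (@le_trans _ _ (B k)); last first.
      by rewrite lerDr mulr_ge0 ?(ltW (A0 _))// indicE.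
    apply: ler_pM.
    + by rewrite le_min ler01 divr_ge0 ?sqr_ge0.
    + exact: fkernel_ge0.
    + rewrite ge_min; apply/orP; right.
      rewrite ler_pdivrMr ?exprn_gt0//.
      have -> : (4 ^+ k)^-1 * r ^+ 2 = (r / 2 ^+ k) ^+ 2.
        by rewrite expr_div_n mulrC -exprM mulnC exprM (_ : 2 ^+ 2 = 4)//; rewrite expr2; ring.
      by rewrite lerXn2r ?nnegrE ?divr_ge0 ?(ltW r0) ?(ltW xk) ?(ltW (e2 k)).
    + by apply: fkernel_le => //; rewrite divr_gt0.
  have ex : exists k, `|x| < 2 ^+ k.+1 * r.
    exists (Num.Def.archi_bound (`|x| / r)).
    by rewrite -ltr_pdivrMr//; apply/upper_nthrootP; exact: leqnSn.
  case: (ex_minnP ex) => k Hk mk; exists k.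
  have xk : 2 ^+ k * r <= `|x|.
    case: k Hk mk => [|k] Hk mk; first by rewrite expr0 mul1r.
    by rewrite leNgt; apply/negP => H; have := mk k H; rewrite ltnn.
  rewrite /u [X in _ * X + _](_ : _ = 1); last by rewrite indicE mem_set//= /SA /= sub0r normrN.
  rewrite mulr1; apply: (@le_trans _ _ (A k)); last first.
    by rewrite lerDl mulr_ge0 ?(ltW (B0 _))// indicE.
  rewrite /kJ -[leRHS]mul1r; apply: ler_pM.
  + by rewrite le_min ler01 divr_ge0 ?sqr_ge0.
  + exact: fkernel_ge0.
  + by rewrite ge_min lexx.
  + by apply: fkernel_le => //; rewrite mulr_gt0.
- move=> k; have [mA eA] := SAm k; have [mB eB] := SBm k.
  have mi S c : measurable S -> measurable_fun setT (fun x : 'rV[R]_N => (c * \1_S x)%:E).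
    by move=> mS; apply/measurable_EFinP; apply: measurable_funM => //; exact: measurable_indic.
  under eq_integral do rewrite EFinD.
  rewrite ge0_integralD//; first last.
  + exact: mi.
  + by move=> x _; rewrite lee_fin mulr_ge0 ?(ltW (B0 _))// indicE.
  + exact: mi.
  + by move=> x _; rewrite lee_fin mulr_ge0 ?(ltW (A0 _))// indicE.
  rewrite EFinD.
  have I S (c : R) : 0 <= c -> measurable S ->
      (\int[lam]_x (c * \1_S x)%:E = c%:E * lam S)%E.
    move=> c0 mS; under eq_integral do rewrite EFinM.
    rewrite ge0_integralZl//.
    - by rewrite integral_indic// setIT.
    - by apply/measurable_EFinP; exact: measurable_indic.
  have e2N k' : 0 < (2 ^+ k' : R) ^+ N by rewrite exprn_gt0.
  have rN : 0 < r ^+ N by rewrite exprn_gt0.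
  rewrite !I ?(ltW (A0 _)) ?(ltW (B0 _))//; apply: leeD.
  + rewrite [X in (_ * X)%E](_ : _ = ((2 * (2 ^+ k.+1 * r)) ^+ N)%:E)// -EFinM lee_fin.
    rewrite /A kw_pow// le_eqVlt; apply/orP; left; apply/eqP.
    rewrite exprVn.
    have -> : 2 * (2 ^+ k.+1 * r) = 4 * (2 ^+ k * r) by rewrite exprS; ring.
    rewrite [(4 * _) ^+ N]exprMn.
    have X0 : (2 ^+ k * r) ^+ N != 0 by rewrite expf_neq0// mulf_neq0 ?gt_eqF.
    have Y0 : kw ^+ k != 0 by rewrite expf_neq0// gt_eqF.
    have Z0 : r `^ (2 * s) != 0 by rewrite gt_eqF.
    move: X0 Y0 Z0; set X := (_ * r) ^+ N; set Y := kw ^+ k; set Z := r `^ _; set F := 4 ^+ N.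
    by clearbody X Y Z F => X0 Y0 Z0; field; rewrite X0 Y0 Z0.
  + rewrite [X in (_ * X)%E](_ : _ = ((2 * (r / 2 ^+ k)) ^+ N)%:E)// -EFinM lee_fin.
    have E : r `^ (2 * s) = kw ^+ k.+1 * (r / 2 ^+ k.+1) `^ (2 * s).
      by rewrite -kw_pow ?divr_gt0//; congr (_ `^ _); rewrite mulrC divfK ?gt_eqF.
    set ro := r / 2 ^+ k.+1 in E *.
    have ro0 : 0 < ro by rewrite divr_gt0.
    have -> : 2 * (r / 2 ^+ k) = 4 * ro.
      by rewrite /ro exprS invfM; field; rewrite gt_eqF.
    rewrite /B -/ro E le_eqVlt; apply/orP; left; apply/eqP.
    rewrite [(4 * _) ^+ N]exprMn [(kw / 4) ^+ k]exprMn exprVn [kw ^+ k.+1]exprS.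
    have X0 : ro ^+ N != 0 by rewrite expf_neq0// gt_eqF.
    have Y0 : kw ^+ k != 0 by rewrite expf_neq0// gt_eqF.
    have Z0 : ro `^ (2 * s) != 0 by rewrite gt_eqF// powR_gt0.
    have V0 : (4 : R) ^+ k != 0 by rewrite expf_neq0.
    have W0 : kw != 0 by rewrite gt_eqF.
    move: X0 Y0 Z0 V0 W0; set X := ro ^+ N; set Y := kw ^+ k; set Z := ro `^ _.
    set F := 4 ^+ N; set V := 4 ^+ k; set W := kw.
    by clearbody X Y Z F V W => X0 Y0 Z0 V0 W0; field; rewrite X0 Y0 Z0 V0 W0.
Qed.

End kernel.

Lemma ae_exists d (T : measurableType d) (R : realType)
    (mu : {measure set T -> \bar R}) (P : T -> Prop) (A : set T) :
  measurable A -> mu A != 0%E -> {ae mu, forall x, P x} -> exists2 x, A x & P x.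
Proof.
move=> mA mA0 [N [mN N0 HN]]; apply: contrapT => H.
have : A `<=` N by move=> x Ax; apply: HN => /= Px; apply: H; exists x.
move=> AN; move/eqP: mA0; apply; apply/eqP; rewrite eq_le measure_ge0 andbT -N0.
by apply: le_measure => //; rewrite inE.
Qed.

Lemma sin_abs_le (R : realType) (x : R) : `|sin x| <= `|x|.
Proof.
wlog x0 : x / 0 < x.
  move=> H; have [x0|x0|->] := ltgtP x 0; last by rewrite sin0 normr0.
    by rewrite -normrN -sinN -[leRHS]normrN; apply: H; rewrite oppr_gt0.
  exact: H.
have [|c _] := @MVT R sin cos 0 x x0 _.
  by apply: continuous_subspaceT; exact: continuous_sin.
rewrite sin0 !subr0 => ->; rewrite normrM ler_piMl//; exact: cos_max.
Qed.

Lemma one_sub_cos (R : realType) (x : R) : 1 - cos x = 2 * sin (x / 2) ^+ 2.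
Proof.
have E : x = (x / 2) *+ 2 by rewrite -mulr_natr divfK.
by rewrite {1}E cos_mulr2n sin2cos2; ring.
Qed.

(** * Positivity of the normalization constant *)

Section fconst.
Context {R : realType} {n : nat} (s : R).
Hypothesis s01 : 0 < s < 1.
Local Notation N := n.+1.
Local Notation lam := (@lebesgue_rV R N).
Local Notation K := (@fkernel R n s).

(** The integral in [fconst] must be both finite and nonzero, since a real integral and an inverse
    have default value $0$. It is finite because $1-\cos z_1\le 2\min(1,|z|^2)$, and nonzero because
    the integrand is positive on a cube. *)
Lemma fconst_gt0 : 0 < @fconst R n s.
Proof.
pose f (z : 'rV[R]_N) := (1 - cos (z 0 ord0)) * K z.
have f0 z : 0 <= f z by rewrite mulr_ge0 ?fkernel_ge0// subr_ge0 cos_le1.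
have mf : measurable_fun setT f.
  apply: measurable_funM; last exact: measurable_fkernel.
  apply: measurable_funB => //.
  apply: (measurableT_comp (f := @cos R)); last exact: measurable_coord.
  by apply: continuous_measurable_fun; exact: continuous_cos.
have fi : ible lam f.
  apply: (ible_le mf _ (ibleZ 2 (kJ_int s01 ltr01).1)) => z.
  rewrite ger0_norm// /kJ mulrA; apply: ler_wpM2r; first exact: fkernel_ge0.
  rewrite expr1n divr1.
  have [h|h] := lerP 1 (`|z| ^+ 2).
    by have := cos_geN1 (z 0 ord0); lra.
  rewrite one_sub_cos ler_pM2l//.
  rewrite -real_normK ?num_real// lerXn2r ?nnegrE//.
  apply: le_trans (sin_abs_le _) _; apply: le_trans (rV_coord_le z ord0).
  by rewrite normrM ler_piMr// ger0_norm ?invr_ge0// invf_le1// ler1n.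
rewrite /fconst invr_gt0 lt_neqAle int_ge0// andbT; apply/negP => /eqP/esym I0.
have := int_gt0_ex fi f0 I0.
pose a : 'rV[R]_N := const_mx (1 / 2).
have [mB eB] := @rV_ball_measure R n a (1 / 2) ltac:(lra).
have nB : lam [set x | `|a - x| < 1 / 2] != 0%E.
  by rewrite eB mulrC divfK// expr1n eqe oner_eq0.
move=> /(ae_exists mB nB)[z /=].
move=> /rV_norm_lt -/(_ ltac:(lra) ord0); rewrite !mxE ltr_norml => /andP[z1 z2].
have z0 : 0 < z 0 ord0 by lra.
have zn : z != 0 by apply: contraTneq z0 => ->; rewrite mxE ltxx.
move/eqP; rewrite mulf_eq0 => /orP[|].
  rewrite one_sub_cos mulf_eq0 pnatr_eq0/= sqrf_eq0.
  by rewrite gt_eqF// sin2_gt0//; apply/andP; split; lra.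
by apply/negP; rewrite gt_eqF// (fkernelE s (enorm_gt0 zn) erefl) invr_gt0 mulr_gt0 ?exprn_gt0 ?powR_gt0 ?enorm_gt0.
Qed.

End fconst.

Section int_fubini.
Context d1 d2 (X : measurableType d1) (Y : measurableType d2) (R : realType).
Variables (m1 : {sigma_finite_measure set X -> \bar R}).
Variables (m2 : {sigma_finite_measure set Y -> \bar R}).
Variables (b : Y -> R) (g : X -> Y -> R).
Hypothesis mg : measurable_fun setT (fun p : X * Y => g p.1 p.2).
Hypothesis gx : forall x, ible m2 (g x).
Hypothesis gy : forall y, ible m1 (g ^~ y).
Hypothesis ib : ible m2 b.
Hypothesis gb : forall y, \int[m1]_x `|g x y| <= b y.

Let ig : (m1 \x m2)%E.-integrable setT (fun p => (g p.1 p.2)%:E).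
Proof.
apply/integrable21ltyP; first exact/measurable_EFinP.
apply: (@le_lt_trans _ _ (\int[m2]_y (b y)%:E)%E).
  apply: ge0_le_integral => //.
  - by move=> y _; exact: integral_ge0.
  - have mm : measurable_fun setT (fun p : X * Y => `|(g p.1 p.2)%:E|%E).
      by apply: measurableT_comp => //; exact/measurable_EFinP.
    by have := measurable_fun_fubini_tonelli_G (m1 := m1) _ mm; apply.
  - by case/integrableP : ib.
  - move=> y _ /=; rewrite ible_fin ?lee_fin//; exact: ible_abs.
by rewrite ible_fin// ltry.
Qed.

Lemma ible_fubini : ible m1 (fun x => \int[m2]_y g x y).
Proof.
apply: ible_cvt (integrable_fubini_F ig) => x.
by rewrite /fubini_F /= ible_fin.
Qed.

Lemma int_fubini : \int[m1]_x \int[m2]_y g x y = \int[m2]_y \int[m1]_x g x y.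
Proof.
have := Fubini ig => /= E.
rewrite /Rintegral; congr fine.
transitivity (\int[m1]_x \int[m2]_y (g x y)%:E)%E.
  by apply: eq_integral => x _; rewrite ible_fin.
by rewrite E; apply: eq_integral => y _; rewrite ible_fin//; exact: gy.
Qed.

End int_fubini.

(** * The truncated operator and convolutions on space-time *)

Section convolution.
Context {R : realType} {n : nat} (s : R).
Hypothesis s01 : 0 < s < 1.
Local Notation N := n.+1.
Local Notation lam := (@lebesgue_rV R N).
Local Notation mu := (@leb_rVT R N).
Local Notation Z := ('rV[R]_N * measurableTypeR R)%type.
Local Notation K := (@fkernel R n s).
Implicit Types (f p : Z -> R) (z w : Z) (x y : 'rV[R]_N) (e C : R).

Definition bmeas f C := measurable_fun setT f /\ forall z, `|f z| <= C.

Lemma measurable_rV_add d (T : measurableType d) (f g : T -> 'rV[R]_N) :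
  measurable_fun setT f -> measurable_fun setT g ->
  measurable_fun setT (fun t => f t - g t).
Proof.
move=> mf mg; apply: measurable_fun_rV => i; under eq_fun do rewrite !mxE.
by apply: measurable_funB;
  [apply: (measurableT_comp (f := fun x : 'rV[R]_N => x 0 i)) mf|
   apply: (measurableT_comp (f := fun x : 'rV[R]_N => x 0 i)) mg];
  exact: measurable_coord.
Qed.

Lemma measurable_Z_sub d (T : measurableType d) (f g : T -> Z) :
  measurable_fun setT f -> measurable_fun setT g ->
  measurable_fun setT (fun t => f t - g t).
Proof.
move=> mf mg; apply: measurable_fun_pair.
- by apply: measurable_rV_add; apply: measurableT_comp.
- by apply: measurable_funB; apply: measurableT_comp.
Qed.

Lemma measurable_Z_subT : measurable_fun setT (fun p : Z * Z => p.1 - p.2).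
Proof. exact: measurable_Z_sub. Qed.

Lemma measurable_shift z : measurable_fun setT (fun w : Z => w - z).
Proof. by apply: measurable_Z_sub. Qed.

Lemma bmeas_shift f C z : bmeas f C -> bmeas (fun w => f (w - z)) C.
Proof.
move=> [mf fC]; split => //; apply: (measurableT_comp (f := f)) => //.
exact: measurable_shift.
Qed.

Lemma preserves_mu_subl z : preserves mu (fun w => z - w).
Proof. exact: leb_rVT_subl. Qed.

Lemma preserves_mu_subr z : preserves mu (fun w => w - z).
Proof.
have [m1 p1] := preserves_mu_subl (- z); have [m2 p2] := preserves_mu_subl 0.
have E : (fun w : Z => w - z) = (fun w => (- z) - w) \o (fun w => 0 - w).
  by apply/funext => w /=; rewrite sub0r opprK addrC.
split; first by rewrite E; exact: measurableT_comp m1 m2.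
move=> A mA; rewrite E comp_preimage p2 ?p1//.
by rewrite -[X in measurable X]setTI; exact: m1.
Qed.

End convolution.

Section operators.
Context {R : realType} {n : nat} (s : R).
Hypothesis s01 : 0 < s < 1.
Local Notation N := n.+1.
Local Notation lam := (@lebesgue_rV R N).
Local Notation mu := (@leb_rVT R N).
Local Notation Z := ('rV[R]_N * measurableTypeR R)%type.
Local Notation K := (@fkernel R n s).
Implicit Types (f p : Z -> R) (z w : Z) (x y : 'rV[R]_N) (e C : R).

(** Cutting the kernel at distance $e$ makes it integrable. The cut uses the Euclidean norm, as the
    principal value in [fraclap] does. *)
Definition ke e y : R := fconst (n := n) s * (K y * (e < enorm y)%R%:R).

Lemma ke_ge0 e y : 0 <= ke e y.
Proof.
apply: mulr_ge0; first exact/ltW/fconst_gt0.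
by apply: mulr_ge0 => //; exact: fkernel_ge0.
Qed.

Lemma keN e y : ke e (- y) = ke e y.
Proof. by rewrite /ke fkernelN enormN. Qed.

Lemma measurable_ke e : measurable_fun setT (ke e).
Proof.
apply: measurable_funM => //; apply: measurable_funM; first exact: measurable_fkernel.
rewrite (_ : (fun x => _) = \1_[set x : 'rV[R]_N | e < enorm x]).
  apply: measurable_indic.
  rewrite (_ : mkset _ = @enorm R N @^-1` `]e, +oo[%classic).
    by rewrite -[X in measurable X]setTI; exact: measurable_enorm.
  by apply/seteqP; split => x /=; rewrite in_itv/= andbT.
apply/funext => x; rewrite indicE; congr (_%:R); congr nat_of_bool.
by apply/idP/idP; [move/mem_set|move/set_mem].
Qed.

Lemma ke_le_kJ e y : 0 < e -> ke e y <= fconst (n := n) s * kJ s (e / N%:R) y.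
Proof.
move=> e0; apply: ler_wpM2l; first exact/ltW/fconst_gt0.
rewrite /kJ mulrC.
apply: ler_wpM2r; first exact: fkernel_ge0.
case: ltP => ey; last first.
  by rewrite le_min ler01 divr_ge0// sqr_ge0.
have h : e / N%:R <= `|y|.
  rewrite ler_pdivrMr ?ltr0n// mulrC; apply: le_trans (ltW ey) (enorm_le_norm y).
rewrite le_min lexx/= ler_pdivlMr ?exprn_gt0 ?divr_gt0 ?ltr0n// mul1r.
by rewrite lerXn2r ?nnegrE// divr_ge0// ltW.
Qed.

Lemma ke_ible e : 0 < e -> ible lam (ke e).
Proof.
move=> e0; apply: (ible_le (measurable_ke e) _ (ibleZ (fconst (n := n) s) (kJ_int s01 _).1)).
- by move=> y; rewrite ger0_norm ?ke_ge0//; exact: ke_le_kJ.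
- by rewrite divr_gt0.
Qed.

Definition kmass e := \int[lam]_y ke e y.

Lemma kmass_ge0 e : 0 <= kmass e.
Proof. by apply: int_ge0 => y; exact: ke_ge0. Qed.

(** [Lop e] is a discrete version of $\partial_t+(-\Delta)^s$ that makes sense for every bounded
    measurable function. The time difference is backward: it refers only to the past, and its
    product rule has an error of favourable sign. *)
Definition Aop e f z := \int[lam]_y ((f z - f (z - (y, 0))) * ke e y).
Definition Dop e f z := (f z - f (z - (0, e))) / e.
Definition Lop e f z := Aop e f z + Dop e f z.
Definition conv f p z := \int[mu]_w (f (z - w) * p w).

Let mZ0 : measurable_fun setT (fun p : Z * 'rV[R]_N => p.1 - (p.2, 0 : R)).
Proof.
apply: measurable_Z_sub => //.
by apply: measurable_fun_pair => //; exact: measurable_snd.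
Qed.

Let mdiff f C : bmeas f C ->
  measurable_fun setT (fun p : Z * 'rV[R]_N => f p.1 - f (p.1 - (p.2, 0))).
Proof.
move=> [mf _]; apply: measurable_funB; apply: (measurableT_comp (f := f)) => //.
Qed.

Let bdiff f C z w : bmeas f C -> `|f z - f w| <= C + C.
Proof. by move=> [_ fC]; apply: le_trans (ler_normB _ _) _; rewrite lerD. Qed.

Lemma Aop_ible e f C z : 0 < e -> bmeas f C ->
  ible lam (fun y => (f z - f (z - (y, 0))) * ke e y).
Proof.
move=> e0 bf.
apply: (ible_swapl (ke_ible e0) (f := fun z y => f z - f (z - (y, 0)))).
- exact: mdiff bf.
- by move=> ? ?; exact: bdiff bf.
Qed.

Lemma Aop_bmeas e f C : 0 < e -> bmeas f C -> bmeas (Aop e f) ((C + C) * kmass e).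
Proof.
move=> e0 bf; split.
  apply: (meas_int2 (ke_ible e0) (f := fun z y => f z - f (z - (y, 0)))).
  - exact: mdiff bf.
  - by move=> ? ?; exact: bdiff bf.
move=> z; apply: le_trans.
  apply: (int2_bound (ke_ible e0) (f := fun z y => f z - f (z - (y, 0)))).
  - exact: mdiff bf.
  - by move=> ? ?; exact: bdiff bf.
rewrite le_eqVlt; apply/orP; left; apply/eqP; congr (_ * _).
by apply: eq_int => y; rewrite ger0_norm ?ke_ge0.
Qed.

Let mconv f C : bmeas f C -> measurable_fun setT (fun p : Z * Z => f (p.1 - p.2)).
Proof.
by move=> [mf _]; apply: (measurableT_comp (f := f)) => //; exact: measurable_Z_subT.
Qed.

Lemma conv_ible f p C z : bmeas f C -> ible mu p ->
  ible mu (fun w => f (z - w) * p w).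
Proof.
move=> bf ip; apply: (ible_swapl ip (f := fun z w => f (z - w))).
- exact: mconv bf.
- by move=> ? ?; exact: bf.2.
Qed.

Lemma conv_bmeas f p C : bmeas f C -> ible mu p ->
  bmeas (conv f p) (C * \int[mu]_w `|p w|).
Proof.
move=> bf ip; split.
  apply: (meas_int2 ip (f := fun z w => f (z - w))).
  - exact: mconv bf.
  - by move=> ? ?; exact: bf.2.
move=> z; apply: (int2_bound ip (f := fun z w => f (z - w))).
- exact: mconv bf.
- by move=> ? ?; exact: bf.2.
Qed.

Lemma convD f g p C C' z : bmeas f C -> bmeas g C' -> ible mu p ->
  conv (fun w => f w + g w) p z = conv f p z + conv g p z.
Proof.
move=> bf bg ip; rewrite -intD; [|exact: conv_ible bf ip|exact: conv_ible bg ip].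
by apply: eq_int => w; rewrite mulrDl.
Qed.

Lemma convB f g p C C' z : bmeas f C -> bmeas g C' -> ible mu p ->
  conv (fun w => f w - g w) p z = conv f p z - conv g p z.
Proof.
move=> bf bg ip; rewrite -intB; [|exact: conv_ible bf ip|exact: conv_ible bg ip].
by apply: eq_int => w; rewrite mulrBl.
Qed.

Lemma convBr f p q C z : bmeas f C -> ible mu p -> ible mu q ->
  conv f (fun w => p w - q w) z = conv f p z - conv f q z.
Proof.
move=> bf ip iq; rewrite -intB; [|exact: conv_ible bf ip|exact: conv_ible bf iq].
by apply: eq_int => w; rewrite mulrBr.
Qed.

Lemma convDr f p q C z : bmeas f C -> ible mu p -> ible mu q ->
  conv f (fun w => p w + q w) z = conv f p z + conv f q z.
Proof.
move=> bf ip iq; rewrite -intD; [|exact: conv_ible bf ip|exact: conv_ible bf iq].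
by apply: eq_int => w; rewrite mulrDr.
Qed.

Lemma convZ f p (a C : R) z : bmeas f C -> ible mu p ->
  conv (fun w => a * f w) p z = a * conv f p z.
Proof.
move=> bf ip; rewrite -intZ; last exact: conv_ible bf ip.
by apply: eq_int => w; rewrite mulrA.
Qed.

Lemma convZr f p (a C : R) z : bmeas f C -> ible mu p ->
  conv f (fun w => a * p w) z = a * conv f p z.
Proof.
move=> bf ip; rewrite -intZ; last exact: conv_ible bf ip.
by apply: eq_int => w; rewrite mulrCA.
Qed.

Lemma conv_le f g p C C' z : bmeas f C -> bmeas g C' -> ible mu p ->
  (forall w, 0 <= p w) -> (forall w, p w != 0 -> f (z - w) <= g (z - w)) ->
  conv f p z <= conv g p z.
Proof.
move=> bf bg ip p0 fg; apply: int_le; [exact: conv_ible bf ip|exact: conv_ible bg ip|].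
move=> w; have [->|pw] := eqVneq (p w) 0; first by rewrite !mulr0.
by apply: ler_wpM2r => //; exact: fg.
Qed.

Lemma conv_bound f p C z : bmeas f C -> ible mu p ->
  `|conv f p z| <= C * \int[mu]_w `|p w|.
Proof. by move=> bf ip; have [_ ->] := conv_bmeas bf ip. Qed.

Lemma conv_comm f p z : conv f p z = \int[mu]_w (f w * p (z - w)).
Proof.
have [m P] := preserves_mu_subl (R := R) (n := n) z.
Abort.

Lemma ible_shift p z : ible mu p -> ible mu (fun w => p (w - z)).
Proof. by move=> ip; have := ible_preserves (preserves_mu_subr z) ip. Qed.

Lemma int_shift p z : ible mu p -> \int[mu]_w p (w - z) = \int[mu]_w p w.
Proof. by move=> ip; have := int_preserves (preserves_mu_subr z) ip. Qed.

Lemma ible_refl p z : ible mu p -> ible mu (fun w => p (z - w)).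
Proof. by move=> ip; have := ible_preserves (preserves_mu_subl z) ip. Qed.

Lemma int_refl p z : ible mu p -> \int[mu]_w p (z - w) = \int[mu]_w p w.
Proof. by move=> ip; have := int_preserves (preserves_mu_subl z) ip. Qed.

Lemma conv_comm f p C z : bmeas f C -> ible mu p ->
  conv f p z = \int[mu]_w (f w * p (z - w)).
Proof.
move=> bf ip; rewrite /conv -(int_refl z); last exact: conv_ible bf ip.
by apply: eq_int => w; rewrite subKr.
Qed.

Lemma conv_shiftr f p C z v : bmeas f C -> ible mu p ->
  conv f (fun w => p (w - v)) z = conv f p (z - v).
Proof.
move=> bf ip; rewrite /conv -[RHS](int_shift v (conv_ible _ bf ip)).
by apply: eq_int => w; rewrite /= opprB addrA addrNK.
Qed.

Lemma conv_shiftl f p z v : conv (fun w => f (w - v)) p z = conv f p (z - v).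
Proof. by apply: eq_int => w; congr (f _ * _); rewrite addrAC. Qed.

Lemma Aop_conv e f p C z : 0 < e -> bmeas f C -> ible mu p ->
  Aop e (conv f p) z = conv (Aop e f) p z.
Proof.
move=> e0 bf ip.
pose F w y := f (z - w) - f (z - w - (y, 0)).
have bF w y : `|F w y| <= C + C by exact: bdiff bf.
have mF : measurable_fun setT (fun q : Z * 'rV[R]_N => F q.1 q.2).
  have mm : measurable_fun setT (fun q : Z * 'rV[R]_N => (z - q.1, q.2)).
    by apply: measurable_fun_pair => //; exact: measurable_Z_sub.
  exact: measurableT_comp (mdiff bf) mm.
rewrite [RHS](_ : _ = \int[mu]_w (p w * \int[lam]_y (F w y * ke e y))); last first.
  by apply: eq_int => w; rewrite mulrC.
rewrite (int_swap ip (ke_ible e0) mF bF); apply: eq_int => y.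
rewrite mulrC; congr (_ * _).
rewrite -conv_shiftl -(convB _ bf (bmeas_shift (y, 0) bf))//.
Qed.

(** Symmetry of the truncated operator under convolution, together with the integrability of
    [Aop e p]. Fubini applies because for each $y$ the integral in $w$ is at most $2C\|p\|_1$ times
    the kernel at $y$. *)
Let Aop_fub e f p C C' z : 0 < e -> bmeas f C -> bmeas p C' -> ible mu p ->
  ible mu (fun w => f (z - w) * Aop e p w) /\
  conv f (Aop e p) z = conv (Aop e f) p z.
Proof.
move=> e0 bf bp ip.
have C0 : 0 <= C by apply: le_trans (bf.2 0).
pose g w y := f (z - w) * ((p w - p (w - (y, 0))) * ke e y).
have mg : measurable_fun setT (fun q : Z * 'rV[R]_N => g q.1 q.2).
  apply: measurable_funM.
    by apply: (measurableT_comp (f := f)); [exact: bf.1|exact: measurable_Z_sub].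
  apply: measurable_funM; first exact: mdiff bp.
  by apply: measurableT_comp => //; exact: measurable_ke.
have gx w : ible lam (g w) by apply: ibleZ; exact: Aop_ible bp.
have dy y : ible mu (fun w => p w - p (w - (y, 0))).
  by apply: ibleB => //; exact: ible_shift.
have gy y : ible mu (g ^~ y).
  apply: ible_cvt (ibleZ (ke e y) (conv_ible z bf (dy y))) => w.
  by rewrite /g /=; congr (_%:E); ring.
have ib : ible lam (fun y => (C * ((\int[mu]_w `|p w|) *+ 2)) * ke e y).
  by apply: ibleZ; exact: ke_ible.
have gb y : \int[mu]_w `|g w y| <= (C * ((\int[mu]_w `|p w|) *+ 2)) * ke e y.
  have i1 : ible mu (fun w => `|p w| + `|p (w - (y, 0))|).
    by apply: ibleD; [exact: ible_abs|apply: (@ible_shift (fun w => `|p w|)); exact: ible_abs].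
  apply: (@le_trans _ _ (\int[mu]_w ((C * ke e y) * (`|p w| + `|p (w - (y, 0))|)))).
    apply: int_le; [exact: ible_abs|exact: ibleZ|].
    move=> w; rewrite /g normrM -mulrA; apply: ler_pM => //; first exact: bf.2.
    by rewrite normrM [`|ke _ _|]ger0_norm ?ke_ge0// mulrC ler_wpM2l ?ke_ge0//; exact: ler_normB.
  rewrite intZ// intD; [|exact: ible_abs|by apply: (@ible_shift (fun w => `|p w|)); exact: ible_abs].
  rewrite (int_shift (p := fun w => `|p w|)); last exact: ible_abs.
  by rewrite -mulr2n mulrAC.
have E w : f (z - w) * Aop e p w = \int[lam]_y g w y.
  by rewrite -intZ//; exact: Aop_ible bp.
split; first by apply: ible_cvt (ible_fubini mg gx gy ib gb) => w; rewrite E.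
rewrite /conv (eq_int _ E) (int_fubini mg gx gy ib gb) -/(conv _ _ _) -(Aop_conv _ e0 bf ip).
apply: eq_int => y; rewrite /g.
transitivity (\int[mu]_w (ke e y * (f (z - w) * (p w - p (w - (y, 0)))))).
  by apply: eq_int => w; ring.
rewrite intZ; last exact: (conv_ible _ bf (dy y)).
rewrite -/(conv f (fun w => p w - p (w - (y, 0))) z) (convBr _ bf)//; last exact: ible_shift.
by rewrite (conv_shiftr _ _ bf)// mulrC.
Qed.

Lemma conv_Aop e f p C C' z : 0 < e -> bmeas f C -> bmeas p C' -> ible mu p ->
  conv f (Aop e p) z = conv (Aop e f) p z.
Proof. by move=> e0 bf bp ip; have [_ ->] := Aop_fub z e0 bf bp ip. Qed.

Lemma Aop_mu_ible e p C : 0 < e -> bmeas p C -> ible mu p -> ible mu (Aop e p).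
Proof.
move=> e0 bp ip; have b1 : bmeas (fun _ : Z => 1) 1 by split => // z; rewrite normr1.
have [H _] := Aop_fub 0 e0 b1 bp ip.
by apply: ible_cvt H => w; rewrite /= mul1r.
Qed.

Lemma Dop_mu_ible e p : ible mu p -> ible mu (Dop e p).
Proof.
move=> ip; apply: ible_cvt (ibleZ e^-1 (ibleB ip (ible_shift (0, e) ip))) => w.
by rewrite /Dop mulrC.
Qed.

Lemma conv_Dop e f p C z : bmeas f C -> ible mu p ->
  conv f (Dop e p) z = Dop e (conv f p) z.
Proof.
move=> bf ip; rewrite /Dop -(conv_shiftr _ _ bf)// -(convBr _ bf)//; last exact: ible_shift.
rewrite mulrC -(convZr _ _ bf)//; last exact: ibleB (ible_shift _ ip).
by apply: eq_int => w; rewrite [X in _ = _ * X]mulrC.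
Qed.

Lemma Lop_mu_ible e p C : 0 < e -> bmeas p C -> ible mu p -> ible mu (Lop e p).
Proof.
by move=> e0 bp ip; apply: ibleD; [exact: Aop_mu_ible bp ip|exact: Dop_mu_ible].
Qed.

Lemma Lop_conv e f p C C' z : 0 < e -> bmeas f C -> bmeas p C' -> ible mu p ->
  Lop e (conv f p) z = conv f (Lop e p) z.
Proof.
move=> e0 bf bp ip; rewrite /Lop (convDr _ bf); last 2 first.
- exact: Aop_mu_ible bp ip.
- exact: Dop_mu_ible.
by rewrite (conv_Aop _ e0 bf bp ip) (Aop_conv _ e0 bf ip) (conv_Dop _ _ bf ip).
Qed.

Lemma Dop_bmeas e f C : 0 < e -> bmeas f C -> bmeas (Dop e f) ((C + C) / e).
Proof.
move=> e0 bf; split.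
  by apply: measurable_funM => //; apply: measurable_funB; [exact: bf.1|exact: (bmeas_shift _ bf).1].
move=> z; rewrite /Dop normrM [X in _ * X]ger0_norm ?invr_ge0 ?(ltW e0)//.
by rewrite ler_wpM2r ?invr_ge0 ?(ltW e0)//; exact: bdiff bf.
Qed.

Lemma Lop_bmeas e f C : 0 < e -> bmeas f C ->
  bmeas (Lop e f) ((C + C) * kmass e + (C + C) / e).
Proof.
move=> e0 bf; have [m1 h1] := Aop_bmeas e0 bf; have [m2 h2] := Dop_bmeas e0 bf.
split; first exact: measurable_funD.
by move=> z; apply: le_trans (ler_normD _ _) (lerD (h1 z) (h2 z)).
Qed.

Lemma Lop_conv_l e f p C z : 0 < e -> bmeas f C -> ible mu p ->
  Lop e (conv f p) z = conv (Lop e f) p z.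
Proof.
move=> e0 bf ip; rewrite /Lop.
rewrite (convD _ (Aop_bmeas e0 bf) (Dop_bmeas e0 bf) ip) -(Aop_conv _ e0 bf ip).
congr (_ + _); rewrite /Dop -conv_shiftl -(convB _ bf (bmeas_shift _ bf))// mulrC.
rewrite -intZ.
  by apply: eq_int => w; rewrite mulrA; congr (_ * _); rewrite mulrC.
apply: (conv_ible (f := fun w => f w - f (w - (0, e))) (C := C + C)) => //.
split; first by apply: measurable_funB; [exact: bf.1|exact: (bmeas_shift _ bf).1].
by move=> w; exact: bdiff bf.
Qed.

End operators.

(** * Smooth functions built from $e^{-1/t}$ *)

Section flat.
Context {R : realType}.
Implicit Types (t h : R) (k : nat).

(* The functions [t^-k exp(-1/t)] extended by [0]; differentiation maps this
   family into its own span. *)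
Definition flat k t : R := if 0 < t then t ^- k * expR (- t^-1) else 0.

Lemma flat_ge0 k t : 0 <= flat k t.
Proof.
by rewrite /flat; case: ifP => // t0; rewrite mulr_ge0 ?expR_ge0// invr_ge0 exprn_ge0// ltW.
Qed.

Lemma flat_neg k t : t <= 0 -> flat k t = 0.
Proof. by rewrite /flat leNgt => /negbTE ->. Qed.

Lemma flat_gt0 k t : 0 < t -> 0 < flat k t.
Proof. by rewrite /flat => t0; rewrite t0 mulr_gt0 ?expR_gt0// invr_gt0 exprn_gt0. Qed.

(** One term of the exponential series suffices. The quadratic bound is what makes the function
    differentiable at $0$, with derivative $0$. *)
Lemma flat_sqr k t : flat k t <= (k.+2)`!%:R * t ^+ 2.
Proof.
rewrite /flat; case: ifP => t0; last by rewrite mulr_ge0// sqr_ge0.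
have := @expR_ge1Dxn R t^-1 k.+1; rewrite invr_ge0 (ltW t0) => /(_ isT) H.
have f0 : 0 < (k.+2)`!%:R :> R by rewrite ltr0n fact_gt0.
have {}H : t^-1 ^+ k.+2 / (k.+2)`!%:R <= expR t^-1 by apply: le_trans H; rewrite lerDr.
have tk : 0 < t^-1 ^+ k.+2 by rewrite exprn_gt0// invr_gt0.
rewrite expRN.
have : (expR t^-1)^-1 <= (k.+2)`!%:R / t^-1 ^+ k.+2.
  by rewrite -[leRHS]invf_div lef_pV2 ?posrE ?expR_gt0 ?divr_gt0.
rewrite exprVn invrK => H'.
apply: (@le_trans _ _ (t ^- k * ((k.+2)`!%:R * t ^+ k.+2))).
  by rewrite ler_wpM2l// invr_ge0 exprn_ge0// ltW.
rewrite -addn2 exprD le_eqVlt; apply/orP; left; apply/eqP; field.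
by rewrite expf_neq0// gt_eqF.
Qed.

Lemma flat_bound k t : flat k t <= (k.+2)`!%:R.
Proof.
have f1 : 1 <= (k.+2)`!%:R :> R by rewrite ler1n fact_gt0.
have [t1|t1] := lerP t 1; last first.
  rewrite /flat (lt_trans ltr01 t1); apply: le_trans f1.
  rewrite -[leRHS]mulr1; apply: ler_pM; rewrite ?expR_ge0//.
  - by rewrite invr_ge0 exprn_ge0// ltW// (lt_trans ltr01).
  - by rewrite invf_le1 ?exprn_gt0 ?(lt_trans ltr01 t1)// exprn_ege1// ltW.
  - by rewrite expR_le1 oppr_le0 invr_ge0 ltW// (lt_trans ltr01 t1).
have [t0|t0] := lerP t 0; first by rewrite flat_neg.
apply: le_trans (flat_sqr k t) _; rewrite ler_piMr//.
by rewrite exprn_ile1// ltW.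
Qed.

Definition dflat k t : R := - k%:R * flat k.+1 t + flat k.+2 t.

Lemma is_derive_flat k t : is_derive t 1 (flat k) (dflat k t).
Proof.
have [t0|t0|->] := ltgtP t 0.
- rewrite /dflat !flat_neg ?ltW// mulr0 addr0.
  apply: (@near_eq_is_derive _ _ _ (cst 0)) (is_derive_cst _ _ _).
  by near=> x; rewrite flat_neg//; apply/ltW; near: x; exact: lt_nbhsl.
- have tn : t != 0 by rewrite gt_eqF.
  suff D : is_derive t 1 (fun x : R => x ^- k * expR (- x^-1)) (dflat k t).
    apply: near_eq_is_derive D.
    by near=> x; rewrite /flat ifT//; near: x; exact: lt_nbhsr.
  have d1 : is_derive t 1 (fun x : R => x^-1) (- (t ^- 2)).
    by apply: is_derive_eq; first exact: is_deriveV; rewrite /GRing.scale/= mulr1.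
  have d2 : is_derive t 1 (fun x : R => - x^-1) (t ^- 2).
    by rewrite -[X in is_derive _ _ _ X]opprK; exact: is_deriveN.
  have d3 : is_derive t 1 (fun x : R => expR (- x^-1)) (expR (- t^-1) * t ^- 2).
    exact: (is_derive1_comp (f := expR)).
  have d4 : is_derive t 1 (fun x : R => x ^- k) (- (k%:R) * t ^- k.+1).
    have dX : is_derive t 1 (fun x : R => x ^+ k) (k%:R * t ^+ k.-1).
      rewrite (_ : (fun x => _) = (id : R -> R) ^+ k); last by rewrite exprfctE.
      by apply: is_derive_eq; rewrite /GRing.scale/= mulr1.
    have tk : (fun x : R => x ^+ k) t != 0 by rewrite /= expf_neq0.
    have [d v] := is_deriveV (f := fun x : R => x ^+ k) (x := t) tk dX; split; first exact: d.
    rewrite v /GRing.scale/=.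
    case: k {dX tk d v} => [|k]; first by rewrite !mul0r mulr0 oppr0 mul0r.
    rewrite /= !exprS; field.
    by rewrite tn expf_neq0.
  have [d v] := is_deriveM d4 d3; split; first exact: d.
  rewrite [LHS]v /dflat /flat t0 /GRing.scale/= !exprS; field.
  by rewrite tn expf_neq0.
- rewrite /dflat !flat_neg// mulr0 addr0.
  (* By [flat_sqr] the difference quotient at $0$ is at most a constant times $|h|$. *)
  have C : (fun h : R => h^-1 *: (flat k (h *: 1 + 0) - flat k 0)) @ 0^' --> (0 : R).
    apply/cvgrPdist_le => /= e e0; near=> h.
    have hn : h != 0 by near: h; exact: nbhs_dnbhs_neq.
    rewrite sub0r normrN [flat k 0]flat_neg// subr0 addr0 /GRing.scale/= mulr1.
    rewrite normrM normfV ger0_norm ?flat_ge0//.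
    rewrite ler_pdivrMl ?normr_gt0//; apply: le_trans (flat_sqr k h) _.
    rewrite -real_normK ?num_real// expr2 mulrCA ler_wpM2l//.
    have f0 : 0 < (k.+2)`!%:R :> R by rewrite ltr0n fact_gt0.
    rewrite mulrC -ler_pdivlMr//.
    near: h; apply: dnbhs0_le; exact: divr_gt0.
  split; first by apply/cvg_ex; exists 0; exact: C.
  exact/cvg_lim.
Unshelve. all: by end_near. Qed.

Lemma flat_continuous k : continuous (flat k).
Proof.
move=> t; apply: differentiable_continuous.
by apply/derivable1_diffP; have [] := is_derive_flat k t.
Qed.

Lemma dflat_bound k t : `|dflat k t| <= k%:R * (k.+3)`!%:R + (k.+4)`!%:R.
Proof.
apply: le_trans (ler_normD _ _) _; rewrite normrM normrN.
rewrite (ger0_norm (flat_ge0 _ _)) (ger0_norm (flat_ge0 _ _)) ger0_norm//.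
by rewrite lerD ?flat_bound// ler_wpM2l// flat_bound.
Qed.

Lemma lip_of_derive (f df : R -> R) (C : R) :
  (forall t, is_derive t 1 f (df t)) -> (forall t, `|df t| <= C) ->
  forall a b, `|f a - f b| <= C * `|a - b|.
Proof.
move=> fdf dfC a b; wlog ab : a b / b < a.
  move=> H; have [|ba|->] := ltgtP b a; first exact: H.
    by rewrite distrC [`|a - b|]distrC; exact: H.
  by rewrite !subrr normr0 mulr0.
have [|c _ ->] := MVT ab (fun x _ => fdf x).
  apply: continuous_subspaceT => x; apply: differentiable_continuous.
  by apply/derivable1_diffP; have [] := fdf x.
by rewrite normrM ler_wpM2r.
Qed.

Lemma taylor_of_derive (f df ddf : R -> R) (C : R) :
  (forall t, is_derive t 1 f (df t)) -> (forall t, is_derive t 1 df (ddf t)) ->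
  (forall t, `|ddf t| <= C) ->
  forall a h, `|f (a + h) - f a - h * df a| <= C * h ^+ 2.
Proof.
move=> fdf dfddf ddfC a h.
have C0 : 0 <= C by apply: le_trans (normr_ge0 _) (ddfC 0).
have fc b : {for b, continuous f}.
  by apply: differentiable_continuous; apply/derivable1_diffP; have [] := fdf b.
suff [c ca fac] : exists2 c, `|c - a| <= `|h| & f (a + h) - f a = h * df c.
  rewrite fac -mulrBr normrM -(real_normK (num_real h)) expr2 mulrCA.
  rewrite ler_wpM2l//; apply: le_trans (lip_of_derive dfddf ddfC _ _) _.
  by rewrite ler_wpM2l.
have [h0|h0|->] := ltgtP h 0; last first.
- by exists a; rewrite ?subrr ?normr0// addr0 subrr mul0r.
- have ah : a < a + h by lra.
  have fw : {within `[a, a + h], continuous f}.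
    by apply: continuous_subspaceT => x; exact: fc.
  have [c] := MVT ah (fun x _ => fdf x) fw.
  rewrite in_itv/= => /andP[c1 c2] ->; exists c; last by rewrite addrC addKr mulrC.
  by rewrite ger0_norm ?gtr0_norm//; lra.
- have ah : a + h < a by lra.
  have fw : {within `[a + h, a], continuous f}.
    by apply: continuous_subspaceT => x; exact: fc.
  have [c] := MVT ah (fun x _ => fdf x) fw.
  rewrite in_itv/= => /andP[c1 c2] E; exists c.
    by rewrite ler0_norm ?ltr0_norm//; lra.
  by rewrite -opprB E; ring.
Qed.

End flat.

Section gen.
Context {R : realType} {V : normedModType R}.

(** A class stable under every directional derivative, so that all its members are smooth. The
    condition on [l] says that it is affine with linear part [dl]; the family [flat] enters with all
    exponents because differentiation raises the exponent. *)
Inductive gen : (V -> R) -> Prop :=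
| gen_flat k (l dl : V -> R) : continuous l ->
    (forall h v x, l (h *: v + x) = h * dl v + l x) -> gen (fun x => flat k (l x))
| gen_cst c : gen (fun=> c)
| gen_add f g : gen f -> gen g -> gen (fun x => f x + g x)
| gen_mul f g : gen f -> gen g -> gen (fun x => f x * g x).

Lemma gen_derive f v : gen f ->
  [/\ continuous f, (forall x, derivable f x v) & gen ('D_v f)].
Proof.
elim=> {f} [k l dl lc lE|c|f g _ [fc fd fg] _ [gc gd gg]|f g Gf [fc fd fg] Gg [gc gd gg]].
- have D x : is_derive x v (fun x => flat k (l x)) (dl v * dflat k (l x)).
    have D1 : is_derive (0 : R) 1 (fun h : R => flat k (h * dl v + l x)) (dl v * dflat k (l x)).
      have D2 : is_derive (0 : R) 1 (fun h : R => h * dl v + l x) (dl v).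
        apply: is_derive_eq.
        by rewrite /GRing.scale/= mulr1 addr0 mulr0 add0r.
      have D3 : is_derive (0 * dl v + l x) 1 (flat k) (dflat k (l x)).
        by rewrite mul0r add0r; exact: is_derive_flat.
      by rewrite mulrC; exact: (@is_derive1_comp R (flat k) _ 0 _ _ D3 D2).
    have E : (fun h : R => flat k (h * dl v + l x)) = (fun h => flat k (l (h *: v + x))).
      by apply/funext => h; rewrite lE.
    move: D1; rewrite E => -[d1 d2]; split.
      by apply/(derivable1P (fun x => flat k (l x)) x v); exact: d1.
    rewrite -d2 /derive; set g1 := fun h => h^-1 *: _; set g2 := fun h => h^-1 *: _.
    suff -> : g1 = g2 by [].
    by rewrite funeqE /g1 /g2 => h /=; rewrite addr0 scale0r add0r [_%:A]mulr1.
  split.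
  + by move=> x; apply: continuous_comp; [exact: lc|exact: flat_continuous].
  + by move=> x; have [] := D x.
  + have -> : 'D_v (fun x => flat k (l x)) = (fun x => dl v * (- k%:R * flat k.+1 (l x) + flat k.+2 (l x))).
      by apply/funext => x; have [_ ->] := D x.
    apply: gen_mul; first exact: gen_cst.
    apply: gen_add; last exact: gen_flat lE.
    by apply: gen_mul; [exact: gen_cst|exact: gen_flat lE].
- split; [exact: cst_continuous|exact: derivable_cst|].
  by have -> : 'D_v (fun=> c) = (fun=> 0) :> (V -> R); [apply/funext => x; exact: derive_cst|exact: gen_cst].
- split.
  + by move=> x; apply: continuousD; [exact: fc|exact: gc].
  + by move=> x; apply: derivableD.
  + have -> : 'D_v (fun x => f x + g x) = (fun x => 'D_v f x + 'D_v g x).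
      by apply/funext => x; rewrite -deriveD.
    exact: gen_add.
- split.
  + by move=> x; apply: continuousM; [exact: fc|exact: gc].
  + by move=> x; apply: derivableM.
  + have -> : 'D_v (fun x => f x * g x) = (fun x => f x * 'D_v g x + g x * 'D_v f x).
      by apply/funext => x; rewrite deriveM.
    by apply: gen_add; apply: gen_mul.
Qed.

Lemma gen_iter f vs : gen f -> gen (iter_derive vs f).
Proof.
by move=> gf; elim: vs => [|v vs IH] //=; have [] := gen_derive v IH.
Qed.

Lemma gen_smooth f : gen f -> smooth f.
Proof.
move=> gf vs; have G := gen_iter vs gf; split; first by have [] := gen_derive 0 G.
by move=> x v; have [_ + _] := gen_derive v G; apply.
Qed.

Lemma gen_prod I (s : seq I) (F : I -> V -> R) : (forall i, gen (F i)) ->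
  gen (fun x => \prod_(i <- s) F i x).
Proof.
move=> H; elim: s => [|i s IH].
  by rewrite (_ : (fun x => _) = (fun=> 1)); [exact: gen_cst|apply/funext => x; rewrite big_nil].
rewrite (_ : (fun x => _) = (fun x => F i x * \prod_(j <- s) F j x)); first exact: gen_mul.
by apply/funext => x; rewrite big_cons.
Qed.

End gen.

(** * Quantitative regularity: bounded second derivatives and second differences *)

Section C2b.
Context {R : realType}.
Implicit Types (g dg ddg : R -> R) (C : R).

Definition C2b g dg ddg C :=
  [/\ forall t : R, is_derive t 1 g (dg t), forall t : R, is_derive t 1 dg (ddg t) &
      forall t : R, [/\ `|g t| <= C, `|dg t| <= C & `|ddg t| <= C]].

Lemma C2b_comp g dg ddg C (a b : R) : `|a| <= 1 -> C2b g dg ddg C ->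
  C2b (fun t => g (a * t + b)) (fun t => a * dg (a * t + b))
      (fun t => a * (a * ddg (a * t + b))) C.
Proof.
move=> a1 [d1 d2 B].
have da (t : R) : is_derive t 1 (fun t : R => a * t + b) a.
  by apply: is_derive_eq; rewrite /GRing.scale/= mulr1 addr0.
have dc (f df : R -> R) (t : R) : (forall t : R, is_derive t 1 f (df t)) ->
    is_derive t 1 (fun t => f (a * t + b)) (a * df (a * t + b)).
  by move=> H; rewrite mulrC; exact: (is_derive1_comp (H _) (da t)).
split.
- by move=> t; exact: dc.
- move=> t0; have D := dc _ _ t0 d2.
  exact: (@is_deriveZ _ _ _ _ a _ _ _ D).
- move=> t; have [B1 B2 B3] := B (a * t + b); split => //.
    by rewrite normrM -[leRHS]mul1r ler_pM.
  by rewrite !normrM mulrA -[leRHS]mul1r ler_pM ?mulr_ge0// -[leRHS]mul1r ler_pM.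
Qed.

Lemma C2b_mul g dg ddg C h dh ddh D : C2b g dg ddg C -> C2b h dh ddh D ->
  C2b (fun t => g t * h t) (fun t => g t * dh t + h t * dg t)
    (fun t => (g t * ddh t + dh t * dg t) + (h t * ddg t + dg t * dh t)) (4 * (C * D)).
Proof.
move=> [g1 g2 gB] [h1 h2 hB].
have dm (f1 f2 df1 df2 : R -> R) (t : R) : is_derive t 1 f1 (df1 t) ->
    is_derive t 1 f2 (df2 t) ->
    is_derive t 1 (fun t => f1 t * f2 t) (f1 t * df2 t + f2 t * df1 t).
  by move=> D1 D2; exact: is_deriveM D1 D2.
split.
- by move=> t; exact: dm.
- move=> t; have D1 := dm _ _ _ _ t (g1 t) (h2 t); have D2 := dm _ _ _ _ t (h1 t) (g2 t).
  exact: is_deriveD D1 D2.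
- move=> t; have [a1 a2 a3] := gB t; have [b1 b2 b3] := hB t.
  have M (x y : R) : `|x| <= C -> `|y| <= D -> `|x * y| <= C * D.
    by move=> xC yD; rewrite normrM ler_pM.
  have CD : 0 <= C * D by apply: le_trans (M _ _ a1 b1).
  have M' x y : `|x| <= D -> `|y| <= C -> `|x * y| <= C * D.
    by move=> xC yD; rewrite mulrC M.
  split.
  + by apply: le_trans (M _ _ a1 b1) _; rewrite ler_peMl// ler1n.
  + apply: le_trans (ler_normD _ _) _.
    by apply: le_trans (lerD (M _ _ a1 b2) (M' _ _ b1 a2)) _; lra.
  + apply: le_trans (ler_normD _ _) _.
    apply: (@le_trans _ _ ((C * D + C * D) + (C * D + C * D))); last lra.
    apply: lerD; apply: le_trans (ler_normD _ _) _; apply: lerD; by [exact: M|exact: M'].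
Qed.

Lemma C2b_flat : C2b (flat 0) (flat 2) (dflat 2) (2 * (5)`!%:R + (6)`!%:R : R).
Proof.
split.
- move=> t; have := is_derive_flat 0 t.
  by rewrite /dflat oppr0 mul0r add0r.
- by move=> t; exact: is_derive_flat.
- move=> t; rewrite (ger0_norm (flat_ge0 _ _)) (ger0_norm (flat_ge0 _ _)); split.
  + apply: le_trans (flat_bound 0 t) _.
    by rewrite -natrM -natrD ler_nat.
  + apply: le_trans (flat_bound 2 t) _.
    by rewrite -natrM -natrD ler_nat.
  + exact: dflat_bound.
Qed.

Definition bump1 (a b t : R) : R := flat 0 (t - a) * flat 0 (b - t).

Lemma bump1_ge0 a b t : 0 <= bump1 a b t.
Proof. by rewrite mulr_ge0 ?flat_ge0. Qed.

Lemma bump1_supp a b t : bump1 a b t != 0 -> a < t < b.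
Proof.
rewrite /bump1 mulf_eq0 negb_or => /andP[h1 h2]; apply/andP; split.
- by rewrite -subr_gt0 ltNge; apply: contra_neqN h1 => ?; rewrite flat_neg.
- by rewrite -subr_gt0 ltNge; apply: contra_neqN h2 => ?; rewrite flat_neg.
Qed.

Lemma bump1_gt0 a b t : a < t < b -> 0 < bump1 a b t.
Proof. by move=> /andP[? ?]; rewrite mulr_gt0 ?flat_gt0 ?subr_gt0. Qed.

Lemma bump1_C2b a b : exists dg ddg C, 0 <= C /\ C2b (bump1 a b) dg ddg C.
Proof.
have A := C2b_comp (a := 1) (- a) ltac:(by rewrite normr1) C2b_flat.
have B := C2b_comp (a := -1) b ltac:(by rewrite normrN normr1) C2b_flat.
have M := C2b_mul A B; eexists; eexists; eexists; split; last first.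
  have -> : bump1 a b = (fun t => flat 0 (1 * t + - a) * flat 0 (-1 * t + b)).
    by apply/funext => t; rewrite /bump1 mul1r mulN1r [b - t]addrC.
  exact: M.
by rewrite !mulr_ge0 ?addr_ge0.
Qed.

Lemma C2b_second g dg ddg C (a h : R) : C2b g dg ddg C ->
  `|g (a + h) + g (a - h) - 2 * g a| <= 2 * C * h ^+ 2.
Proof.
move=> [d1 d2 B].
have T := taylor_of_derive d1 d2 (C := C) (fun t => let: And3 _ _ b := B t in b) a.
have -> : g (a + h) + g (a - h) - 2 * g a =
   (g (a + h) - g a - h * dg a) + (g (a - h) - g a - (- h) * dg a) by ring.
apply: le_trans (ler_normD _ _) _.
by apply: le_trans (lerD (T h) (T (- h))) _; rewrite sqrrN; lra.
Qed.

End C2b.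

Section lip2.
Context {R : realType} {n : nat}.
Local Notation N := n.+1.
Local Notation Z := ('rV[R]_N * measurableTypeR R)%type.
Implicit Types (f g : Z -> R) (z v : Z) (y : 'rV[R]_N).

Definition nrm v : R := `|v.1| + `|v.2 : R|.

Lemma nrm_ge0 v : 0 <= nrm v. Proof. by rewrite addr_ge0. Qed.

(** The bounds from which rates of convergence are computed. The last one, on symmetric second
    differences in space, makes the principal value absolutely convergent. *)
Definition lip2 f C := [/\ 0 <= C, forall z, `|f z| <= C,
  forall z v, `|f (z + v) - f z| <= C * nrm v &
  forall z y, `|f (z + (y, 0)) + f (z - (y, 0)) - 2 * f z| <= C * `|y| ^+ 2].

Lemma lip2_mul f g C D : lip2 f C -> lip2 g D ->
  lip2 (fun z => f z * g z) (4 * (C * D)).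
Proof.
move=> [C0 f0 f1 f2] [D0 g0 g1 g2].
have CD : 0 <= C * D by rewrite mulr_ge0.
split.
- by rewrite mulr_ge0.
- move=> z; rewrite normrM; apply: (@le_trans _ _ (C * D)); first by rewrite ler_pM.
  by rewrite ler_peMl// ler1n.
- move=> z v.
  have -> : f (z + v) * g (z + v) - f z * g z =
    (f (z + v) - f z) * g (z + v) + f z * (g (z + v) - g z) by ring.
  apply: le_trans (ler_normD _ _) _; rewrite !normrM.
  have nv := nrm_ge0 v.
  have H1 : `|f (z + v) - f z| * `|g (z + v)| <= C * nrm v * D by rewrite ler_pM.
  have H2 : `|f z| * `|g (z + v) - g z| <= C * (D * nrm v) by rewrite ler_pM.
  apply: le_trans (lerD H1 H2) _.
  have : 0 <= C * D * nrm v by rewrite mulr_ge0.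
  lra.
- move=> z y; set zp := z + _; set zm := z - _.
  (* Discrete Leibniz rule for second differences; the products of first differences are quadratic
     in $|y|$ as well. *)
  have -> : f zp * g zp + f zm * g zm - 2 * (f z * g z) =
    f z * (g zp + g zm - 2 * g z) + (f zp + f zm - 2 * f z) * g z +
    ((f zp - f z) * (g zp - g z) + (f zm - f z) * (g zm - g z)) by ring.
  have n1 : nrm (y, 0 : measurableTypeR R) = `|y| by rewrite /nrm/= normr0 addr0.
  have n2 : nrm (- (y, 0 : measurableTypeR R)) = `|y| by rewrite /nrm/= normrN oppr0 normr0 addr0.
  have F1 := f1 z (y, 0); have F2 := f1 z (- (y, 0)); rewrite n1 in F1; rewrite n2 in F2.
  have G1 := g1 z (y, 0); have G2 := g1 z (- (y, 0)); rewrite n1 in G1; rewrite n2 in G2.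
  have y0 : 0 <= `|y| by [].
  have H1 : `|f z * (g zp + g zm - 2 * g z)| <= C * (D * `|y| ^+ 2) by rewrite normrM; apply: ler_pM => //; first [exact: g2|exact: f2].
  have H2 : `|(f zp + f zm - 2 * f z) * g z| <= C * `|y| ^+ 2 * D by rewrite normrM; apply: ler_pM => //; first [exact: g2|exact: f2].
  have H3 : `|(f zp - f z) * (g zp - g z)| <= C * `|y| * (D * `|y|) by rewrite normrM ler_pM.
  have H4 : `|(f zm - f z) * (g zm - g z)| <= C * `|y| * (D * `|y|) by rewrite normrM ler_pM.
  apply: le_trans (ler_normD _ _) _; apply: le_trans (lerD (ler_normD _ _) (ler_normD _ _)) _.
  apply: le_trans (lerD (lerD H1 H2) (lerD H3 H4)) _.
  by rewrite le_eqVlt; apply/orP; left; apply/eqP; ring.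
Qed.

Lemma lip2_prod I (s : seq I) (F : I -> Z -> R) :
  (forall i, exists C, lip2 (F i) C) ->
  exists C, lip2 (fun z => \prod_(i <- s) F i z) C.
Proof.
move=> H; elim: s => [|i s [D IH]].
  exists 1; split => //.
  - by move=> z; rewrite big_nil normr1.
  - by move=> z v; rewrite !big_nil subrr normr0 mul1r nrm_ge0.
  - move=> z y; rewrite !big_nil mul1r (_ : 1 + 1 - 2 * 1 = 0) ?normr0 ?sqr_ge0//.
    by ring.
have [C HC] := H i; exists (4 * (C * D)).
rewrite (_ : (fun z => _) = (fun z => F i z * \prod_(i <- s) F i z)); first exact: lip2_mul.
by apply/funext => z; rewrite big_cons.
Qed.

Lemma lip2_space (i : 'I_N) (g dg ddg : R -> R) (C : R) : 0 <= C -> C2b g dg ddg C ->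
  lip2 (fun z => g (z.1 0 i)) (2 * C).
Proof.
move=> C0 H; have [d1 d2 B] := H; split.
- by rewrite mulr_ge0.
- by move=> z; have [h _ _] := B (z.1 0 i); apply: le_trans h _; lra.
- move=> z v; have L := lip_of_derive d1 (fun t => let: And3 _ b _ := B t in b).
  apply: le_trans (L _ _) _; rewrite /= mxE addrAC subrr add0r.
  rewrite /nrm; apply: (@le_trans _ _ (C * `|v.1|)); first by rewrite ler_wpM2l// rV_coord_le.
  by rewrite -mulrA; have : 0 <= `|v.2 : R| by []; have : 0 <= `|v.1| by []; nra.
- move=> z y; rewrite /= !mxE; apply: le_trans (C2b_second _ _ H) _.
  rewrite ler_wpM2l ?mulr_ge0// -real_normK ?num_real// lerXn2r ?nnegrE//.
  exact: rV_coord_le.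
Qed.

Lemma lip2_time (g dg ddg : R -> R) (C : R) : 0 <= C -> C2b g dg ddg C ->
  lip2 (fun z => g z.2) (2 * C).
Proof.
move=> C0 H; have [d1 d2 B] := H; split.
- by rewrite mulr_ge0.
- by move=> z; have [h _ _] := B z.2; apply: le_trans h _; lra.
- move=> z v; have L := lip_of_derive d1 (fun t => let: And3 _ b _ := B t in b).
  apply: le_trans (L _ _) _; rewrite /= addrAC subrr add0r.
  rewrite /nrm; have : 0 <= `|v.2 : R| by []; have : 0 <= `|v.1| by []; nra.
- move=> z y; rewrite /= oppr0 !addr0 (_ : _ - _ = 0) ?normr0; last ring.
  by rewrite mulr_ge0// mulr_ge0.
Qed.

End lip2.

(** * Space-time cylinders and functions supported in them *)

Section cylinders.
Context {R : realType} {n : nat}.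
Local Notation N := n.+1.
Local Notation mu := (@leb_rVT R N).
Local Notation Z := ('rV[R]_N * measurableTypeR R)%type.
Implicit Types (f : Z -> R) (a : 'rV[R]_N) (r C : R).

Definition cyl a r (t1 t2 : R) : set Z := [set z | `|a - z.1| < r /\ t1 < z.2 < t2].

Lemma cyl_measure a r (t1 t2 : R) : 0 < r -> t1 <= t2 ->
  measurable (cyl a r t1 t2) /\ mu (cyl a r t1 t2) = ((2 * r) ^+ N * (t2 - t1))%:E.
Proof.
move=> r0 t12.
have -> : cyl a r t1 t2 = [set x : 'rV[R]_N | `|a - x| < r] `*` `]t1, t2[%classic.
  by apply/seteqP; split => -[x t] /=; rewrite in_itv.
have [mB eB] := @rV_ball_measure R n a r r0.
split; first exact: measurableX.
pose A := [set x : 'rV[R]_N | `|a - x| < r].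
transitivity (lebesgue_rV N A * @lebesgue_measure R `]t1, t2[%classic)%E.
  by rewrite -product_measure1E.
rewrite eB [X in (_ * X)%E](lebesgue_measure_itv `]t1, t2[) /= lte_fin.
case: ltP => t; first by rewrite -EFinD -EFinM.
by rewrite (_ : t2 = t1) ?subrr ?mulr0 ?mule0//; apply/eqP; rewrite eq_le t t12.
Qed.

Lemma ible_indic (A : set Z) (c : R) : measurable A -> mu A = c%:E ->
  ible mu (\1_A : Z -> R) /\ \int[mu]_z \1_A z = c.
Proof.
move=> mA eA; have mi : measurable_fun setT (\1_A : Z -> R) by exact: measurable_indic.
have E : (\int[mu]_z (\1_A z)%:E)%E = c%:E by rewrite integral_indic// setIT.
have i : ible mu (\1_A : Z -> R).
  by apply: (ible_ge0 mi) (ltry c) => [z|]; rewrite ?E// indicE.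
by split => //; apply: EFin_inj; rewrite -ible_fin.
Qed.

Lemma cyl_ible a r (t1 t2 : R) : 0 < r -> t1 <= t2 ->
  ible mu (\1_(cyl a r t1 t2) : Z -> R) /\
  \int[mu]_z \1_(cyl a r t1 t2) z = (2 * r) ^+ N * (t2 - t1).
Proof. by move=> r0 t12; have [m e] := cyl_measure a r0 t12; exact: ible_indic. Qed.

Lemma ible_supp f a r (t1 t2 : R) C : 0 < r -> t1 <= t2 -> measurable_fun setT f ->
  (forall z, `|f z| <= C) -> (forall z, f z != 0 -> cyl a r t1 t2 z) -> ible mu f.
Proof.
move=> r0 t12 mf fC fs.
apply: (ible_le mf _ (ibleZ C (cyl_ible a r0 t12).1)) => z.
have C0 : 0 <= C by apply: le_trans (fC z).
have [->|fz] := eqVneq (f z) 0; first by rewrite normr0 mulr_ge0// indicE.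
by rewrite indicE mem_set ?mulr1//; exact: fs.
Qed.

Lemma int_supp_pos f a r (t1 t2 : R) : 0 < r -> t1 < t2 -> ible mu f ->
  (forall z, 0 <= f z) -> (forall z, cyl a r t1 t2 z -> 0 < f z) -> 0 < \int[mu]_z f z.
Proof.
move=> r0 t12 fi f0 fp; rewrite lt_neqAle int_ge0// andbT; apply/negP => /eqP/esym H.
have [m e] := cyl_measure a r0 (ltW t12).
have ne : mu (cyl a r t1 t2) != 0%E.
  by rewrite e eqe gt_eqF// mulr_gt0 ?exprn_gt0 ?mulr_gt0 ?subr_gt0.
have [z cz] := ae_exists m ne (int_gt0_ex fi f0 H).
by apply/eqP; rewrite gt_eqF// fp.
Qed.

End cylinders.

(** * Mollifiers supported in the past *)

Section mollifier.
Context {R : realType} {n : nat}.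
Local Notation N := n.+1.
Local Notation mu := (@leb_rVT R N).
Local Notation Z := ('rV[R]_N * measurableTypeR R)%type.

(* The support lies strictly in the past, so that convolving with a mollifier
   at the time [t = 1] only involves times [< 1]. *)
Record moll (eps : R) (eta deta : Z -> R) (C : R) : Prop := Moll {
  moll_meas : measurable_fun setT eta;
  moll_ge0 : forall z, 0 <= eta z;
  moll_ible : ible mu eta;
  moll_int : \int[mu]_z eta z = 1;
  moll_supp : forall z, eta z != 0 -> `|z.1| < eps /\ eps / 4 < z.2 < eps;
  moll_lip2 : lip2 eta C;
  moll_dmeas : measurable_fun setT deta;
  moll_dbound : forall z, `|deta z| <= C;
  moll_dsupp : forall z, deta z != 0 -> `|z.1| < eps /\ eps / 4 < z.2 < eps;
  moll_taylor : forall z k, `|eta z - eta (z - (0, k : measurableTypeR R)) - k * deta z| <= C * k ^+ 2;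
  moll_derive : forall x (t : R), is_derive t 1 (fun t' => eta (x, t' : measurableTypeR R)) (deta (x, t : measurableTypeR R));
  moll_test : forall z, -1 + eps < z.2 -> z.2 <= 1 ->
    test_function (strip `]-1, 1[) (fun w : 'rV[R]_N * R => eta (z - w))
}.

(** The normalized product of a bump on $(-\varepsilon,\varepsilon)$ in each space coordinate and a
    bump on $(\varepsilon/4,\varepsilon)$ in time. *)
Lemma moll_exists eps : 0 < eps -> exists eta deta C, moll eps eta deta C.
Proof.
move=> e0.
pose B := @bump1 R (- eps) eps; pose b := @bump1 R (eps / 4) eps.
have [dB [ddB [CB [CB0 HB]]]] := @bump1_C2b R (- eps) eps.
have [db [ddb [Cb [Cb0 Hb]]]] := @bump1_C2b R (eps / 4) eps.
pose sp (z : Z) := \prod_(i <- index_enum 'I_N) B (z.1 0 i).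
have [C1 L1] : exists C, lip2 sp C.
  by apply: lip2_prod => i; exists (2 * CB); exact: lip2_space HB.
have L2 : lip2 (fun z : Z => b z.2) (2 * Cb) by exact: lip2_time Hb.
pose e (z : Z) := sp z * b z.2; pose de (z : Z) := sp z * db z.2.
have sp0 z : 0 <= sp z by apply: prodr_ge0 => i _; exact: bump1_ge0.
have spS z : sp z != 0 -> `|z.1| < eps.
  rewrite /sp => /prodf_neq0 H; apply/rV_norm_lt => // i.
  by rewrite ltr_norml; apply: bump1_supp; exact: H.
have bc g dg ddg C : C2b g dg ddg C -> continuous (g : R -> R).
  move=> [d _ _] t; apply: differentiable_continuous.
  by apply/derivable1_diffP; have [] := d t.
have dbc : continuous (db : R -> R).
  case: Hb => _ d _ t; apply: differentiable_continuous.
  by apply/derivable1_diffP; have [] := d t.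
have msp : measurable_fun setT sp.
  apply: measurable_prod => i _; apply: (measurableT_comp (f := B)).
    by apply: continuous_measurable_fun; exact: bc HB.
  apply: (measurableT_comp (f := fun x : 'rV[R]_N => x 0 i)) => //.
  exact: measurable_coord.
have mb : measurable_fun setT (fun z : Z => b z.2).
  apply: (measurableT_comp (f := b)) => //.
  by apply: continuous_measurable_fun; exact: bc Hb.
have mdb : measurable_fun setT (fun z : Z => db z.2).
  apply: (measurableT_comp (f := db)) => //.
  exact: continuous_measurable_fun.
have me : measurable_fun setT e by exact: measurable_funM.
have eS z : e z != 0 -> `|z.1| < eps /\ eps / 4 < z.2 < eps.
  rewrite /e mulf_eq0 negb_or => /andP[h1 h2]; split; first exact: spS.
  exact: bump1_supp h2.
have Le := lip2_mul L1 L2.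
have e_ge0 z : 0 <= e z by rewrite mulr_ge0// bump1_ge0.
have [CC0 eC _ _] := Le.
have ei : ible mu e.
  apply: (@ible_supp _ _ e 0 eps (eps / 4) eps) eC _ => //; first lra.
  by move=> z /eS[h1 h2]; split => //=; rewrite sub0r normrN.
have I0 : 0 < \int[mu]_z e z.
  apply: (@int_supp_pos _ _ e 0 eps (eps / 4) eps) => //; first lra.
  move=> z [h1 h2]; apply: mulr_gt0; last exact: bump1_gt0.
  apply: prodr_gt0 => i _; apply: bump1_gt0.
  rewrite -ltr_norml; move: i; apply/rV_norm_lt => //.
  by move: h1; rewrite sub0r normrN.
pose c := (\int[mu]_z e z)^-1.
have c0 : 0 < c by rewrite invr_gt0.
have [_ L1b _ _] := L1; have [_ _ Bb] := Hb.
have [dB1 _ _] := HB; have [db1 ddb1 _] := Hb.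
(* The derivative also vanishes at the two ends, because the bump attains its minimum $0$ there;
   this keeps the support condition strict. *)
have dbS t : db t != 0 -> eps / 4 < t < eps.
  have [H|H|->] := ltgtP t (eps / 4).
  - have : 'D_1 b t = db t by have [] := db1 t.
    have -> : 'D_1 b t = 0.
      rewrite (@near_eq_derive _ _ _ b (cst 0)) ?derive_cst//.
      near=> x; apply/eqP; apply: contraT => /bump1_supp /andP[xx _].
      suff : x < eps / 4 by rewrite ltNge ltW.
      by near: x; exact: lt_nbhsl.
    by move=> <-; rewrite eqxx.
  - have [H'|H'|H'] := ltgtP t eps; first by rewrite ?H ?H'.
    + have : 'D_1 b t = db t by have [] := db1 t.
      have -> : 'D_1 b t = 0.
        rewrite (@near_eq_derive _ _ _ b (cst 0)) ?derive_cst//.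
        near=> x; apply/eqP; apply: contraT => /bump1_supp /andP[_ xx].
        suff : eps < x by rewrite ltNge ltW.
        by near: x; exact: lt_nbhsr.
      by move=> <-; rewrite eqxx.
    + rewrite H'; have [_ T _] := Hb.
      have : is_derive eps 1 b 0.
        apply: (@derive1_at_min _ b (eps - 1) (eps + 1)).
        * by lra.
        * by move=> x _; have [] := db1 x.
        * by rewrite in_itv/=; apply/andP; split; lra.
        * move=> x _; rewrite /b {1}/bump1 subrr [flat 0 0]flat_neg// mulr0.
          exact: bump1_ge0.
      by case=> _; have [_ ->] := db1 eps => ->; rewrite eqxx.
  - have : is_derive (eps / 4) 1 b 0.
      apply: (@derive1_at_min _ b (eps / 4 - 1) (eps / 4 + 1)).
      * by lra.
      * by move=> x _; have [] := db1 x.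
      * by rewrite in_itv/=; apply/andP; split; lra.
      * move=> x _; rewrite /b {1}/bump1 subrr [flat 0 0]flat_neg// mul0r.
        exact: bump1_ge0.
    by case=> _; have [_ ->] := db1 (eps / 4) => ->; rewrite eqxx.
(* One constant has to serve for the function and for its time derivative, hence the sum of the two
   bounds. *)
pose CF := c * (4 * (C1 * (2 * Cb))) + c * (C1 * Cb).
have [C10 _ _ _] := L1.
have CA : c * (4 * (C1 * (2 * Cb))) <= CF by rewrite lerDl !mulr_ge0 ?(ltW c0).
have CBd : c * (C1 * Cb) <= CF by rewrite lerDr !mulr_ge0 ?(ltW c0).
exists (fun z => c * e z), (fun z => c * de z), CF; split.
- exact: measurable_funM.
- by move=> z; rewrite mulr_ge0 ?(ltW c0).
- exact: ibleZ.
- by rewrite intZ// mulVf ?gt_eqF.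
- by move=> z H; apply: eS; apply: contraNneq H => ->; rewrite mulr0.
- have [_ E0 E1 E2] := Le; split.
  + by rewrite (le_trans _ CA)// !mulr_ge0 ?(ltW c0).
  + move=> z; rewrite normrM (gtr0_norm c0); apply: le_trans CA.
    by rewrite ler_pM2l //; exact: E0.
  + move=> z v; rewrite -mulrBr normrM (gtr0_norm c0).
    apply: (@le_trans _ _ (c * (4 * (C1 * (2 * Cb))) * nrm v)).
      by rewrite -mulrA ler_pM2l//; exact: E1.
    by rewrite ler_wpM2r ?nrm_ge0.
  + move=> z y.
    rewrite (_ : _ - _ = c * (e (z + (y, 0)) + e (z - (y, 0)) - 2 * e z)); last ring.
    rewrite normrM (gtr0_norm c0).
    apply: (@le_trans _ _ (c * (4 * (C1 * (2 * Cb))) * `|y| ^+ 2)).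
      by rewrite -mulrA ler_pM2l//; exact: E2.
    by rewrite ler_wpM2r ?sqr_ge0.
- by apply: measurable_funM => //; exact: measurable_funM.
- move=> z; rewrite normrM (gtr0_norm c0); apply: le_trans CBd.
  by rewrite ler_pM2l// normrM ler_pM//; have [] := Bb z.2.
- move=> z; rewrite /de !mulf_eq0 !negb_or => /and3P[_ h1 h2].
  by split; [exact: spS|exact: dbS].
- move=> z k.
  have -> : c * e z - c * e (z - (0, k)) - k * (c * de z) =
      - (c * sp z) * (b (z.2 + - k) - b z.2 - - k * db z.2).
    rewrite /e /de (_ : sp (z - (0, k)) = sp z); last first.
      by apply: eq_bigr => i _; rewrite /= !mxE oppr0 addr0.
    by rewrite /=; ring.
  rewrite normrM normrN normrM (gtr0_norm c0) -sqrrN.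
  apply: (@le_trans _ _ ((c * C1) * (Cb * (- k) ^+ 2))).
    apply: ler_pM => //; first by rewrite mulr_ge0 ?(ltW c0).
      by rewrite ler_pM2l //; exact: E0.
    by apply: (taylor_of_derive db1 ddb1) => t; have [] := Bb t.
  rewrite mulrA ler_wpM2r ?sqr_ge0// -mulrA; exact: CBd.
- move=> x t.
  have -> : (fun t' : R => c * e (x, t' : measurableTypeR R)) = (fun t' => (c * sp (x, 0 : measurableTypeR R)) * b t').
    by apply/funext => t'; rewrite /e mulrA.
  have -> : c * de (x, t : measurableTypeR R) = (c * sp (x, 0 : measurableTypeR R)) * db t.
    by rewrite /de mulrA.
  exact: (@is_deriveZ _ _ _ _ (c * sp (x, 0 : measurableTypeR R)) _ _ _ (db1 t)).
- move=> z z1 z2.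
  have cl : continuous (fun w : 'rV[R]_N * R => w.2) by move=> w; exact: cvg_snd.
  have cc i : continuous (fun w : 'rV[R]_N * R => w.1 0 i).
    move=> w; apply: (continuous_comp (f := fst) (g := fun x : 'rV[R]_N => x 0 i)).
      exact: cvg_fst.
    exact: coord_continuous.
  have g1 (a d : R) (l : 'rV[R]_N * R -> R) : continuous l ->
      (forall h v x, l (h *: v + x) = h * l v + l x) ->
      gen (fun w => flat 0 (a * l w + d)).
    move=> lc ll; apply: (gen_flat 0 (l := fun w => a * l w + d) (dl := fun v => a * l v)).
      move=> w; apply: cvgD; last exact: cvg_cst.
      by apply: cvgM; [exact: cvg_cst|exact: lc].
    by move=> h v x; rewrite ll; ring.
  have gB i (a d : R) : gen (fun w : 'rV[R]_N * R => flat 0 (a * w.1 0 i + d)).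
    by apply: g1; [exact: cc|move=> h v x; rewrite /= !mxE].
  have gb (a d : R) : gen (fun w : 'rV[R]_N * R => flat 0 (a * w.2 + d)).
    exact: g1.
  (* A compact box that contains the support; the restriction on [z.2] places it inside the open
     strip. *)
  pose box := [set x : 'rV[R]_N | forall i, `[z.1 0 i - eps, z.1 0 i + eps]%classic (x ord0 i)] `*` `[z.2 - eps, z.2 - eps / 4]%classic.
  have S : [set w : 'rV[R]_N * R | c * e (z - w) != 0] `<=` box.
    move=> w /= H; have /eS[/= h1 /andP[h2 h3]] : e (z - w) != 0.
      by apply: contraNneq H => ->; rewrite mulr0.
    split; last by rewrite /= in_itv/=; apply/andP; split; lra.
    move=> i /=; have /rV_norm_lt := h1 => /(_ e0 i); rewrite !mxE ltr_norml => /andP[? ?].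
    by rewrite in_itv/=; apply/andP; split; lra.
  have K : compact box.
    apply: compact_setX; last exact: segment_compact.
    apply: (@rV_compact R N (fun i => `[z.1 0 i - eps, z.1 0 i + eps]%classic)) => i.
    exact: segment_compact.
  have clK : closure [set w : 'rV[R]_N * R | c * e (z - w) != 0] `<=` box.
    rewrite [X in _ `<=` X](closure_id box).1; first exact: closure_subset.
    by apply: compact_closed => //; exact: norm_hausdorff.
  split.
  + apply: gen_smooth; apply: gen_mul; first exact: gen_cst.
    apply: gen_mul.
      apply: gen_prod => i.
      rewrite (_ : (fun x => _) = (fun w : 'rV[R]_N * R => flat 0 (-1 * w.1 0 i + (z.1 0 i + eps)) * flat 0 (1 * w.1 0 i + (eps - z.1 0 i)))).
        by apply: gen_mul; exact: gB.
      apply/funext => w; rewrite /B /bump1 /= !mxE; congr (flat 0 _ * flat 0 _); ring.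
    rewrite (_ : (fun x => _) = (fun w : 'rV[R]_N * R => flat 0 (-1 * w.2 + (z.2 - eps / 4)) * flat 0 (1 * w.2 + (eps - z.2)))).
      by apply: gen_mul; exact: gb.
    by apply/funext => w; rewrite /b /bump1 /=; congr (flat 0 _ * flat 0 _); ring.
  + by apply: (subclosed_compact _ K clK); exact: closed_closure.
  + move=> w /clK[_ /=]; rewrite in_itv/= /strip/= in_itv/= => /andP[? ?].
    by split => //; apply/andP; split; lra.
Unshelve. all: by end_near. Qed.

End mollifier.

(** * The operator acting on mollifiers, and its truncations *)

Section mollifier_laplacian.
Context {R : realType} {n : nat} (s : R).
Hypothesis s01 : 0 < s < 1.
Local Notation N := n.+1.
Local Notation lam := (@lebesgue_rV R N).
Local Notation mu := (@leb_rVT R N).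
Local Notation Z := ('rV[R]_N * measurableTypeR R)%type.
Local Notation K := (@fkernel R n s).
Local Notation c := (@fconst R n s).
Implicit Types (f p eta deta : Z -> R) (z w : Z) (x y : 'rV[R]_N) (e C eps : R).

Lemma preserves_rV_opp : preserves lam (fun y : 'rV[R]_N => - y).
Proof.
have := @lebesgue_rV_subl R N 0.
by rewrite (_ : (fun x => 0 - x) = (fun x => - x))//; apply/funext => y; rewrite sub0r.
Qed.

(** The weight inside the ball of radius $e$. It controls the error of cutting the kernel and tends
    to $0$ with $e$ by dominated convergence. *)
Definition krho e : R := \int[lam]_y (kJ s 1 y * (enorm y <= e)%R%:R).

Lemma measurable_enorm_le e : measurable_fun setT (fun y : 'rV[R]_N => (enorm y <= e)%R%:R : R).
Proof.
rewrite (_ : (fun x => _) = \1_[set x : 'rV[R]_N | enorm x <= e]).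
  apply: measurable_indic.
  rewrite (_ : mkset _ = @enorm R N @^-1` `]-oo, e]%classic).
    by rewrite -[X in measurable X]setTI; exact: measurable_enorm.
  by apply/seteqP; split => x /=; rewrite in_itv/=.
apply/funext => x; rewrite indicE; congr (_%:R); congr nat_of_bool.
by apply/idP/idP; [move/mem_set|move/set_mem].
Qed.

Lemma kJ_cut_ge0 e y : 0 <= kJ s 1 y * (enorm y <= e)%R%:R.
Proof. by apply: mulr_ge0 => //; exact: kJ_ge0. Qed.

Lemma krho_ible e : ible lam (fun y => kJ s 1 y * (enorm y <= e)%R%:R).
Proof.
apply: (ible_le _ _ (kJ_int s01 ltr01).1).
  by apply: measurable_funM; [exact: measurable_kJ|exact: measurable_enorm_le].
move=> y; rewrite (ger0_norm (kJ_cut_ge0 _ _)).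
by case: (enorm y <= e); rewrite ?mulr1// mulr0; exact: kJ_ge0.
Qed.

Lemma krho_ge0 e : 0 <= krho e.
Proof. by apply: int_ge0 => y; exact: kJ_cut_ge0. Qed.

Lemma krho_cvg0 C : 0 < C -> exists2 e0, 0 < e0 & forall e, e <= e0 -> krho e <= C.
Proof.
move=> C0.
have [||||_] := @dct _ _ _ lam (fun k y => kJ s 1 y * (enorm y <= k.+1%:R^-1)%R%:R)
  (fun=> 0) (kJ s 1).
- by move=> k; apply: measurable_funM; [exact: measurable_kJ|exact: measurable_enorm_le].
- move=> k y; rewrite (ger0_norm (kJ_cut_ge0 _ _)).
  by case: (enorm y <= _); rewrite ?mulr1// mulr0; exact: kJ_ge0.
- exact: (kJ_int s01 ltr01).1.
- move=> y; have [->|y0] := eqVneq y 0.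
    rewrite (_ : (fun k => _) = cst 0); first exact: cvg_cst.
    by apply/funext => k; rewrite /kJ fkernel0// mulr0 mul0r.
  apply: cvg_near_cst; near=> k.
  rewrite (_ : (_ <= _)%R = false) ?mulr0//; apply/negbTE; rewrite -ltNge.
  near: k; have := @near_infty_natSinv_lt R (PosNum (enorm_gt0 y0)).
  exact.
rewrite int0 => H.
have /cvgrPdist_le/(_ C C0)[k _ Hk] := H.
exists k.+1%:R^-1; first by rewrite invr_gt0.
move=> e ek; have := Hk k (leqnn k); rewrite sub0r normrN => H'.
apply: le_trans (le_trans (ler_norm _) H').
apply: int_le; [exact: krho_ible|exact: krho_ible|].
move=> y; rewrite ler_wpM2l ?kJ_ge0// ler_nat.
by case: (lerP (enorm y) e) => // h; rewrite (le_trans h ek).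
Unshelve. all: by end_near. Qed.

Definition sdiff f w y := 2 * f w - f (w - (y, 0)) - f (w + (y, 0)).

(** The fractional Laplacian written with second differences, which needs no principal value. *)
Definition Ainf f w := 2^-1 * \int[lam]_y (sdiff f w y * (c * K y)).

Lemma sdiff_bound f C w y : lip2 f C -> `|sdiff f w y| <= 4 * C * Num.min 1 (`|y| ^+ 2 / 1 ^+ 2).
Proof.
move=> [C0 f0 _ f2]; rewrite expr1n divr1.
have h1 : `|sdiff f w y| <= C * `|y| ^+ 2.
  have -> : sdiff f w y = - (f (w + (y, 0)) + f (w - (y, 0)) - 2 * f w).
    by rewrite /sdiff; ring.
  by rewrite normrN.
have h2 : `|sdiff f w y| <= 4 * C.
  apply: le_trans (ler_normB _ _) _; apply: le_trans (lerD (ler_normB _ _) (lexx _)) _.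
  rewrite normrM ger0_norm//.
  by have := f0 w; have := f0 (w - (y, 0)); have := f0 (w + (y, 0)); lra.
case: (lerP 1 (`|y| ^+ 2)) => h; first by rewrite mulr1.
apply: le_trans h1 _; rewrite ler_wpM2r ?sqr_ge0//; lra.
Qed.

Lemma measurable_sdiff f w : measurable_fun setT f -> measurable_fun setT (sdiff f w).
Proof.
move=> mf.
have m1 : measurable_fun setT (fun y : 'rV[R]_N => (y, 0 : measurableTypeR R)).
  by apply: measurable_fun_pair.
have m2 : measurable_fun setT (fun y : 'rV[R]_N => w - (y, 0 : measurableTypeR R)).
  exact: measurable_Z_sub.
have m3 : measurable_fun setT (fun y : 'rV[R]_N => w + (y, 0 : measurableTypeR R)).
  rewrite (_ : (fun y => _) = (fun y => (w - 0) - ((- y), 0 : measurableTypeR R))).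
    apply: measurable_Z_sub => //; apply: measurable_fun_pair => //.
    exact: preserves_rV_opp.1.
  by apply/funext => y; rewrite subr0; congr (_ + _); congr pair; rewrite /= ?opprK ?oppr0.
apply: measurable_funB; last exact: measurableT_comp.
by apply: measurable_funB => //; exact: measurableT_comp.
Qed.

Lemma sdiff_ible f C w : measurable_fun setT f -> lip2 f C ->
  ible lam (fun y => sdiff f w y * (c * K y)).
Proof.
move=> mf lf; have [C0 _ _ _] := lf; have c0 := @fconst_gt0 R n s s01.
apply: (ible_le _ _ (ibleZ (4 * C * c) (kJ_int s01 ltr01).1)).
  apply: measurable_funM; first exact: measurable_sdiff.
  by apply: measurable_funM => //; exact: measurable_fkernel.
move=> y; rewrite normrM (ger0_norm (mulr_ge0 (ltW c0) (fkernel_ge0 _ _))).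
apply: le_trans (ler_wpM2r (mulr_ge0 (ltW c0) (fkernel_ge0 _ _)) (sdiff_bound w y lf)) _.
by rewrite /kJ le_eqVlt; apply/orP; left; apply/eqP; ring.
Qed.

(** Average the defining integral with its image under $y\mapsto-y$. *)
Lemma Aop_sdiff e f C w : 0 < e -> measurable_fun setT f -> lip2 f C ->
  Aop s e f w = 2^-1 * \int[lam]_y (sdiff f w y * ke s e y).
Proof.
move=> e0 mf [C0 f0 _ _].
have bf : bmeas f C by [].
have i1 := Aop_ible s01 w e0 bf.
have i2 := ible_preserves preserves_rV_opp i1.
have E : Aop s e f w = \int[lam]_y ((f w - f (w - (- y, 0 : measurableTypeR R))) * ke s e (- y)).
  by rewrite -[LHS](int_preserves preserves_rV_opp i1).
have -> : Aop s e f w = 2^-1 * (Aop s e f w + Aop s e f w) by field.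
congr (_ * _); rewrite {2}E -intD//; apply: eq_int => y.
rewrite keN /sdiff -mulrDl; congr (_ * _).
have -> : w - (- y, 0 : measurableTypeR R) = w + (y, 0).
  by congr (_ + _); congr pair; rewrite /= ?opprK ?oppr0.
ring.
Qed.

Lemma sdiff_ke_ible e f C w : measurable_fun setT f -> lip2 f C ->
  ible lam (fun y => sdiff f w y * ke s e y).
Proof.
move=> mf lf; apply: (ible_le _ _ (ible_abs (sdiff_ible w mf lf))).
  by apply: measurable_funM; [exact: measurable_sdiff|exact: measurable_ke].
move=> y; rewrite /ke !normrM; do 2 apply: ler_wpM2l => //.
by rewrite ler_piMr//; case: (e < enorm y); rewrite ?normr1 ?normr0.
Qed.

Lemma Aop_Ainf e f C w : 0 < e -> measurable_fun setT f -> lip2 f C ->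
  `|Aop s e f w - Ainf f w| <= 2 * C * c * krho e.
Proof.
move=> e0 mf lf; have c0 := @fconst_gt0 R n s s01.
rewrite (Aop_sdiff _ e0 mf lf) /Ainf -mulrBr -intB; last 2 first.
- exact: sdiff_ke_ible lf.
- exact: sdiff_ible lf.
rewrite normrM gtr0_norm ?invr_gt0//.
rewrite (_ : 2 * C * c * _ = 2^-1 * (4 * C * c * krho e)); last by field.
rewrite ler_pM2l ?invr_gt0// -intZ; last exact: krho_ible.
apply: int_bound.
- by apply: ibleB; [exact: sdiff_ke_ible lf|exact: sdiff_ible lf].
- exact/ibleZ/krho_ible.
move=> y; rewrite -mulrBr normrM /ke.
have -> : `|c * (K y * (e < enorm y)%R%:R) - c * K y| = c * K y * (enorm y <= e)%R%:R.
  case: (ltP e (enorm y)) => h; first by rewrite mulr1 subrr normr0 mulr0.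
  by rewrite !mulr0 sub0r normrN mulr1 ger0_norm// mulr_ge0 ?fkernel_ge0// ltW.
apply: le_trans (ler_wpM2r _ (sdiff_bound w y lf)) _.
  by rewrite !mulr_ge0 ?fkernel_ge0// ltW.
by rewrite /kJ le_eqVlt; apply/orP; left; apply/eqP; ring.
Qed.

(** Where $f$ vanishes on a spatial neighbourhood of size $\varepsilon\ge e$, the cut removes
    nothing; hence the error of truncation has compact support although the fractional Laplacian of
    $f$ has not. *)
Lemma Aop_Ainf_supp e f C w eps : 0 < e -> e <= eps -> measurable_fun setT f -> lip2 f C ->
  (forall y, `|y| <= eps -> f (w + (y, 0)) = 0) -> Aop s e f w = Ainf f w.
Proof.
move=> e0 ee mf lf Hs; rewrite (Aop_sdiff _ e0 mf lf) /Ainf; congr (_ * _).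
apply: eq_int => y; rewrite /ke; case: (ltP e (enorm y)) => h; first by rewrite mulr1.
have y1 : `|y| <= eps by exact: le_trans (norm_le_enorm y) (le_trans h ee).
rewrite (_ : sdiff f w y = 0) ?mul0r// /sdiff Hs//.
rewrite (_ : w - (y, 0) = w + (- y, 0)) ?Hs ?normrN//; last first.
  by congr (_ + _); congr pair; rewrite /= oppr0.
rewrite (_ : w = w + (0, 0)) ?Hs ?normr0 ?(le_trans _ ee) ?ltW//; last first.
  by rewrite (_ : (0, 0) = 0) ?addr0.
ring.
Qed.

Definition Linf eta deta w := Ainf eta w + deta w.

Lemma moll_bmeas eps eta deta C : moll eps eta deta C -> bmeas eta C.
Proof. by move=> [m _ _ _ _ [_ h _ _] _ _ _ _ _ _]; split. Qed.

Lemma moll_Dop eps eta deta C k w : moll eps eta deta C -> 0 < k ->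
  `|Dop k eta w - deta w| <= C * k.
Proof.
move=> [_ _ _ _ _ _ _ _ _ T _ _] k0.
rewrite /Dop (_ : _ - _ = k^-1 * (eta w - eta (w - (0, k : measurableTypeR R)) - k * deta w)); last first.
  by field; rewrite gt_eqF.
rewrite normrM gtr0_norm ?invr_gt0// ler_pdivrMl//.
by apply: le_trans (T w k) _; rewrite expr2 mulrCA.
Qed.

(** A uniform rate with compact support, hence convergence in $L^1$. Outside the doubled cylinder
    the mollifier and its backward shift vanish, and [Aop_Ainf_supp] makes the spatial parts
    equal. *)
Lemma Lop_Linf_bound eps eta deta C e w : moll eps eta deta C ->
  0 < e -> e <= eps ->
  `|Lop s e eta w - Linf eta deta w| <=
    (2 * C * c * krho e + C * e) * \1_(cyl 0 (2 * eps) 0 (2 * eps)) w.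
Proof.
move=> H e0 ee; have eps0 : 0 < eps by exact: lt_le_trans ee.
have [m _ _ _ S l _ _ dS _ _ _] := H.
rewrite indicE; case: (boolP (w \in cyl 0 (2 * eps) 0 (2 * eps))) => [_|/negP wS].
  rewrite mulr1 /Lop /Linf (_ : _ - _ = (Aop s e eta w - Ainf eta w) + (Dop e eta w - deta w)); last ring.
  apply: le_trans (ler_normD _ _) _; apply: lerD; first exact: Aop_Ainf.
  exact: moll_Dop H _.
have out w' : w' \notin cyl 0 eps (eps / 4) eps -> eta w' = 0 /\ deta w' = 0.
  move=> Hw; split; apply: contraNeq Hw => /[dup]; [move=> /S|move=> /dS].
    by move=> [h1 h2] _; apply/mem_set; split => //; rewrite sub0r normrN.
  by move=> [h1 h2] _; apply/mem_set; split => //; rewrite sub0r normrN.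
have wn : w \notin cyl 0 eps (eps / 4) eps.
  apply/negP => /set_mem[h1 /andP[h2 h3]]; apply: wS; apply/mem_set; split; first by lra.
  by apply/andP; split; lra.
have [e1 e2] := out _ wn.
rewrite mulr0 /Lop /Linf e2 addr0 (@Aop_Ainf_supp e eta C w eps)//; last first.
  move=> y ye; apply: (out _ _).1; apply/negP => /set_mem[].
  rewrite /= addr0 => h1 h2; apply: wS; apply/mem_set; split.
    move: h1; rewrite !sub0r !normrN => h1.
    have -> : w.1 = (w.1 + y) - y by rewrite addrK.
    by apply: le_lt_trans (ler_normB _ _) _; lra.
  by case/andP: h2 => ? ?; apply/andP; split; lra.
rewrite addrAC subrr add0r /Dop e1 (out (w - (0, e : measurableTypeR R)) _).1 ?subr0 ?mul0r ?normr0//.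
apply/negP => /set_mem[]; rewrite /= subr0 => h1 /andP[h2 h3]; apply: wS.
by apply/mem_set; split; [lra|apply/andP; split; lra].
Qed.

Lemma Lop_Linf_cvg eps eta deta C (r : R) : 0 < eps -> moll eps eta deta C -> 0 < r ->
  exists2 e0, 0 < e0 & forall e w, 0 < e -> e <= e0 ->
    `|Lop s e eta w - Linf eta deta w| <= r * \1_(cyl 0 (2 * eps) 0 (2 * eps)) w.
Proof.
move=> eps0 H r0; have c0 := @fconst_gt0 R n s s01.
have C0 : 0 <= C by have [_ _ _ _ _ [] ] := H.
pose D := 2 * C * c + C + 1.
have D0 : 0 < D by rewrite ltr_wpDl// addr_ge0// !mulr_ge0// ltW.
have [e1 e10 He1] := @krho_cvg0 (r / D) (divr_gt0 r0 D0).
exists (Num.min (Num.min e1 eps) (r / D)).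
  by rewrite !lt_min e10 eps0 divr_gt0.
move=> e w e0; rewrite !le_min => /andP[/andP[ee1 eeps] er].
apply: le_trans (Lop_Linf_bound w H e0 eeps) _.
apply: ler_wpM2r; first by rewrite indicE.
apply: (@le_trans _ _ (2 * C * c * (r / D) + C * (r / D))).
  by rewrite lerD// ler_wpM2l ?mulr_ge0 ?(ltW c0)//; exact: He1.
rewrite -mulrDl mulrCA ler_piMr ?(ltW r0)// ler_pdivrMr// mul1r.
by rewrite /D lerDl.
Qed.

Lemma moll_2cyl eps : 0 < eps ->
  ible mu (\1_(cyl (0 : 'rV[R]_N) (2 * eps) 0 (2 * eps)) : Z -> R) /\
  \int[mu]_z \1_(cyl (0 : 'rV[R]_N) (2 * eps) 0 (2 * eps)) z = (4 * eps) ^+ N * (2 * eps).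
Proof.
move=> e0; have r0 : 0 < 2 * eps by lra.
have [i ->] := cyl_ible (0 : 'rV[R]_N) r0 (ltW r0); split => //.
by rewrite subr0 (_ : 2 * (2 * eps) = 4 * eps); last ring.
Qed.

Lemma Linf_meas eps eta deta C : 0 < eps -> moll eps eta deta C ->
  measurable_fun setT (Linf eta deta).
Proof.
move=> e0 H.
apply: (@measurable_fun_cvg _ _ _ _ (fun k => Lop s k.+1%:R^-1 eta)).
- move=> k; have := Lop_bmeas s01 (e := k.+1%:R^-1) _ (moll_bmeas H).
  by case; rewrite ?invr_gt0.
- move=> w _; apply/cvgrPdist_le => r r0.
  have [e1 e10 He1] := Lop_Linf_cvg e0 H r0.
  near=> k; rewrite distrC; apply: le_trans (He1 _ _ _ _) _.
  + by rewrite invr_gt0.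
  + by apply/ltW; near: k; exact: (@near_infty_natSinv_lt R (PosNum e10)).
  + by rewrite indicE ler_piMr// ?(ltW r0)//; case: (_ \in _).
Unshelve. all: by end_near. Qed.

Lemma Linf_ible eps eta deta C : 0 < eps -> moll eps eta deta C -> ible mu (Linf eta deta).
Proof.
move=> e0 H; have [e1 e10 He1] := Lop_Linf_cvg e0 H ltr01.
have L := Lop_mu_ible s01 e10 (moll_bmeas H) (moll_ible H).
have i := ibleD (ible_abs L) (ibleZ 1 (moll_2cyl e0).1).
apply: (ible_le (Linf_meas e0 H) _ i) => w.
have -> : Linf eta deta w = Lop s e1 eta w - (Lop s e1 eta w - Linf eta deta w) by ring.
by apply: le_trans (ler_normB _ _) (lerD (lexx _) (He1 _ _ _ _)).
Qed.

Lemma Lop_Linf_L1 eps eta deta C (r : R) : 0 < eps -> moll eps eta deta C -> 0 < r ->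
  exists2 e0, 0 < e0 & forall e, 0 < e -> e <= e0 ->
    \int[mu]_w `|Lop s e eta w - Linf eta deta w| <= r.
Proof.
move=> eps0 H r0.
have [i I] := moll_2cyl eps0.
pose V : R := (4 * eps) ^+ N * (2 * eps).
have V0 : 0 < V by rewrite mulr_gt0 ?exprn_gt0// mulr_gt0.
have [e0 e00 He0] := Lop_Linf_cvg eps0 H (divr_gt0 r0 V0).
exists e0 => // e e1 e2.
have L := Lop_mu_ible s01 e1 (moll_bmeas H) (moll_ible H).
apply: (@le_trans _ _ (\int[mu]_w ((r / V) * \1_(cyl (0 : 'rV[R]_N) (2 * eps) 0 (2 * eps)) w))).
  apply: int_le; [|exact: ibleZ|by move=> w; exact: He0].
  by apply: ible_abs; apply: ibleB => //; exact: Linf_ible H.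
by rewrite intZ// I -/V divfK// gt_eqF.
Qed.

(** The principal value of the definition is [Ainf]: after the substitution $y\mapsto x-y$ the cut
    integrals are multiples of [Aop], which converges at the rate [krho]. *)
Lemma fraclap_moll eps eta deta C z x (t : R) : 0 < eps -> moll eps eta deta C ->
  fraclap s (fun x => eta (z - (x, t : measurableTypeR R))) x =
  Ainf eta (z - (x, t : measurableTypeR R)).
Proof.
move=> eps0 H; have c0 := @fconst_gt0 R n s s01.
set w := z - _.
have l2 := moll_lip2 H; have m := moll_meas H; have bm := moll_bmeas H.
have C0 : 0 <= C by case: l2.
have E (e : R) : 0 < e -> \int[lam]_(y in [set y | e < enorm (x - y)])
    ((eta (z - (x, t : measurableTypeR R)) - eta (z - (y, t : measurableTypeR R))) * K (x - y)) =
    c^-1 * Aop s e eta w.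
  move=> e0; have i := Aop_ible s01 w e0 bm.
  have P := lebesgue_rV_subl (x : 'rV[R]_N).
  have i1 := ible_preserves preserves_rV_opp i.
  rewrite Rintegral_mkcond.
  transitivity (\int[lam]_y (c^-1 * ((eta w - eta (w - (- (x - y), 0 : measurableTypeR R))) * ke s e (- (x - y))))).
    apply: eq_int => y; rewrite patchE keN /ke.
    have -> : (y \in [set y | e < enorm (x - y)]) = (e < enorm (x - y)).
      by apply/idP/idP; [move/set_mem|move/mem_set].
    have -> : w - (- (x - y), 0 : measurableTypeR R) = z - (y, t : measurableTypeR R).
      rewrite /w; congr pair; rewrite /= ?oppr0 ?addr0//.
      by rewrite opprK addrA subrK.
    case: (e < enorm (x - y)); last by rewrite !mulr0.
    by rewrite mulr1; field; exact: lt0r_neq0.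
  have I2 := ible_preserves P i1.
  rewrite intZ; last exact: I2.
  congr (_ * _).
  rewrite [LHS](int_preserves P i1); exact: (int_preserves preserves_rV_opp i).
rewrite /fraclap.
have -> : lim ((fun e : R => \int[lam]_(y in [set y | e < enorm (x - y)])
    ((eta (z - (x, t : measurableTypeR R)) - eta (z - (y, t : measurableTypeR R))) * K (x - y))) @ 0^'+) = c^-1 * Ainf eta w.
  apply: cvg_lim => //; apply/cvgrPdist_le => r r0.
  pose D := 2 * C + 1.
  have D0 : 0 < D by rewrite /D; lra.
  have [e1 e10 He1] := @krho_cvg0 (r / D) (divr_gt0 r0 D0).
  near=> e.
  have e0 : 0 < e by near: e; exact: nbhs_right_gt.
  have ee1 : e <= e1 by near: e; exact: nbhs_right_le.
  rewrite E// -mulrBr normrM normfV (gtr0_norm c0) mulrC ler_pdivrMr// distrC.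
  apply: le_trans (Aop_Ainf w e0 m l2) _.
  rewrite (_ : 2 * C * c * _ = 2 * C * krho e * c) ?ler_pM2r//; last by ring.
  apply: (@le_trans _ _ (2 * C * (r / D))); first by rewrite ler_wpM2l ?mulr_ge0//; exact: He1.
  by rewrite mulrCA ler_piMr ?(ltW r0)// ler_pdivrMr// mul1r /D lerDl.
by rewrite mulrA divff ?mul1r// gt_eqF.
Unshelve. all: by end_near. Qed.

End mollifier_laplacian.

(** * Continuity of translations in $L^1_{loc}$ for bounded measurable functions *)

Section translation_continuity.
Context {R : realType} {n : nat}.
Local Notation N := n.+1.
Local Notation mu := (@leb_rVT R N).
Local Notation Z := ('rV[R]_N * measurableTypeR R)%type.
Implicit Types (f g h : Z -> R) (v w : Z) (r C a b : R) (A : set Z).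

Definition Dbox r : set Z := cyl (0 : 'rV[R]_N) r (- r) r.

Lemma Dbox_ible r : 0 < r -> ible mu (\1_(Dbox r) : Z -> R).
Proof. by move=> r0; apply: (cyl_ible _ r0 _).1; lra. Qed.

Lemma indic_ge0 A w : 0 <= \1_A w :> R.
Proof. by rewrite indicE. Qed.

Lemma indic_le1 A w : \1_A w <= 1 :> R.
Proof. by rewrite indicE; case: (_ \in _). Qed.

Lemma Dbox_le r w v : nrm v <= 1 -> \1_(Dbox r) (w + v) <= \1_(Dbox (r + 1)) w :> R.
Proof.
move=> v1; rewrite !indicE ler_nat; case: (boolP (w + v \in _)) => // /set_mem[/= h1 h2].
rewrite mem_set//; move: v1; rewrite /nrm => v1.
have vx : `|v.1| <= 1 by apply: le_trans v1; rewrite lerDl.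
have vt : `|v.2 : R| <= 1 by apply: le_trans v1; rewrite lerDr.
split; last by move: vt h2; rewrite ler_norml => /andP[? ?] /andP[? ?]; apply/andP; split; lra.
have -> : 0 - w.1 = (0 - (w.1 + v.1)) + v.1 by rewrite !sub0r opprD addrNK.
by apply: le_lt_trans (ler_normD _ _) _; lra.
Qed.

(** Modulus of continuity under translation, in $L^1$ of a box. The proof below goes from sets
    bounded by Lipschitz functions to all measurable sets, then to simple functions and their
    limits. *)
Definition tmod f r v := \int[mu]_w (`|f (w - v) - f w| * \1_(Dbox r) w).

Definition Tcont f := forall r C, 0 < r -> 0 < C ->
  exists2 d, 0 < d & forall v, nrm v <= d -> tmod f r v <= C.

Lemma tdiff_bmeas f C v : bmeas f C -> bmeas (fun w => `|f (w - v) - f w|) (C + C).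
Proof.
move=> bf; have [m b] := bmeas_shift v bf; have [m' b'] := bf; split.
  by apply: measurableT_comp => //; exact: measurable_funB.
by move=> w; rewrite normr_id; apply: le_trans (ler_normB _ _) (lerD _ _).
Qed.

Lemma tmod_ible f C r v : 0 < r -> bmeas f C ->
  ible mu (fun w => `|f (w - v) - f w| * \1_(Dbox r) w).
Proof. by move=> r0 bf; have [m b] := tdiff_bmeas v bf; apply: ibleM m b (Dbox_ible r0). Qed.

Lemma Tcont_dom f g h Cf Cg Ch a b : bmeas f Cf -> bmeas g Cg -> bmeas h Ch ->
  0 <= a -> 0 <= b -> Tcont f -> Tcont g ->
  (forall w w', `|h w - h w'| <= a * `|f w - f w'| + b * `|g w - g w'|) -> Tcont h.
Proof.
move=> bf bg bh a0 b0 tf tg hfg r C r0 C0.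
have D0 : 0 < a + b + 1 by lra.
have [d1 d10 H1] := tf r (C / (a + b + 1)) r0 (divr_gt0 C0 D0).
have [d2 d20 H2] := tg r (C / (a + b + 1)) r0 (divr_gt0 C0 D0).
exists (Num.min d1 d2); first by rewrite lt_min d10.
move=> v; rewrite le_min => /andP[v1 v2].
have i1 := tmod_ible v r0 bf; have i2 := tmod_ible v r0 bg.
apply: (@le_trans _ _ (a * tmod f r v + b * tmod g r v)).
  rewrite -!intZ// -intD; [|exact: ibleZ|exact: ibleZ].
  apply: int_le; [exact: tmod_ible bh|by apply: ibleD; exact: ibleZ|].
  by move=> w; rewrite !mulrA -mulrDl ler_wpM2r ?indic_ge0.
have h1 := H1 v v1; have h2 := H2 v v2.
apply: (@le_trans _ _ (a * (C / (a + b + 1)) + b * (C / (a + b + 1)))).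
  by rewrite lerD// ler_wpM2l.
rewrite -mulrDl mulrCA ler_piMr ?(ltW C0)// ler_pdivrMr// mul1r; lra.
Qed.

(** A three-epsilon argument. Translating by $|v|\le1$ moves the box of size $r$ into the box of
    size $r+1$, where the convergence is dominated. *)
Lemma Tcont_lim (F : nat -> Z -> R) f C : (forall k, bmeas (F k) C) ->
  (forall k, Tcont (F k)) -> (forall w, F ^~ w @ \oo --> f w) -> bmeas f C /\ Tcont f.
Proof.
move=> bF tF Ff.
have bf : bmeas f C.
  split; first by apply: measurable_fun_cvg (fun k => (bF k).1) _ => w _; exact: Ff.
  move=> w; have c : (fun k => `|F k w|) @ \oo --> `|f w| by apply: cvg_norm; exact: Ff.
  rewrite -(cvg_lim (@Rhausdorff R) c); apply: limr_le; first by apply/cvg_ex; eexists; exact: c.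
  by apply: nearW => k; exact: (bF k).2.
split => // r e r0 e0.
have r10 : 0 < r + 1 by lra.
have be k : bmeas (fun w => `|F k w - f w|) (C + C).
  split; first by apply: measurableT_comp => //; apply: measurable_funB; [exact: (bF k).1|exact: bf.1].
  by move=> w; rewrite normr_id; apply: le_trans (ler_normB _ _) (lerD ((bF k).2 _) (bf.2 _)).
have ie k q : 0 < q -> ible mu (fun w => `|F k w - f w| * \1_(Dbox q) w).
  by move=> q0; have [m b] := be k; apply: ibleM m b (Dbox_ible q0).
have H : (fun k => \int[mu]_w (`|F k w - f w| * \1_(Dbox (r + 1)) w)) @ \oo --> (0 : R).
  have [||||_] := @dct _ _ _ mu (fun k w => `|F k w - f w| * \1_(Dbox (r + 1)) w) (fun=> 0)
    (fun w => (C + C) * \1_(Dbox (r + 1)) w).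
  - by move=> k; exact: ible_meas (ie k _ r10).
  - by move=> k w; rewrite normrM (ger0_norm (indic_ge0 _ _)) ler_wpM2r ?indic_ge0//; exact: (be k).2.
  - exact: ibleZ (Dbox_ible r10).
  - move=> w; rewrite -(mul0r (\1_(Dbox (r + 1)) w)); apply: cvgMr_tmp; rewrite -(normr0 R).
    by apply: cvg_norm; rewrite -(subrr (f w)); apply: cvgB; [exact: Ff|exact: cvg_cst].
  by rewrite int0.
have /cvgrPdist_le/(_ (e / 3) ltac:(lra))[k _ /(_ k (leqnn k))] := H.
rewrite sub0r normrN => Hk.
have [d d0 Hd] := tF k r (e / 3) r0 ltac:(lra).
exists (Num.min d 1); first by rewrite lt_min d0 ltr01.
move=> v; rewrite le_min => /andP[vd v1].
have J1 : \int[mu]_w (`|F k w - f w| * \1_(Dbox r) w) <= e / 3.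
  apply: le_trans (le_trans (ler_norm _) Hk); apply: int_le; [exact: ie|exact: ie|].
  move=> w; rewrite ler_wpM2l//.
  have /(_ w 0) := @Dbox_le r; rewrite addr0; apply.
  by rewrite /nrm /= !normr0 addr0 ler01.
have i2 : ible mu (fun w => `|F k (w - v) - f (w - v)| * \1_(Dbox r) w).
  have bs : bmeas (fun w => `|F k (w - v) - f (w - v)|) (C + C) by exact: (bmeas_shift v (be k)).
  by apply: ibleM bs.1 bs.2 (Dbox_ible r0).
have J2 : \int[mu]_w (`|F k (w - v) - f (w - v)| * \1_(Dbox r) w) <= e / 3.
  apply: le_trans (le_trans (ler_norm _) Hk).
  have -> : \int[mu]_w (`|F k (w - v) - f (w - v)| * \1_(Dbox r) w) =
      \int[mu]_w (`|F k w - f w| * \1_(Dbox r) (w + v)).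
    have i3 := ible_shift (- v) i2.
    rewrite -(int_shift (- v) i2); apply: eq_int => w.
    by rewrite /= opprK addrK.
  apply: int_le.
  - have := ible_shift (- v) i2; apply: ible_cvt => w.
    by rewrite /= opprK addrK.
  - exact: ie.
  - by move=> w; rewrite ler_wpM2l//; exact: Dbox_le.
have ik := tmod_ible v r0 (bF k).
apply: (@le_trans _ _ (\int[mu]_w (`|F k (w - v) - f (w - v)| * \1_(Dbox r) w) +
    (tmod (F k) r v + \int[mu]_w (`|F k w - f w| * \1_(Dbox r) w)))).
  rewrite -intD//; last exact: ie.
  rewrite -intD//; last by apply: ibleD => //; exact: ie.
  apply: int_le; [exact: tmod_ible bf|by apply: ibleD => //; apply: ibleD => //; exact: ie|].
  move=> w; rewrite -!mulrDl ler_wpM2r ?indic_ge0//.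
  rewrite [X in `|X| <= _](_ : _ = - (F k (w - v) - f (w - v)) + ((F k (w - v) - F k w) + (F k w - f w))); last ring.
  by apply: le_trans (ler_normD _ _) _; rewrite normrN lerD// ler_normD.
by have := Hd v vd; lra.
Qed.

Lemma Tcont_lip f C L : bmeas f C -> 0 <= L ->
  (forall w v, `|f (w - v) - f w| <= L * nrm v) -> Tcont f.
Proof.
move=> bf L0 fL r e r0 e0.
pose V := \int[mu]_w (\1_(Dbox r) w : R).
have V0 : 0 <= V by apply: int_ge0 => w; exact: indic_ge0.
have D0 : 0 < L * V + 1 by have := mulr_ge0 L0 V0; lra.
exists (e / (L * V + 1)); first exact: divr_gt0.
move=> v vd; apply: (@le_trans _ _ (\int[mu]_w ((L * nrm v) * \1_(Dbox r) w))).
  apply: int_le; [exact: tmod_ible bf|exact/ibleZ/Dbox_ible|].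
  by move=> w; rewrite ler_wpM2r ?indic_ge0.
rewrite intZ; last exact: Dbox_ible.
rewrite -/V; apply: (@le_trans _ _ (L * V * (e / (L * V + 1)))).
  by rewrite mulrAC ler_wpM2l ?mulr_ge0.
rewrite mulrCA ler_piMr ?(ltW e0)// ler_pdivrMr// mul1r; lra.
Qed.

Definition Tset A := measurable A /\ Tcont (\1_A : Z -> R).

Lemma indic_bmeas A : measurable A -> bmeas (\1_A : Z -> R) 1.
Proof.
move=> mA; split; first exact: measurable_indic.
by move=> w; rewrite ger0_norm ?indic_ge0 ?indic_le1.
Qed.

(** Complements and unions come from the pointwise domination in [Tcont_dom], countable unions from
    the pointwise limit of the finite ones. A general map [phi] is allowed, so that coordinates can
    be treated one at a time. *)
Lemma Tset_sigma (T : Type) (phi : Z -> T) : sigma_algebra setT [set B | Tset (phi @^-1` B)].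
Proof.
have TC A : Tset A -> Tset (~` A).
  move=> [mA tA]; split; first exact: measurableC.
  apply: (Tcont_dom (indic_bmeas mA) (indic_bmeas mA) (indic_bmeas (measurableC mA)) ler01 (lexx 0) tA tA).
  move=> w w'; rewrite mul0r addr0 mul1r !indicE !in_setC.
  by case: (w \in A); case: (w' \in A); rewrite ?subrr ?normr0//= ?subr0 ?sub0r ?normrN.
have TU A B : Tset A -> Tset B -> Tset (A `|` B).
  move=> [mA tA] [mB tB]; split; first exact: measurableU.
  apply: (Tcont_dom (indic_bmeas mA) (indic_bmeas mB) (indic_bmeas (measurableU _ _ mA mB)) ler01 ler01 tA tB).
  move=> w w'; rewrite !mul1r !indicE !in_setU.
  by case: (w \in A); case: (w' \in A); case: (w \in B); case: (w' \in B);
    rewrite /= ?subrr ?normr0 ?subr0 ?sub0r ?normrN ?normr1 ?add0r ?addr0 ?lerDl// ?lexx// ler01.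
have T0 : Tset set0.
  split; first exact: measurable0.
  move=> r C r0 C0; exists 1 => // v _; rewrite /tmod (eq_int _ (g := fun=> 0)) ?int0 ?ltW// => w.
  by rewrite !indic0 subrr normr0 mul0r.
split => /=.
- by rewrite preimage_set0.
- by move=> B; rewrite setTD preimage_setC; exact: TC.
- move=> B HB; rewrite preimage_bigcup.
  pose U k := \big[setU/set0]_(j < k) (phi @^-1` B j).
  have UE k : U k = \bigcup_(j in `I_k) (phi @^-1` B j) by rewrite bigcup_mkord.
  have HU k : Tset (U k).
    by elim: k => [|k IH]; [rewrite /U big_ord0|rewrite /U big_ord_recr; apply: TU].
  split; first by apply: bigcup_measurable => k _; exact: (HB k).1.
  have [|||] := @Tcont_lim (fun k => \1_(U k)) (\1_(\bigcup_k (phi @^-1` B k))) 1 => //.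
  + by move=> k; apply: indic_bmeas; exact: (HU k).1.
  + by move=> k; exact: (HU k).2.
  + move=> w; apply: cvg_near_cst.
    case: (pselect (exists2 k, setT k & (phi @^-1` B k) w)) => [[k _ Bk]|nB].
      near=> j; rewrite !indicE [in RHS]mem_set; last by exists k.
      rewrite mem_set// UE; exists k => //=.
      by near: j; exists k.+1.
    near=> j; rewrite !indicE [in RHS]memNset//; congr (_%:R); congr nat_of_bool.
    by apply: memNset; rewrite UE => -[i _ Bi]; apply: nB; exists i.
Unshelve. all: by end_near. Qed.

(** The indicator of a sublevel set is the limit of the Lipschitz ramps $\max(0,1-k\max(0,l-b))$. *)
Lemma Tset_le (l : Z -> R) b : measurable_fun setT l ->
  (forall w v, `|l (w - v) - l w| <= nrm v) -> Tset [set w | l w <= b].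
Proof.
move=> ml ll.
have mA : measurable [set w | l w <= b].
  rewrite (_ : mkset _ = l @^-1` `]-oo, b]%classic).
    by rewrite -[X in measurable X]setTI; exact: ml.
  by apply/seteqP; split => x /=; rewrite in_itv/=.
split => //.
pose F (k : nat) w : R := Num.max 0 (1 - k%:R * Num.max 0 (l w - b)).
have F0 k w : 0 <= F k w by rewrite le_max lexx.
have F1 k w : F k w <= 1.
  by rewrite ge_max ler01/= gerBl mulr_ge0// le_max lexx.
have mF k : bmeas (F k) 1.
  split; last by move=> w; rewrite ger0_norm.
  apply: measurable_maxr => //; apply: measurable_funB => //; apply: measurable_funM => //.
  by apply: measurable_maxr => //; exact: measurable_funB.
have maxd (x y : R) : `|Num.max 0 x - Num.max 0 y| <= `|x - y|.
  case: (lerP 0 x) => hx; case: (lerP 0 y) => hy; rewrite ?subrr ?normr0//.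
  - by rewrite subr0 ger0_norm// ger0_norm; lra.
  - by rewrite sub0r normrN ger0_norm// ler0_norm; lra.
have [|||] := @Tcont_lim F (\1_[set w | l w <= b]) 1 => //.
- move=> k; apply: (@Tcont_lip _ 1 k%:R) => // w v.
  apply: le_trans (maxd _ _) _.
  rewrite (_ : _ - _ = - (k%:R * (Num.max 0 (l (w - v) - b) - Num.max 0 (l w - b)))); last ring.
  rewrite normrN normrM ger0_norm// ler_wpM2l//; apply: le_trans (maxd _ _) _.
  by rewrite (_ : _ - _ = l (w - v) - l w) ?ll//; ring.
- move=> w; apply: cvg_near_cst; rewrite indicE.
  have [h|h] := lerP (l w) b.
    have E : Num.max 0 (l w - b) = 0 by apply/max_idPl; rewrite subr_le0.
    by near=> k; rewrite mem_set//= /F E mulr0 subr0 (max_idPr ler01).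
  near=> k; rewrite memNset/=; last by apply/negP; rewrite -ltNge.
  have E : Num.max 0 (l w - b) = l w - b by apply/max_idPr; rewrite subr_ge0 ltW.
  rewrite /F E; apply/max_idPl; rewrite subr_le0.
  rewrite -ler_pdivrMr ?subr_gt0// mul1r.
  by near: k; exact: nbhs_infty_ger.
Unshelve. all: by end_near. Qed.

Lemma Tset_lip (l : Z -> R) (B : set R) : measurable_fun setT (l : Z -> measurableTypeR R) ->
  (forall w v, `|l (w - v) - l w| <= nrm v) -> @measurable _ (measurableTypeR R) B ->
  Tset (l @^-1` B).
Proof.
move=> ml ll mB.
suff : @measurable _ (measurableTypeR R) `<=` [set B | Tset (l @^-1` B)] by apply.
apply: smallest_sub; first exact: Tset_sigma.
move=> _ [[a b] _ <-] /=.
have S := Tset_sigma (id : Z -> Z).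
have [_ SC SU] := S.
have -> : l @^-1` [set x | x \in `]a, b]] = ~` (~` [set w | l w <= b] `|` [set w | l w <= a]).
  apply/seteqP; split => w /=; rewrite in_itv/=.
    by move=> /andP[h1 h2] [H|H]; [exact: H|move: h1; rewrite ltNge H].
  move=> H; apply/andP; split.
    by rewrite ltNge; apply/negP => h; apply: H; right.
  by apply: contrapT => h; apply: H; left.
have TC A : Tset A -> Tset (~` A) by move=> TA; have := SC A; rewrite setTD; apply.
have TU A A' : Tset A -> Tset A' -> Tset (A `|` A').
  by move=> TA TA'; rewrite -bigcup2E; apply: SU => -[|[|k]] //=; case: S.
exact: (TC _ (TU _ _ (TC _ (Tset_le _ ml ll)) (Tset_le _ ml ll))).
Qed.

Lemma Tset_all A : measurable A -> Tset A.
Proof.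
suff : @measurable _ Z `<=` Tset by apply.
apply: smallest_sub; first exact: (Tset_sigma id).
rewrite subUset; split => [_ [B mB <-]|_ [B mB <-]]; rewrite setTI; last first.
  apply: (Tset_lip (l := fun w => w.2) _ _ mB); first exact: measurable_snd.
  move=> w v; rewrite (_ : _ - _ = - (v.2 : R)); last by rewrite /=; ring.
  by rewrite normrN /nrm lerDr.
suff : @measurable _ 'rV[R]_N `<=` [set B | Tset (fst @^-1` B)] by apply.
apply: smallest_sub; first exact: Tset_sigma.
rewrite -bigcup_seq => B' [i _ [D mD <-]] /=; rewrite setTI -comp_preimage.
apply: (Tset_lip (l := fun w => w.1 0 i)) => //.
  apply: (measurableT_comp (f := fun x : 'rV[R]_N => x 0 i)) => //.
  exact: measurable_coord.
move=> w v; rewrite /= !mxE addrAC subrr add0r normrN /nrm.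
by apply: le_trans (rV_coord_le _ _) _; rewrite lerDl.
Qed.

Import HBNNSimple.

(** Nonnegative simple functions approximate the shifted function $f+C$; the shift disappears in
    differences. *)
Lemma Tcont_bmeas f C : bmeas f C -> Tcont f.
Proof.
move=> bf; have [mf fC] := bf.
have C0 : 0 <= C by apply: le_trans (normr_ge0 _) (fC 0).
pose g w := f w + C.
have g0 w : 0 <= g w by have := fC w; rewrite ler_norml => /andP[? ?]; rewrite /g; lra.
have g1 w : g w <= C + C by have := fC w; rewrite ler_norml => /andP[? ?]; rewrite /g; lra.
have mg : measurable_fun setT (EFin \o g).
  by apply/measurable_EFinP; exact: measurable_funD.
pose F := nnsfun_approx measurableT mg.
have cF w : (fun k => F k w) @ \oo --> g w.
  have /= := @cvg_nnsfun_approx _ _ _ _ measurableT _ mg (fun x _ => ltac:(by rewrite lee_fin)) w I.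
  by move/fine_cvg.
have FC k w : F k w <= C + C.
  apply: le_trans (g1 w); rewrite -(cvg_lim (@Rhausdorff R) (cF w)).
  apply: limr_ge; first by apply/cvg_ex; eexists; exact: cF.
  by near=> j; apply/lefP/nd_nnsfun_approx; near: j; exists k.
have tF k : Tcont (F k).
  have [m [c E]] : exists (m : nat) (c : nat -> R), forall w,
      F k w = \sum_(i < m) (c i * \1_(F k @^-1` [set c i]) w).
    eexists; exists (nth 0 (finmap.enum_fset (fset_set (F k @` setT)))).
    exact: fimfunEord.
  have mS i : measurable (F k @^-1` [set c i]) by exact: measurable_funPTI.
  have : forall j, exists2 D, bmeas (fun w => \sum_(i < j) (c i * \1_(F k @^-1` [set c i]) w)) D & Tcont (fun w => \sum_(i < j) (c i * \1_(F k @^-1` [set c i]) w)).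
    elim=> [|j [D bD tD]].
      have E0 : (fun w : Z => \sum_(i < 0) (c i * \1_(F k @^-1` [set c i]) w)) = (fun=> 0 : R).
        by apply/funext => w; rewrite big_ord0.
      exists 0; rewrite E0; first by split => // w; rewrite normr0.
      move=> r e r0 e0; exists 1 => // v _; rewrite /tmod (eq_int _ (g := fun=> 0)) ?int0 ?ltW// => w.
      by rewrite subrr normr0 mul0r.
    have bI := indic_bmeas (mS j); have [_ tI] := Tset_all (mS j).
    have bS : bmeas (fun w => \sum_(i < j.+1) (c i * \1_(F k @^-1` [set c i]) w)) (D + `|c j|).
      split.
        apply: measurable_sum => i; apply: (measurable_funM (measurable_cst _)).
        exact: (indic_bmeas (mS i)).1.
      move=> w; rewrite big_ord_recr/=; apply: le_trans (ler_normD _ _) _.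
      by rewrite lerD ?(bD.2)// normrM ler_piMr// (bI.2).
    exists (D + `|c j|) => //.
    apply: (Tcont_dom bD bI bS ler01 (normr_ge0 (c j)) tD tI) => w w'.
    rewrite !big_ord_recr/= opprD addrACA; apply: le_trans (ler_normD _ _) _.
    by rewrite mul1r -mulrBr normrM.
  move=> /(_ m)[D _]; congr Tcont; apply/funext => w; exact/esym/E.
have bF k : bmeas (F k) (C + C).
  by split; [exact: measurable_funP|move=> w; rewrite ger0_norm].
have [bg tg] := Tcont_lim bF tF cF.
apply: (Tcont_dom bg bg bf ler01 (lexx 0) tg tg) => w w'.
by rewrite mul0r addr0 mul1r /g opprD addrACA subrr addr0.
Unshelve. all: by end_near. Qed.

End translation_continuity.

(** * Convergence of mollifications and the square of the discrete operator *)

Section mollification.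
Context {R : realType} {n : nat} (s : R).
Hypothesis s01 : 0 < s < 1.
Local Notation N := n.+1.
Local Notation lam := (@lebesgue_rV R N).
Local Notation mu := (@leb_rVT R N).
Local Notation Z := ('rV[R]_N * measurableTypeR R)%type.
Implicit Types (f g p eta deta : Z -> R) (z w v : Z) (x y : 'rV[R]_N) (e C D eps : R).

Lemma moll_nrm eps eta deta C v : moll eps eta deta C -> eta v != 0 -> nrm v <= 2 * eps.
Proof.
move=> H /(moll_supp H)[h1 /andP[h2 h3]]; rewrite /nrm.
have e0 : 0 < eps by apply: le_lt_trans h1.
by rewrite [`|v.2 : R|]ger0_norm; lra.
Qed.

Lemma moll_int_abs eps eta deta C : moll eps eta deta C -> \int[mu]_w `|eta w| = 1.
Proof.
move=> H; rewrite -(moll_int H); apply: eq_int => w; exact/ger0_norm/(moll_ge0 H).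
Qed.

Lemma moll_conv_bmeas eps eta deta C f D : moll eps eta deta C -> bmeas f D ->
  bmeas (conv f eta) D.
Proof.
by move=> H bf; have := conv_bmeas bf (moll_ible H); rewrite (moll_int_abs H) mulr1.
Qed.

Lemma moll_conv_cst eps eta deta C (a : R) z : moll eps eta deta C ->
  conv (fun=> a) eta z = a.
Proof. by move=> H; rewrite /conv intZ ?(moll_int H) ?mulr1//; exact: moll_ible H. Qed.

Lemma moll_conv_diff eps eta deta C f D z : moll eps eta deta C -> bmeas f D ->
  `|conv f eta z - f z| <= \int[mu]_v (`|f (z - v) - f z| * eta v).
Proof.
move=> H bf; have D0 : 0 <= D by apply: le_trans (bf.2 0).
have bc : bmeas (fun _ : Z => f z) D.
  by split => // w; exact: bf.2.
rewrite -{1}(moll_conv_cst (f z) z H) -(convB _ bf bc (moll_ible H)).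
have b' : bmeas (fun w => f w - f z) (D + D).
  split; first by apply: measurable_funB => //; exact: bf.1.
  by move=> w; apply: le_trans (ler_normB _ _) (lerD (bf.2 _) (bf.2 _)).
have i := conv_ible z b' (moll_ible H).
apply: le_trans (int_abs i) _; rewrite le_eqVlt; apply/orP; left; apply/eqP.
by apply: eq_int => v; rewrite normrM (ger0_norm (moll_ge0 H _)).
Qed.

Lemma measurable_Zadd2 d (T : measurableType d) (f1 f2 : T -> Z) :
  measurable_fun setT f1 -> measurable_fun setT f2 ->
  measurable_fun setT (fun t => f1 t + f2 t).
Proof.
move=> m1 m2; rewrite (_ : (fun t => _) = (fun t => f1 t - (0 - f2 t))).
  by apply: measurable_Z_sub => //; exact: measurable_Z_sub.
by apply/funext => t; rewrite sub0r opprK.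
Qed.

(** By Fubini the error is at most an average, with weight the mollifier, of the translation moduli
    [tmod]. *)
Lemma conv_cvg_Dbox f D r C : bmeas f D -> 0 < r -> 0 < C ->
  exists2 d, 0 < d & forall eps eta deta C', moll eps eta deta C' -> eps <= d ->
    \int[mu]_w (`|conv f eta w - f w| * \1_(Dbox r) w) <= C.
Proof.
move=> bf r0 C0; have [d d0 Hd] := Tcont_bmeas bf r0 C0.
exists (d / 2); first lra.
move=> eps eta deta C' H ed.
have ie := moll_ible H; have iD := @Dbox_ible R n r r0.
have mF : measurable_fun setT (fun q : Z * Z => `|f (q.1 - q.2) - f q.1|).
  apply: measurableT_comp => //; apply: measurable_funB.
    by apply: (measurableT_comp (f := f)); [exact: bf.1|exact: measurable_Z_sub].
  by apply: (measurableT_comp (f := f)); [exact: bf.1|].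
have bF w v : Num.norm `|f (w - v) - f w| <= D + D.
  by rewrite normr_id; apply: le_trans (ler_normB _ _) (lerD (bf.2 _) (bf.2 _)).
have bcf := moll_conv_bmeas H bf.
have bb : bmeas (fun w => `|conv f eta w - f w|) (D + D).
  split; first by apply: measurableT_comp => //; apply: measurable_funB; [exact: bcf.1|exact: bf.1].
  by move=> w; rewrite normr_id; apply: le_trans (ler_normB _ _) (lerD (bcf.2 _) (bf.2 _)).
apply: (@le_trans _ _ (\int[mu]_w (\1_(Dbox r) w * \int[mu]_v (`|f (w - v) - f w| * eta v)))).
  have mI := meas_int2 ie mF bF.
  have bI := int2_bound ie mF bF.
  apply: int_le.
  - exact: ibleM bb.1 bb.2 iD.
  - have := ibleM mI bI iD; apply: ible_cvt => w; by rewrite mulrC.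
  - by move=> w; rewrite mulrC ler_wpM2l ?indic_ge0//; exact: moll_conv_diff H bf.
rewrite (int_swap iD ie mF bF).
rewrite -[leRHS]mulr1 -(moll_int H) -intZ//; apply: int_le.
- have mF' : measurable_fun setT (fun q : Z * Z => `|f (q.2 - q.1) - f q.2|).
    apply: measurableT_comp => //; apply: measurable_funB.
      by apply: (measurableT_comp (f := f)); [exact: bf.1|exact: measurable_Z_sub].
    by apply: (measurableT_comp (f := f)); [exact: bf.1|].
  have mI := meas_int2 (f := fun v w => `|f (w - v) - f w|) iD mF' (fun v w => bF w v).
  have bI := int2_bound (f := fun v w => `|f (w - v) - f w|) iD mF' (fun v w => bF w v).
  by have := ibleM mI bI ie; apply: ible_cvt => v; rewrite mulrC.
- exact: ibleZ.
- move=> v; have [->|ev] := eqVneq (eta v) 0; first by rewrite mul0r mulr0.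
  rewrite mulrC ler_wpM2r ?(moll_ge0 H)//; apply: Hd.
  by apply: le_trans (moll_nrm H ev) _; lra.
Qed.

(** An integrable weight is, up to a small $L^1$ remainder, bounded and supported in a box: the
    excess over $k$ times the indicator of the box tends to $0$ dominatedly. *)
Lemma ible_trunc p C : ible mu p -> 0 < C ->
  exists2 k : R, 0 < k & exists2 q : Z -> R, ible mu q &
    [/\ forall w, 0 <= q w, \int[mu]_w q w <= C &
        forall w, `|p w| <= q w + k * \1_(Dbox k) w].
Proof.
move=> ip C0.
pose q (k : nat) w : R := Num.max 0 (`|p w| - k.+1%:R * \1_(Dbox k.+1%:R) w).
have mq k : measurable_fun setT (q k).
  apply: measurable_maxr => //; apply: measurable_funB.
    by apply: measurableT_comp => //; exact: ible_meas ip.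
  by apply: measurable_funM => //; apply: ible_meas; exact: Dbox_ible.
have q0 k w : 0 <= q k w by rewrite le_max lexx.
have qp k w : `|q k w| <= `|p w|.
  rewrite ger0_norm// ge_max normr_ge0/= gerBl mulr_ge0// indic_ge0.
have [||||_] := @dct _ _ _ mu q (fun=> 0) (fun w => `|p w|) => //.
- exact: ible_abs.
- move=> w; apply: cvg_near_cst; near=> k.
  rewrite /q indicE mem_set ?mulr1.
    apply/max_idPl; rewrite subr_le0; apply: (@le_trans _ _ k%:R); last by rewrite ler_nat.
    by near: k; exact: nbhs_infty_ger.
  have k1 : `|w.1| < k.+1%:R.
    apply: (@le_lt_trans _ _ k%:R); last by rewrite ltr_nat.
    by near: k; exact: nbhs_infty_ger.
  have k2 : `|w.2 : R| < k.+1%:R.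
    apply: (@le_lt_trans _ _ k%:R); last by rewrite ltr_nat.
    by near: k; exact: nbhs_infty_ger.
  by split; [rewrite sub0r normrN|rewrite -ltr_norml].
rewrite int0 => /cvgrPdist_le/(_ C C0)[k _ /(_ k (leqnn k))].
rewrite sub0r normrN => Hk.
exists k.+1%:R => //; exists (q k).
  by apply: ible_le (mq k) (qp k) (ible_abs ip).
split => //; first exact: le_trans (ler_norm _) Hk.
by move=> w; rewrite -lerBlDr le_max lexx orbT.
Unshelve. all: by end_near. Qed.

(** Convergence of mollifications against an arbitrary integrable weight. This generality is needed
    because the weights come from [Linf], whose tails are not compactly supported. *)
Lemma conv_cvg_weight f D p C : bmeas f D -> ible mu p -> 0 < C ->
  exists2 d, 0 < d & forall eps eta deta C', moll eps eta deta C' -> eps <= d ->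
    \int[mu]_w (`|conv f eta w - f w| * `|p w|) <= C.
Proof.
move=> bf ip C0; have D0 : 0 <= D by apply: le_trans (bf.2 0).
have DD : 0 < 4 * D + 1 by lra.
have [k k0 [q iq [q0 Iq pq]]] := ible_trunc ip (divr_gt0 C0 DD).
have [d d0 Hd] := conv_cvg_Dbox bf k0 (divr_gt0 C0 (mulr_gt0 (ltr0n _ 2) k0)).
exists d => // eps eta deta C' H ed; have {}Hd := Hd _ _ _ _ H ed.
have bcf := moll_conv_bmeas H bf.
have bb : bmeas (fun w => `|conv f eta w - f w|) (D + D).
  split; first by apply: measurableT_comp => //; apply: measurable_funB; [exact: bcf.1|exact: bf.1].
  by move=> w; rewrite normr_id; apply: le_trans (ler_normB _ _) (lerD (bcf.2 _) (bf.2 _)).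
have i1 := ibleM bb.1 bb.2 (Dbox_ible k0).
have i2 := ibleM bb.1 bb.2 (ible_abs ip).
apply: (@le_trans _ _ (\int[mu]_w ((D + D) * q w + k * (`|conv f eta w - f w| * \1_(Dbox k) w)))).
  apply: int_le => //; first by apply: ibleD; exact: ibleZ.
  move=> w; apply: le_trans (ler_wpM2l _ (pq w)) _ => //.
  rewrite mulrDr mulrCA lerD2r ler_wpM2r//.
  by have := bb.2 w; rewrite normr_id.
rewrite intD; [|exact: ibleZ|exact: ibleZ].
rewrite !intZ//.
have h1 : (D + D) * \int[mu]_w q w <= C / 2.
  apply: (@le_trans _ _ ((D + D) * (C / (4 * D + 1)))); first by rewrite ler_wpM2l ?addr_ge0.
  by rewrite mulrCA ler_pM2l// ler_pdivrMr//; lra.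
have h2 : k * \int[mu]_w (`|conv f eta w - f w| * \1_(Dbox k) w) <= C / 2.
  apply: (@le_trans _ _ (k * (C / (2 * k)))); first by rewrite ler_wpM2l ?(ltW k0).
  by rewrite le_eqVlt; apply/orP; left; apply/eqP; field; rewrite gt_eqF.
lra.
Qed.

(** Here $p$ is only integrable; the rate comes from the Lipschitz bound of the fixed mollifier
    [eta1]. *)
Lemma conv_conv_moll p eta1 deta1 C1 eps eta deta C z eps1 :
  moll eps1 eta1 deta1 C1 -> moll eps eta deta C -> ible mu p ->
  `|\int[mu]_w (eta1 w * \int[mu]_v (eta (z - w - v) * p v)) -
    \int[mu]_v (eta1 (z - v) * p v)| <= C1 * (2 * eps) * \int[mu]_v `|p v|.
Proof.
move=> H1 H ip.
have b1 := moll_bmeas H1; have b := moll_bmeas H.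
have mF : measurable_fun setT (fun q : Z * Z => eta (z - q.1 - q.2)).
  apply: (measurableT_comp (f := eta)); first exact: b.1.
  by apply: measurable_Z_sub => //; exact: measurable_Z_sub.
have bF w v : `|eta (z - w - v)| <= C by exact: b.2.
rewrite (int_swap (moll_ible H1) ip mF bF).
have e0 : 0 <= 2 * eps.
  have h : \int[mu]_w eta w != 0 by rewrite (moll_int H) oner_eq0.
  have [v ev] : exists v, eta v != 0.
    apply: contrapT => Hn; move/eqP: h; apply; rewrite (eq_int _ (g := fun=> 0)) ?int0//.
    by move=> w; apply/eqP; apply: contraT => ew; exfalso; apply: Hn; exists w.
  exact: le_trans (nrm_ge0 v) (moll_nrm H ev).
have mF' : measurable_fun setT (fun q : Z * Z => eta (z - q.2 - q.1)).
  apply: (measurableT_comp (f := eta)); first exact: b.1.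
  by apply: measurable_Z_sub => //; exact: measurable_Z_sub.
have mI := meas_int2 (f := fun v w => eta (z - w - v)) (moll_ible H1) mF' (fun v w => bF w v).
have bI := int2_bound (f := fun v w => eta (z - w - v)) (moll_ible H1) mF' (fun v w => bF w v).
have i1 : ible mu (fun v => p v * \int[mu]_w (eta (z - w - v) * eta1 w)).
  by apply: ible_cvt (ibleM mI bI ip) => v; rewrite mulrC.
have bs : bmeas (fun v => eta1 (z - v)) C1.
  split; last by move=> v; exact: b1.2.
  by apply: (measurableT_comp (f := eta1)); [exact: b1.1|exact: measurable_Z_sub].
have i2 := ibleM bs.1 bs.2 ip.
rewrite -intB// -intZ; last exact: ible_abs.
apply: int_bound; [exact: ibleB|exact/ibleZ/ible_abs|].
move=> v; rewrite [eta1 _ * _]mulrC -mulrBr normrM mulrC ler_wpM2r//.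
have -> : \int[mu]_w (eta (z - w - v) * eta1 w) = conv eta1 eta (z - v).
  rewrite (conv_comm _ b1 (moll_ible H)); apply: eq_int => w.
  by rewrite mulrC; congr (_ * eta _); rewrite addrAC.
apply: le_trans (moll_conv_diff _ H b1) _.
have -> : C1 * (2 * eps) = \int[mu]_w (C1 * (2 * eps) * eta w).
  by rewrite intZ ?(moll_int H) ?mulr1//; exact: moll_ible H.
apply: int_le.
- have bd := tdiff_bmeas.
  have i3 : ible mu (fun w => `|eta1 (z - v - w) - eta1 (z - v)| * eta w).
    apply: (@ibleM _ _ _ _ (C1 + C1)); last exact: moll_ible H.
      apply: measurableT_comp => //; apply: measurable_funB => //.
      by apply: (measurableT_comp (f := eta1)); [exact: b1.1|exact: measurable_Z_sub].
    by move=> w; rewrite normr_id; apply: le_trans (ler_normB _ _) (lerD (b1.2 _) (b1.2 _)).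
  exact: i3.
- exact/ibleZ/(moll_ible H).
- move=> w; have [->|ew] := eqVneq (eta w) 0; first by rewrite !mulr0.
  rewrite ler_wpM2r ?(moll_ge0 H)//; have [C10 _ L _] := moll_lip2 H1.
  apply: le_trans (L _ _) _; rewrite ler_wpM2l//.
  have -> : nrm (- w) = nrm w by rewrite /nrm /= !normrN.
  exact: moll_nrm H ew.
Qed.

(** The truncated quadratic form without the factor one half: summed over the components it tends to
    $2\mathcal{B}(u,u)$. *)
Definition Sq e f w := \int[lam]_y ((f w - f (w - (y, 0))) ^+ 2 * ke s e y).

Lemma Sq_meas_aux f C : bmeas f C ->
  measurable_fun setT (fun p : Z * 'rV[R]_N => (f p.1 - f (p.1 - (p.2, 0 : measurableTypeR R))) ^+ 2) /\
  forall w y, `|(f w - f (w - (y, 0 : measurableTypeR R))) ^+ 2| <= (C + C) ^+ 2.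
Proof.
move=> [mf fC]; split.
  apply: measurable_funX; apply: measurable_funB; apply: (measurableT_comp (f := f)) => //.
  apply: measurable_Z_sub => //.
  by apply: measurable_fun_pair => //; exact: measurable_snd.
move=> w y; rewrite normrX lerXn2r ?nnegrE//.
  by rewrite addr_ge0// (le_trans _ (fC w)).
by apply: le_trans (ler_normB _ _) (lerD _ _).
Qed.

Lemma Sq_ible e f C w : 0 < e -> bmeas f C ->
  ible lam (fun y => (f w - f (w - (y, 0))) ^+ 2 * ke s e y).
Proof.
move=> e0 bf; have [m b] := Sq_meas_aux bf.
exact: (ible_swapl (ke_ible s01 e0) (f := fun w y => (f w - f (w - (y, 0 : measurableTypeR R))) ^+ 2) m b).
Qed.

Lemma Sq_bmeas e f C : 0 < e -> bmeas f C -> bmeas (Sq e f) ((C + C) ^+ 2 * kmass (n := n) s e).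
Proof.
move=> e0 bf; have [m b] := Sq_meas_aux bf; split.
  exact: (meas_int2 (ke_ible s01 e0) (f := fun w y => (f w - f (w - (y, 0 : measurableTypeR R))) ^+ 2) m b).
move=> w; apply: le_trans (int2_bound (ke_ible s01 e0) (f := fun w y => (f w - f (w - (y, 0 : measurableTypeR R))) ^+ 2) m b w) _.
rewrite le_eqVlt; apply/orP; left; apply/eqP; congr (_ * _).
by apply: eq_int => y; rewrite ger0_norm// ke_ge0.
Qed.

Lemma Sq_ge0 e f w : 0 <= Sq e f w.
Proof. by apply: int_ge0 => y; rewrite mulr_ge0 ?sqr_ge0 ?ke_ge0. Qed.

Lemma ke_anti e e' y : e <= e' -> ke (n := n) s e' y <= ke s e y.
Proof.
move=> ee; rewrite /ke ler_wpM2l ?(ltW (@fconst_gt0 R n s s01))// ler_wpM2l ?fkernel_ge0//.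
by rewrite ler_nat; case: (ltP e' (enorm y)) => // h; rewrite (le_lt_trans ee h).
Qed.

Lemma Sq_anti e e' f C w : 0 < e -> e <= e' -> bmeas f C -> Sq e' f w <= Sq e f w.
Proof.
move=> e0 ee bf; apply: int_le.
- exact: Sq_ible (lt_le_trans e0 ee) bf.
- exact: Sq_ible bf.
by move=> y; rewrite ler_wpM2l ?sqr_ge0//; exact: ke_anti.
Qed.

Lemma sqr_bmeas f C (a : R) : bmeas f C -> bmeas (fun w => (f w - a) ^+ 2) ((C + `|a|) ^+ 2).
Proof.
move=> [mf fC]; split; first by apply: measurable_funX; exact: measurable_funB.
move=> w; rewrite normrX lerXn2r ?nnegrE//.
  by rewrite addr_ge0// (le_trans _ (fC w)).
by apply: le_trans (ler_normB _ _) (lerD _ _).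
Qed.

(** In space this is an identity. In time the backward difference leaves
    $-(f(w)-f(w-(0,e)))^2/e\le0$, which is dropped. *)
Lemma Lop_sqr_le e f C (a : R) w : 0 < e -> bmeas f C ->
  Lop s e (fun w => (f w - a) ^+ 2) w <= 2 * (f w - a) * Lop s e f w - Sq e f w.
Proof.
move=> e0 bf; have ia := Aop_ible s01 w e0 bf; have iS := Sq_ible w e0 bf.
have E : Aop s e (fun w => (f w - a) ^+ 2) w = 2 * (f w - a) * Aop s e f w - Sq e f w.
  rewrite -intZ// -intB//; last exact: ibleZ.
  by apply: eq_int => y; ring.
rewrite /Lop E mulrDr.
suff : Dop e (fun w => (f w - a) ^+ 2) w <= 2 * (f w - a) * Dop e f w by lra.
rewrite /Dop mulrA ler_wpM2r ?invr_ge0 ?(ltW e0)//.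
have := sqr_ge0 (f w - f (w - (0, e))).
lra.
Qed.

End mollification.

Section dct_ae.
Context d (T : measurableType d) (R : realType) (mu : {measure set T -> \bar R}).

Lemma dct_ae (F : nat -> T -> R) (f g : T -> R) : (forall n, ible mu (F n)) ->
  measurable_fun setT f -> ible mu g ->
  {ae mu, forall x, forall n, `|F n x| <= g x} ->
  {ae mu, forall x, F ^~ x @ \oo --> f x} ->
  ible mu f /\ (fun n => \int[mu]_x F n x) @ \oo --> \int[mu]_x f x.
Proof.
move=> iF mf gi Fg Ff.
have := @dominated_convergence _ _ _ mu setT measurableT (fun n => EFin \o F n)
  (EFin \o f) (EFin \o g).
case.
- by move=> n; apply/measurable_EFinP; exact: ible_meas.
- exact/measurable_EFinP.
- by apply: filterS Ff => x H _; apply/cvg_EFin; [exact: nearW|exact: H].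
- exact: gi.
- by apply: filterS Fg => x H n _ /=; rewrite lee_fin.
move=> fi _ C; split => //.
have C' : (fun n => (\int[mu]_x F n x)%:E) @ \oo --> (\int[mu]_x f x)%:E.
  rewrite -ible_fin//; apply: cvg_trans C; apply: near_eq_cvg.
  by apply: nearW => n /=; rewrite ible_fin.
exact: (fine_cvg C').
Qed.

End dct_ae.

Lemma fin_eps (R : realType) k (P : 'I_k -> R -> Prop) :
  (forall i, exists2 d, 0 < d & forall e, 0 < e -> e <= d -> P i e) ->
  exists2 d, 0 < d & forall e, 0 < e -> e <= d -> forall i, P i e.
Proof.
elim: k P => [|k IH] P H; first by exists 1 => // e _ _ [].
have [d d0 Hd] := IH (fun i => P (lift ord0 i)) (fun i => H _).
have [d' d'0 Hd'] := H ord0.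
exists (Num.min d d'); first by rewrite lt_min d0.
move=> e e0; rewrite le_min => /andP[h1 h2] i.
by case: (unliftP ord0 i) => [j|] ->; [exact: Hd|exact: Hd'].
Qed.

(** * The subsolution inequality for $|u-b|^2$ at fixed scales *)

Section subsolution.
Context {R : realType} {n : nat} (s : R).
Hypothesis s01 : 0 < s < 1.
Local Notation N := n.+1.
Local Notation lam := (@lebesgue_rV R N).
Local Notation mu := (@leb_rVT R N).
Local Notation Z := ('rV[R]_N * measurableTypeR R)%type.
Implicit Types (f g p eta deta : Z -> R) (z w v : Z) (x y : 'rV[R]_N) (e C D eps : R).

Lemma moll_gt0 eps eta deta C : moll eps eta deta C -> 0 < eps.
Proof.
move=> H; rewrite ltNge; apply/negP => ee.
have /eqP : \int[mu]_w eta w != 0 by rewrite (moll_int H) oner_eq0.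
apply; rewrite (eq_int _ (g := fun=> 0)) ?int0// => w.
by apply/eqP; apply: contraT => /(moll_supp H)[h1 _]; have := le_lt_trans (normr_ge0 _) h1; rewrite ltNge ee.
Qed.

Lemma moll_conv_aff eps eta deta C f D (a b : R) z : moll eps eta deta C -> bmeas f D ->
  conv (fun w => a * f w + b) eta z = a * conv f eta z + b.
Proof.
move=> H bf; have ie := moll_ible H.
have ba : bmeas (fun w => a * f w) (`|a| * D).
  split; first by apply: measurable_funM => //; exact: bf.1.
  by move=> w; rewrite normrM ler_wpM2l// bf.2.
have bb : bmeas (fun _ : Z => b) `|b| by split.
by rewrite (convD _ ba bb ie) (convZ _ _ bf ie) (moll_conv_cst _ _ H).
Qed.

(** Jensen's inequality, by integrating the tangent of the square at the mean value. *)
Lemma moll_jensen eps eta deta C f D (b : R) z : moll eps eta deta C -> bmeas f D ->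
  (conv f eta z - b) ^+ 2 <= conv (fun w => (f w - b) ^+ 2) eta z.
Proof.
move=> H bf; set F := conv f eta z.
have -> : (F - b) ^+ 2 = conv (fun w => 2 * (F - b) * f w + ((F - b) ^+ 2 - 2 * (F - b) * F)) eta z.
  rewrite (moll_conv_aff _ _ _ H bf) -/F; ring.
have ba : bmeas (fun w => 2 * (F - b) * f w + ((F - b) ^+ 2 - 2 * (F - b) * F))
    (`|2 * (F - b)| * D + `|(F - b) ^+ 2 - 2 * (F - b) * F|).
  split.
    by apply: measurable_funD => //; apply: measurable_funM => //; exact: bf.1.
  move=> w; apply: le_trans (ler_normD _ _) _.
  by rewrite lerD2r normrM ler_wpM2l// bf.2.
apply: (conv_le ba (sqr_bmeas b bf) (moll_ible H) (moll_ge0 H)) => w _.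
have := sqr_ge0 (f (z - w) - F); lra.
Qed.

Lemma conv_le_ae eps eta deta C f D (k : R) z : moll eps eta deta C -> bmeas f D ->
  {ae mu, forall v, eta (z - v) != 0 -> f v <= k} -> conv f eta z <= k.
Proof.
move=> H bf fk; have ie := moll_ible H; rewrite (conv_comm _ bf ie).
have ir := ible_refl z ie.
have -> : k = \int[mu]_v (k * eta (z - v)).
  by rewrite intZ// (int_refl z ie) (moll_int H) mulr1.
apply: int_le_ae; [exact: ibleM bf.1 bf.2 ir|exact: ibleZ|].
apply: filterS fk => v Hv; have [->|h] := eqVneq (eta (z - v)) 0; first by rewrite !mulr0.
by rewrite ler_wpM2r ?(moll_ge0 H)//; exact: Hv.
Qed.

(** Factor the difference of the squares of the two increments: their sum is at most $4D$, their
    difference at most $\delta(w)+\delta(w')$ with $\delta=|f-g|$. Writing this as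
    $2\delta(w)-(\delta(w)-\delta(w'))$ makes [Aop] appear, which can later be moved onto a
    mollifier. *)
Lemma Sq_diff rho f g D w : 0 < rho -> bmeas f D -> bmeas g D ->
  `|Sq s rho f w - Sq s rho g w| <=
  4 * D * (2 * kmass (n := n) s rho * `|f w - g w| - Aop s rho (fun w => `|f w - g w|) w).
Proof.
move=> r0 bf bg.
have bd : bmeas (fun w => `|f w - g w|) (D + D).
  split; first by apply: measurableT_comp => //; apply: measurable_funB; [exact: bf.1|exact: bg.1].
  by move=> v; rewrite normr_id; apply: le_trans (ler_normB _ _) (lerD (bf.2 _) (bg.2 _)).
have i1 := Sq_ible s01 w r0 bf; have i2 := Sq_ible s01 w r0 bg.
have ia := Aop_ible s01 w r0 bd; have ik := ke_ible (n := n) s01 r0.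
have -> : 2 * kmass (n := n) s rho * `|f w - g w| = \int[lam]_y (2 * `|f w - g w| * ke s rho y).
  by rewrite intZ// /kmass; ring.
rewrite -[X in _ <= _ * X]intB; [|exact: ibleZ|exact: ia].
rewrite -[leRHS]intZ; last exact: ibleB (ibleZ _ ik) ia.
rewrite -intB//; apply: int_bound; [exact: ibleB|exact/ibleZ/(ibleB (ibleZ _ ik) ia)|].
move=> y; rewrite -!mulrBl [leRHS]mulrA normrM (ger0_norm (ke_ge0 s01 _ _))//.
rewrite ler_wpM2r ?ke_ge0//; set w' := w - _.
rewrite subr_sqr normrM mulrC.
apply: ler_pM => //.
  have := bf.2 w; have := bf.2 w'; have := bg.2 w; have := bg.2 w'.
  rewrite !ler_norml => /andP[? ?] /andP[? ?] /andP[? ?] /andP[? ?].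
  by apply/andP; split; lra.
have -> : f w - f w' - (g w - g w') = (f w - g w) - (f w' - g w') by ring.
by apply: le_trans (ler_normB _ _) _; lra.
Qed.


(** The interface between the weak equation and the regularity argument. The density [B] is known
    through its truncations [Sq], and the equation is tested only with mollifiers; [u] is bounded at
    every point of space-time. *)
Record wsol m (u : 'I_m -> Z -> R) (M : R) (B : Z -> R) : Prop := Wsol {
  wsol_bmeas : forall i, bmeas (u i) M;
  wsol_ge0 : forall z, 0 <= B z;
  wsol_ible : forall a r (t1 t2 : R), 0 < r -> -1 < t1 -> t1 < t2 -> t2 <= 1 ->
    ible mu (fun w => B w * \1_(cyl a r t1 t2) w);
  wsol_Sq_le : {ae mu, forall w, -1 < w.2 -> w.2 < 1 ->
    forall k, \sum_i Sq s k.+1%:R^-1 (u i) w <= 2 * B w};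
  wsol_Sq_cvg : {ae mu, forall w, -1 < w.2 -> w.2 < 1 ->
    (fun k => \sum_i Sq s k.+1%:R^-1 (u i) w) @ \oo --> 2 * B w};
  wsol_weak : forall eps eta deta C z i, moll eps eta deta C ->
    -1 + eps < z.2 -> z.2 <= 1 ->
    conv (u i) (Linf s eta deta) z = \int[mu]_v (u i v * (B v * eta (z - v)))
}.

Variables (m : nat) (u : 'I_m -> Z -> R) (M : R) (B : Z -> R).
Hypothesis W : wsol u M B.
Let bu := wsol_bmeas W.

Variables (a : 'rV[R]_N) (r t1 t2 k : R) (b : 'I_m -> R).
Hypothesis r0 : 0 < r.
Hypothesis t1_gt : -1 < t1.
Hypothesis t12 : t1 < t2.
Hypothesis t2_le : t2 <= 1.
Hypothesis k0 : 0 < k.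
Hypothesis ub_le : {ae mu, forall w, cyl a r t1 t2 w -> \sum_i (u i w - b i) ^+ 2 <= k}.
Hypothesis u_le : {ae mu, forall w, cyl a r t1 t2 w -> \sum_i u i w ^+ 2 <= k^-1}.

Let Q := cyl a r t1 t2.
Let p w := B w * \1_Q w.
Let h w := \sum_i (u i w - b i) ^+ 2.

Let ip : ible mu p. Proof. exact: (wsol_ible W). Qed.

Let p_ge0 w : 0 <= p w. Proof. by rewrite mulr_ge0 ?indic_ge0//; exact: wsol_ge0 W _. Qed.

Let M0 (i : 'I_m) : 0 <= M. Proof. by apply: le_trans ((bu i).2 0). Qed.

Let Cb := \sum_i (2 * (M + `|b i|) * M).

Lemma bmeas_sum (F : 'I_m -> Z -> R) (D : 'I_m -> R) : (forall i, bmeas (F i) (D i)) ->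
  bmeas (fun w => \sum_i F i w) (\sum_i D i).
Proof.
move=> bF; split; first by apply: measurable_sum => i; exact: (bF i).1.
by move=> w; apply: le_trans (ler_norm_sum _ _ _) _; apply: ler_sum => i _; exact: (bF i).2.
Qed.

Lemma conv_sum (F : 'I_m -> Z -> R) (D : 'I_m -> R) q z : (forall i, bmeas (F i) (D i)) ->
  ible mu q -> conv (fun w => \sum_i F i w) q z = \sum_i conv (F i) q z.
Proof.
move=> bF iq; rewrite /conv -int_sum; last by move=> i; exact: conv_ible (bF i) iq.
by apply: eq_int => w; rewrite mulr_suml.
Qed.

Let bh : bmeas h (\sum_i (M + `|b i|) ^+ 2).
Proof. by apply: bmeas_sum => i; exact: sqr_bmeas. Qed.

Section fixed_scales.
Variables (eps e rho C : R) (eta deta : Z -> R).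
Hypothesis H : moll eps eta deta C.
Hypothesis e0 : 0 < e.
Hypothesis er : e <= rho.

Let U i := conv (u i) eta.
Let bU i : bmeas (U i) M. Proof. exact: moll_conv_bmeas H (bu i). Qed.
Let bSU i := Sq_bmeas s01 (lt_le_trans e0 er) (bU i).
Let E := \int[mu]_w `|Lop s e eta w - Linf s eta deta w|.
Let eps0 := moll_gt0 H.

(** On mollifications the discrete operator reproduces the weak equation up to the $L^1$ distance
    between [Lop] and [Linf] on the mollifier. *)
Lemma Lop_conv_near i w :
  `|Lop s e (U i) w - conv (u i) (Linf s eta deta) w| <= M * E.
Proof.
have iL := Lop_mu_ible s01 e0 (moll_bmeas H) (moll_ible H).
have il := Linf_ible s01 eps0 H.
rewrite (Lop_conv s01 _ e0 (bu i) (moll_bmeas H) (moll_ible H)) -(convBr _ (bu i))//.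
by apply: conv_bound => //; exact: ibleB.
Qed.

Let G w := 2 * conv eta p w + (Cb * E - \sum_i Sq s rho (U i) w).

(** The central computation: $L_e|U-b|^2$ is at most $2(U-b)\cdot L_eU$ minus the quadratic term,
    and the weak equation replaces $L_eU(w)$ by an average of $u\,B$. It remains to bound
    $(U(w)-b)\cdot u(v)$ by $1$, with $U$ and $u$ taken at different points. *)
Lemma Lop_sqr_sum_le w : -1 + eps < w.2 -> w.2 <= 1 ->
  (forall v, eta (w - v) != 0 -> Q v) ->
  Lop s e (fun w => \sum_i (U i w - b i) ^+ 2) w <= G w.
Proof.
move=> w1 w2 wQ.
have bs i := sqr_bmeas (b i) (bU i).
have -> : Lop s e (fun w => \sum_i (U i w - b i) ^+ 2) w =
    \sum_i Lop s e (fun w => (U i w - b i) ^+ 2) w.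
  rewrite /Lop big_split/=; congr (_ + _).
    rewrite /Aop -int_sum; last by move=> i; exact: (Aop_ible s01 w e0 (bs i)).
    by apply: eq_int => y; rewrite -sumrB mulr_suml.
  by rewrite /Dop -sumrB mulr_suml.
have step i : Lop s e (fun w => (U i w - b i) ^+ 2) w <=
    2 * ((U i w - b i) * conv (u i) (Linf s eta deta) w) + 2 * (M + `|b i|) * M * E - Sq s rho (U i) w.
  apply: le_trans (Lop_sqr_le s01 _ _ e0 (bU i)) _.
  apply: lerB; last exact: Sq_anti (bU i).
  rewrite -lerBlDl -!mulrA -mulrBr -mulrBr ler_wpM2l//.
  apply: le_trans (ler_norm _) _; rewrite normrM ler_pM//.
    by apply: le_trans (ler_normB _ _) (lerD ((bU i).2 _) _).
  exact: Lop_conv_near.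
apply: le_trans (ler_sum _ (fun i _ => step i)) _.
rewrite /G sumrB big_split/= addrA lerD2r.
rewrite -mulr_suml lerD2r -mulr_sumr ler_wpM2l//.
have iBe i : ible mu (fun v => u i v * (B v * eta (w - v))).
  apply: (ibleM (bu i).1 (bu i).2).
  have bs' : bmeas (fun v => eta (w - v)) C.
    split; last by move=> v; exact: (moll_bmeas H).2.
    by apply: (measurableT_comp (f := eta)); [exact: moll_meas H|exact: measurable_Z_sub].
  apply: ible_cvt (ibleM bs'.1 bs'.2 ip) => v /=; congr EFin.
  have [->|hv] := eqVneq (eta (w - v)) 0; first by rewrite mulr0 mul0r.
  by rewrite /p indicE mem_set ?mulr1 1?mulrC//; exact: wQ.
under eq_bigr do rewrite (wsol_weak W _ H)// -intZ//.
rewrite -int_sum; last by move=> i; exact: ibleZ.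
apply: int_le_ae.
- by apply: ible_sum => i; exact: ibleZ.
- exact: conv_ible (moll_bmeas H) ip.
apply: filterS u_le => v uv.
have [ev|ev] := eqVneq (eta (w - v)) 0.
  by rewrite ev mul0r big1// => i _; rewrite !mulr0.
have Qv := wQ _ ev.
rewrite /p indicE mem_set// mulr1 [leRHS]mulrC -[leRHS]mul1r.
rewrite (eq_bigr (fun i => (U i w - b i) * u i v * (B v * eta (w - v)))); last by move=> i _; rewrite mulrA.
rewrite -mulr_suml ler_wpM2r//; first by rewrite mulr_ge0 ?(wsol_ge0 W)// (moll_ge0 H).
(* The bound $|u-b|^2\le k$ survives mollification by Jensen. *)
have Ub : \sum_i (U i w - b i) ^+ 2 <= k.
  apply: (@le_trans _ _ (conv h eta w)).
    rewrite (conv_sum _ (fun i => sqr_bmeas (b i) (bu i)) (moll_ible H)).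
    by apply: ler_sum => i _; exact: moll_jensen H (bu i).
  apply: (conv_le_ae H bh); apply: filterS ub_le => v' Hv' ev'; apply: Hv'; exact: wQ.
apply: (@le_trans _ _ (\sum_i (2^-1 * k^-1 * (U i w - b i) ^+ 2 + 2^-1 * k * u i v ^+ 2))).
  apply: ler_sum => i _; set x := U i w - b i; set y := u i v.
  rewrite -subr_ge0 (_ : _ - _ = 2^-1 * k^-1 * (x - k * y) ^+ 2); last first.
    by field; rewrite gt_eqF.
  by rewrite mulr_ge0 ?sqr_ge0// mulr_ge0// invr_ge0 ltW.
rewrite big_split/= -!mulr_sumr.
apply: (@le_trans _ _ (2^-1 * k^-1 * k + 2^-1 * k * k^-1)); last first.
  by rewrite le_eqVlt; apply/orP; left; apply/eqP; field; rewrite gt_eqF.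
apply: lerD; apply: ler_wpM2l => //; last exact: uv.
  by rewrite mulr_ge0// invr_ge0 ltW.
by rewrite mulr_ge0// ltW.
Qed.

(** Testing with a second mollifier lets the discrete operator fall on [eta1], where its limit is
    known, instead of on the square. *)
Lemma conv_sqr_le eps1 eta1 deta1 C1 z0 : moll eps1 eta1 deta1 C1 ->
  `|a - z0.1| + eps1 + eps < r -> t1 < z0.2 - eps1 - eps -> z0.2 <= t2 ->
  conv (fun w => \sum_i (U i w - b i) ^+ 2) (Lop s e eta1) z0 <=
  2 * conv (conv eta p) eta1 z0 + Cb * E - \sum_i conv (Sq s rho (U i)) eta1 z0.
Proof.
move=> H1 zr zt1 zt2.
have i1 := moll_ible H1; have b1 := moll_bmeas H1.
have bH := bmeas_sum (fun i => sqr_bmeas (b i) (bU i)).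
rewrite -(Lop_conv s01 _ e0 bH b1 i1) (Lop_conv_l s01 _ e0 bH i1).
have bp := conv_bmeas (moll_bmeas H) ip.
have bS := bmeas_sum bSU.
have bp2 : bmeas (fun w => 2 * conv eta p w) (2 * (C * \int[mu]_w `|p w|)).
  split; first by apply: measurable_funM => //; exact: bp.1.
  by move=> w; rewrite normrM ger0_norm// ler_wpM2l// bp.2.
have bE : bmeas (fun _ : Z => Cb * E) `|Cb * E| by split.
have bES : bmeas (fun w => Cb * E - \sum_i Sq s rho (U i) w)
    (`|Cb * E| + \sum_(i < m) ((M + M) ^+ 2 * kmass (n := n) s rho)).
  split; first by apply: measurable_funB => //; exact: bS.1.
  by move=> w; apply: le_trans (ler_normB _ _) _; rewrite lerD2l bS.2.
have bG : bmeas G (2 * (C * \int[mu]_w `|p w|) +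
    (`|Cb * E| + \sum_(i < m) ((M + M) ^+ 2 * kmass (n := n) s rho))).
  split; first by apply: measurable_funD; [exact: bp2.1|exact: bES.1].
  by move=> w; apply: le_trans (ler_normD _ _) (lerD (bp2.2 w) (bES.2 w)).
apply: (@le_trans _ _ (conv G eta1 z0)).
  apply: (conv_le (Lop_bmeas s01 e0 bH) bG i1 (moll_ge0 H1)) => w /(moll_supp H1)[w1 /andP[w2 w3]].
  have h1 := t1_gt; have h2 := t2_le; apply: Lop_sqr_sum_le => /=; [lra|lra|].
  move=> v /(moll_supp H)[/= v1 /andP[v2 v3]]; split; last by apply/andP; split; lra.
  have -> : a - v.1 = (a - z0.1) + w.1 + (z0.1 - w.1 - v.1).
    by apply/rowP => i; rewrite !mxE; ring.
  apply: le_lt_trans (ler_normD _ _) _; apply: le_lt_trans (lerD (ler_normD _ _) (lexx _)) _.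
  lra.
rewrite /G (convD _ bp2 bES i1) (convZ _ _ bp i1) (convB _ bE bS i1) (moll_conv_cst _ _ H1).
by rewrite (conv_sum _ bSU i1) addrA.
Qed.

End fixed_scales.

End subsolution.

(** * Passage to the limit in the subsolution inequality *)

Section subsolution_limit.
Context {R : realType} {n : nat} (s : R).
Hypothesis s01 : 0 < s < 1.
Local Notation N := n.+1.
Local Notation lam := (@lebesgue_rV R N).
Local Notation mu := (@leb_rVT R N).
Local Notation Z := ('rV[R]_N * measurableTypeR R)%type.
Implicit Types (f g p eta deta : Z -> R) (z w v : Z) (x y : 'rV[R]_N) (e C D eps : R).

Lemma conv_abs_le f g p D D' z : bmeas f D -> bmeas g D' -> ible mu p ->
  (forall w, 0 <= p w) -> (forall w, `|f w| <= g w) -> `|conv f p z| <= conv g p z.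
Proof.
move=> bf bg ip p0 fg.
apply: int_bound; [exact: conv_ible bf ip|exact: conv_ible bg ip|].
by move=> w; rewrite normrM (ger0_norm (p0 _)) ler_wpM2r.
Qed.

Lemma absdiff_bmeas f g D : bmeas f D -> bmeas g D -> bmeas (fun w => `|f w - g w|) (D + D).
Proof.
move=> bf bg; split.
  by apply: measurableT_comp => //; apply: measurable_funB; [exact: bf.1|exact: bg.1].
by move=> v; rewrite normr_id; apply: le_trans (ler_normB _ _) (lerD (bf.2 _) (bg.2 _)).
Qed.

(** By symmetry the operator acting on $|f-g|$ in [Sq_diff] is transferred to the mollifier, which
    leaves a weighted $L^1$ norm of $f-g$. *)
Lemma conv_Sq_diff rho f g D eta C z : 0 < rho -> bmeas f D -> bmeas g D ->
  bmeas eta C -> ible mu eta -> (forall w, 0 <= eta w) ->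
  `|conv (Sq s rho f) eta z - conv (Sq s rho g) eta z| <=
  4 * D * \int[mu]_w (`|f w - g w| *
    (2 * kmass (n := n) s rho * `|eta (z - w)| + `|Aop s rho eta (z - w)|)).
Proof.
move=> r0 bf bg be ie e0; have bd := absdiff_bmeas bf bg.
have D0 : 0 <= D by apply: le_trans (bf.2 0).
have k0 := kmass_ge0 (n := n) s01 rho.
have b1 := Sq_bmeas s01 r0 bf; have b2 := Sq_bmeas s01 r0 bg.
have bA := Aop_bmeas s01 r0 bd.
set d := fun w => `|f w - g w| in bd bA *.
have bkd : bmeas (fun w => 2 * kmass (n := n) s rho * d w) (2 * kmass (n := n) s rho * (D + D)).
  split; first by apply: measurable_funM => //; exact: bd.1.
  by move=> w; rewrite normrM ger0_norm ?mulr_ge0// ler_wpM2l ?mulr_ge0// bd.2.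
have bX : bmeas (fun w => 2 * kmass (n := n) s rho * d w - Aop s rho d w)
    (2 * kmass (n := n) s rho * (D + D) + (D + D + (D + D)) * kmass (n := n) s rho).
  split; first by apply: measurable_funB; [exact: bkd.1|exact: bA.1].
  by move=> w; apply: le_trans (ler_normB _ _) (lerD (bkd.2 _) (bA.2 _)).
have bX4 : bmeas (fun w => 4 * D * (2 * kmass (n := n) s rho * d w - Aop s rho d w))
    (4 * D * (2 * kmass (n := n) s rho * (D + D) + (D + D + (D + D)) * kmass (n := n) s rho)).
  split; first by apply: measurable_funM => //; exact: bX.1.
  by move=> w; rewrite normrM ger0_norm ?mulr_ge0// ler_wpM2l ?mulr_ge0// bX.2.
have bS : bmeas (fun w => Sq s rho f w - Sq s rho g w)
   ((D + D) ^+ 2 * kmass (n := n) s rho + (D + D) ^+ 2 * kmass (n := n) s rho).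
  split; first by apply: measurable_funB; [exact: b1.1|exact: b2.1].
  by move=> w; apply: le_trans (ler_normB _ _) (lerD (b1.2 _) (b2.2 _)).
rewrite -(convB _ b1 b2 ie).
apply: le_trans (conv_abs_le z bS bX4 ie e0 _) _.
  by move=> w; exact: Sq_diff.
rewrite (convZ _ _ bX ie) ler_wpM2l ?mulr_ge0//.
have iA := Aop_mu_ible s01 r0 be ie.
rewrite (convB _ bkd bA ie) (convZ _ _ bd ie) -(conv_Aop s01 _ r0 bd be ie).
rewrite (conv_comm _ bd ie) (conv_comm _ bd iA).
have i1 := ibleM bd.1 bd.2 (ible_refl z ie).
have i2 := ibleM bd.1 bd.2 (ible_refl z iA).
rewrite -intZ// -intB//; last exact: ibleZ.
have i3 := ibleM bd.1 bd.2 (ible_abs (ible_refl z ie)).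
have i4 := ibleM bd.1 bd.2 (ible_abs (ible_refl z iA)).
apply: int_le; first exact: ibleB (ibleZ _ i1) i2.
  by apply: ible_cvt (ibleD (ibleZ (2 * kmass (n := n) s rho) i3) i4) => w /=; congr EFin; rewrite mulrDr mulrCA.
move=> w; have d0 : 0 <= d w by rewrite /d.
rewrite mulrDr; apply: lerD.
  by rewrite mulrCA ler_wpM2l// ler_wpM2l ?mulr_ge0// ler_norm.
rewrite -mulrN ler_wpM2l// -normrN; exact: ler_norm.
Qed.

Lemma conv_sqr_diff f g D (b : R) q z : bmeas f D -> bmeas g D -> ible mu q ->
  `|conv (fun w => (f w - b) ^+ 2) q z - conv (fun w => (g w - b) ^+ 2) q z| <=
  2 * (D + `|b|) * \int[mu]_w (`|f w - g w| * `|q (z - w)|).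
Proof.
move=> bf bg iq; have b1 := sqr_bmeas b bf; have b2 := sqr_bmeas b bg.
have D0 : 0 <= D by apply: le_trans (bf.2 0).
have bd := absdiff_bmeas bf bg; have ir := ible_refl z iq.
rewrite (conv_comm _ b1 iq) (conv_comm _ b2 iq).
rewrite -intB; [|exact: ibleM b1.1 b1.2 ir|exact: ibleM b2.1 b2.2 ir].
have i3 := ibleM bd.1 bd.2 (ible_abs ir).
rewrite -intZ//; apply: int_bound; [|exact: ibleZ|].
  by apply: ibleB; [exact: ibleM b1.1 b1.2 ir|exact: ibleM b2.1 b2.2 ir].
move=> w; rewrite -mulrBl normrM mulrA ler_wpM2r// subr_sqr normrM mulrC.
apply: ler_pM => //; last first. rewrite le_eqVlt; apply/orP; left; apply/eqP; congr `| _ |; ring.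
have := bf.2 w; have := bg.2 w; have := lexx `|b|.
rewrite {1}ler_norml !ler_norml => /andP[? ?] /andP[? ?] /andP[? ?].
by apply/andP; split; lra.
Qed.

End subsolution_limit.

Section subsolution_main.
Context {R : realType} {n : nat} (s : R).
Hypothesis s01 : 0 < s < 1.
Local Notation N := n.+1.
Local Notation lam := (@lebesgue_rV R N).
Local Notation mu := (@leb_rVT R N).
Local Notation Z := ('rV[R]_N * measurableTypeR R)%type.
Implicit Types (f g p eta deta : Z -> R) (z w v : Z) (x y : 'rV[R]_N) (e C D eps : R).

Variables (m : nat) (u : 'I_m -> Z -> R) (M : R) (B : Z -> R).
Hypothesis W : wsol s u M B.
Let bu := wsol_bmeas W.

Variables (a : 'rV[R]_N) (r t1 t2 k : R) (b : 'I_m -> R).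
Hypothesis r0 : 0 < r.
Hypothesis t1_gt : -1 < t1.
Hypothesis t12 : t1 < t2.
Hypothesis t2_le : t2 <= 1.
Hypothesis k0 : 0 < k.
Hypothesis ub_le : {ae mu, forall w, cyl a r t1 t2 w -> \sum_i (u i w - b i) ^+ 2 <= k}.
Hypothesis u_le : {ae mu, forall w, cyl a r t1 t2 w -> \sum_i u i w ^+ 2 <= k^-1}.

Let h w := \sum_i (u i w - b i) ^+ 2.

Variables (eps1 C1 : R) (eta1 deta1 : Z -> R) (z0 : Z).
Hypothesis H1 : moll eps1 eta1 deta1 C1.
Hypothesis zr : `|a - z0.1| + eps1 < r.
Hypothesis zt1 : t1 < z0.2 - eps1.
Hypothesis zt2 : z0.2 <= t2.

Let p w := B w * \1_(cyl a r t1 t2) w.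
Let ip : ible mu p. Proof. exact: (wsol_ible W). Qed.

(** The scales $\varepsilon$ and $e$ tend to $0$ while the quadratic term is still cut at $\rho$,
    where it is stable under $L^1$ convergence. *)
Lemma conv_Linf_sqr_le rho C : 0 < rho -> 0 < C ->
  conv h (Linf s eta1 deta1) z0 <=
  2 * conv eta1 p z0 - \sum_i conv (Sq s rho (u i)) eta1 z0 + C.
Proof.
move=> rho0 C0.
have M0 : unit * ('I_m -> 0 <= M) by split => // i; apply: le_trans ((bu i).2 0).
have ie1 := moll_ible H1; have be1 := moll_bmeas H1; have eps10 := moll_gt0 H1.
have il1 := Linf_ible s01 eps10 H1.
have iA1 := Aop_mu_ible s01 rho0 be1 ie1.
have [C10 _ _ _] := moll_lip2 H1.
pose Cb := \sum_i (2 * (M + `|b i|) * M).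
pose CH := \sum_i (M + `|b i|) ^+ 2.
pose Cd := \sum_i (2 * (M + `|b i|)).
pose CS := \sum_(i < m) (4 * M).
have Cb0 : 0 <= Cb by apply: sumr_ge0 => i _; rewrite !mulr_ge0 ?addr_ge0// (M0.2 i).
have CH0 : 0 <= CH by apply: sumr_ge0 => i _; exact: sqr_ge0.
have Cd0 : 0 <= Cd by apply: sumr_ge0 => i _; rewrite mulr_ge0// addr_ge0// (M0.2 i).
have CS0 : 0 <= CS by apply: sumr_ge0 => i _; rewrite mulr_ge0// (M0.2 i).
(* All the error terms are multiples of one quantity [dl], and [K] is the sum of the
   coefficients. *)
pose K := Cd + CH + 2 + Cb + CS.
have K0 : 0 < K by rewrite /K; lra.
pose dl := C / K; have dl0 : 0 < dl by rewrite divr_gt0.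
(* One weight that dominates all those against which $|U-u|$ is integrated, so that a single choice
   of $\varepsilon$ suffices. *)
pose P w := `|Linf s eta1 deta1 w| + (2 * kmass (n := n) s rho * `|eta1 w| + `|Aop s rho eta1 w|).
have iP1 : ible mu (fun w => 2 * kmass (n := n) s rho * `|eta1 w| + `|Aop s rho eta1 w|).
  by apply: ibleD; [exact/ibleZ/ible_abs|exact: ible_abs].
have iP : ible mu P by apply: ibleD; [exact: ible_abs|exact: iP1].
have iPz := ible_refl z0 iP.
have mg : exists2 d, 0 < d & forall e, e <= d -> `|a - z0.1| + eps1 + e < r /\ t1 < z0.2 - eps1 - e.
  have g1 := zr; have g2 := zt1.
  exists (Num.min ((r - `|a - z0.1| - eps1) / 2) ((z0.2 - eps1 - t1) / 2)).
    by rewrite lt_min; apply/andP; split; lra.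
  by move=> e; rewrite le_min => /andP[? ?]; split; lra.
have [dm dm0 Hm] := mg.
have [du du0 Hu] : exists2 d, 0 < d & forall e, 0 < e -> e <= d -> forall i, forall eta deta C', moll e eta deta C' ->
    \int[mu]_w (`|conv (u i) eta w - u i w| * P (z0 - w)) <= dl.
  apply: fin_eps => i; have [d d0 Hd] := conv_cvg_weight (bu i) iPz dl0.
  exists d => // e _ ed eta deta C' H.
  apply: le_trans (Hd _ _ _ _ H ed); apply: int_le.
  - have bd := absdiff_bmeas (moll_conv_bmeas H (bu i)) (bu i); exact: ibleM bd.1 bd.2 iPz.
  - have bd := absdiff_bmeas (moll_conv_bmeas H (bu i)) (bu i); exact: ibleM bd.1 bd.2 (ible_abs iPz).
  - by move=> w; rewrite ler_wpM2l// ler_norm.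
pose Ip := \int[mu]_v `|p v|.
have Ip0 : 0 <= Ip by apply: int_ge0.
pose dp := dl / (C1 * 2 * Ip + 1).
have dpp : 0 < C1 * 2 * Ip + 1 by rewrite ltr_wpDl// !mulr_ge0.
have dp0 : 0 < dp by rewrite divr_gt0.
pose eps := Num.min dm (Num.min du dp).
have eps0 : 0 < eps by rewrite !lt_min dm0 du0.
have em : eps <= dm by rewrite ge_min lexx.
have eu : eps <= du by rewrite !ge_min lexx !orbT.
have ep : eps <= dp by rewrite !ge_min lexx !orbT.
have [zr' zt'] := Hm _ em.
have [eta [deta [C' H]]] := @moll_exists R n eps eps0.
have [e1 e10 He1] := Lop_Linf_L1 s01 eps0 H dl0.
have [e2 e20 He2] := Lop_Linf_L1 s01 eps10 H1 dl0.
(* The order matters: [e] is chosen after $\varepsilon$, since it depends on the mollifier at that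
   scale. *)
pose e := Num.min rho (Num.min e1 e2).
have e0 : 0 < e by rewrite !lt_min rho0 e10.
have er : e <= rho by rewrite ge_min lexx.
have {}He1 := He1 e e0 ltac:(by rewrite !ge_min lexx !orbT).
have {}He2 := He2 e e0 ltac:(by rewrite !ge_min lexx !orbT).
pose U i := conv (u i) eta.
have bU i : bmeas (U i) M by exact: moll_conv_bmeas H (bu i).
have {}Hu i : \int[mu]_w (`|U i w - u i w| * P (z0 - w)) <= dl by exact: Hu eps0 eu i _ _ _ H.
have key := conv_sqr_le s01 W r0 t1_gt t12 t2_le k0 ub_le u_le H e0 er H1 zr' zt' zt2.
have bHi i := sqr_bmeas (b i) (bU i); have bhi i := sqr_bmeas (b i) (bu i).
have bH := bmeas_sum bHi; have bh := bmeas_sum bhi.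
have A1 : `|conv (fun w => \sum_i (U i w - b i) ^+ 2) (Linf s eta1 deta1) z0 -
    conv h (Linf s eta1 deta1) z0| <= Cd * dl.
  rewrite (conv_sum _ bHi il1) (conv_sum _ bhi il1) -sumrB mulr_suml.
  apply: le_trans (ler_norm_sum _ _ _) _; apply: ler_sum => i _.
  apply: le_trans (conv_sqr_diff _ _ (bU i) (bu i) il1) _.
  rewrite ler_wpM2l ?mulr_ge0 ?addr_ge0 ?(M0.2 i)//.
  have bd := absdiff_bmeas (bU i) (bu i).
  apply: le_trans (Hu i); apply: int_le.
  - exact: ibleM bd.1 bd.2 (ible_abs (ible_refl z0 il1)).
  - exact: ibleM bd.1 bd.2 iPz.
  - move=> w; rewrite ler_wpM2l// lerDl addr_ge0// !mulr_ge0//; exact: kmass_ge0.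
have A2 : `|conv (fun w => \sum_i (U i w - b i) ^+ 2) (Lop s e eta1) z0 -
    conv (fun w => \sum_i (U i w - b i) ^+ 2) (Linf s eta1 deta1) z0| <= CH * dl.
  have iL := Lop_mu_ible s01 e0 be1 ie1.
  rewrite -(convBr _ bH)//; apply: le_trans (conv_bound _ bH (ibleB iL il1)) _.
  by rewrite ler_wpM2l.
have A3 : `|conv (conv eta p) eta1 z0 - conv eta1 p z0| <= dl.
  have := conv_conv_moll z0 H1 H ip.
  rewrite (_ : \int[mu]_w _ = conv (conv eta p) eta1 z0); last first.
    by apply: eq_int => w; rewrite mulrC.
  move=> /le_trans; apply.
  apply: (@le_trans _ _ ((C1 * 2 * Ip + 1) * eps)).
    have E : C1 * (2 * eps) * Ip = C1 * 2 * Ip * eps by ring.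
    by rewrite -/Ip [leRHS]mulrDl E mul1r lerDl ltW.
  by rewrite mulrC -ler_pdivlMr.
have A4 i : `|conv (Sq s rho (U i)) eta1 z0 - conv (Sq s rho (u i)) eta1 z0| <= 4 * M * dl.
  apply: le_trans (conv_Sq_diff s01 _ rho0 (bU i) (bu i) be1 ie1 (moll_ge0 H1)) _.
  rewrite ler_wpM2l ?mulr_ge0 ?(M0.2 i)//.
  have bd := absdiff_bmeas (bU i) (bu i).
  apply: le_trans (Hu i); apply: int_le.
  - exact: ibleM bd.1 bd.2 (ible_refl z0 iP1).
  - exact: ibleM bd.1 bd.2 iPz.
  - by move=> w; rewrite ler_wpM2l// lerDr.
have A5 : \sum_i conv (Sq s rho (u i)) eta1 z0 - \sum_i conv (Sq s rho (U i)) eta1 z0 <= CS * dl.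
  rewrite -sumrB mulr_suml; apply: ler_sum => i _; apply: le_trans (A4 i).
  by rewrite -normrN opprB ler_norm.
have A6 : Cb * \int[mu]_w `|Lop s e eta w - Linf s eta deta w| <= Cb * dl by rewrite ler_wpM2l.
have CK : C = Cd * dl + CH * dl + 2 * dl + Cb * dl + CS * dl.
  by rewrite -!mulrDl -/K /dl mulrC divfK// gt_eqF.
move: A1 A2 A3; rewrite !ler_norml => /andP[? ?] /andP[? ?] /andP[? ?].
move: key; rewrite -/U -/p -/Cb => key.
rewrite /h in CK *; lra.
Qed.

(** The weak subsolution property of $|u-b|^2$. With $\rho=1/(j+1)\to0$ the quadratic terms tend,
    dominated by [2 * B], to a limit that exactly cancels [2 * conv eta1 p]. *)
Lemma conv_Linf_subsol : conv h (Linf s eta1 deta1) z0 <= 0.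
Proof.
have ie1 := moll_ible H1; have be1 := moll_bmeas H1.
have ir1 := ible_refl z0 ie1.
have rk j : 0 < j.+1%:R^-1 :> R by rewrite invr_gt0.
have bS j i := Sq_bmeas s01 (rk j) (bu i).
pose F j w := (\sum_i Sq s j.+1%:R^-1 (u i) w) * eta1 (z0 - w).
pose f w := 2 * (eta1 (z0 - w) * p w).
have wQ w : eta1 (z0 - w) != 0 -> cyl a r t1 t2 w.
  move=> /(moll_supp H1)[/= v1 /andP[v2 v3]]; have g1 := zr; have g2 := zt1; have g3 := zt2.
  have e1 := moll_gt0 H1.
  split; last by apply/andP; split; lra.
  have -> : a - w.1 = (a - z0.1) + (z0.1 - w.1) by apply/rowP => i; rewrite !mxE; ring.
  by apply: le_lt_trans (ler_normD _ _) _; lra.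
have iF j : ible mu (F j).
  by have bb := bmeas_sum (bS j); exact: ibleM bb.1 bb.2 ir1.
have if_ : ible mu f by apply: ibleZ; exact: conv_ible be1 ip.
have [||_ L] := dct_ae iF (ible_meas if_) if_.
- apply: filterS (wsol_Sq_le W) => w Hw j; rewrite /F /f.
  have [->|ew] := eqVneq (eta1 (z0 - w)) 0; first by rewrite !mulr0 mul0r mulr0 normr0.
  have /= Qw := wQ _ ew; have [_ /andP[q1 q2]] := Qw.
  have g1 := t1_gt; have g2 := t2_le.
  rewrite ger0_norm; last first.
    by rewrite mulr_ge0 ?(moll_ge0 H1)//; apply: sumr_ge0 => i _; exact: Sq_ge0.
  rewrite [X in _ <= 2 * X]mulrC mulrA ler_wpM2r ?(moll_ge0 H1)//.
  by rewrite /p indicE mem_set// mulr1; apply: Hw; lra.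
- apply: filterS (wsol_Sq_cvg W) => w Hw; rewrite /F /f.
  have [->|ew] := eqVneq (eta1 (z0 - w)) 0.
    by rewrite mul0r mulr0; under eq_fun do rewrite mulr0; exact: cvg_cst.
  have /= Qw := wQ _ ew; have [_ /andP[q1 q2]] := Qw.
  have g1 := t1_gt; have g2 := t2_le.
  rewrite [X in _ --> X](_ : _ = 2 * B w * eta1 (z0 - w)); last first.
    by rewrite /p indicE mem_set// mulr1; ring.
  by apply: cvgMl; apply: Hw; lra.
have FE j : \int[mu]_w F j w = \sum_i conv (Sq s j.+1%:R^-1 (u i)) eta1 z0.
  rewrite -(conv_sum _ (bS j) ie1) (conv_comm _ (bmeas_sum (bS j)) ie1).
  by apply: eq_int.
have fE : \int[mu]_w f w = 2 * conv eta1 p z0.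
  by rewrite /f intZ//; exact: conv_ible be1 ip.
apply/ler_addgt0Pr => C C0; rewrite add0r.
have C2 : 0 < C / 2 by lra.
move/cvgrPdist_le : L => /(_ _ C2)[j _ /(_ j (leqnn j))].
rewrite FE fE ler_norml => /andP[_ h1].
have := conv_Linf_sqr_le (rk j) C2; lra.
Qed.

End subsolution_main.

(** * The spatial profile of the barrier *)

Section barrier.
Context {R : realType} {n : nat} (s : R).
Hypothesis s01 : 0 < s < 1.
Local Notation N := n.+1.
Local Notation lam := (@lebesgue_rV R N).
Local Notation mu := (@leb_rVT R N).
Local Notation Z := ('rV[R]_N * measurableTypeR R)%type.
Local Notation c := (@fconst R n s).
Implicit Types (f g : Z -> R) (z w v : Z) (x y : 'rV[R]_N) (r e C D eps : R).

(** A truncated concave paraboloid. The normalization gives $\varphi\ge3/4$ on the sup-norm ball of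
    radius $r$ and support in the one of radius $2Nr$, the radius [rho] below. *)
Definition phi (x0 : 'rV[R]_N) r z : R :=
  Num.max 0 (1 - dotp (x0 - z.1) (x0 - z.1) / (4 * N%:R * r ^+ 2)).

Lemma phi_ge0 x0 r z : 0 <= phi x0 r z.
Proof. by rewrite le_max lexx. Qed.

Let den_gt0 r : 0 < r -> 0 < 4 * N%:R * r ^+ 2.
Proof. by move=> r0; rewrite mulr_gt0 ?exprn_gt0// mulr_gt0// ltr0n. Qed.

Lemma phi_le1 x0 r z : 0 < r -> phi x0 r z <= 1.
Proof.
move=> r0; rewrite ge_max ler01 gerBl divr_ge0 ?dotp_ge0//.
exact/ltW/den_gt0.
Qed.

Lemma phi_bmeas x0 r : 0 < r -> bmeas (phi x0 r) 1.
Proof.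
move=> r0; split; last by move=> z; rewrite ger0_norm ?phi_ge0 ?phi_le1.
apply: measurable_maxr => //; apply: measurable_funB => //; apply: measurable_funM => //.
apply: (measurableT_comp (f := fun x : 'rV[R]_N => dotp x x)); first exact: measurable_dotp.
exact: measurable_rV_add.
Qed.

Lemma phi_supp x0 r z : 0 < r -> phi x0 r z != 0 -> `|x0 - z.1| < 2 * N%:R * r.
Proof.
move=> r0 h; have : 0 < phi x0 r z by rewrite lt_neqAle eq_sym h phi_ge0.
rewrite lt_max ltxx/= subr_gt0 ltr_pdivrMr ?den_gt0// mul1r => hd.
set x := x0 - z.1 in hd *.
have h1 : `|x| ^+ 2 < (2 * N%:R * r) ^+ 2.
  apply: (@le_lt_trans _ _ (dotp x x)).
    by rewrite -[leRHS](sqr_sqrtr (dotp_ge0 x)) lerXn2r ?nnegrE ?sqrtr_ge0// norm_le_enorm.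
  apply: lt_le_trans hd _; rewrite !exprMn ler_wpM2r ?sqr_ge0//.
  have -> : 2 ^+ 2 = 4 :> R by ring.
  rewrite ler_wpM2l// expr2 ler_peMl// ler1n.
  by [].
rewrite ltr_pXn2r ?nnegrE// in h1.
by rewrite !mulr_ge0// ltW.
Qed.

Lemma phi_ge34 x0 r z : 0 < r -> `|x0 - z.1| <= r -> 3 / 4 <= phi x0 r z.
Proof.
move=> r0 h; rewrite le_max; apply/orP; right.
suff : dotp (x0 - z.1) (x0 - z.1) / (4 * N%:R * r ^+ 2) <= 1 / 4.
  by set q := dotp _ _ / _; move: q => q; lra.
rewrite ler_pdivrMr ?den_gt0//; apply: le_trans (dotp_le_norm _) _.
rewrite (_ : 1 / 4 * _ = N%:R * r ^+ 2); last by field.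
by rewrite ler_wpM2l// lerXn2r ?nnegrE// ltW.
Qed.

(** Where $\varphi>0$ it touches the paraboloid, which lies below it everywhere; so its second
    differences are bounded by those of the paraboloid, that is by $2|y|^2/r^2$ (parallelogram
    identity), and trivially by $2$. Hence [kJ] bounds the integrand. *)
Lemma Aop_phi_le x0 r e z : 0 < r -> 0 < e -> 0 < phi x0 r z ->
  Aop s e (phi x0 r) z <= c * kC (n := n) s / r `^ (2 * s).
Proof.
move=> r0 e0 hz; have c0 := @fconst_gt0 R n s s01.
have bp := phi_bmeas x0 r0.
have i1 := Aop_ible s01 z e0 bp.
have i2 := ible_preserves (@preserves_rV_opp R n) i1.
have E2 := int_preserves (@preserves_rV_opp R n) i1.
have [iJ IJ] := @kJ_int R n s s01 r r0.
rewrite -mulrA; apply: le_trans (ler_wpM2l (ltW c0) IJ); rewrite -intZ//.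
rewrite -(ler_pM2l (ltr0n R 2)) -[leRHS]intZ; last exact: ibleZ.
have -> : 2 * Aop s e (phi x0 r) z = Aop s e (phi x0 r) z + Aop s e (phi x0 r) z by ring.
rewrite /Aop -{2}E2 -intD//; apply: int_le; [exact: ibleD|exact/ibleZ/ibleZ|].
move=> y; rewrite keN -mulrDl.
have ph w : 1 - dotp (x0 - w.1) (x0 - w.1) / (4 * N%:R * r ^+ 2) <= phi x0 r w.
  by rewrite le_max lexx orbT.
have pz : phi x0 r z = 1 - dotp (x0 - z.1) (x0 - z.1) / (4 * N%:R * r ^+ 2).
  by move: hz; rewrite /phi lt_max ltxx/= => hz; apply/max_idPr/ltW.
set w1 := z - (y, 0); set w2 := z - (- y, 0).
have hX1 : phi x0 r z - phi x0 r w1 + (phi x0 r z - phi x0 r w2) <= 2 * 1.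
  have := phi_ge0 x0 r w1; have := phi_ge0 x0 r w2; have := phi_le1 x0 z r0; lra.
have hX2 : phi x0 r z - phi x0 r w1 + (phi x0 r z - phi x0 r w2) <= 2 * (`|y| ^+ 2 / r ^+ 2).
  have par : dotp (x0 - w1.1) (x0 - w1.1) + dotp (x0 - w2.1) (x0 - w2.1) =
      2 * dotp (x0 - z.1) (x0 - z.1) + 2 * dotp y y.
    rewrite !dotpE !mulr_sumr -!big_split/=; apply: eq_bigr => i _.
    rewrite !mxE; ring.
  have := ph w1; have := ph w2; rewrite pz.
  set A := dotp (x0 - w1.1) _ in par *; set B := dotp (x0 - w2.1) _ in par *.
  set E := dotp (x0 - z.1) _ in par *; set d := 4 * N%:R * r ^+ 2 => h2 h1.
  have AB : A / d + B / d = 2 * (E / d) + 2 * (dotp y y / d).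
    by rewrite -mulrDl par mulrDl !mulrA.
  have d0 : 0 < d by exact: den_gt0.
  have yy : dotp y y / d <= `|y| ^+ 2 / r ^+ 2.
    rewrite ler_pdivrMr// [leRHS](_ : _ = 4 * (N%:R * `|y| ^+ 2)); last first.
      by rewrite /d; field; rewrite gt_eqF.
    apply: le_trans (dotp_le_norm y) _; rewrite ler_peMl ?mulr_ge0 ?sqr_ge0//; lra.
  lra.
rewrite /ke /kJ; set m := Num.min 1 _; set X := _ + _ in hX1 hX2 *.
have -> : 2 * (c * (m * fkernel s y)) = 2 * m * (c * fkernel s y) by ring.
have -> b : X * (c * (fkernel s y * b)) = X * (c * fkernel s y) * b by ring.
have cK : 0 <= c * fkernel s y by rewrite mulr_ge0 ?fkernel_ge0// ltW.
have m0 : 0 <= m by rewrite le_min ler01 divr_ge0// sqr_ge0.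
have hX : X <= 2 * m by rewrite /m; case: (leP 1 (`|y| ^+ 2 / r ^+ 2)).
case: (e < enorm y); first by rewrite mulr1 ler_wpM2r.
by rewrite mulr0; apply: mulr_ge0 => //; exact: mulr_ge0.
Qed.

(** A lower bound of the kernel up to sup-norm distance $4Nr$, the largest distance between two
    points of the support of the barrier. *)
Definition kap r : R := c * ((N%:R * (4 * N%:R * r)) ^+ N * (N%:R * (4 * N%:R * r)) `^ (2 * s))^-1.

Lemma kap_gt0 r : 0 < r -> 0 < kap r.
Proof.
move=> r0; have c0 := @fconst_gt0 R n s s01.
have n0 : 0 < N%:R * (4 * N%:R * r) :> R by rewrite !mulr_gt0 ?ltr0n.
by rewrite mulr_gt0// invr_gt0 mulr_gt0 ?exprn_gt0 ?powR_gt0.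
Qed.

Lemma ke_ge_kap r e y : 0 < e -> e < enorm y -> `|y| <= 4 * N%:R * r -> kap r <= ke s e y.
Proof.
move=> e0 ey yr; have c0 := @fconst_gt0 R n s s01.
rewrite /ke ey mulr1 ler_pM2l//; apply: fkernel_ge => //.
by apply: contraTneq ey => ->; rewrite enorm0 -leNgt ltW.
Qed.

Lemma kap_le r : 0 < r -> kap r * (2 * r) ^+ N <= c / r `^ (2 * s).
Proof.
move=> r0; have c0 := @fconst_gt0 R n s s01.
set q := N%:R * (4 * N%:R * r).
have n1 : 1 <= N%:R * N%:R :> R by rewrite -natrM ler1n.
have q0 : 0 < q by rewrite !mulr_gt0 ?ltr0n.
have qE : q = 4 * (N%:R * N%:R) * r by rewrite /q; ring.
have q2 : 2 * r <= q by rewrite qE ler_pM2r//; lra.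
have qr : r <= q by lra.
rewrite /kap -/q -mulrA ler_pM2l//.
have -> : (q ^+ N * q `^ (2 * s))^-1 * (2 * r) ^+ N = (q `^ (2 * s))^-1 * ((2 * r) ^+ N / q ^+ N).
  by rewrite invfM; ring.
have h1 : (q `^ (2 * s))^-1 <= (r `^ (2 * s))^-1.
  rewrite lef_pV2 ?posrE ?powR_gt0//.
  apply: ge0_ler_powR; rewrite ?nnegrE ?(ltW r0) ?(ltW q0)//.
  by case/andP: s01 => ? ?; rewrite mulr_ge0 ?(ltW _).
have h2 : (2 * r) ^+ N / q ^+ N <= 1.
  by rewrite ler_pdivrMr ?exprn_gt0// mul1r lerXn2r ?nnegrE ?(ltW q0)// mulr_ge0// ltW.
rewrite -[leRHS]mulr1; apply: ler_pM => //; first by rewrite invr_ge0 powR_ge0.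
by rewrite divr_ge0// exprn_ge0 ?(ltW q0)// mulr_ge0// ltW.
Qed.

End barrier.

(** * The nonlocal operator at a contact point with the barrier *)

Section contact.
Context {R : realType} {n : nat} (s : R).
Hypothesis s01 : 0 < s < 1.
Local Notation N := n.+1.
Local Notation lam := (@lebesgue_rV R N).
Local Notation mu := (@leb_rVT R N).
Local Notation Z := ('rV[R]_N * measurableTypeR R)%type.
Local Notation c := (@fconst R n s).

(** This and the next two lemmas are the pointwise comparison of integrands, according to the
    position of the other point: outside the support of the barrier, inside it but off the ball, or
    in the ball. Only the last case gains a negative multiple of $f$. *)
Lemma contact_far (fz fz' mz p g kk kp d dl Kt : R) : 0 <= kk -> 0 <= Kt ->
  fz - mz * p + Kt < 0 -> - g <= fz' -> 0 <= kp -> 0 <= d -> 0 <= dl ->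
  (fz - fz') * kk <= mz * ((p - 0) * kk) + kp * (mz * 0 - fz' * 0 + d) + g * kk + dl * kk.
Proof.
move=> kk0 Kt0 Fz fg kp0 d0 dl0; rewrite !mulr0 !subr0 add0r.
have h : fz - fz' <= mz * p + g by lra.
have := ler_wpM2r kk0 h; have := mulr_ge0 kp0 d0; have := mulr_ge0 dl0 kk0.
rewrite [(mz * p + g) * kk]mulrDl -[mz * p * kk]mulrA; lra.
Qed.

Lemma contact_near (fz fz' mz p p' g kk kp d dl : R) : 0 <= kk ->
  fz - mz * p <= fz' - mz * p' + dl -> 0 <= g -> 0 <= kp -> 0 <= d ->
  (fz - fz') * kk <= mz * ((p - p') * kk) + kp * (mz * 0 - fz' * 0 + d) + g * kk + dl * kk.
Proof.
move=> kk0 F g0 kp0 d0; rewrite !mulr0 subr0 add0r.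
have h : fz - fz' <= mz * (p - p') + dl by lra.
have := ler_wpM2r kk0 h; have := mulr_ge0 kp0 d0; have := mulr_ge0 g0 kk0.
rewrite [(_ + dl) * kk]mulrDl -[mz * (p - p') * kk]mulrA; lra.
Qed.

(** The increment of $f$ minus that of the barrier is nonpositive up to [dl], so the kernel may be
    replaced by its lower bound [kp]. In the second alternative the kernel is cut off, and the loss
    is absorbed by [d]. *)
Lemma contact_ball (fz fz' mz p p' g kk kp d dl Kt D : R) : 0 <= kk ->
  fz - mz * p <= fz' - mz * p' + dl -> 0 <= g -> 0 <= kp -> 0 <= d -> 0 <= mz -> 0 <= dl ->
  0 <= p' -> p' <= 1 -> fz - mz * p + Kt < 0 -> 0 <= Kt -> fz' <= D ->
  (kp <= kk) \/ (kk = 0 /\ D <= d) ->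
  (fz - fz') * kk <= mz * ((p - p') * kk) + kp * (mz * 1 - fz' * 1 + d) + g * kk + dl * kk.
Proof.
move=> kk0 F g0 kp0 d0 mz0 dl0 p0 p1 Fz Kt0 fD [kpk|[-> Dd]]; last first.
  rewrite !mulr0 !mulr1 add0r !addr0 mulr_ge0//; lra.
have X0 : fz - fz' - mz * (p - p') - dl <= 0 by lra.
have mp : mz * p' <= mz by rewrite ler_piMr.
have Xle : fz - fz' - mz * (p - p') - dl <= mz - fz' by lra.
have h1 := ler_wnM2l X0 kpk; have h2 := ler_wpM2l kp0 Xle.
have h3 := mulr_ge0 g0 kk0; have h4 := mulr_ge0 kp0 d0.
move: h1; rewrite [(_ - dl) * kk]mulrBl [(_ - mz * _) * kk]mulrBl -[mz * (p - p') * kk]mulrA.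
rewrite !mulr1 [kp * (_ + d)]mulrDr.
rewrite [(fz - fz' - mz * (p - p') - dl) * kp]mulrC; lra.
Qed.

Variables (f : Z -> R) (D : R).
Hypothesis bf : bmeas f D.
Variables (g : 'rV[R]_N -> R) (Dg : R).
Hypothesis mg : measurable_fun setT g.
Hypothesis g_ge0 : forall x, 0 <= g x.
Hypothesis g_le : forall x, g x <= Dg.
Variables (x0 : 'rV[R]_N) (r tau : R).
Hypothesis r0 : 0 < r.
Let rho : R := 2 * N%:R * r.
Hypothesis g_tail : forall e x, 0 < e -> `|x0 - x| <= rho ->
  \int[lam]_y (g (x - y) * ke s e y) <= tau.

Let Ball := [set x : 'rV[R]_N | `|x0 - x| < r].

Lemma ball_int (a : 'rV[R]_N) q : 0 < q ->
  ible lam (\1_[set x : 'rV[R]_N | `|a - x| < q] : 'rV[R]_N -> R) /\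
  \int[lam]_y \1_[set x : 'rV[R]_N | `|a - x| < q] y = (2 * q) ^+ N.
Proof.
move=> q0; have [mB eB] := rV_ball_measure a q0.
have mi : measurable_fun setT (\1_[set x : 'rV[R]_N | `|a - x| < q] : 'rV[R]_N -> R).
  exact: measurable_indic.
have E : (\int[lam]_z (\1_[set x : 'rV[R]_N | `|a - x| < q] z)%:E)%E = ((2 * q) ^+ N)%:E.
  by rewrite integral_indic// setIT.
have i : ible lam (\1_[set x : 'rV[R]_N | `|a - x| < q] : 'rV[R]_N -> R).
  by apply: (ible_ge0 mi) (ltry ((2 * q) ^+ N)) => [z|]; rewrite ?E// indicE.
by split => //; apply: EFin_inj; rewrite -ible_fin.
Qed.

Lemma slice_ible t : ible lam (fun y => f (y, t : measurableTypeR R) * \1_Ball y).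
Proof.
apply: (@ibleM _ _ _ _ D); last exact: (ball_int x0 r0).1.
  by apply: (measurableT_comp (f := f)); [exact: bf.1|exact: measurable_fun_pair].
by move=> y; exact: bf.2.
Qed.

Let D0 : 0 <= D. Proof. exact: le_trans (bf.2 0). Qed.

Let gke_ible e x : 0 < e -> ible lam (fun y => g (x - y) * ke s e y).
Proof.
move=> e0; apply: (@ibleM _ _ _ _ Dg); last exact: ke_ible.
  by apply: (measurableT_comp (f := g)) => //; exact: measurable_rV_add.
by move=> y; rewrite ger0_norm.
Qed.

Let rrho : r <= rho.
Proof.
have n1 : 1 <= N%:R :> R by rewrite ler1n.
have h1 := r0; rewrite -[leLHS]mul1r ler_wpM2r//; [exact: ltW|lra].
Qed.

(** The gain is [kap] times the mass of $f$ in the ball on the time slice. The term in $D$ pays for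
    the part of the ball hidden by the truncation, [tau] for the possible negativity of $f$ far
    away, and [dl] for a minimum that is only approximate. *)
Lemma Aop_contact e z mz Kt dl : 0 < e -> 0 <= dl -> 0 <= mz -> 0 <= Kt ->
  `|x0 - z.1| <= rho -> 0 <= f z ->
  (forall w, w.2 = z.2 -> - g w.1 <= f w) ->
  f z - mz * phi x0 r z + Kt < 0 ->
  (forall w, `|x0 - w.1| <= rho -> w.2 = z.2 ->
    f z - mz * phi x0 r z <= f w - mz * phi x0 r w + dl) ->
  Aop s e f z <= mz * (c * kC (n := n) s / r `^ (2 * s)) +
    kap (n := n) s r * (mz * (2 * r) ^+ N -
      \int[lam]_y (f (y, z.2) * \1_[set x : 'rV[R]_N | `|x0 - x| < r] y) +
      D * (2 * (2 * e)) ^+ N) +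
    tau + dl * kmass (n := n) s e.
Proof.
move=> e0 dl0 mz0 Kt0 z1 fz f_ge Fz zmin.
pose ph := phi x0 r.
have phz : 0 < ph z.
  rewrite lt_neqAle phi_ge0 andbT; apply/negP => /eqP E.
  by move: Fz; rewrite -/ph -E mulr0 subr0 ltNge addr_ge0.
have [iB EB] := ball_int x0 r0.
have e2 : 0 < 2 * e by rewrite mulr_gt0.
have [iE EE] := ball_int 0 e2.
set Be := [set x : 'rV[R]_N | `|0 - x| < 2 * e] in iE EE.
have P := @lebesgue_rV_subl R N z.1.
have iB' := ible_preserves P iB; have EB' := int_preserves P iB.
have iI1 := slice_ible z.2.
have iI1' := ible_preserves P iI1; have EI1' := int_preserves P iI1.
rewrite -/Ball in iB EB iB' EB' *.
have ik := ke_ible (n := n) s01 e0.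
have iA := Aop_ible s01 z e0 bf.
have iAp := Aop_ible s01 z e0 (phi_bmeas x0 r0).
have ig := gke_ible z.1 e0.
set kp := kap s r.
have kp0 : 0 <= kp by exact/ltW/kap_gt0.
have -> : mz * (2 * r) ^+ N - \int[lam]_y (f (y, z.2) * \1_Ball y) + D * (2 * (2 * e)) ^+ N =
  \int[lam]_y ((mz * \1_Ball (z.1 - y) - f (z.1 - y, z.2) * \1_Ball (z.1 - y)) + D * \1_Be y).
  rewrite (intD (ibleB (ibleZ mz iB') iI1') (ibleZ D iE)) (intB (ibleZ mz iB') iI1').
  by rewrite (intZ _ iB') (intZ _ iE) EB' EB EI1' EE.
have iX : ible lam (fun y => (mz * \1_Ball (z.1 - y) - f (z.1 - y, z.2) * \1_Ball (z.1 - y)) + D * \1_Be y).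
  by apply: ibleD; [exact: ibleB (ibleZ _ iB') iI1'|exact: ibleZ].
apply: (@le_trans _ _ (mz * Aop s e ph z + kp * \int[lam]_y ((mz * \1_Ball (z.1 - y) - f (z.1 - y, z.2) * \1_Ball (z.1 - y)) + D * \1_Be y) + \int[lam]_y (g (z.1 - y) * ke s e y) + dl * kmass (n := n) s e)); last first.
  rewrite lerD2r; apply: lerD; last exact: g_tail.
  by rewrite lerD2r; apply: ler_wpM2l; [|exact: (Aop_phi_le s01 r0 e0 phz)].
pose F1 y := mz * ((ph z - ph (z - (y, 0))) * ke s e y).
pose F2 y := kp * ((mz * \1_Ball (z.1 - y) - f (z.1 - y, z.2) * \1_Ball (z.1 - y)) + D * \1_Be y).
pose F3 y := g (z.1 - y) * ke s e y.
pose F4 (y : 'rV[R]_N) := dl * ke s e y.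
have i1 : ible lam F1 by exact: (ibleZ _ iAp).
have i2 : ible lam F2 by exact: (ibleZ _ iX).
have i4 : ible lam F4 by exact: (ibleZ _ ik).
have i12 := ibleD i1 i2; have i123 := ibleD i12 ig; have i1234 := ibleD i123 i4.
rewrite [leRHS](_ : _ = \int[lam]_y (F1 y + F2 y + F3 y + F4 y)); last first.
  rewrite (intD i123 i4) (intD i12 ig) (intD i1 i2); congr (_ + _ + _ + _).
  - by rewrite /F1 intZ.
  - by rewrite /F2 intZ.
  - by rewrite /F4 intZ.
apply: int_le; [exact: iA|exact: i1234|].
rewrite /F1 /F2 /F3 /F4.
move=> {i1 i2 i4 i12 i123 i1234 iX iA iAp ig ik iB iB' EB EB' iE EE iI1 iI1' EI1'} y; set z' := z - (y, 0).
have z'2 : z'.2 = z.2 by rewrite /z' /= subr0.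
have z'E : (z.1 - y, z.2) = z' by rewrite [RHS]surjective_pairing z'2.
rewrite z'E; have kk0 := ke_ge0 (n := n) s01 e y; have gz0 := g_ge0 (z.1 - y).
have Bey : 0 <= D * \1_Be y by apply: mulr_ge0 => //; rewrite indicE.
have [hr|hr] := leP `|x0 - (z.1 - y)| rho; last first.
  have pz' : ph z' = 0.
    by apply/eqP; apply: contraTT hr => /(phi_supp r0) h; rewrite -leNgt ltW.
  have nB : \1_Ball (z.1 - y) = 0 :> R.
    rewrite indicE; case: (boolP (_ \in _)) => // /set_mem h.
    by have := lt_le_trans h rrho; rewrite ltNge (ltW hr).
  rewrite nB pz'; have fg : - g (z.1 - y) <= f z' by rewrite -[z.1 - y]/(z'.1); exact: f_ge.
  exact: (contact_far kk0 Kt0 Fz fg kp0 Bey dl0).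
have zm := zmin z' hr z'2.
have [hB|hB] := boolP (z.1 - y \in Ball); rewrite [\1_Ball _]indicE ?hB ?(negbTE hB); last first.
  exact: (contact_near kk0 zm gz0 kp0 Bey).
have fD : f z' <= D by apply: le_trans (ler_norm _) (bf.2 _).
suff alt : (kp <= ke s e y) \/ (ke s e y = 0 /\ D <= D * \1_Be y).
  exact: (contact_ball kk0 zm gz0 kp0 Bey mz0 dl0 (phi_ge0 _ _ _) (phi_le1 _ _ r0) Fz Kt0 fD alt).
have [ey|ey] := ltP e (enorm y); [left|right].
  apply: ke_ge_kap => //.
  have -> : y = (x0 - (z.1 - y)) - (x0 - z.1) by apply/rowP => i; rewrite !mxE; ring.
  apply: le_trans (ler_normB _ _) _; apply: le_trans (lerD hr z1) _.
  by rewrite /rho le_eqVlt; apply/orP; left; apply/eqP; ring.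
split; first by rewrite /ke ltNge ey !mulr0.
rewrite indicE mem_set ?mulr1//.
rewrite /Be /= sub0r normrN; apply: le_lt_trans (le_trans (norm_le_enorm y) ey) _.
by rewrite -[ltLHS]mul1r ltr_pM2r // ltr1n.
Qed.

End contact.

(** * Comparison with the time-dependent barrier *)

Section barrier_min.
Context {R : realType} {n : nat} (s : R).
Hypothesis s01 : 0 < s < 1.
Local Notation N := n.+1.
Local Notation Z := ('rV[R]_N * measurableTypeR R)%type.

Variables (f ph : Z -> R) (D L V kp cA A hm tau rho T t0 : R) (x0 : 'rV[R]_N).
Variables (I I1 : R -> R).
Hypothesis f_le : forall z, `|f z| <= D.
Hypothesis L0 : 0 <= L.
Hypothesis V0 : 0 <= V.
Hypothesis kp0 : 0 < kp.
Hypothesis cA0 : 0 <= cA.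
Hypothesis AE : cA + kp * V <= A.
Hypothesis tau0 : 0 <= tau.
Hypothesis hm0 : 0 <= hm.
Hypothesis T0 : 0 < T.
Hypothesis ph0 : forall z, 0 <= ph z.
Hypothesis ph1 : forall z, ph z <= 1.
Hypothesis ph_t : forall z e, ph (z - (0, e : measurableTypeR R)) = ph z.
Let Kset := [set z : Z | `|x0 - z.1| <= rho /\ t0 - T <= z.2 <= t0].
Hypothesis f_ge0 : forall z, Kset z -> 0 <= f z.
Hypothesis I_ge0 : forall t, 0 <= I t.
Hypothesis I_le : forall t, kp * I t <= hm.
Hypothesis I_lip : forall t, t0 - T <= t -> I t <= D * (V * (t - (t0 - T))).
Hypothesis I1_ge0 : forall t, t0 - T <= t -> t <= t0 -> 0 <= I1 t.
Hypothesis I_step : forall t e, 0 < e -> t0 - T <= t - e -> t <= t0 ->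
  I t - I (t - e) <= e * (I1 t + L * e * V).
Hypothesis contact : forall e z mz Kt dl, 0 < e -> 0 <= dl -> 0 <= mz -> 0 <= Kt -> Kset z ->
  f z - mz * ph z + Kt < 0 ->
  (forall w, Kset w -> w.2 = z.2 -> f z - mz * ph z <= f w - mz * ph w + dl) ->
  Aop s e f z <= mz * cA + kp * (mz * V - I1 z.2 + D * (2 * (2 * e)) ^+ N) +
    tau + dl * kmass (n := n) s e.
Hypothesis f_super : forall C, 0 < C -> exists2 e0, 0 < e0 & forall e z, 0 < e -> e <= e0 ->
  `|x0 - z.1| <= rho -> t0 - T < z.2 -> z.2 <= t0 -> - C <= Lop s e f z.

Let D0 : 0 <= D. Proof. exact: le_trans (f_le 0). Qed.
Let A0 : 0 <= A.
Proof. by apply: le_trans AE; rewrite addr_ge0// mulr_ge0// ltW. Qed.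

(** The solution minus the barrier, whose amplitude is [kp * I t] and which descends with slope
    [Kc]. *)
Let Fb Kc z : R := f z - kp * I z.2 * ph z + Kc * (z.2 - (t0 - T)).

Lemma barrier_final (mz i1 d' e k C Q4 D1 V1 X1 : R) :
  - (C / 4) <= X1 + D1 ->
  X1 <= mz * cA + kp * (mz * V - i1 + D * Q4) + tau + d' * k ->
  D1 <= d' / e + kp * (i1 + V1) - (A * hm + tau + C) ->
  mz * cA + kp * (mz * V) <= A * hm ->
  kp * V1 + kp * (D * Q4) <= C / 4 -> d' / e + d' * k <= C / 4 -> 0 < C -> False.
Proof.
rewrite !mulrDr !mulrN; lra.
Qed.

(** At a negative approximate minimum the spatial part of [Lop] is at most $-$[kp * I1] plus
    controlled terms, and the time part at most $+$[kp * I1] $-$ [Kc]. The terms in [I1] cancel, and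
    the slope [Kc] contradicts the supersolution inequality. Approximate minimizers avoid any
    question of attainment. *)
Lemma barrier_ge0 C z : 0 < C -> Kset z -> 0 <= Fb (A * hm + tau + C) z.
Proof.
move=> C0 Kz; rewrite leNgt; apply/negP => Fz; set Kc := _ + C in Fz.
have Kc0 : 0 <= Kc by rewrite /Kc; apply: addr_ge0 (ltW C0); exact: addr_ge0 (mulr_ge0 A0 hm0) tau0.
pose S := [set Fb Kc w | w in Kset].
have mph w : kp * I w.2 * ph w <= kp * I w.2.
  by apply: ler_piMr (ph1 w); apply: mulr_ge0 (I_ge0 _); exact: ltW.
have Kt w : Kset w -> 0 <= Kc * (w.2 - (t0 - T)).
  by move=> [_ /andP[h _]]; rewrite mulr_ge0// subr_ge0.
have lS : lbound S (- D - hm).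
  move=> _ [w Kw <-]; rewrite /Fb.
  have h1 : - D <= f w by have := f_le w; rewrite ler_norml => /andP[].
  have := mph w; have := I_le w.2; have := Kt w Kw; lra.
have iS : has_inf S by split; [exists (Fb Kc z); exists z|exists (- D - hm)].
have i0 : inf S < 0 by apply: le_lt_trans Fz; apply: ge_inf; [exact: iS.2|exists z].
pose dl := - inf S; have dl0 : 0 < dl by rewrite /dl oppr_gt0.
have C4 : 0 < C / 4 by lra.
have [e1 e10 He1] := f_super C4.
have kp0' := ltW kp0.
pose Q1 := kp * (L * V) + kp * (D * 4 ^+ N).
have p4 : 0 <= 4 ^+ N :> R by exact: exprn_ge0.
have Q10 : 0 <= Q1.
  by apply: addr_ge0; apply: mulr_ge0 => //; apply: mulr_ge0.
pose Q2 := 2 * (kp * (D * V)).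
have Q20 : 0 <= Q2 by rewrite /Q2; apply: mulr_ge0 => //; apply: mulr_ge0 => //; apply: mulr_ge0.
pose e := Num.min e1 (Num.min 1 (Num.min (C / 4 / (Q1 + 1)) (dl / (Q2 + 1)))).
have Q1p : 0 < Q1 + 1 by lra.
have Q2p : 0 < Q2 + 1 by lra.
have e0 : 0 < e by rewrite !lt_min e10 ltr01 !divr_gt0.
have ee1 : e <= e1 by rewrite ge_min lexx.
have e_1 : e <= 1 by rewrite !ge_min lexx !orbT.
have eQ1 : Q1 * e <= C / 4.
  have : e <= C / 4 / (Q1 + 1) by rewrite !ge_min lexx !orbT.
  rewrite ler_pdivlMr// => h; move: h; rewrite mulrDr mulr1 [Q1 * e]mulrC; lra.
have eQ2 : Q2 * e < dl.
  have : e <= dl / (Q2 + 1) by rewrite !ge_min lexx !orbT.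
  rewrite ler_pdivlMr// => h; move: h; rewrite mulrDr mulr1 [Q2 * e]mulrC; lra.
(* The defect of the approximate minimum is divided by $e$ in the time difference and multiplied by
   the mass of the cut kernel in space, so it is chosen after $e$ and small against both. *)
pose km := e^-1 + kmass (n := n) s e.
have km0 : 0 < km by rewrite ltr_pwDl ?invr_gt0// kmass_ge0.
pose d' := Num.min (dl / 2) (C / 4 / km).
have d'0 : 0 < d' by rewrite lt_min !divr_gt0.
have d'1 : d' <= dl / 2 by rewrite ge_min lexx.
have d'2 : d' * km <= C / 4 by rewrite -ler_pdivlMr// ge_min lexx orbT.
have [_ [w Kw <-] Hw] := inf_adherent d'0 iS.
have wmin v : Kset v -> Fb Kc w <= Fb Kc v + d'.
  move=> Kv; apply: (le_trans (ltW Hw)); rewrite lerD2r; apply: ge_inf; first exact: iS.2.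
  by exists v.
have Fw : Fb Kc w < - dl / 2 by move: Hw d'1; rewrite /dl; lra.
have Fw0 : Fb Kc w < 0 by lra.
have [w1 /andP[w2 w3]] := Kw.
have fw : 0 <= f w by exact: f_ge0.
have Ktw := Kt w Kw.
have mw0 : 0 <= kp * I w.2 by exact: mulr_ge0 kp0' (I_ge0 _).
(* Near the initial time the amplitude is too small for such a negative value; hence the point one
   step $e$ earlier is still admissible. *)
have we : t0 - T + e < w.2.
  rewrite ltNge; apply/negP => h.
  have h1 : kp * I w.2 <= kp * (D * (V * e)).
    rewrite ler_pM2l//; apply: le_trans (I_lip w2) _.
    by rewrite ler_wpM2l// ler_wpM2l//; lra.
  have h3 : 2 * (kp * (D * (V * e))) = Q2 * e by rewrite /Q2; ring.
  have := mph w; move: Fw; rewrite /Fb; lra.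
have wE : - (C / 4) <= Lop s e f w by apply: He1 => //; lra.
have zmin v : Kset v -> v.2 = w.2 ->
    f w - kp * I w.2 * ph w <= f v - kp * I w.2 * ph v + d'.
  by move=> Kv vw; have := wmin v Kv; rewrite /Fb vw; lra.
have HA := contact e0 (ltW d'0) mw0 Ktw Kw Fw0 zmin.
pose we' := w - (0, e : measurableTypeR R).
have we1 : we'.1 = w.1 by rewrite /we' /= subr0.
have we2 : we'.2 = w.2 - e by [].
have Kwe : Kset we' by split; rewrite ?we1// we2; apply/andP; split; lra.
have HF := wmin _ Kwe.
have pe : ph we' = ph w by exact: ph_t.
have st : I w.2 - I (w.2 - e) <= e * (I1 w.2 + L * e * V) by apply: I_step => //; lra.
have I10 : 0 <= I1 w.2 by exact: I1_ge0.
have LeV : 0 <= L * e * V by apply: mulr_ge0 => //; apply: mulr_ge0 => //; exact: ltW.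
have HD : Dop e f w <= d' / e + kp * (I1 w.2 + L * e * V) - Kc.
  rewrite /Dop ler_pdivrMr// -/we'.
  have -> : (d' / e + kp * (I1 w.2 + L * e * V) - Kc) * e =
     d' + kp * (e * (I1 w.2 + L * e * V)) - Kc * e by field; rewrite gt_eqF.
  have h2 : kp * I w.2 - kp * I (w.2 - e) <= kp * (e * (I1 w.2 + L * e * V)).
    by rewrite -mulrBr ler_pM2l.
  have h1 := le_trans (ler_wpM2r (ph0 w) h2) (ler_piMr (mulr_ge0 kp0' (mulr_ge0 (ltW e0) (addr_ge0 I10 LeV))) (ph1 w)).
  move: HF; rewrite /Fb pe we2; move: h1; rewrite mulrBl; lra.
have e4 : (2 * (2 * e)) ^+ N <= 4 ^+ N * e.
  rewrite mulrA (_ : 2 * 2 = 4 :> R); last by ring.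
  by rewrite exprMn ler_wpM2l// -[leRHS]expr1 ler_wiXn2l// ltW.
have h1 : kp * I w.2 * cA + kp * (kp * I w.2 * V) <= A * hm.
  have -> : kp * I w.2 * cA + kp * (kp * I w.2 * V) = (cA + kp * V) * (kp * I w.2) by ring.
  by apply: ler_pM => //; apply: addr_ge0 => //; exact: mulr_ge0.
have h2 : kp * (L * e * V) + kp * (D * (2 * (2 * e)) ^+ N) <= C / 4.
  apply: le_trans eQ1; have := ler_wpM2l kp0' (ler_wpM2l D0 e4); rewrite /Q1.
  have -> : (kp * (L * V) + kp * (D * 4 ^+ N)) * e = kp * (L * e * V) + kp * (D * (4 ^+ N * e)) by ring.
  lra.
have h4 : d' / e + d' * kmass (n := n) s e <= C / 4 by rewrite -mulrDr.
rewrite /Lop in wE; exact: (barrier_final wE HA HD h1 h2 h4 C0).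
Qed.

Lemma barrier_lower z : A * T <= 1 / 4 -> (forall t, t0 - T / 2 <= t -> kp * I t = hm) ->
  `|x0 - z.1| <= rho -> 3 / 4 <= ph z ->
  t0 - T / 2 <= z.2 -> z.2 <= t0 -> hm / 2 - tau * T <= f z.
Proof.
move=> AT hI z1 p34 h2 h3; apply/ler_addgt0Pr => C C0.
have CT : 0 < C / T by rewrite divr_gt0.
have hT := T0.
have Kz : Kset z by split => //; apply/andP; split; lra.
have := barrier_ge0 CT Kz; rewrite /Fb hI//.
have q1 : hm * (3 / 4) <= hm * ph z by rewrite ler_wpM2l.
have Kc0 : 0 <= A * hm + tau + C / T.
  by apply: addr_ge0 (ltW CT); exact: addr_ge0 (mulr_ge0 A0 hm0) tau0.
have q2 : (A * hm + tau + C / T) * (z.2 - (t0 - T)) <= (A * hm + tau + C / T) * T.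
  by rewrite ler_wpM2l//; lra.
have q3 : (A * hm + tau + C / T) * T = A * T * hm + tau * T + C by field; rewrite gt_eqF.
have q4 : A * T * hm <= 1 / 4 * hm by rewrite ler_wpM2r.
lra.
Qed.

End barrier_min.

(** * Weak Harnack inequality for Lipschitz supersolutions *)

Section harnack.
Context {R : realType} {n : nat} (s : R).
Hypothesis s01 : 0 < s < 1.
Local Notation N := n.+1.
Local Notation lam := (@lebesgue_rV R N).
Local Notation mu := (@leb_rVT R N).
Local Notation Z := ('rV[R]_N * measurableTypeR R)%type.
Local Notation c := (@fconst R n s).

Variables (f : Z -> R) (D L : R).
Hypothesis bf : bmeas f D.
Hypothesis L0 : 0 <= L.
Hypothesis fL : forall z v, `|f (z + v) - f z| <= L * nrm v.
Variables (g : 'rV[R]_N -> R) (Dg : R).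
Hypothesis mg : measurable_fun setT g.
Hypothesis g_ge0 : forall x, 0 <= g x.
Hypothesis g_le : forall x, g x <= Dg.
Variables (x0 : 'rV[R]_N) (t0 r T tau : R).
Hypothesis r0 : 0 < r.
Hypothesis T0 : 0 < T.
Let rho : R := 2 * N%:R * r.
Let A : R := c * (kC (n := n) s + 1) / r `^ (2 * s).
Hypothesis T_le : A * T <= 1 / 4.
Hypothesis f_ge : forall z, t0 - T <= z.2 -> z.2 <= t0 -> - g z.1 <= f z.
Hypothesis g0 : forall x, `|x0 - x| <= rho -> g x = 0.
Hypothesis g_tail : forall e x, 0 < e -> `|x0 - x| <= rho ->
  \int[lam]_y (g (x - y) * ke s e y) <= tau.
Hypothesis f_super : forall C, 0 < C -> exists2 e0, 0 < e0 & forall e z, 0 < e -> e <= e0 ->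
  `|x0 - z.1| <= rho -> t0 - T < z.2 -> z.2 <= t0 -> - C <= Lop s e f z.

Let c0 : 0 < c. Proof. exact: fconst_gt0. Qed.
Let D0 : 0 <= D. Proof. exact: le_trans (bf.2 0). Qed.
Let k0 : 0 < kap (n := n) s r. Proof. exact: kap_gt0. Qed.
Let rrho : r <= rho.
Proof.
have n1 : 1 <= N%:R :> R by rewrite ler1n.
have h1 := r0; rewrite -[leLHS]mul1r ler_wpM2r//; [exact: ltW|lra].
Qed.

Let tm := t0 - T / 2.
Let Ball := [set x : 'rV[R]_N | `|x0 - x| < r].
(** The mass collected up to time $t$, frozen from the middle time [tm] on, so that the barrier has
    constant amplitude on the second half. *)
Let I t := \int[mu]_w (f w * \1_(cyl x0 r (t0 - T) (Num.min t tm)) w).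
Let I1 t := \int[lam]_y (f (y, t : measurableTypeR R) * \1_Ball y).
(** The final amplitude of the barrier: not an average, but the integral over the first half of the
    cylinder times the lower bound of the kernel. *)
Definition hmean := kap (n := n) s r * \int[mu]_w (f w * \1_(cyl x0 r (t0 - T) tm) w).

Let f_ge0 z : t0 - T <= z.2 -> z.2 <= t0 -> `|x0 - z.1| <= rho -> 0 <= f z.
Proof. by move=> h1 h2 h3; have := f_ge h1 h2; rewrite g0// oppr0. Qed.

Let cyl_le t : cyl x0 r (t0 - T) (Num.min t tm) `<=` cyl x0 r (t0 - T) tm.
Proof. by move=> z [h1]; rewrite lt_min => /and3P[h2 _ h3]; split => //; apply/andP. Qed.

Let mcyl (t1 t2 : R) : measurable (cyl x0 r t1 t2).
Proof.
have [h|h] := leP t1 t2; first exact: (cyl_measure x0 r0 h).1.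
rewrite (_ : cyl _ _ _ _ = set0)//; apply/seteqP; split => // z [_ /andP[h1 h2]].
by have := lt_trans h1 h2; rewrite ltNge (ltW h).
Qed.

Let icyl t : ible mu (\1_(cyl x0 r (t0 - T) (Num.min t tm)) : Z -> R).
Proof.
have h := T0.
have [i _] := @cyl_ible R n x0 r (t0 - T) tm r0 ltac:(rewrite /tm; lra).
apply: (ible_le _ _ i); first by apply: measurable_indic; exact: mcyl.
move=> w; rewrite ger0_norm ?indic_ge0// !indicE ler_nat.
by case: (boolP (_ \in cyl _ _ _ (Num.min _ _))) => // /set_mem /cyl_le h1; rewrite mem_set.
Qed.

Let iI t : ible mu (fun w => f w * \1_(cyl x0 r (t0 - T) (Num.min t tm)) w).
Proof. exact: ibleM bf.1 bf.2 (icyl t). Qed.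

Let f_cyl w : cyl x0 r (t0 - T) tm w -> 0 <= f w.
Proof.
move=> [h1 /andP[h2 h3]]; have := T0; move: h3; rewrite /tm => h3 h4.
by apply: f_ge0; [lra|lra|exact: le_trans (ltW h1) rrho].
Qed.

Let I_ge0 t : 0 <= I t.
Proof.
apply: int_ge0 => w; rewrite indicE.
case: (boolP (w \in _)) => [/set_mem/cyl_le h|]; last by rewrite mulr0.
by rewrite mulr1 f_cyl.
Qed.

Let tmE : Num.min t0 tm = tm.
Proof. by apply/min_idPr; rewrite /tm; have := T0; lra. Qed.

Let I_le t : I t <= I t0.
Proof.
apply: int_le; [exact: iI|exact: iI|] => w; rewrite !indicE tmE.
case: (boolP (w \in cyl _ _ _ (Num.min _ _))) => [/set_mem/cyl_le h|_]; first by rewrite mem_set.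
case: (boolP (w \in _)) => [/set_mem h|]; last by rewrite !mulr0.
by rewrite mulr0 mulr1 f_cyl.
Qed.

Let I_lip t : t0 - T <= t -> I t <= D * ((2 * r) ^+ N * (t - (t0 - T))).
Proof.
move=> h; have [i E] := @cyl_ible R n x0 r (t0 - T) t r0 h.
rewrite -E -intZ//; apply: int_le; [exact: iI|exact: ibleZ|] => w.
apply: le_trans (ler_norm _) _; rewrite normrM (ger0_norm (indic_ge0 _ _)).
apply: ler_pM; rewrite ?indic_ge0//; first exact: bf.2.
rewrite !indicE ler_nat; case: (boolP (w \in cyl _ _ _ (Num.min _ _))) => // /set_mem[h1].
by rewrite lt_min => /and3P[h2 h3 _]; rewrite mem_set//; split => //; apply/andP.
Qed.

Let I1_ible t := slice_ible bf x0 r0 t.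

Let I_step t e : 0 < e -> t0 - T <= t - e -> t <= t0 ->
  I t - I (t - e) <= e * (I1 t + L * e * (2 * r) ^+ N).
Proof.
move=> e0 h1 h2.
pose S := `[t - e, t[%classic : set R.
have mS : measurable (S : set (measurableTypeR R)) by exact: measurable_itv.
have lS : (@lebesgue_measure R S = e%:E)%E.
  rewrite /S (lebesgue_measure_itv `[t - e, t[) /= lte_fin ltrBlDr ltrDl e0 -EFinD.
  by congr EFin; ring.
have iS : ible (@lebesgue_measure R) (\1_S : measurableTypeR R -> R) /\
    \int[@lebesgue_measure R]_x (\1_S x : R) = e.
  have mi : measurable_fun setT (\1_S : measurableTypeR R -> R) by exact: measurable_indic.
  have E : (\int[@lebesgue_measure R]_z (\1_S z)%:E)%E = e%:E by rewrite integral_indic// setIT.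
  have i : ible (@lebesgue_measure R) (\1_S : measurableTypeR R -> R).
    by apply: (ible_ge0 mi) (ltry e) => [z|]; rewrite ?E// indicE.
  by split => //; apply: EFin_inj; rewrite -ible_fin.
pose a y := (f (y, t : measurableTypeR R) + L * e) * \1_Ball y.
have [iB EB] := ball_int x0 r0.
have ia : ible lam a.
  apply: ible_cvt (ibleD (I1_ible t) (ibleZ (L * e) iB)) => y.
  by rewrite /a mulrDl.
have m1 : measurable_fun setT (fun p : 'rV[R]_N * measurableTypeR R => 1 : R) by [].
have b1 (x : 'rV[R]_N) (y : measurableTypeR R) : `|1 : R| <= 1 by rewrite normr1.
have iP := ible_prod ia iS.1 m1 b1; have EP := int_prod ia iS.1 m1 b1.
rewrite -intB//.
have -> : e * (I1 t + L * e * (2 * r) ^+ N) =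
    \int[lam]_y (a y * \int[@lebesgue_measure R]_x (1 * (\1_S x : R))).
  rewrite (eq_int _ (g := fun y => e * a y)); last first.
    by move=> y; rewrite mulrC; congr (_ * _); rewrite -[RHS]iS.2; apply: eq_int => x; rewrite mul1r.
  rewrite intZ//; congr (_ * _); rewrite -EB -intZ// -intD//; last exact: ibleZ.
  by apply: eq_int => y; rewrite /a mulrDl.
rewrite -EP; apply: int_le; [exact: ibleB|exact: iP|].
move=> w; clear b1 m1 EP iP; rewrite mul1r -mulrBr.
have nz : 0 <= a w.1.
  rewrite /a indicE; case: (boolP (w.1 \in Ball)) => [/set_mem h|]; last by rewrite mulr0.
  rewrite mulr1 addr_ge0 ?mulr_ge0 ?(ltW e0)//; apply: f_ge0 => //=; first lra.
  exact: le_trans (ltW h) rrho.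
have [h|h] := boolP (w \in cyl x0 r (t0 - T) (Num.min t tm)); last first.
  rewrite [\1_(cyl _ _ _ (Num.min t tm)) w]indicE (negbTE h) sub0r mulrN.
  apply: (@le_trans _ _ 0); last by rewrite mulr_ge0// indicE.
  rewrite oppr_le0 indicE; case: (boolP (w \in _)) => [/set_mem/cyl_le h'|]; last by rewrite mulr0.
  by rewrite mulr1 f_cyl.
have /set_mem[q1] := h; rewrite lt_min => /and3P[q2 q3 q4].
rewrite indicE h indicE; case: (boolP (w \in cyl _ _ _ (Num.min (t - e) tm))) => h'.
  by rewrite subrr mulr0 mulr_ge0// indicE.
have wt : t - e <= w.2.
  rewrite leNgt; apply/negP => h3; move/negP: h'; apply; apply: mem_set; split => //.
  by rewrite lt_min q2 h3.
rewrite subr0 mulr1 /a !indicE mem_set// mem_set ?mulr1; last first.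
  by rewrite /S/= in_itv/= wt.
have := fL (w.1, t : measurableTypeR R) (0, (w.2 : R) - t : measurableTypeR R).
rewrite (_ : (w.1, t) + _ = w); last first.
  by case: (w) => x y /=; congr pair; rewrite /= ?addr0// addrC subrK.
rewrite ler_norml => /andP[_ h4].
have nv : nrm ((0, w.2 - t) : Z) <= e.
  by rewrite /nrm /= normr0 add0r ler_norml; apply/andP; split; lra.
have := ler_wpM2l L0 nv; lra.
Qed.


Let I1_ge0 t : t0 - T <= t -> t <= t0 -> 0 <= I1 t.
Proof.
move=> h1 h2; apply: int_ge0 => y; rewrite indicE.
case: (boolP (_ \in _)) => [/set_mem h|]; last by rewrite mulr0.
by rewrite mulr1; apply: f_ge0 => //=; exact: le_trans (ltW h) rrho.
Qed.

Let tau_ge0 : 0 <= tau.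
Proof.
apply: le_trans (g_tail (e := 1) (x := x0) ltr01 _); last first.
  by rewrite subrr normr0 (le_trans (ltW r0) rrho).
by apply: int_ge0 => y; rewrite mulr_ge0// ke_ge0.
Qed.

Lemma harnack_step z : `|x0 - z.1| <= r -> t0 - T / 2 <= z.2 -> z.2 <= t0 ->
  hmean / 2 - tau * T <= f z.
Proof.
move=> h1 h2 h3.
have I_le' t : kap (n := n) s r * I t <= hmean.
  by rewrite /hmean ler_pM2l// (le_trans (I_le t))// /I tmE.
have h0 : 0 <= hmean := le_trans (mulr_ge0 (ltW k0) (I_ge0 0)) (I_le' 0).
have V0 : 0 <= (2 * r) ^+ N by rewrite exprn_ge0// mulr_ge0// ltW.
have cA0 : 0 <= c * kC (n := n) s / r `^ (2 * s).
  by rewrite divr_ge0 ?powR_ge0// mulr_ge0 ?(ltW c0)// ltW// kC_gt0.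
have AE : c * kC (n := n) s / r `^ (2 * s) + kap (n := n) s r * (2 * r) ^+ N <= A.
  have -> : A = c * kC (n := n) s / r `^ (2 * s) + c / r `^ (2 * s) by rewrite /A; ring.
  by rewrite lerD2l; exact: kap_le.
apply: (@barrier_lower R n s s01 f (phi x0 r) D L ((2 * r) ^+ N) (kap (n := n) s r)
  (c * kC (n := n) s / r `^ (2 * s)) A hmean tau rho T t0 x0 I I1 bf.2 L0 V0 k0 cA0 AE
  tau_ge0 h0 T0 (phi_ge0 x0 r) _ _ _ I_ge0 I_le' I_lip I1_ge0 I_step _ f_super z T_le _ _ _ h2 h3).
- by move=> w; exact: phi_le1.
- by move=> w e; rewrite /phi /= subr0.
- by move=> w [w1 /andP[w2 w3]]; exact: f_ge0.
- move=> e w mz Kt dl e0 dl0 mz0 Kt0 [w1 /andP[w2 w3]] Fw wm.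
  apply: (Aop_contact s01 bf mg g_ge0 g_le r0 g_tail e0 dl0 mz0 Kt0 w1 _ _ Fw).
  + exact: f_ge0.
  + by move=> v vw; apply: f_ge; rewrite vw.
  + by move=> v v1 v2; apply: wm => //; split => //; rewrite v2 w2.
- move=> t ht; rewrite /hmean /I; congr (_ * _).
  by apply: eq_int => w; rewrite (min_idPr ht).
- exact: le_trans h1 rrho.
- exact: phi_ge34.
Qed.

End harnack.

(** * Weak Harnack inequality for $k-|u-b|^2$ *)

Section harnack_ae.
Context {R : realType} {n : nat} (s : R).
Hypothesis s01 : 0 < s < 1.
Local Notation N := n.+1.
Local Notation lam := (@lebesgue_rV R N).
Local Notation mu := (@leb_rVT R N).
Local Notation Z := ('rV[R]_N * measurableTypeR R)%type.
Local Notation c := (@fconst R n s).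
Implicit Types (f : Z -> R) (z w v : Z) (x y : 'rV[R]_N) (e C D eps : R).

Lemma conv_lip f D eps eta deta C : bmeas f D -> moll eps eta deta C ->
  exists2 L, 0 <= L & forall z v, `|conv f eta (z + v) - conv f eta z| <= L * nrm v.
Proof.
move=> bf H; have ie := moll_ible H; have be := moll_bmeas H.
have e0 := moll_gt0 H; have [C0 _ lp _] := moll_lip2 H.
have D0 : 0 <= D by apply: le_trans (bf.2 0).
have [iS ES] := @moll_2cyl R n eps e0.
set S := cyl _ _ _ _ in iS ES.
pose V := \int[mu]_z (\1_S z : R).
have V0 : 0 <= V by apply: int_ge0 => z; exact: indic_ge0.
exists (D * (2 * C * V)); first by rewrite !mulr_ge0.
move=> z v; rewrite !(conv_comm _ bf ie).
have i1 := ibleM bf.1 bf.2 (ible_refl (z + v) ie).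
have i2 := ibleM bf.1 bf.2 (ible_refl z ie).
have iS1 := ible_refl (z + v) iS; have iS2 := ible_refl z iS.
rewrite -intB//.
have -> : D * (2 * C * V) * nrm v = \int[mu]_w (D * C * nrm v * (\1_S (z + v - w) + \1_S (z - w))).
  rewrite intZ; last exact: ibleD.
  rewrite intD// (int_refl (z + v) iS) (int_refl z iS) -/V; ring.
apply: int_bound; [exact: ibleB|by apply: ibleZ; exact: ibleD|].
move=> w; rewrite -mulrBr normrM -!mulrA; apply: ler_pM => //; first exact: bf.2.
have Sin w' : eta w' != 0 -> \1_S w' = 1 :> R.
  move=> /(moll_supp H)[h1 /andP[h2 h3]]; rewrite indicE mem_set//.
  by split; [rewrite sub0r normrN|apply/andP; split]; lra.
have s1 := indic_ge0 (R := R) S (z + v - w); have s2 := indic_ge0 (R := R) S (z - w).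
have [h1|h1] := eqVneq (eta (z + v - w)) 0.
  have [h2|h2] := eqVneq (eta (z - w)) 0.
    by rewrite h1 h2 subrr normr0 !mulr_ge0 ?nrm_ge0// addr_ge0.
  have := lp (z - w) v; rewrite addrAC => /le_trans; apply; rewrite ler_wpM2l//.
  by rewrite (Sin _ h2) ler_peMr ?nrm_ge0// lerDr.
have := lp (z - w) v; rewrite addrAC => /le_trans; apply; rewrite ler_wpM2l//.
by rewrite (Sin _ h1) ler_peMr ?nrm_ge0// lerDl.
Qed.

Lemma Lop_cst_sub e f D (k : R) z : 0 < e -> bmeas f D ->
  Lop s e (fun w => k - f w) z = - Lop s e f z.
Proof.
move=> e0 bf; rewrite /Lop opprD; congr (_ + _); last by rewrite /Dop; ring.
rewrite /Aop -[RHS]mulN1r -[RHS]intZ; last exact: (Aop_ible s01 z e0 bf).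
by apply: eq_int => y; ring.
Qed.

Variables (m : nat) (u : 'I_m -> Z -> R) (M : R) (B : Z -> R).
Hypothesis W : wsol s u M B.
Let bu := wsol_bmeas W.
Variables (b : 'I_m -> R) (k : R) (x0 : 'rV[R]_N) (t0 t1 r T tau Dg : R) (G : R -> R).
Hypothesis k0 : 0 < k.
Hypothesis uk : forall w, \sum_i u i w ^+ 2 <= k^-1.
Hypothesis r0 : 0 < r.
Hypothesis T0 : 0 < T.
Let rho : R := 2 * N%:R * r.
Hypothesis T_le : c * (kC (n := n) s + 1) / r `^ (2 * s) * T <= 1 / 4.
Hypothesis t1_gt : -1 < t1.
Hypothesis t1_lt : t1 < t0 - T.
Hypothesis t0_le : t0 <= 1.
Hypothesis mG : measurable_fun setT G.
Hypothesis G_ge0 : forall q, 0 <= G q.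
Hypothesis G_le : forall q, G q <= Dg.
Hypothesis G_mono : {homo G : p q / p <= q}.
Hypothesis G0 : forall q, q <= 2 * rho -> G q = 0.
Hypothesis iG : ible lam (fun y => G (4 * `|y|) * (c * fkernel s y)).
Hypothesis G_tail : \int[lam]_y (G (4 * `|y|) * (c * fkernel s y)) <= tau.
Let h w := \sum_i (u i w - b i) ^+ 2.
Hypothesis h_le : {ae mu, forall w, t1 < w.2 -> w.2 < t0 -> h w <= k + G `|x0 - w.1|}.

Let Dh := \sum_i (M + `|b i|) ^+ 2.
Let bh : bmeas h Dh.
Proof. by apply: bmeas_sum => i; exact: sqr_bmeas. Qed.
Let rho0 : 0 < rho. Proof. by rewrite /rho !mulr_gt0// ltr0n. Qed.

(** The mollification of $k-h$ is Lipschitz and, by [conv_Linf_subsol], a supersolution up to the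
    truncation error, so [harnack_step] applies to it. *)
Lemma harnack_moll eps eta deta C z : moll eps eta deta C -> eps < t0 - T - t1 ->
  eps <= rho / 2 -> `|x0 - z.1| <= r -> t0 - T / 2 <= z.2 -> z.2 <= t0 ->
  hmean s (fun z => k - conv h eta z) x0 t0 r T / 2 - tau * T <= k - conv h eta z.
Proof.
move=> H et er; have e0 := moll_gt0 H; have ie := moll_ible H; have be := moll_bmeas H.
have Dh0 : 0 <= Dh by apply: le_trans (bh.2 0).
have bc := moll_conv_bmeas H bh.
have bf : bmeas (fun z => k - conv h eta z) (k + Dh).
  split; first by apply: measurable_funB => //; exact: bc.1.
  by move=> w; apply: le_trans (ler_normB _ _) _; rewrite ger0_norm ?(ltW k0)// lerD2l bc.2.
have [L L0 lip] := conv_lip bh H.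
have fL z' v : `|k - conv h eta (z' + v) - (k - conv h eta z')| <= L * nrm v.
  rewrite (_ : _ - _ = - (conv h eta (z' + v) - conv h eta z')); last by ring.
  by rewrite normrN.
(* Mollifying at scale $\varepsilon$ enlarges distances by at most $\varepsilon$; [G] is
   nondecreasing. *)
pose g x := G (`|x0 - x| + eps).
have mg : measurable_fun setT g.
  apply: (measurableT_comp (f := G)) => //; apply: measurable_funD => //.
  apply: (measurableT_comp (f := fun x : 'rV[R]_N => `|x|)); first exact: measurable_norm_rV.
  exact: measurable_rV_add.
apply: (@harnack_step R n s s01 _ _ _ bf L0 fL g Dg mg _ _ x0 t0 r T tau r0 T0 T_le).
- by move=> x; exact: G_ge0.
- by move=> x; exact: G_le.
- move=> w w1 w2; rewrite /g -subr_ge0 opprK addrAC subr_ge0.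
  apply: (conv_le_ae H bh); apply: filterS h_le => v hv ev.
  have [/= v1 /andP[v2 v3]] := moll_supp H ev.
  apply: le_trans (hv _ _) _; [lra|lra|rewrite lerD2l; apply: G_mono].
  have -> : x0 - v.1 = (x0 - w.1) + (w.1 - v.1) by apply/rowP => i; rewrite !mxE; ring.
  by apply: le_trans (ler_normD _ _) _; rewrite lerD2l ltW.
- by move=> x hx; rewrite /g G0//; move: hx; rewrite -/rho; have := rho0; lra.
- move=> e x e'0 hx; apply: le_trans G_tail; rewrite -/rho in hx.
  apply: int_le => //.
    apply: (@ibleM _ _ _ _ Dg); last exact: ke_ible.
      by apply: (measurableT_comp (f := g)) => //; exact: measurable_rV_add.
    by move=> y; rewrite /g ger0_norm.
  move=> y; have c0 := @fconst_gt0 R n s s01.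
  apply: ler_pM => //; [exact: G_ge0|exact: ke_ge0| |].
    have tri : `|x0 - (x - y)| <= rho + `|y|.
      have -> : x0 - (x - y) = (x0 - x) + y by apply/rowP => i; rewrite !mxE; ring.
      by apply: le_trans (ler_normD _ _) _; rewrite lerD2r.
    (* If $|y|<\rho/2$ the argument of [G] is at most $2\rho$, where [G] vanishes; otherwise
       $\rho+|y|+\varepsilon\le4|y|$. This is the origin of the factor $4$ in the tail. *)
    rewrite /g; have [hy|hy] := ltP `|y| (rho / 2).
      rewrite G0 ?G_ge0//; lra.
    apply: G_mono; lra.
  rewrite /ke ler_pM2l// -[leRHS]mulr1 ler_wpM2l ?fkernel_ge0//.
  by case: (e < enorm y).
move=> C' C'0; have [e1 e10 He1] := Lop_Linf_L1 s01 e0 H (divr_gt0 C'0 (ltr_wpDl Dh0 ltr01)).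
exists e1 => // e w e'0 ee w1 w2 w3; rewrite -/rho in w1.
rewrite (Lop_cst_sub _ _ e'0 bc) lerN2 (Lop_conv s01 _ e'0 bh be ie).
have il := Linf_ible s01 e0 H; have iL := Lop_mu_ible s01 e'0 be ie.
have rr : 0 < 2 * rho by rewrite mulr_gt0.
have t10 : t1 < t0 by have := t1_lt; have := T0; lra.
have ub : {ae mu, forall w, cyl x0 (2 * rho) t1 t0 w -> \sum_i (u i w - b i) ^+ 2 <= k}.
  apply: filterS h_le => v hv [v1 /andP[v2 v3]].
  by apply: le_trans (hv v2 v3) _; rewrite G0 ?addr0// ltW.
have ul : {ae mu, forall w, cyl x0 (2 * rho) t1 t0 w -> \sum_i u i w ^+ 2 <= k^-1}.
  by apply: aeW => v _; exact: uk.
have g1 := rho0; have g2 := t1_lt.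
have S := @conv_Linf_subsol R n s s01 m u M B W x0 (2 * rho) t1 t0 k b rr t1_gt t10 t0_le k0 ub ul
  eps C eta deta w H ltac:(lra) ltac:(lra) w3.
have : `|conv h (Lop s e eta) w - conv h (Linf s eta deta) w| <= C'.
  rewrite -(convBr _ bh)//; apply: le_trans (conv_bound _ bh (ibleB iL il)) _.
  apply: (@le_trans _ _ ((Dh + 1) * (C' / (Dh + 1)))); last first.
    by rewrite mulrC divfK// gt_eqF// ltr_wpDl.
  apply: ler_pM => //; [exact: int_ge0|lra|exact: He1].
rewrite ler_norml -/h in S * => /andP[_]; lra.
Qed.

(** The estimates for mollifications pass to the limit in $L^1$ of the two half cylinders. *)
Lemma harnack_ae : {ae mu, forall z, cyl x0 r (t0 - T / 2) t0 z ->
  hmean s (fun z => k - h z) x0 t0 r T / 2 - tau * T <= k - h z}.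
Proof.
have hT := T0.
have [iC EC] := @cyl_ible R n x0 r (t0 - T / 2) t0 r0 ltac:(lra).
have [iQ EQ] := @cyl_ible R n x0 r (t0 - T) (t0 - T / 2) r0 ltac:(lra).
set Cc := cyl x0 r (t0 - T / 2) t0 in iC EC *.
set Q := cyl x0 r (t0 - T) (t0 - T / 2) in iQ EQ.
set X := _ - tau * T.
have kp0 : 0 < kap (n := n) s r by exact: kap_gt0.
pose VC := (2 * r) ^+ N * (t0 - (t0 - T / 2)).
have VC0 : 0 <= VC by rewrite /VC -EC; apply: int_ge0 => z; exact: indic_ge0.
have bcf f D : bmeas f D -> bmeas (fun z => k - f z) (k + D).
  move=> bf; split; first by apply: measurable_funB => //; exact: bf.1.
  by move=> w; apply: le_trans (ler_normB _ _) _; rewrite ger0_norm ?(ltW k0)// lerD2l bf.2.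
(* Positive part of the deficit; its integral is shown to be below every positive number. *)
pose ps z := Num.max 0 (X - (k - h z)) * \1_Cc z.
have mps : measurable_fun setT (fun z => Num.max 0 (X - (k - h z))).
  by apply: measurable_maxr => //; apply: measurable_funB => //; exact: (bcf _ _ bh).1.
have bps z : `|Num.max 0 (X - (k - h z))| <= `|X| + (k + Dh).
  rewrite ger0_norm ?le_max ?lexx// ge_max addr_ge0//=; last first.
    by apply: le_trans (normr_ge0 _) ((bcf _ _ bh).2 z).
  apply: le_trans (ler_norm _) _; apply: le_trans (ler_normB _ _) _.
  by rewrite lerD2l; exact: (bcf _ _ bh).2.
have ips : ible mu ps by exact: ibleM mps bps iC.
have ps0 z : 0 <= ps z by rewrite mulr_ge0 ?indic_ge0// le_max lexx.
have key : \int[mu]_z ps z = 0.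
  apply/eqP; rewrite eq_le int_ge0// andbT; apply/ler_addgt0Pr => C C0; rewrite add0r.
  have iP := ibleD iC iQ.
  pose K := kap (n := n) s r * VC / 2 + 1.
  have K0 : 0 < K.
    by rewrite /K ltr_wpDl// divr_ge0// mulr_ge0// ltW.
  have [d d0 Hd] := conv_cvg_weight bh iP (divr_gt0 C0 K0).
  have rh := rho0; have tt := t1_lt.
  pose eps := Num.min d (Num.min (rho / 2) ((t0 - T - t1) / 2)).
  have eps0 : 0 < eps by rewrite !lt_min d0; apply/andP; split; lra.
  have e1 : eps <= d by rewrite ge_min lexx.
  have e2 : eps <= rho / 2 by rewrite !ge_min lexx !orbT.
  have e3 : eps < t0 - T - t1.
    have : eps <= (t0 - T - t1) / 2 by rewrite !ge_min lexx !orbT.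
    lra.
  have [eta [deta [C' H]]] := @moll_exists R n eps eps0.
  have {}Hd := Hd _ _ _ _ H e1.
  have bc := moll_conv_bmeas H bh.
  have bd := absdiff_bmeas bc bh.
  have id1 := ibleM bd.1 bd.2 iC; have id2 := ibleM bd.1 bd.2 iQ.
  have Ed : \int[mu]_w (`|conv h eta w - h w| * `|\1_Cc w + \1_Q w|) =
      \int[mu]_w (`|conv h eta w - h w| * \1_Cc w) + \int[mu]_w (`|conv h eta w - h w| * \1_Q w).
    rewrite -intD//; apply: eq_int => w; by rewrite (ger0_norm (addr_ge0 (indic_ge0 _ _) (indic_ge0 _ _))) mulrDr.
  rewrite Ed in Hd.
  have J1 : 0 <= \int[mu]_w (`|conv h eta w - h w| * \1_Cc w).
    by apply: int_ge0 => w; rewrite mulr_ge0// indic_ge0.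
  have J2 : 0 <= \int[mu]_w (`|conv h eta w - h w| * \1_Q w).
    by apply: int_ge0 => w; rewrite mulr_ge0// indic_ge0.
  set I1 := \int[mu]_w (_ * \1_Cc w) in Hd J1; set I2 := \int[mu]_w (_ * \1_Q w) in Hd J2.
  have hmE : hmean s (fun z => k - h z) x0 t0 r T <=
      hmean s (fun z => k - conv h eta z) x0 t0 r T + kap (n := n) s r * I2.
    rewrite /hmean -mulrDr ler_pM2l// /I2 -intD//; last first.
      by exact: ibleM (bcf _ _ bc).1 (bcf _ _ bc).2 iQ.
    apply: int_le.
    - exact: ibleM (bcf _ _ bh).1 (bcf _ _ bh).2 iQ.
    - by apply: ibleD => //; exact: ibleM (bcf _ _ bc).1 (bcf _ _ bc).2 iQ.
    move=> w; rewrite -mulrDl ler_wpM2r ?indic_ge0//.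
    have := ler_norm (conv h eta w - h w); lra.
  apply: (@le_trans _ _ (kap (n := n) s r * I2 / 2 * VC + I1)).
    rewrite /VC -EC /I1 -intZ// -intD//; last exact: ibleZ.
    apply: int_le => //; first by apply: ibleD => //; exact: ibleZ.
    move=> w; rewrite /ps -mulrDl.
    have [wC|wC] := boolP (w \in Cc); last by rewrite indicE (negbTE wC) !mulr0.
    rewrite ler_wpM2r ?indic_ge0// ge_max; apply/andP; split.
      by rewrite addr_ge0// divr_ge0// mulr_ge0// ltW.
    have [w1 /andP[w2 w3]] := set_mem wC.
    have := harnack_moll H e3 e2 (ltW w1) (ltW w2) (ltW w3).
    have := ler_norm (h w - conv h eta w); rewrite distrC /X; lra.
  apply: (@le_trans _ _ (K * (I1 + I2))); last by rewrite mulrC -ler_pdivlMr.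
  have q1 : 0 <= kap (n := n) s r * VC / 2 * I1 by rewrite mulr_ge0// divr_ge0// mulr_ge0// ltW.
  have q2 : kap (n := n) s r * I2 / 2 * VC = kap (n := n) s r * VC / 2 * I2 by ring.
  by rewrite q2 /K mulrDl mul1r mulrDr; lra.
apply: filterS (int_gt0_ex ips ps0 key) => z Hz Cz.
move: Hz; rewrite /ps indicE mem_set// mulr1 => /eqP.
rewrite eq_le ge_max lexx/= => /andP[h1 _]; lra.
Qed.

End harnack_ae.

(** * Combinatorial and algebraic ingredients *)

Section pure.
Context {R : realType}.

Lemma powR_small (p : R) e : 0 < p -> 0 < e ->
  exists2 l, 0 < l & l <= e /\ l `^ p <= e.
Proof.
move=> p0 e0; have h0 : 0 < e `^ p^-1 by exact: powR_gt0.
exists (Num.min e (e `^ p^-1)); first by rewrite lt_min e0.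
split; first by rewrite ge_min lexx.
apply: (@le_trans _ _ ((e `^ p^-1) `^ p)).
  by apply: ge0_ler_powR; rewrite ?nnegrE ?(ltW p0)// ?le_min ?ge_min ?(ltW e0) ?(ltW h0) ?lexx ?orbT.
by rewrite -powRrM mulVf ?gt_eqF// powRr1// ltW.
Qed.

Lemma powRV2 (l p : R) : 0 <= l -> l^-1 `^ p = (l `^ p)^-1.
Proof. by move=> l0; rewrite -powR_inv1// -powRrM mulN1r powRN. Qed.

(** The sum of the levels is a potential: it starts at [#|Bt| * n0] and drops by one at each scale
    where some level can be lowered. Levels are stored as [(nb b).+1], so lowering a stored level
    $1$ yields the first alternative. *)
Lemma descent (Bt : finType) (P : nat -> Bt -> nat -> Prop) n0 :
  (forall j b k, P j b k -> P j.+1 b k) -> (forall b, P 0%N b n0.+1) ->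
  exists2 j, (j <= #|Bt| * n0)%N &
  (exists b, P j.+1 b 0%N) \/
  exists nb : Bt -> nat, forall b, [/\ (nb b <= n0)%N, P j b (nb b).+1 & ~ P j.+1 b (nb b)].
Proof.
move=> mono P0.
have key : forall S j (nb : Bt -> nat), (\sum_b nb b <= S)%N ->
    (forall b, (nb b <= n0)%N /\ P j b (nb b).+1) ->
  exists2 j', (j' <= j + S)%N & (exists b, P j'.+1 b 0%N) \/
  exists nb : Bt -> nat, forall b, [/\ (nb b <= n0)%N, P j' b (nb b).+1 & ~ P j'.+1 b (nb b)].
  elim => [|S IH] j nb hS hP.
    have [[b Pb]|H] := pselect (exists b, P j.+1 b (nb b)).
      exists j; rewrite ?addn0//; left; exists b.
      move: hS; rewrite leqn0 sum_nat_eq0 => /forallP/(_ b)/= /eqP h0.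
      by rewrite -h0.
    exists j; rewrite ?addn0//; right; exists nb => b; have [h1 h2] := hP b; split => // Pb.
    by apply: H; exists b.
  have [[b Pb]|H] := pselect (exists b, P j.+1 b (nb b)); last first.
    exists j; rewrite ?leq_addr//; right; exists nb => b; have [h1 h2] := hP b; split => // Pb.
    by apply: H; exists b.
  case E : (nb b) => [|k].
    by exists j; rewrite ?leq_addr//; left; exists b; rewrite -E.
  pose nb' b' := if b' == b then k else nb b'.
  have [||j' hj' Hj'] := IH j.+1 nb'.
  - rewrite -ltnS; apply: leq_trans hS.
    rewrite [X in (X < _)%N](bigD1 b)//= [X in (_ < X)%N](bigD1 b)//= /nb' eqxx E addSn ltnS leq_add2l.
    by apply: leq_sum => b' /negbTE ->.
  - move=> b'; have [h1 h2] := hP b'; rewrite /nb'; case: eqP => [bb|_].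
      by rewrite -E bb; split => //; move: h1; rewrite bb E; exact: ltnW.
    by split => //; exact: mono.
  by exists j' => //; rewrite -addSnnS.
have [||j hj Hj] := key (#|Bt| * n0)%N 0%N (fun=> n0) => //.
  by rewrite sum_nat_const.
by exists j.
Qed.

(* [|Q - b|^2 - |P - b|^2] is affine in [b], so its bound at the points
   [+- k' d e_i] extends to their convex hull, which contains [(k' / m) P]. *)
Lemma osc_alg m (P Q : 'I_m.+1 -> R) (d k' sg : R) : 0 <= d -> 0 <= k' ->
  (forall i, \sum_j (Q j - k' * d * (j == i)%:R) ^+ 2 <=
     \sum_j (P j - k' * d * (j == i)%:R) ^+ 2 + sg) ->
  (forall i, \sum_j (Q j + k' * d * (j == i)%:R) ^+ 2 <=
     \sum_j (P j + k' * d * (j == i)%:R) ^+ 2 + sg) ->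
  \sum_j P j ^+ 2 <= d ^+ 2 ->
  \sum_j (Q j - k' / m.+1%:R * P j) ^+ 2 <= (1 - k' / m.+1%:R) ^+ 2 * \sum_j P j ^+ 2 + sg.
Proof.
move=> d0 k0 H1 H2 Pd; set k := k' / m.+1%:R.
have kk0 : 0 <= k by rewrite divr_ge0.
have ex (F : 'I_m.+1 -> R) e i : \sum_j (F j + e * (j == i)%:R) ^+ 2 = \sum_j F j ^+ 2 + 2 * e * F i + e ^+ 2.
  rewrite (eq_bigr (fun j => F j ^+ 2 + (if j == i then 2 * e * F j + e ^+ 2 else 0))); last first.
    by move=> j _; case: eqP => _ /=; [rewrite mulr1|rewrite mulr0]; ring.
  by rewrite big_split/= -big_mkcond/= big_pred1_eq addrA.
pose A := \sum_j Q j ^+ 2 - \sum_j P j ^+ 2.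
(* The two hypotheses for $\pm e_i$ together give an absolute value; averaging over $i$ afterwards
   produces the factor $k'/(m+1)$. *)
have hA i : A + 2 * (k' * d) * `|Q i - P i| <= sg.
  have e1 := H1 i; have e2 := H2 i.
  rewrite !(ex _ _ i) in e2.
  have ex' (F : 'I_m.+1 -> R) : \sum_j (F j - k' * d * (j == i)%:R) ^+ 2 =
      \sum_j F j ^+ 2 + 2 * (- (k' * d)) * F i + (- (k' * d)) ^+ 2.
    by rewrite -ex; apply: eq_bigr => j _; rewrite mulNr.
  rewrite !ex' in e1.
  case: (ger0P (Q i - P i)) => _; rewrite /A; lra.
have E : \sum_j (Q j - k * P j) ^+ 2 = A - \sum_j 2 * k * (P j * (Q j - P j)) + (1 - k) ^+ 2 * \sum_j P j ^+ 2.
  rewrite /A mulr_sumr -!sumrB -big_split/=; apply: eq_bigr => j _; ring.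
rewrite E addrC lerD2l.
have Pj j : `|P j| <= d.
  rewrite -(@ler_pXn2r _ 2)// ?nnegrE// real_normK ?num_real//.
  by apply: le_trans Pd; rewrite (bigD1 j)//= lerDl sumr_ge0// => i _; exact: sqr_ge0.
have mean : A = \sum_(j < m.+1) (A / m.+1%:R).
  by rewrite sumr_const card_ord -[RHS]mulr_natr divfK// pnatr_eq0.
rewrite [in leLHS]mean -sumrB.
have -> : sg = \sum_(j < m.+1) (sg / m.+1%:R).
  by rewrite sumr_const card_ord -[RHS]mulr_natr divfK// pnatr_eq0.
apply: ler_sum => j _.
apply: (@le_trans _ _ ((A + 2 * (k' * d) * `|Q j - P j|) / m.+1%:R)); last first.
  by rewrite ler_wpM2r ?invr_ge0//; exact: hA.
rewrite [leRHS]mulrDl lerD2l.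
have -> : 2 * (k' * d) * `|Q j - P j| / m.+1%:R = 2 * k * (d * `|Q j - P j|) by rewrite /k; ring.
rewrite -mulrN ler_wpM2l ?mulr_ge0//.
apply: le_trans (ler_norm _) _; rewrite normrN normrM ler_wpM2r//.
Qed.

End pure.

(** * Parabolic cylinders and scale-invariant constants *)

Section oscillation.
Context {R : realType} {n : nat} (s : R).
Hypothesis s01 : 0 < s < 1.
Local Notation N := n.+1.
Local Notation lam := (@lebesgue_rV R N).
Local Notation mu := (@leb_rVT R N).
Local Notation Z := ('rV[R]_N * measurableTypeR R)%type.
Local Notation c := (@fconst R n s).
Implicit Types (f : Z -> R) (z w v : Z) (x y : 'rV[R]_N) (e C D eps : R).

(** Chosen so that the time span $T=2\theta r^{2s}$ satisfies the condition $AT\le1/4$ of the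
    Harnack inequality with equality; [pcyl] is the second half of that span. *)
Definition theta : R := (8 * (c * (kC (n := n) s + 1)))^-1.

Definition pcyl x (t0 r : R) : set Z := cyl x r (t0 - theta * r `^ (2 * s)) t0.

Let c0 : 0 < c. Proof. exact: fconst_gt0. Qed.
Let kC1 : 0 < kC (n := n) s + 1.
Proof. by rewrite addr_gt0//; exact: kC_gt0. Qed.

Lemma theta_gt0 : 0 < theta.
Proof. by rewrite invr_gt0 !mulr_gt0. Qed.

Let s2 : 0 < 2 * s. Proof. by have /andP[h _] := s01; rewrite mulr_gt0. Qed.

Lemma pcyl_sub x t0 r r' : 0 <= r' -> r' <= r -> pcyl x t0 r' `<=` pcyl x t0 r.
Proof.
move=> r0 rr z [h1 /andP[h2 h3]]; split; first exact: lt_le_trans rr.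
rewrite h3 andbT; apply: le_lt_trans h2; rewrite lerD2l lerN2.
rewrite ler_pM2l ?theta_gt0//; apply: ge0_ler_powR; rewrite ?nnegrE ?(ltW s2)//.
exact: le_trans rr.
Qed.

Lemma theta_le r : 0 < r ->
  c * (kC (n := n) s + 1) / r `^ (2 * s) * (2 * theta * r `^ (2 * s)) <= 1 / 4.
Proof.
move=> r0; have p0 : 0 < r `^ (2 * s) by exact: powR_gt0.
rewrite le_eqVlt; apply/orP; left; apply/eqP; rewrite /theta.
by field; rewrite !gt_eqF.
Qed.

(** The value of [hmean] on the constant $1$, which does not depend on the scale
    ([kap_osc_mass]). *)
Definition osc_mass : R :=
  c * theta * 2 ^+ N / ((4 * (N%:R * N%:R)) ^+ N * (4 * (N%:R * N%:R)) `^ (2 * s)).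

Lemma osc_mass_gt0 : 0 < osc_mass.
Proof.
have n0 : 0 < 4 * (N%:R * N%:R) :> R by rewrite !mulr_gt0// ltr0n.
by rewrite divr_gt0// ?mulr_gt0 ?theta_gt0 ?exprn_gt0 ?powR_gt0.
Qed.

Lemma kap_osc_mass r : 0 < r ->
  kap (n := n) s r * ((2 * r) ^+ N * (theta * r `^ (2 * s))) = osc_mass.
Proof.
move=> r0; have n0 : 0 < 4 * (N%:R * N%:R) :> R by rewrite !mulr_gt0// ltr0n.
have p0 : 0 < r `^ (2 * s) by exact: powR_gt0.
rewrite /kap /osc_mass.
have -> : N%:R * (4 * N%:R * r) = 4 * (N%:R * N%:R) * r :> R by ring.
set q := 4 * (N%:R * N%:R) in n0 *.
rewrite !exprMn powRM ?(ltW n0) ?(ltW r0)//.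
by field; rewrite !gt_eqF ?exprn_gt0 ?powR_gt0.
Qed.

Lemma tail_step r : 0 < r ->
  ible lam (fun y => (r <= 4 * `|y|)%R%:R * (c * fkernel s y)) /\
  \int[lam]_y ((r <= 4 * `|y|)%R%:R * (c * fkernel s y)) <=
    c * kC (n := n) s * 4 `^ (2 * s) / r `^ (2 * s).
Proof.
move=> r0; have r4 : 0 < r / 4 by rewrite divr_gt0.
have [i I] := @kJ_int R n s s01 _ r4.
have le y : `|(r <= 4 * `|y|)%R%:R * (c * fkernel s y)| <= c * kJ s (r / 4) y.
  rewrite ger0_norm ?mulr_ge0 ?fkernel_ge0 ?(ltW c0)//.
  rewrite mulrCA ler_pM2l// /kJ ler_wpM2r ?fkernel_ge0//.
  have [h|h] := leP r (4 * `|y|); last by rewrite le_min ler01 divr_ge0 ?sqr_ge0.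
  rewrite le_min lexx ler_pdivlMr ?exprn_gt0// mul1r lerXn2r ?nnegrE ?(ltW r4)//.
  by rewrite ler_pdivrMr// mulrC.
have m : measurable_fun setT (fun y : 'rV[R]_N => (r <= 4 * `|y|)%R%:R * (c * fkernel s y)).
  apply: measurable_funM; last by apply: measurable_funM => //; exact: measurable_fkernel.
  rewrite (_ : (fun y => _) = \1_[set y : 'rV[R]_N | r <= 4 * `|y|]).
    apply: measurable_indic.
    rewrite (_ : mkset _ = (fun y : 'rV[R]_N => 4 * `|y|) @^-1` `[r, +oo[%classic).
      rewrite -[X in measurable X]setTI; apply: (measurable_funM _ measurable_norm_rV) => //.
    by apply/seteqP; split => y /=; rewrite in_itv/= andbT.
  apply/funext => y; rewrite indicE; congr (nat_of_bool _)%:R.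
  by apply/idP/idP; [move/mem_set|move/set_mem].
have ii := ible_le m le (ibleZ c i); split => //.
apply: le_trans (int_le ii (ibleZ c i) (fun y => le_trans (ler_norm _) (le y))) _.
rewrite intZ// -!mulrA ler_pM2l//; apply: le_trans I _.
rewrite ler_pM2l ?kC_gt0// powRM ?invr_ge0 ?(ltW r0)// invfM powRV2//.
by rewrite invrK mulrC.
Qed.

(** If the sum exceeded [sg] almost everywhere on the cylinder, its integral would contradict the
    bounds on the single integrals. *)
Lemma osc_point (Bt : finType) (F : Bt -> Z -> R) (D : Bt -> R) (kp sg X : R) x r (t1 t2 : R)
    (Good : Z -> Prop) : 0 < r -> t1 < t2 -> 0 < kp ->
  (forall p, bmeas (F p) (D p)) -> {ae mu, forall z, Good z} ->
  (forall p, kp * \int[mu]_w (F p w * \1_(cyl x r t1 t2) w) <= X) ->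
  #|Bt|%:R * X < kp * ((2 * r) ^+ N * (t2 - t1)) * sg ->
  exists z, [/\ cyl x r t1 t2 z, Good z & \sum_p F p z <= sg].
Proof.
move=> r0 t12 kp0 bF good FX lt; apply: contrapT => H.
have [iC EC] := @cyl_ible R n x r t1 t2 r0 (ltW t12).
have iF p := ibleM (bF p).1 (bF p).2 iC.
have : kp * \int[mu]_w (sg * \1_(cyl x r t1 t2) w) <= \sum_(p : Bt) X.
  apply: (@le_trans _ _ (kp * \int[mu]_w (\sum_p F p w * \1_(cyl x r t1 t2) w))); last first.
    by rewrite int_sum// mulr_sumr; apply: ler_sum => p _; exact: FX.
  rewrite ler_pM2l//; apply: int_le_ae; [exact: ibleZ|exact: ible_sum|].
  apply: filterS good => z gz; rewrite -mulr_suml.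
  have [zC|zC] := boolP (z \in cyl x r t1 t2); last by rewrite indicE (negbTE zC) !mulr0.
  rewrite ler_wpM2r ?indic_ge0// leNgt; apply/negP => h; apply: H; exists z.
  by split => //; [exact: set_mem|exact: ltW].
have -> : kp * \int[mu]_w (sg * \1_(cyl x r t1 t2) w) = kp * ((2 * r) ^+ N * (t2 - t1)) * sg.
  by rewrite intZ// EC; ring.
by rewrite sumr_const -[X *+ _]mulr_natl leNgt lt.
Qed.

End oscillation.

(** * Tails and the Harnack inequality at one scale *)

Section oscillation_step.
Context {R : realType} {n : nat} (s : R).
Hypothesis s01 : 0 < s < 1.
Local Notation N := n.+1.
Local Notation lam := (@lebesgue_rV R N).
Local Notation mu := (@leb_rVT R N).
Local Notation Z := ('rV[R]_N * measurableTypeR R)%type.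
Local Notation c := (@fconst R n s).
Local Notation theta := (@theta R n s).
Local Notation pcyl := (@pcyl R n s).
Implicit Types (f : Z -> R) (z w v : Z) (x y : 'rV[R]_N) (e C D eps : R).

(** Admissible growth beyond the radius [rj], with tail normalized by $r_j^{2s}$, so that
    multiplication by the duration of a cylinder gives a scale-free quantity. *)
Definition radial_tail (G : R -> R) (Dg rj X : R) :=
  [/\ measurable_fun setT G, forall q, 0 <= G q <= Dg, {homo G : p q / p <= q},
      forall q, q < rj -> G q = 0 &
      ible lam (fun y => G (4 * `|y|) * (c * fkernel s y)) /\
      \int[lam]_y (G (4 * `|y|) * (c * fkernel s y)) <= X / rj `^ (2 * s)].

Lemma radial_tailD G Dg rj X H Dh rj' X' (a b r : R) : 0 <= a -> 0 <= b -> 0 < r ->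
  r <= rj -> r <= rj' -> 0 <= X -> 0 <= X' ->
  radial_tail G Dg rj X -> radial_tail H Dh rj' X' ->
  radial_tail (fun q => a * G q + b * H q) (a * Dg + b * Dh) r (a * X + b * X').
Proof.
move=> a0 b0 r0 rr rr' X0 X'0 [mG bG oG zG [iG IG]] [mH bH oH zH [iH IH]].
have s2 : 0 <= 2 * s by have /andP[h _] := s01; rewrite mulr_ge0// ltW.
have pw q q' Y : 0 < q -> q <= q' -> 0 <= Y -> Y / q' `^ (2 * s) <= Y / q `^ (2 * s).
  move=> q0 qq Y0; have q'0 : 0 < q' by exact: lt_le_trans qq.
  rewrite ler_wpM2l// lef_pV2 ?posrE ?powR_gt0//.
  by apply: ge0_ler_powR; rewrite ?nnegrE ?(ltW q0) ?(ltW q'0).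
split.
- by apply: measurable_funD; apply: measurable_funM.
- move=> q; have /andP[g1 g2] := bG q; have /andP[h1 h2] := bH q.
  by rewrite addr_ge0 ?mulr_ge0//= lerD// ler_wpM2l.
- by move=> p q pq; rewrite lerD// ler_wpM2l//; [exact: oG|exact: oH].
- by move=> q qr; rewrite zG ?zH ?mulr0 ?addr0//; exact: lt_le_trans qr _.
- have E y : (a * G (4 * `|y|) + b * H (4 * `|y|)) * (c * fkernel s y) =
    a * (G (4 * `|y|) * (c * fkernel s y)) + b * (H (4 * `|y|) * (c * fkernel s y)) by ring.
  split; first by apply: ible_cvt (ibleD (ibleZ a iG) (ibleZ b iH)) => y; rewrite /= E.
  under eq_int do rewrite E.
  rewrite (intD (ibleZ a iG) (ibleZ b iH)) (intZ a iG) (intZ b iH) mulrDl -!mulrA.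
  apply: lerD; rewrite ler_wpM2l//.
    by apply: le_trans IG _; exact: pw.
  by apply: le_trans IH _; exact: pw.
Qed.

Lemma radial_tail_step r : 0 < r ->
  radial_tail (fun q => (r <= q)%R%:R) 1 r (c * kC (n := n) s * 4 `^ (2 * s)).
Proof.
move=> r0; split.
- rewrite (_ : (fun q => _) = \1_[set q : R | r <= q]).
    apply: measurable_indic; rewrite (_ : mkset _ = `[r, +oo[%classic) ?measurable_itv//.
    by apply/seteqP; split => y /=; rewrite in_itv/= andbT.
  apply/funext => y; rewrite indicE; congr (nat_of_bool _)%:R.
  by apply/idP/idP; [move/mem_set|move/set_mem].
- by move=> q; case: (r <= q); rewrite ?lexx ?ler01.
- move=> p q pq; rewrite ler_nat; case: (leP r p) => // rp.
  by rewrite (le_trans rp pq).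
- by move=> q; rewrite ltNge => /negbTE ->.
- exact: tail_step.
Qed.

Variables (m : nat) (u : 'I_m.+1 -> Z -> R) (M : R) (B : Z -> R).
Hypothesis W : wsol s u M B.
Let bu := wsol_bmeas W.

(** The contrapositive of the Harnack inequality: if the bound cannot be lowered by [e0] on the next
    scale, then $k-|u-b|^2$ has little mass on the early cylinder. The tail costs $T$ times
    $X/r_j^{2s}$, hence the factor $\lambda^{2s}$ with $\lambda$ the ratio [la]. *)
Lemma osc_harnack (b : 'I_m.+1 -> R) (k : R) x0 (t0 rj la Dg X e0 : R) G :
  0 < k -> (forall w, \sum_i u i w ^+ 2 <= k^-1) -> 0 < rj -> 0 < la ->
  4 * N%:R * la < 1 -> 2 * la `^ (2 * s) < 1 ->
  -1 < t0 - theta * rj `^ (2 * s) -> t0 <= 1 ->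
  radial_tail G Dg rj X ->
  {ae mu, forall w, t0 - theta * rj `^ (2 * s) < w.2 -> w.2 < t0 ->
    \sum_i (u i w - b i) ^+ 2 <= k + G `|x0 - w.1|} ->
  ~ {ae mu, forall w, pcyl x0 t0 (la * rj) w -> \sum_i (u i w - b i) ^+ 2 <= k - e0} ->
  hmean s (fun w => k - \sum_i (u i w - b i) ^+ 2) x0 t0 (la * rj)
    (2 * theta * (la * rj) `^ (2 * s)) <= 2 * (e0 + X * (2 * theta) * la `^ (2 * s)).
Proof.
move=> k0 uk rj0 la0 laN la2 t1 t01 [mG bG oG zG [iG IG]] hle stop.
set hm := hmean _ _ _ _ _ _.
have th0 := theta_gt0 (n := n) s01.
have r0 : 0 < la * rj by rewrite mulr_gt0.
set r := la * rj in r0 hm stop *.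
have p0 : 0 < r `^ (2 * s) by exact: powR_gt0.
have q0 : 0 < rj `^ (2 * s) by exact: powR_gt0.
have rE : r `^ (2 * s) = la `^ (2 * s) * rj `^ (2 * s) by rewrite powRM ?ltW.
have T0 : 0 < 2 * theta * r `^ (2 * s) by rewrite !mulr_gt0.
have t1T : t0 - theta * rj `^ (2 * s) < t0 - 2 * theta * r `^ (2 * s).
  rewrite ltrD2l ltrN2 rE -[2 * theta * _]mulrA mulrCA ltr_pM2l// mulrA.
  by rewrite gtr_pMl.
have G0 q : q <= 2 * (2 * N%:R * r) -> G q = 0.
  move=> hq; apply: zG; apply: le_lt_trans hq _.
  rewrite (_ : 2 * _ = 4 * N%:R * la * rj); last by rewrite /r; ring.
  by rewrite -[ltRHS]mul1r ltr_pM2r.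
have G_ge0 q : 0 <= G q by have /andP[] := bG q.
have G_le q : G q <= Dg by have /andP[] := bG q.
have := @harnack_ae R n s s01 m.+1 u M B W b k x0 t0 (t0 - theta * rj `^ (2 * s)) r
  (2 * theta * r `^ (2 * s)) (X / rj `^ (2 * s)) Dg G k0 uk r0 T0 (theta_le s01 r0) t1 t1T t01
  mG G_ge0 G_le oG G0 iG IG hle.
rewrite -/hm => H; rewrite leNgt; apply/negP => lt; apply: stop.
apply: filterS H => w Hw Cw.
have {}Hw : hm / 2 - X / rj `^ (2 * s) * (2 * theta * r `^ (2 * s)) <= k - \sum_i (u i w - b i) ^+ 2.
  apply: Hw; move: Cw; rewrite /pcyl (_ : 2 * theta * _ / 2 = theta * r `^ (2 * s)) //.
  by field.
have E : X / rj `^ (2 * s) * (2 * theta * r `^ (2 * s)) = X * (2 * theta) * la `^ (2 * s).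
  by rewrite rE; field; rewrite gt_eqF.
rewrite E in Hw; lra.
Qed.

End oscillation_step.

(** * Decay of oscillation in one step *)

Section oscillation_lemma.
Context {R : realType} {n : nat} (s : R).
Hypothesis s01 : 0 < s < 1.
Local Notation N := n.+1.
Local Notation lam := (@lebesgue_rV R N).
Local Notation mu := (@leb_rVT R N).
Local Notation Z := ('rV[R]_N * measurableTypeR R)%type.
Local Notation c := (@fconst R n s).
Local Notation theta := (@theta R n s).
Local Notation pcyl := (@pcyl R n s).
Implicit Types (f : Z -> R) (z w v : Z) (x y : 'rV[R]_N) (e C D eps : R).

Let s2 : 0 < 2 * s. Proof. by have /andP[h _] := s01; rewrite mulr_gt0. Qed.

Variables (m : nat) (u : 'I_m.+1 -> Z -> R) (M : R) (B : Z -> R).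
Hypothesis W : wsol s u M B.
Let bu := wsol_bmeas W.
Hypothesis M0 : 0 < M.
Hypothesis M1 : M < 1.
Hypothesis uM : forall w, \sum_i u i w ^+ 2 <= M ^+ 2.

(** The displacement of the centres relative to $d$. Since $(1+k')M\le1$ and $d\le M<1$, the product
    of the bounds of $|u-b|$ and $|u|$ stays below $1$; this is where the strict bound on $u$
    enters. *)
Let k' : R := Num.min 1 (M^-1 - 1).
Let k'0 : 0 < k'.
Proof. by rewrite lt_min ltr01 subr_gt0 invf_gt1. Qed.
Let k'1 : k' <= 1. Proof. by rewrite ge_min lexx. Qed.
Let k'M : (1 + k') * M <= 1.
Proof.
rewrite -ler_pdivlMr// mul1r -lerBrDl ge_min; apply/orP; right; exact: lexx.
Qed.
Let ka := k' / m.+1%:R.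
Let ka0 : 0 < ka. Proof. by rewrite divr_gt0. Qed.
Let ka1 : ka <= 1.
Proof. by rewrite ler_pdivrMr// mul1r (le_trans k'1)// ler1n. Qed.

Let sgn (p : 'I_m.+1 * bool) : R := if p.2 then 1 else -1.
Let bb (cc : 'I_m.+1 -> R) (d : R) (p : 'I_m.+1 * bool) i : R := cc i + sgn p * (k' * d) * (i == p.1)%:R.

Let shift_sq (F : 'I_m.+1 -> R) cc d p :
  \sum_i (F i - bb cc d p i) ^+ 2 = \sum_i (F i - cc i) ^+ 2
    - 2 * (sgn p * (k' * d)) * (F p.1 - cc p.1) + (k' * d) ^+ 2.
Proof.
rewrite (eq_bigr (fun i => (F i - cc i) ^+ 2 +
   (if i == p.1 then - (2 * (sgn p * (k' * d)) * (F i - cc i)) + (k' * d) ^+ 2 else 0))); last first.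
  move=> i _; rewrite /bb /sgn; case: eqP => _; rewrite ?mulr1 ?mulr0.
    by case: p.2; ring.
  by ring.
by rewrite big_split/= -big_mkcond/= big_pred1_eq addrA.
Qed.

Let coord_le (F : 'I_m.+1 -> R) d i : 0 <= d -> \sum_j F j ^+ 2 <= d ^+ 2 -> `|F i| <= d.
Proof.
move=> d0 Fd; rewrite -(@ler_pXn2r _ 2)// ?nnegrE// real_normK ?num_real//.
by apply: le_trans Fd; rewrite (bigD1 i)//= lerDl sumr_ge0// => j _; exact: sqr_ge0.
Qed.

Let shift_le (F : 'I_m.+1 -> R) cc d p : 0 <= d -> \sum_i (F i - cc i) ^+ 2 <= d ^+ 2 ->
  \sum_i (F i - bb cc d p i) ^+ 2 <= (1 + k') ^+ 2 * d ^+ 2.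
Proof.
move=> d0 Fd; rewrite shift_sq.
have := @coord_le (fun i => F i - cc i) d p.1 d0 Fd; rewrite ler_norml => /andP[h1 h2].
have kd : 0 <= k' * d by rewrite mulr_ge0// ltW.
have h3 : - (2 * (sgn p * (k' * d)) * (F p.1 - cc p.1)) <= 2 * (k' * d) * d.
  have q1 := ler_wpM2l kd h1; have q2 := ler_wpM2l kd h2.
  rewrite /sgn; case: p.2; lra.
have -> : (1 + k') ^+ 2 * d ^+ 2 = d ^+ 2 + 2 * (k' * d) * d + (k' * d) ^+ 2 by ring.
lra.
Qed.

Let shift_le2 (F : 'I_m.+1 -> R) cc d p X : 0 <= d -> \sum_i (F i - cc i) ^+ 2 <= X ->
  \sum_i (F i - bb cc d p i) ^+ 2 <= 2 * X + 2 * d ^+ 2.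
Proof.
move=> d0 Fd; rewrite shift_sq; set Y := F p.1 - cc p.1.
have Y2 : Y ^+ 2 <= X.
  by apply: le_trans Fd; rewrite (bigD1 p.1)//= lerDl sumr_ge0// => j _; exact: sqr_ge0.
have kd : (k' * d) ^+ 2 <= d ^+ 2.
  rewrite exprMn ler_piMl ?sqr_ge0//; rewrite expr_le1//; exact: ltW.
have : - (2 * (sgn p * (k' * d)) * Y) <= Y ^+ 2 + (k' * d) ^+ 2.
  rewrite /sgn; case: p.2; rewrite -subr_ge0.
    by rewrite (_ : _ - _ = (Y + k' * d) ^+ 2) ?sqr_ge0//; ring.
  by rewrite (_ : _ - _ = (Y - k' * d) ^+ 2) ?sqr_ge0//; ring.
lra.
Qed.

Local Notation Bt := ('I_m.+1 * bool)%type.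
Let nB : R := #|{: Bt}|%:R.
Let nB0 : 0 < nB.
Proof. by rewrite ltr0n; apply/card_gt0P; exists (ord0, true). Qed.

(* The levels of the functions [|u - b|^2], [b = cc +- k' d e_i], are lowered
   by steps of [a d^2] as the scale decreases, until none can be lowered on the
   next scale; there the Harnack inequality yields a point where all of them
   are almost attained. *)
Lemma oscillation Ct : 0 <= Ct -> exists q dl, [/\ 2^-1 <= q < 1, 0 < dl <= 1 &
  forall x0 t0 rh d cc G Dg, 0 < rh -> 0 < d <= M ->
    -1 < t0 - theta * rh `^ (2 * s) -> t0 <= 1 ->
    radial_tail s (n := n) G Dg rh (Ct * d ^+ 2) ->
    {ae mu, forall w, t0 - theta * rh `^ (2 * s) < w.2 -> w.2 < t0 ->
      \sum_i (u i w - cc i) ^+ 2 <= d ^+ 2 + G `|x0 - w.1|} ->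
    exists c', {ae mu, forall w, pcyl x0 t0 (dl * rh) w ->
      \sum_i (u i w - c' i) ^+ 2 <= (q * d) ^+ 2}].
Proof.
move=> Ct0.
have c0 := @fconst_gt0 R n s s01.
have th0 := theta_gt0 (n := n) s01.
pose Th := osc_mass (n := n) s; have Th0 : 0 < Th by exact: osc_mass_gt0.
pose L0 := (1 + k') ^+ 2.
have L00 : 0 < L0 by rewrite exprn_gt0// addr_gt0.
pose a' := ka / 4; have a'0 : 0 < a' by rewrite divr_gt0.
(* The number of levels is taken so large that the step [a] is small against the gain [Th * a']. *)
have [n0 hn0] : exists n0 : nat, 8 * nB * L0 / (Th * a') < n0.+1%:R.
  have h : 0 <= 8 * nB * L0 / (Th * a').
    by apply/ltW; rewrite divr_gt0 ?mulr_gt0// addr_gt0.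
  exists (Num.bound (8 * nB * L0 / (Th * a'))).
  by apply: lt_trans (archi_boundP h) _; rewrite ltr_nat.
pose a := L0 / n0.+1%:R; have a0 : 0 < a by rewrite divr_gt0.
have aTh : 8 * nB * a < Th * a'.
  rewrite /a mulrA ltr_pdivrMr//; move: hn0; rewrite ltr_pdivrMr ?mulr_gt0//.
  by rewrite [n0.+1%:R * _]mulrC.
pose X1 := 4 * (c * kC (n := n) s * 4 `^ (2 * s)) + 2 * Ct.
have X10 : 0 <= X1 by rewrite addr_ge0 ?mulr_ge0 ?powR_ge0 ?(ltW c0)// ltW// kC_gt0.
(* The first bound lets the Harnack cylinder at ratio [la] fit into the current one, the second
   makes the tail small against [Th * a']. *)
pose ee := Num.min (1 / (8 * N%:R)) (Th * a' / (8 * nB * (X1 * (2 * theta) + 1))).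
have X1p : 0 < X1 * (2 * theta) + 1 by rewrite ltr_wpDl// mulr_ge0// mulr_ge0// ltW.
have ee0 : 0 < ee by rewrite lt_min !divr_gt0 ?mulr_gt0// ltr0n.
have [la la0 [la1 la2]] := powR_small s2 ee0.
have N1 : 1 <= N%:R :> R by rewrite ler1n.
have e8 : ee * (8 * N%:R) <= 1.
  by rewrite -ler_pdivlMr ?ge_min ?lexx// mulr_gt0// ltr0n.
have laN : 4 * N%:R * la < 1.
  have : la * (8 * N%:R) <= 1 by apply: le_trans e8; rewrite ler_wpM2r// mulr_ge0.
  have : 0 < la * N%:R by rewrite mulr_gt0// ltr0n.
  have -> : la * (8 * N%:R) = 2 * (4 * N%:R * la) by ring.
  have -> : 4 * N%:R * la = 4 * (la * N%:R) by ring.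
  lra.
have ee8 : ee <= 1 / 8.
  rewrite ler_pdivlMr//; apply: le_trans e8; rewrite ler_pM2l//; lra.
have la22 : 2 * la `^ (2 * s) < 1 by lra.
have la_1 : la <= 1 by lra.
have laT : 8 * nB * (X1 * (2 * theta) * la `^ (2 * s)) <= Th * a'.
  have h : la `^ (2 * s) <= Th * a' / (8 * nB * (X1 * (2 * theta) + 1)).
    by apply: le_trans la2 _; rewrite ge_min lexx orbT.
  move: h; rewrite ler_pdivlMr ?mulr_gt0// => h.
  have p0 : 0 <= 8 * nB * la `^ (2 * s) by rewrite !mulr_ge0 ?powR_ge0 ?(ltW nB0).
  apply: le_trans h.
  have -> : 8 * nB * (X1 * (2 * theta) * la `^ (2 * s)) = 8 * nB * la `^ (2 * s) * (X1 * (2 * theta)) by ring.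
  have -> : la `^ (2 * s) * (8 * nB * (X1 * (2 * theta) + 1)) = 8 * nB * la `^ (2 * s) * (X1 * (2 * theta) + 1) by ring.
  by rewrite ler_wpM2l// lerDl.
(* The contraction factor comes from $(1-\kappa)^2+\kappa/4\le(1-\kappa/2)^2$ for $0\le\kappa\le1$.
   The exponent counts the scales that [descent] may use, plus the one on which no level can be
   lowered. *)
exists (1 - ka / 2), (la ^+ (#|{: Bt}| * n0).+1); split.
- by apply/andP; split; have := ka1; have := ka0; lra.
- by rewrite exprn_gt0// exprn_ile1// ltW.
move=> x0 t0 rh d cc G Dg rh0 /andP[d0 dM] t1 t01 tG hle.
have d20 : 0 < d ^+ 2 by rewrite exprn_gt0.
pose rj j := la ^+ j * rh.
have rj0 j : 0 < rj j by rewrite mulr_gt0// exprn_gt0.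
have rjS j : rj j.+1 = la * rj j by rewrite /rj exprS mulrA.
have rj_le i j : (i <= j)%N -> rj j <= rj i.
  by move=> ij; rewrite /rj ler_pM2r// ler_wiXn2l// ltW.
have rj_rh j : rj j <= rh by have := rj_le 0%N j (leq0n j); rewrite {2}/rj expr0 mul1r.
have tj j : t0 - theta * rh `^ (2 * s) <= t0 - theta * rj j `^ (2 * s).
  rewrite lerD2l lerN2 ler_pM2l//; apply: ge0_ler_powR; rewrite ?nnegrE ?(ltW s2) ?(ltW rh0) ?(ltW (rj0 j))//.
pose h p w := \sum_i (u i w - bb cc d p i) ^+ 2.
pose P j p k := {ae mu, forall w, pcyl x0 t0 (rj j) w -> h p w <= k%:R * a * d ^+ 2}.
have G0 w j : pcyl x0 t0 (rj j) w -> G `|x0 - w.1| = 0.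
  by move=> [h1 _]; case: tG => _ _ _ zG _; apply: zG; exact: lt_le_trans h1 (rj_rh j).
have hcc j : {ae mu, forall w, pcyl x0 t0 (rj j) w -> \sum_i (u i w - cc i) ^+ 2 <= d ^+ 2}.
  apply: filterS hle => w hw Cw; have [_ /andP[w2 w3]] := Cw.
  by have := hw (le_lt_trans (tj j) w2) w3; rewrite (G0 _ _ Cw) addr0.
have mono j p k : P j p k -> P j.+1 p k.
  move=> H; apply: filterS H => w hw Cw; apply: hw.
  by apply: pcyl_sub Cw => //; [exact: ltW|exact: rj_le].
have P0 p : P 0%N p n0.+1.
  apply: filterS (hcc 0%N) => w hw Cw.
  rewrite (_ : n0.+1%:R * a = (1 + k') ^+ 2); last by rewrite /a mulrC divfK.
  by apply: shift_le; [exact: ltW|exact: hw].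
have [j hj alt] := descent mono P0.
have subj : pcyl x0 t0 (la ^+ (#|{: Bt}| * n0).+1 * rh) `<=` pcyl x0 t0 (rj j.+1).
  by apply: pcyl_sub => //; [rewrite mulr_ge0 ?exprn_ge0// ltW|exact: rj_le].
case: alt => [[p Hp]|[nb Hnb]].
  exists (bb cc d p); apply: filterS Hp => w hw Cw.
  by apply: le_trans (hw (subj _ Cw)) _; rewrite !mul0r sqr_ge0.
pose kk p := (nb p).+1%:R * a * d ^+ 2.
have kk0 p : 0 < kk p by apply: mulr_gt0 d20; exact: mulr_gt0.
have kkL p : kk p <= L0 * d ^+ 2.
  have [h1 _ _] := Hnb p; rewrite /kk ler_pM2r//.
  apply: (@le_trans _ _ (n0.+1%:R * a)); first by rewrite ler_pM2r// ler_nat.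
  by rewrite /a mulrC divfK.
have uk p w : \sum_i u i w ^+ 2 <= (kk p)^-1.
  apply: le_trans (uM w) _; rewrite -[leLHS]invrK lef_pV2 ?posrE ?invr_gt0 ?exprn_gt0//.
  apply: le_trans (kkL p) _; rewrite -[leRHS]mul1r ler_pdivlMr ?exprn_gt0//.
  have d2 : d ^+ 2 <= M ^+ 2 by rewrite lerXn2r ?nnegrE ?(ltW d0) ?(ltW M0).
  have q1 : L0 * M ^+ 2 <= 1.
    by rewrite /L0 -exprMn expr_le1// mulr_ge0 ?(ltW M0)// addr_ge0// ltW.
  have q2 : M ^+ 2 <= 1 by rewrite expr_le1// ltW.
  apply: (@le_trans _ _ (L0 * M ^+ 2 * M ^+ 2)).
    by rewrite ler_wpM2r ?sqr_ge0// ler_wpM2l// ltW.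
  by rewrite mulr_ile1 ?sqr_ge0// mulr_ge0 ?sqr_ge0// ltW.
have t1j : -1 < t0 - theta * rj j `^ (2 * s) by exact: lt_le_trans (tj j).
(* Beyond [rj j] the current level says nothing; there $|u-c|^2\le d^2+G$ gives
   $|u-b|^2\le4d^2+2G$. *)
pose G2 (q : R) := 4 * d ^+ 2 * (rj j <= q)%R%:R + 2 * G q.
have [TG] : exists Dg', radial_tail s (n := n) G2 Dg' (rj j) (X1 * d ^+ 2).
  exists (4 * d ^+ 2 * 1 + 2 * Dg).
  rewrite (_ : X1 * d ^+ 2 = 4 * d ^+ 2 * (c * kC (n := n) s * 4 `^ (2 * s)) + 2 * (Ct * d ^+ 2)); last first.
    by rewrite /X1; ring.
  apply: (radial_tailD s01 _ _ (rj0 j) (lexx _) (rj_rh j) _ _ (radial_tail_step s01 (rj0 j)) tG) => //.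
  - by rewrite mulr_ge0// ltW.
  - by rewrite mulr_ge0 ?powR_ge0// mulr_ge0 ?(ltW c0)// ltW// kC_gt0.
  - by rewrite mulr_ge0// ltW.
move=> tG2.
have Hh p : hmean s (fun w => kk p - h p w) x0 t0 (la * rj j) (2 * theta * (la * rj j) `^ (2 * s)) <=
    2 * (a * d ^+ 2 + X1 * d ^+ 2 * (2 * theta) * la `^ (2 * s)).
  have [h1 h2 h3] := Hnb p.
  apply: (osc_harnack s01 W (kk0 p) (uk p) (rj0 j) la0 laN la22 t1j t01 tG2).
    have h2' : {ae mu, forall w, pcyl x0 t0 (rj j) w -> h p w <= kk p} by exact: h2.
    apply: filterS2 h2' hle => w hw1 hw2 w2 w3; have hw3 := hw2 (le_lt_trans (tj j) w2) w3.
    have g1 : 0 <= G `|x0 - w.1| by case: tG => _ bG _ _ _; have /andP[] := bG `|x0 - w.1|.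
    rewrite /G2; have [hr|hr] := leP (rj j) `|x0 - w.1|; last first.
      rewrite mulr0 add0r; apply: le_trans (hw1 _) _; first by split => //; apply/andP.
      by rewrite lerDl mulr_ge0.
    rewrite mulr1; apply: le_trans (shift_le2 p (ltW d0) hw3) _.
    have := kk0 p; lra.
  rewrite -rjS => H; apply: h3; apply: filterS H => w hw Cw.
  apply: le_trans (hw Cw) _; rewrite /kk -natr1; lra.
pose r := la * rj j; have r0 : 0 < r by rewrite mulr_gt0.
have pr0 : 0 < r `^ (2 * s) by exact: powR_gt0.
have bF p : bmeas (fun w => kk p - h p w) (kk p + \sum_i (M + `|bb cc d p i|) ^+ 2).
  have bh : bmeas (h p) (\sum_i (M + `|bb cc d p i|) ^+ 2).
    by apply: bmeas_sum => i; exact: sqr_bmeas.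
  split; first by apply: measurable_funB => //; exact: bh.1.
  by move=> w; apply: le_trans (ler_normB _ _) _; rewrite ger0_norm ?(ltW (kk0 p))// lerD2l bh.2.
pose Good w := pcyl x0 t0 (rj j) w -> \sum_i (u i w - cc i) ^+ 2 <= d ^+ 2 /\ forall p, h p w <= kk p.
have good : {ae mu, forall w, Good w}.
  have hall : {ae mu, forall w, forall p, pcyl x0 t0 (rj j) w -> h p w <= kk p}.
    by apply: filter_forall => p; have [_ h2 _] := Hnb p; exact: h2.
  apply: filterS2 hall (hcc j) => w h1 h2 Cw; split; first exact: h2.
  by move=> p; exact: h1.
have th2 : t0 - 2 * theta * r `^ (2 * s) < t0 - theta * r `^ (2 * s).
  by rewrite ltrD2l ltrN2 ltr_pM2r// ltr_pMl// ltr1n.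
have halfE : 2 * theta * r `^ (2 * s) / 2 = theta * r `^ (2 * s) by field.
have hX p : kap (n := n) s r * \int[mu]_w ((kk p - h p w) *
    \1_(cyl x0 r (t0 - 2 * theta * r `^ (2 * s)) (t0 - theta * r `^ (2 * s))) w) <=
    2 * (a * d ^+ 2 + X1 * d ^+ 2 * (2 * theta) * la `^ (2 * s)).
  by have := Hh p; rewrite /hmean -/r halfE.
have small : nB * (2 * (a * d ^+ 2 + X1 * d ^+ 2 * (2 * theta) * la `^ (2 * s))) <
    kap (n := n) s r * ((2 * r) ^+ N * ((t0 - theta * r `^ (2 * s)) - (t0 - 2 * theta * r `^ (2 * s)))) * (a' * d ^+ 2).
  have E0 (p q o : R) : o - p * q - (o - 2 * p * q) = p * q by ring.
  rewrite E0.
  rewrite kap_osc_mass// -/Th [ltRHS]mulrA.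
  rewrite (_ : nB * _ = (2 * nB * a + 2 * nB * (X1 * (2 * theta) * la `^ (2 * s))) * d ^+ 2); last by ring.
  rewrite ltr_pM2r//.
  have ThA : 0 < Th * a' by rewrite mulr_gt0.
  set y1 := nB * a in aTh *; set y2 := nB * (X1 * (2 * theta) * la `^ (2 * s)) in laT *.
  have E1 : 8 * nB * a = 8 * y1 by rewrite /y1 [RHS]mulrA.
  have E2 : 8 * nB * (X1 * (2 * theta) * la `^ (2 * s)) = 8 * y2 by rewrite /y2 [RHS]mulrA.
  have E3 : 2 * nB * a = 2 * y1 by rewrite /y1 [RHS]mulrA.
  have E4 : 2 * nB * (X1 * (2 * theta) * la `^ (2 * s)) = 2 * y2 by rewrite /y2 [RHS]mulrA.
  rewrite E1 in aTh; rewrite E2 in laT; rewrite E3 E4; lra.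
(* A single point at which all the functions $|u-b|^2$ are almost maximal. *)
have [z [Qz Gz Sz]] := osc_point r0 th2 (kap_gt0 s01 r0) bF good hX small.
have Cz : pcyl x0 t0 (rj j) z.
  have [z1 /andP[z2 z3]] := Qz; split.
    by apply: lt_le_trans z1 _; rewrite /r ler_piMl// ltW.
  apply/andP; split; last by apply: lt_trans z3 _; rewrite gtrBl mulr_gt0.
  apply: le_lt_trans z2; rewrite lerD2l lerN2 /r powRM ?(ltW la0) ?(ltW (rj0 j))//.
  have -> : 2 * theta * (la `^ (2 * s) * rj j `^ (2 * s)) = 2 * la `^ (2 * s) * (theta * rj j `^ (2 * s)) by ring.
  by rewrite ler_piMl ?(ltW la22)// mulr_ge0 ?powR_ge0// ltW.
have [zc zk] := Gz Cz.
have zp p : kk p <= h p z + a' * d ^+ 2.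
  rewrite -lerBlDl; apply: le_trans Sz; rewrite (bigD1 p)//= lerDl sumr_ge0// => p' _.
  by rewrite subr_ge0.
(* The centre moves towards $u(z)$ by the fraction [ka]. *)
exists (fun i => cc i + ka * (u i z - cc i)).
apply: filterS good => w Gw Cw.
have [wc wk] := Gw (pcyl_sub s01 (ltW (rj0 _)) (rj_le _ _ (leqnSn j)) (subj _ Cw)).
have hb p : h p w <= h p z + a' * d ^+ 2 by apply: le_trans (wk p) (zp p).
pose Pz i := u i z - cc i; pose Qw i := u i w - cc i.
have H1 i : \sum_j (Qw j - k' * d * (j == i)%:R) ^+ 2 <= \sum_j (Pz j - k' * d * (j == i)%:R) ^+ 2 + a' * d ^+ 2.
  have EH (F : 'I_m.+1 -> R) : \sum_j (F j - cc j - k' * d * (j == i)%:R) ^+ 2 =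
      \sum_j (F j - bb cc d (i, true) j) ^+ 2.
    by apply: eq_bigr => j' _; rewrite /bb /sgn /= mul1r opprD addrA.
  by rewrite /Qw /Pz !EH; exact: hb.
have H2 i : \sum_j (Qw j + k' * d * (j == i)%:R) ^+ 2 <= \sum_j (Pz j + k' * d * (j == i)%:R) ^+ 2 + a' * d ^+ 2.
  have EH (F : 'I_m.+1 -> R) : \sum_j (F j - cc j + k' * d * (j == i)%:R) ^+ 2 =
      \sum_j (F j - bb cc d (i, false) j) ^+ 2.
    by apply: eq_bigr => j' _; rewrite /bb /sgn /= mulN1r mulNr opprD opprK addrA.
  by rewrite /Qw /Pz !EH; exact: hb.
have := osc_alg (ltW d0) (ltW k'0) H1 H2 zc.
rewrite -/ka (eq_bigr (fun i => (u i w - (cc i + ka * (u i z - cc i))) ^+ 2)); last first.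
  by move=> i _; rewrite /Qw /Pz opprD addrA.
move=> /le_trans; apply.
apply: (@le_trans _ _ ((1 - ka) ^+ 2 * d ^+ 2 + a' * d ^+ 2)).
  by rewrite lerD2r ler_wpM2l ?sqr_ge0.
rewrite -mulrDl exprMn ler_wpM2r ?(ltW d20)// /a'.
have kk2 : ka ^+ 2 <= ka by rewrite expr2 ler_piMl// ltW.
have -> : (1 - ka) ^+ 2 = 1 - 2 * ka + ka ^+ 2 by ring.
have -> : (1 - ka / 2) ^+ 2 = 1 - ka + ka ^+ 2 / 4 by field.
have := ka0; lra.
Qed.

End oscillation_lemma.

(** * Iteration over all scales at one point *)

Section iteration.
Context {R : realType} {n : nat} (s : R).
Hypothesis s01 : 0 < s < 1.
Local Notation N := n.+1.
Local Notation lam := (@lebesgue_rV R N).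
Local Notation mu := (@leb_rVT R N).
Local Notation Z := ('rV[R]_N * measurableTypeR R)%type.
Local Notation c := (@fconst R n s).
Local Notation theta := (@theta R n s).
Local Notation pcyl := (@pcyl R n s).
Implicit Types (f : Z -> R) (z w v : Z) (x y : 'rV[R]_N) (e C D eps : R).

Let s2 : 0 < 2 * s. Proof. by have /andP[h _] := s01; rewrite mulr_gt0. Qed.

Lemma pcyl_pos x (t0 r : R) : 0 < r -> measurable (pcyl x t0 r) /\ mu (pcyl x t0 r) != 0%E.
Proof.
move=> r0; have p0 : 0 < theta * r `^ (2 * s) by rewrite mulr_gt0 ?theta_gt0 ?powR_gt0.
have [h E] := @cyl_measure R n x r (t0 - theta * r `^ (2 * s)) t0 r0 ltac:(lra).
split => //; rewrite /pcyl E eqe gt_eqF// mulr_gt0 ?exprn_gt0 ?mulr_gt0//; lra.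
Qed.

Variables (m : nat) (u : 'I_m.+1 -> Z -> R) (M : R) (B : Z -> R).
Hypothesis W : wsol s u M B.
Hypothesis M0 : 0 < M.
Hypothesis M1 : M < 1.
Hypothesis uM : forall w, \sum_i u i w ^+ 2 <= M ^+ 2.

Let C1 : R := c * kC (n := n) s * 4 `^ (2 * s).
Let C10 : 0 <= C1.
Proof. by rewrite mulr_ge0 ?powR_ge0// mulr_ge0 ?ltW ?kC_gt0 ?fconst_gt0. Qed.

Let sq3 (x y z : R) : (x - y + z) ^+ 2 <= 3 * (x ^+ 2 + y ^+ 2 + z ^+ 2).
Proof.
have h1 := sqr_ge0 (x + y); have h2 := sqr_ge0 (x - z); have h3 := sqr_ge0 (y + z).
rewrite -subr_ge0 (_ : _ - _ = (x + y) ^+ 2 + (x - z) ^+ 2 + (y + z) ^+ 2); last by ring.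
by rewrite !addr_ge0.
Qed.

Let sum_sq3 (F G H : 'I_m.+1 -> R) X Y V : \sum_i F i ^+ 2 <= X -> \sum_i G i ^+ 2 <= Y ->
  \sum_i H i ^+ 2 <= V -> \sum_i (F i - G i + H i) ^+ 2 <= 3 * (X + Y + V).
Proof.
move=> h1 h2 h3; apply: (@le_trans _ _ (\sum_i 3 * (F i ^+ 2 + G i ^+ 2 + H i ^+ 2))).
  by apply: ler_sum => i _; exact: sq3.
by rewrite -mulr_sumr !big_split/= ler_pM2l// !lerD.
Qed.

Section at_point.
Variables (q dl : R).
Hypothesis q_ge : 2^-1 <= q.
Hypothesis q_lt : q < 1.
Hypothesis dl0 : 0 < dl.
Hypothesis dl_lt : dl < 1.
Hypothesis dl_s : dl `^ (2 * s) <= q ^+ 2 / 2.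
Hypothesis osc : forall x0 t0 rh d (cc : 'I_m.+1 -> R) G Dg, 0 < rh -> 0 < d <= M ->
    -1 < t0 - theta * rh `^ (2 * s) -> t0 <= 1 ->
    radial_tail s (n := n) G Dg rh (72 * C1 * d ^+ 2) ->
    {ae mu, forall w, t0 - theta * rh `^ (2 * s) < w.2 -> w.2 < t0 ->
      \sum_i (u i w - cc i) ^+ 2 <= d ^+ 2 + G `|x0 - w.1|} ->
    exists c' : 'I_m.+1 -> R, {ae mu, forall w, pcyl x0 t0 (dl * rh) w ->
      \sum_i (u i w - c' i) ^+ 2 <= (q * d) ^+ 2}.
Variables (x0 : 'rV[R]_N) (t0 R0 : R).
Hypothesis R00 : 0 < R0.
Hypothesis t0R : -1 < t0 - theta * R0 `^ (2 * s).
Hypothesis t0_le : t0 <= 1.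

Let q0 : 0 < q. Proof. by apply: lt_le_trans q_ge; rewrite invr_gt0. Qed.
Let rj j := dl ^+ j * R0.
Let rj0 j : 0 < rj j. Proof. by rewrite mulr_gt0// exprn_gt0. Qed.
Let rj_le i j : (i <= j)%N -> rj j <= rj i.
Proof. by move=> ij; rewrite ler_pM2r// ler_wiXn2l// ltW. Qed.
Let dj j := q ^+ j * M.
Let dj0 j : 0 < dj j. Proof. by rewrite mulr_gt0// exprn_gt0. Qed.
Let dj_le i j : (i <= j)%N -> dj j <= dj i.
Proof. by move=> ij; rewrite ler_pM2r// ler_wiXn2l// ltW. Qed.
Let djM j : dj j <= M.
Proof. by have := dj_le (leq0n j); rewrite {2}/dj expr0 mul1r. Qed.

Let A j (cc : 'I_m.+1 -> R) :=
  {ae mu, forall w, pcyl x0 t0 (rj j) w -> \sum_i (u i w - cc i) ^+ 2 <= dj j ^+ 2}.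

(** The growth of $|u-c_k|^2$ away from the vertex, read off from the previous scales as a sum of
    steps at the radii [rj l]. *)
Let Gk k (p : R) := \sum_(l < k.+1) 36 * dj l ^+ 2 * (rj l <= p)%R%:R.

(** The tails form a series dominated by its last term: $\delta^{2s}\le q^2/2$, with $\delta$ the
    ratio [dl], halves the older part relative to the new scale, so $36$ per step sums to at most
    $72$. *)
Let Gk_tail k : exists Dg, radial_tail s (n := n) (Gk k) Dg (rj k) (72 * C1 * dj k ^+ 2).
Proof.
have mono G Dg rr X X' : X <= X' -> 0 < rr -> radial_tail s (n := n) G Dg rr X -> radial_tail s (n := n) G Dg rr X'.
  move=> XX rr0 [h1 h2 h3 h4 [h5 h6]]; split => //; split => //; apply: le_trans h6 _.
  by rewrite ler_wpM2r// invr_ge0 powR_ge0.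
have stp j := @radial_tail_step R n s s01 _ (rj0 j).
have d2 j : 0 <= dj j ^+ 2 by exact: sqr_ge0.
have C2 j : 0 <= C1 * dj j ^+ 2 by exact: mulr_ge0.
elim: k => [|k [Dg IH]].
  have := radial_tailD s01 (a := 36 * dj 0%N ^+ 2) (b := 0) _ (lexx 0) (rj0 0%N) (lexx _) (lexx _) C10 C10 (stp 0%N) (stp 0%N).
  move=> /(_ (mulr_ge0 (ler0n R 36) (d2 _))) h; eexists.
  rewrite (_ : Gk 0 = fun p => 36 * dj 0 ^+ 2 * (rj 0 <= p)%R%:R + 0 * (rj 0 <= p)%R%:R).
    apply: (mono _ _ _ _ _ _ (rj0 0%N) h); rewrite -/C1.
    have -> : 36 * dj 0%N ^+ 2 * C1 + 0 * C1 = 36 * (C1 * dj 0%N ^+ 2) by ring.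
    have -> : 72 * C1 * dj 0%N ^+ 2 = 72 * (C1 * dj 0%N ^+ 2) by ring.
    by rewrite ler_wpM2r// ler_nat.
  by apply/funext => p; rewrite /Gk big_ord1 mul0r addr0.
have r1 : rj k.+1 <= rj k by exact: rj_le.
have IH' : radial_tail s (n := n) (Gk k) Dg (rj k.+1) (72 * C1 * dj k ^+ 2 * dl `^ (2 * s)).
  case: IH => h1 h2 h3 h4 [h5 h6]; split => //.
    by move=> p pr; apply: h4; exact: lt_le_trans r1.
  split => //; apply: le_trans h6 _; rewrite le_eqVlt; apply/orP; left; apply/eqP.
  have -> : rj k.+1 = dl * rj k by rewrite /rj exprS mulrA.
  rewrite powRM ?(ltW dl0) ?(ltW (rj0 k))//.
  by field; rewrite !gt_eqF ?powR_gt0.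
have := radial_tailD s01 (a := 1) (b := 36 * dj k.+1 ^+ 2) ler01 _ (rj0 k.+1) (lexx _) (lexx _) _ C10 IH' (stp k.+1).
move=> /(_ (mulr_ge0 (ler0n R 36) (d2 _)) (mulr_ge0 (mulr_ge0 (mulr_ge0 (ler0n R 72) C10) (d2 _)) (powR_ge0 _ _))) h.
eexists.
rewrite (_ : Gk k.+1 = fun p => 1 * Gk k p + 36 * dj k.+1 ^+ 2 * (rj k.+1 <= p)%R%:R); last first.
  by apply/funext => p; rewrite /Gk big_ord_recr/= mul1r.
apply: (mono _ _ _ _ _ _ (rj0 _) h); rewrite -/C1 mul1r.
have hs := ler_wpM2l (C2 k) dl_s.
have E : dj k.+1 ^+ 2 = dj k ^+ 2 * q ^+ 2 by rewrite /dj [q ^+ k.+1]exprS; ring.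
move: hs; rewrite E.
have -> : C1 * dj k ^+ 2 * (q ^+ 2 / 2) = C1 * (dj k ^+ 2 * q ^+ 2) / 2 by ring.
have -> : 72 * C1 * dj k ^+ 2 * dl `^ (2 * s) = 72 * (C1 * dj k ^+ 2 * dl `^ (2 * s)) by ring.
have -> : 36 * (dj k ^+ 2 * q ^+ 2) * C1 = 36 * (C1 * (dj k ^+ 2 * q ^+ 2)) by ring.
have -> : 72 * C1 * (dj k ^+ 2 * q ^+ 2) = 72 * (C1 * (dj k ^+ 2 * q ^+ 2)) by ring.
lra.
Qed.

Let Gk_ge k l p : (l <= k)%N -> rj l <= p -> 36 * dj l ^+ 2 <= Gk k p.
Proof.
move=> lk rp; have lk' : (l < k.+1)%N by [].
rewrite /Gk (bigD1 (Ordinal lk'))//= rp mulr1 lerDl sumr_ge0// => i _.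
by rewrite mulr_ge0// mulr_ge0// sqr_ge0.
Qed.

Let subj i j : (i <= j)%N -> pcyl x0 t0 (rj j) `<=` pcyl x0 t0 (rj i).
Proof. by move=> ij; apply: pcyl_sub => //; [exact: ltW|exact: rj_le]. Qed.

Let A_point j k cj ck : (j <= k)%N -> A j cj -> A k ck ->
  exists p, \sum_i (u i p - cj i) ^+ 2 <= dj j ^+ 2 /\ \sum_i (u i p - ck i) ^+ 2 <= dj k ^+ 2.
Proof.
move=> jk hj hk; have [mC nC] := pcyl_pos x0 t0 (rj0 k).
have hjk : {ae mu, forall w, pcyl x0 t0 (rj k) w ->
    \sum_i (u i w - cj i) ^+ 2 <= dj j ^+ 2 /\ \sum_i (u i w - ck i) ^+ 2 <= dj k ^+ 2}.
  apply: filterS2 hj hk => w h1 h2 Cw; split; last exact: h2.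
  by apply: h1; exact: subj Cw.
by have [p Cp Hp] := ae_exists mC nC hjk; exists p; exact: Hp.
Qed.

(** Strong induction: all previous balls enter, since they provide the growth hypothesis of the next
    oscillation step. *)
Lemma centers k : exists cc, A k cc.
Proof.
elim/ltn_ind: k => -[_|k IH].
  exists (fun=> 0); apply: aeW => w _; rewrite /dj expr0 mul1r.
  by under eq_bigr do rewrite subr0; exact: uM.
have [cs Hcs] : exists cs : nat -> 'I_m.+1 -> R, forall j, (j <= k)%N -> A j (cs j).
  have : forall j, exists cc, (j <= k)%N -> A j cc.
    move=> j; have [jk|jk] := leqP j k; last by exists (fun=> 0).
    by have [cc h] := IH j jk; exists cc.
  by move/choice => [cs h]; exists cs.
have [Dg tG] := Gk_tail k.
have d2 j : (j <= k)%N -> dj k ^+ 2 <= dj j ^+ 2.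
  by move=> jk; rewrite lerXn2r ?nnegrE ?(ltW (dj0 _))// dj_le.
have tk : t0 - theta * R0 `^ (2 * s) <= t0 - theta * rj k `^ (2 * s).
  rewrite lerD2l lerN2 ler_pM2l ?theta_gt0//; apply: ge0_ler_powR; rewrite ?nnegrE ?(ltW s2) ?(ltW R00) ?(ltW (rj0 k))//.
  by have := rj_le (leq0n k); rewrite {2}/rj expr0 mul1r.
have tkj j : (j <= k)%N -> t0 - theta * rj j `^ (2 * s) <= t0 - theta * rj k `^ (2 * s).
  move=> jk; rewrite lerD2l lerN2 ler_pM2l ?theta_gt0//; apply: ge0_ler_powR; rewrite ?nnegrE ?(ltW s2) ?(ltW (rj0 _))//.
  exact: rj_le.
(* Together with the factor $9$ from the sum of three squares this explains the $36$ in [Gk]; it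
   uses $q\ge1/2$. *)
have dq j : dj j ^+ 2 <= 4 * dj j.+1 ^+ 2.
  have -> : dj j.+1 = q * dj j by rewrite /dj exprS mulrA.
  have -> : 4 * (q * dj j) ^+ 2 = 4 * q ^+ 2 * dj j ^+ 2 by ring.
  apply: ler_peMl; first exact: sqr_ge0.
  have : 2^-1 ^+ 2 <= q ^+ 2 by rewrite lerXn2r ?nnegrE ?(ltW q0)// invr_ge0.
  have -> : 2^-1 ^+ 2 = 1 / 4 :> R by field.
  lra.
have hk := Hcs k (leqnn k).
have dk : 0 < dj k <= M by rewrite dj0 djM.
have [|c' Hc'] := @osc x0 t0 (rj k) (dj k) (cs k) (Gk k) Dg (rj0 k) dk (lt_le_trans t0R tk) t0_le tG.
- have hall : {ae mu, forall w, forall j : 'I_k.+1, pcyl x0 t0 (rj j) w -> \sum_i (u i w - cs j i) ^+ 2 <= dj j ^+ 2}.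
    by apply: filter_forall => j; apply: Hcs; rewrite -ltnS.
  apply: filterS hall => w hw w2 w3.
  have Gk0 : 0 <= Gk k `|x0 - w.1|.
    by apply: sumr_ge0 => i _; rewrite mulr_ge0// mulr_ge0// sqr_ge0.
  have inP j : (j <= k)%N -> `|x0 - w.1| < rj j -> \sum_i (u i w - cs j i) ^+ 2 <= dj j ^+ 2.
    move=> jk hr; have jk' : (j < k.+1)%N by [].
    apply: (hw (Ordinal jk')); split => //=; rewrite w3 andbT.
    exact: le_lt_trans (tkj _ jk) w2.
  have [h|h] := ltP `|x0 - w.1| (rj k).
    by apply: le_trans (inP k (leqnn k) h) _; rewrite lerDl.
  (* Beyond the largest cylinder only the global bound $|u|\le M$ is available; between two radii
     the ball of the larger one is compared with the current ball through a common point. *)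
  have [h0|h0] := leP (rj 0%N) `|x0 - w.1|.
    have [p [_ p2]] := A_point (leqnn k) hk hk.
    rewrite (eq_bigr (fun i => (u i w - u i p + (u i p - cs k i)) ^+ 2)); last first.
      by move=> i _; congr (_ ^+ 2); ring.
    apply: le_trans (sum_sq3 (uM w) (uM p) p2) _.
    have := Gk_ge (leq0n k) h0; have := d2 0%N (leq0n k).
    have -> : dj 0 = M by rewrite /dj expr0 mul1r.
    have := sqr_ge0 M; have := sqr_ge0 (dj k); lra.
  have [j [jk hj1 hj2]] : exists j, [/\ (j < k)%N, rj j.+1 <= `|x0 - w.1| & `|x0 - w.1| < rj j].
    have ex : exists j, rj j <= `|x0 - w.1| by exists k.
    case: (ex_minnP ex) => -[|j] hj hmin; first by move: h0; rewrite ltNge hj.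
    exists j; split => //; first exact: (hmin k h).
    by rewrite ltNge; apply/negP => /hmin; rewrite ltnn.
  have [p [p1 p2]] := A_point (ltnW jk) (Hcs j (ltnW jk)) hk.
  rewrite (eq_bigr (fun i => (u i w - cs j i - (u i p - cs j i) + (u i p - cs k i)) ^+ 2)); last first.
    by move=> i _; congr (_ ^+ 2); ring.
  apply: le_trans (sum_sq3 (inP j (ltnW jk) hj2) p1 p2) _.
  have := Gk_ge jk hj1; have := d2 j (ltnW jk); have := dq j.
  have := sqr_ge0 (dj k); lra.
have E1 : dj k.+1 = q * dj k by rewrite /dj exprS mulrA.
have E2 : rj k.+1 = dl * rj k by rewrite /rj exprS mulrA.
by exists c'; rewrite /A E1 E2.
Qed.

(** The balls of any two scales share a value of $u$, so their centres form a Cauchy sequence with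
    rate $q^k$. *)
Lemma limit_value : exists v : 'I_m.+1 -> R, forall k,
  {ae mu, forall w, pcyl x0 t0 (dl ^+ k * R0) w -> forall i, `|u i w - v i| <= 3 * (q ^+ k * M)}.
Proof.
have [cs Hcs] := choice centers.
have sq_le (F : 'I_m.+1 -> R) d i : 0 <= d -> \sum_j F j ^+ 2 <= d ^+ 2 -> `|F i| <= d.
  move=> d0 Fd; rewrite -(@ler_pXn2r _ 2)// ?nnegrE// real_normK ?num_real//.
  by apply: le_trans Fd; rewrite (bigD1 i)//= lerDl sumr_ge0// => j _; exact: sqr_ge0.
have near j k i : (j <= k)%N -> `|cs j i - cs k i| <= 2 * dj j.
  move=> jk; have [p [p1 p2]] := A_point jk (Hcs j) (Hcs k).
  have e1 := sq_le (fun i => u i p - cs j i) _ i (ltW (dj0 _)) p1.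
  have e2 := sq_le (fun i => u i p - cs k i) _ i (ltW (dj0 _)) p2.
  have -> : cs j i - cs k i = (u i p - cs k i) - (u i p - cs j i) by ring.
  apply: le_trans (ler_normB _ _) _; have := dj_le jk; lra.
(* The intervals of radius [2 * dj k] about the centres meet pairwise, and the supremum of their
   left ends lies in all of them. *)
pose v i := sup [set cs k i - 2 * dj k | k in [set: nat]].
exists v => k.
have ub l i : ubound [set cs k i - 2 * dj k | k in [set: nat]] (cs l i + 2 * dj l).
  move=> _ [j _ <-]; have [jl|lj] := leqP j l.
    have := near j l i jl; rewrite ler_norml => /andP[_ ?]; have := dj0 l; lra.
  have := near l j i (ltnW lj); rewrite ler_norml => /andP[? _]; have := dj0 j; lra.
have vc i : `|cs k i - v i| <= 2 * dj k.
  have h1 : v i <= cs k i + 2 * dj k.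
    by apply: (ge_sup _ (ub k i)); exists (cs 0%N i - 2 * dj 0%N); exists 0%N.
  have h2 : cs k i - 2 * dj k <= v i.
    apply: ub_le_sup; last by exists k.
    by exists (cs 0%N i + 2 * dj 0%N); exact: ub.
  by rewrite ler_norml; apply/andP; split; lra.
apply: filterS (Hcs k) => w hw Cw i.
have e1 := sq_le (fun i => u i w - cs k i) _ i (ltW (dj0 _)) (hw Cw).
have -> : u i w - v i = (u i w - cs k i) + (cs k i - v i) by ring.
apply: le_trans (ler_normD _ _) _; have := vc i; rewrite /dj in e1 *; lra.
Qed.

End at_point.

End iteration.

(** * From geometric decay to Hölder continuity *)

Section holder.
Context {R : realType} {n : nat} (s : R).
Hypothesis s01 : 0 < s < 1.
Local Notation N := n.+1.
Local Notation lam := (@lebesgue_rV R N).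
Local Notation mu := (@leb_rVT R N).
Local Notation Z := ('rV[R]_N * measurableTypeR R)%type.
Local Notation c := (@fconst R n s).
Local Notation theta := (@theta R n s).
Local Notation pcyl := (@pcyl R n s).
Implicit Types (z w : Z) (x y : 'rV[R]_N).

Let s2 : 0 < 2 * s. Proof. by have /andP[h _] := s01; rewrite mulr_gt0. Qed.
Let th0 : 0 < theta. Proof. exact: theta_gt0. Qed.

Lemma expr_small (q e : R) : 0 < q -> q < 1 -> 0 < e -> exists k : nat, q ^+ k <= e.
Proof.
move=> q0 q1 e0; have q1' : `|q| < 1 by rewrite gtr0_norm.
have /cvgrPdist_le/(_ e e0)[k _ /(_ k (leqnn k))] := cvg_expr q1'.
by rewrite sub0r normrN ger0_norm ?exprn_ge0 ?(ltW q0)// => h; exists k.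
Qed.

Lemma powR_exprn (x a : R) k : 0 <= x -> (x ^+ k) `^ a = (x `^ a) ^+ k.
Proof.
move=> x0; elim: k => [|k IH]; first by rewrite !expr0 powR1.
by rewrite !exprS powRM ?exprn_ge0// IH.
Qed.

(* A radius for which the parabolic cylinder of vertex [(x, t)] stays above the
   initial time [-1]. *)
Definition rad (t : R) : R := Num.min 1 (((t + 1) / (2 * theta)) `^ (2 * s)^-1).

Lemma rad_gt0 t : -1 < t -> 0 < rad t.
Proof.
move=> t1; rewrite lt_min ltr01 powR_gt0// divr_gt0 ?mulr_gt0//; lra.
Qed.

Lemma rad_time t : -1 < t -> -1 < t - theta * rad t `^ (2 * s).
Proof.
move=> t1; have a0 : 0 < (t + 1) / (2 * theta) by rewrite divr_gt0 ?mulr_gt0//; lra.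
have h : rad t `^ (2 * s) <= (t + 1) / (2 * theta).
  apply: (@le_trans _ _ ((((t + 1) / (2 * theta)) `^ (2 * s)^-1) `^ (2 * s))).
    apply: ge0_ler_powR; rewrite ?nnegrE ?powR_ge0 ?(ltW s2) ?(ltW (rad_gt0 t1))//.
    by rewrite ge_min lexx orbT.
  by rewrite -powRrM mulVf ?gt_eqF// powRr1// ltW.
have : theta * rad t `^ (2 * s) <= (t + 1) / 2.
  apply: le_trans (ler_wpM2l (ltW th0) h) _.
  by rewrite le_eqVlt; apply/orP; left; apply/eqP; field; rewrite gt_eqF.
lra.
Qed.

Lemma rad_le t t' : -1 < t -> t <= t' -> rad t <= rad t'.
Proof.
move=> t1 tt; rewrite le_min !ge_min lexx/=; apply/orP; right.
have h0 : 0 < (2 * theta)^-1 by rewrite invr_gt0 mulr_gt0.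
apply: ge0_ler_powR; rewrite ?nnegrE ?invr_ge0 ?(ltW s2)//.
- by rewrite mulr_ge0 ?(ltW h0)//; lra.
- by rewrite mulr_ge0 ?(ltW h0)//; lra.
- by rewrite ler_pM2r//; lra.
Qed.

Variables (m : nat) (u : 'I_m.+1 -> Z -> R) (M : R).
Hypothesis M0 : 0 < M.
Hypothesis uM : forall w i, `|u i w| <= M.
Variables (q dl : R).
Hypothesis q_ge : 2^-1 <= q.
Hypothesis q_lt : q < 1.
Hypothesis dl0 : 0 < dl.
Hypothesis dl_lt : dl < 1.
Hypothesis dl_s : dl `^ (2 * s) <= q ^+ 2 / 2.
Variable v : Z -> 'I_m.+1 -> R.
Hypothesis uv : forall z, -1 < z.2 -> z.2 <= 1 -> forall k,
  {ae mu, forall w, pcyl z.1 z.2 (dl ^+ k * rad z.2) w ->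
     forall i, `|u i w - v z i| <= 3 * (q ^+ k * M)}.

Let q0 : 0 < q. Proof. by apply: lt_le_trans q_ge; rewrite invr_gt0. Qed.

(** The cylinders below two nearby vertices overlap in a set of positive measure, just before the
    earlier vertex; the two values are compared through $u$ at a common point. *)
Lemma near_value t1 (z z' : Z) k (D : R) i : -1 < t1 -> t1 <= z.2 -> t1 <= z'.2 ->
  z.2 <= 1 -> z'.2 <= 1 -> `|z.1 - z'.1| <= D -> `|z.2 - z'.2 : R| <= D ->
  D < dl ^+ k * rad t1 / 2 -> D < theta * (dl ^+ k * rad t1) `^ (2 * s) / 2 ->
  `|v z i - v z' i| <= 6 * (q ^+ k * M).
Proof.
move=> t10; wlog zz : z z' / z'.2 <= z.2.
  move=> H h1 h2 h3 h4 h5 h6 h7 h8; have [h|h] := leP z'.2 z.2; first exact: H.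
  by rewrite distrC; apply: H => //; rewrite ?(ltW h)// distrC.
move=> h1 h2 h3 h4 h5 h6 h7 h8; set rh := dl ^+ k * rad t1 in h7 h8.
have rh0 : 0 < rh by rewrite mulr_gt0 ?exprn_gt0 ?rad_gt0.
have p0 : 0 < theta * rh `^ (2 * s) by rewrite mulr_gt0 ?powR_gt0.
have sub (a : Z) : t1 <= a.2 -> pcyl a.1 a.2 rh `<=` pcyl a.1 a.2 (dl ^+ k * rad a.2).
  move=> ha; apply: pcyl_sub => //; first exact: ltW.
  by rewrite ler_pM2l ?exprn_gt0//; exact: rad_le.
have r2 : 0 < rh / 2 by rewrite divr_gt0.
have [mC EC] := @cyl_measure R n z.1 (rh / 2) (z'.2 - theta * rh `^ (2 * s) / 2) z'.2 r2 ltac:(lra).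
have nC : mu (cyl z.1 (rh / 2) (z'.2 - theta * rh `^ (2 * s) / 2) z'.2) != 0%E.
  rewrite EC eqe gt_eqF//; apply: mulr_gt0; first by apply: exprn_gt0; exact: mulr_gt0.
  by rewrite opprB addrC subrK divr_gt0.
have z1 : -1 < z.2 by exact: lt_le_trans h1.
have z1' : -1 < z'.2 by exact: lt_le_trans h2.
have [w [w1 /andP[w2 w3]] [H1 H2]] : exists2 w, cyl z.1 (rh / 2) (z'.2 - theta * rh `^ (2 * s) / 2) z'.2 w &
    (forall i, pcyl z.1 z.2 rh w -> `|u i w - v z i| <= 3 * (q ^+ k * M)) /\
    (forall i, pcyl z'.1 z'.2 rh w -> `|u i w - v z' i| <= 3 * (q ^+ k * M)).
  apply: (ae_exists mC nC); apply: filterS2 (uv z1 h3 k) (uv z1' h4 k) => w g1 g2.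
  by split => j hw; [apply: g1|apply: g2]; exact: sub hw.
move: h6; rewrite ler_norml => /andP[h6 h6'].
have {}H1 : `|u i w - v z i| <= 3 * (q ^+ k * M).
  apply: H1; split; first by apply: lt_trans w1 _; lra.
  by apply/andP; split; lra.
have {}H2 : `|u i w - v z' i| <= 3 * (q ^+ k * M).
  apply: H2; split; last by apply/andP; split; lra.
  have -> : z'.1 - w.1 = (z.1 - w.1) - (z.1 - z'.1) by apply/rowP => j; rewrite !mxE; ring.
  by apply: le_lt_trans (ler_normB _ _) _; lra.
have -> : v z i - v z' i = (u i w - v z' i) - (u i w - v z i) by ring.
apply: le_trans (ler_normB _ _) _; lra.
Qed.

(** The exponent solves $(\delta^2)^\alpha=q$, with $\delta$ the ratio [dl]. Distances are compared
    with the square of the radius, which for radii at most $1$ is below both $r$ and $r^{2s}$; space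
    and time are thus treated alike. *)
Definition holder_exp : R := ln q / (2 * ln dl).

Let lnq : ln q < 0. Proof. by rewrite ln_lt0// q0. Qed.
Let lnd : ln dl < 0. Proof. by rewrite ln_lt0// dl0. Qed.

Lemma holder_exp_powR : (dl ^+ 2) `^ holder_exp = q.
Proof.
rewrite powR_exprn ?ltW// -powR_mulrn ?powR_ge0// -powRrM /powR gt_eqF//.
rewrite (_ : holder_exp * 2%:R * ln dl = ln q) ?lnK ?posrE//.
by rewrite /holder_exp; field; rewrite lt_eqF.
Qed.

Lemma holder_exp_gt0 : 0 < holder_exp.
Proof. by rewrite /holder_exp nmulr_lgt0 ?invr_lt0 ?pmulr_rlt0. Qed.

Lemma holder_exp_lt1 : holder_exp < 1.
Proof.
rewrite /holder_exp ltr_ndivrMr ?pmulr_rlt0// mul1r.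
have -> : 2 * ln dl = ln (dl ^+ 2) by rewrite lnXn// mulr_natl.
rewrite ltr_ln ?posrE ?exprn_gt0//.
have h1 : dl ^+ 2 <= dl `^ (2 * s).
  rewrite -powR_mulrn ?(ltW dl0)//; apply: ger_powR; first by rewrite dl0 ltW.
  by have /andP[_ h] := s01; rewrite -[leRHS]mulr1 ler_pM2l// ltW.
have : q ^+ 2 <= q by rewrite expr2 ler_piMl// ltW.
have := q0; have := dl_s; lra.
Qed.

Lemma holder_bound t1 : -1 < t1 -> exists C : R, forall (z z' : Z) (D : R) i,
  t1 <= z.2 -> t1 <= z'.2 -> z.2 <= 1 -> z'.2 <= 1 ->
  `|z.1 - z'.1| <= D -> `|z.2 - z'.2 : R| <= D ->
  `|v z i - v z' i| <= C * D `^ holder_exp.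
Proof.
move=> t10; pose Rm := rad t1; have Rm0 : 0 < Rm by exact: rad_gt0.
have Rm1 : Rm <= 1 by rewrite ge_min lexx.
pose ka := Num.min 2^-1 (theta / 2).
have ka0 : 0 < ka by rewrite lt_min invr_gt0 ltr0n divr_gt0.
pose A := ka * Rm ^+ 2; have A0 : 0 < A by rewrite mulr_gt0 ?exprn_gt0.
have a0 := holder_exp_gt0; have Aa : 0 < A `^ holder_exp by exact: powR_gt0.
have C0 : 0 <= 12 * M / A `^ holder_exp by rewrite divr_ge0 ?mulr_ge0 ?(ltW M0) ?(ltW Aa).
exists (12 * M / A `^ holder_exp) => z z' D i h1 h2 h3 h4 h5 h6.
have [->|zz] := eqVneq z z'; first by rewrite subrr normr0 mulr_ge0 ?powR_ge0.
have D0 : 0 < D.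
  rewrite lt_neqAle (le_trans _ h5)// andbT; apply/negP => /eqP E; move/negP: zz; apply.
  move: h5 h6; rewrite -E !normr_le0 !subr_eq0 => /eqP e1 /eqP e2.
  by rewrite [z]surjective_pairing [z']surjective_pairing e1 e2.
(* Distances that are not small are covered by the boundedness of the values. *)
have [hA|hA] := leP A D.
  apply: (@le_trans _ _ (12 * M / A `^ holder_exp * A `^ holder_exp)); last first.
    by rewrite ler_wpM2l//; apply: ge0_ler_powR; rewrite ?nnegrE ?(ltW a0) ?(ltW A0) ?(ltW D0).
  rewrite divfK ?gt_eqF//.
  have bv (a : Z) : t1 <= a.2 -> a.2 <= 1 -> `|v a i| <= 4 * M.
    move=> g1 g2; have g0 : -1 < a.2 by exact: lt_le_trans g1.
    have r0 : 0 < dl ^+ 0 * rad a.2 by rewrite expr0 mul1r rad_gt0.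
    have [mC nC] := pcyl_pos s01 a.1 a.2 r0.
    have [w Cw Hw] := ae_exists mC nC (uv g0 g2 0%N).
    have {Hw} := Hw Cw i; rewrite expr0 mul1r => Hw.
    have -> : v a i = u i w - (u i w - v a i) by ring.
    by apply: le_trans (ler_normB _ _) _; have := uM w i; lra.
  apply: le_trans (ler_normB _ _) _; have := bv z h1 h3; have := bv z' h2 h4; have := M0; lra.
pose X := dl ^+ 2; have X0 : 0 < X by rewrite exprn_gt0.
have X1 : X < 1 by rewrite exprn_ilt1// ltW.
have ex : exists k, A * X ^+ k.+1 <= D.
  have [k hk] := expr_small X0 X1 (divr_gt0 D0 A0).
  exists k; apply: (@le_trans _ _ (A * X ^+ k)); last by rewrite mulrC -ler_pdivlMr.
  by rewrite ler_pM2l// ler_wiXn2l// ltW.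
(* The scale adapted to the distance: $D$ lies between $A X^{k+1}$ and $A X^k$. *)
case: (ex_minnP ex) => k hk hmin.
have hk' : D < A * X ^+ k.
  case: k hk hmin => [|k] hk hmin; first by rewrite expr0 mulr1.
  by rewrite ltNge; apply/negP => /hmin; rewrite ltnn.
pose rh := dl ^+ k * Rm.
have rh0 : 0 < rh by rewrite mulr_gt0 ?exprn_gt0.
have rh1 : rh <= 1 by rewrite mulr_ile1 ?exprn_ile1 ?exprn_ge0 ?(ltW dl0) ?(ltW dl_lt) ?(ltW Rm0).
have AE : A * X ^+ k = ka * rh ^+ 2 by rewrite /A /X /rh exprAC; ring.
have r2 : rh ^+ 2 <= rh by rewrite expr2 ler_piMl// ltW.
have r2s : rh ^+ 2 <= rh `^ (2 * s).
  rewrite -powR_mulrn ?(ltW rh0)//; apply: ger_powR; first by rewrite rh0.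
  by have /andP[_ h] := s01; rewrite -[leRHS]mulr1 ler_pM2l// ltW.
have k1 : ka <= 2^-1 by rewrite ge_min lexx.
have k2 : ka <= theta / 2 by rewrite ge_min lexx orbT.
have c1 : D < rh / 2.
  apply: (lt_le_trans hk'); rewrite AE mulrC; apply: ler_pM => //; [exact: sqr_ge0|exact: ltW].
have c2 : D < theta * rh `^ (2 * s) / 2.
  apply: (lt_le_trans hk'); rewrite AE mulrAC; apply: ler_pM => //; [exact: ltW|exact: sqr_ge0].
apply: le_trans (near_value i t10 h1 h2 h3 h4 h5 h6 c1 c2) _.
apply: (@le_trans _ _ (12 * M / A `^ holder_exp * (A * X ^+ k.+1) `^ holder_exp)); last first.
  rewrite ler_wpM2l//; apply: ge0_ler_powR; rewrite ?nnegrE ?(ltW a0) ?(ltW D0)//.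
  by apply: mulr_ge0; [exact: ltW|apply: exprn_ge0; exact: ltW].
have -> : (A * X ^+ k.+1) `^ holder_exp = A `^ holder_exp * (X ^+ k.+1) `^ holder_exp.
  by apply: powRM; [exact: ltW|apply: exprn_ge0; exact: ltW].
have Xq : X `^ holder_exp = q by exact: holder_exp_powR.
rewrite (@powR_exprn X _ k.+1 (ltW X0)) Xq [leRHS]mulrA divfK ?gt_eqF//.
rewrite exprS.
have := ler_wpM2r (mulr_ge0 (exprn_ge0 k (ltW q0)) (ltW M0)) q_ge.
have -> : 12 * M * (q * q ^+ k) = 12 * (q * (q ^+ k * M)) by ring.
lra.
Qed.

(** The exceptional set of the decay estimate depends on the vertex. Restricting to rational
    vertices leaves countably many null sets, and [near_value] transfers the value from a rational
    vertex slightly later than the given point. *)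
Lemma value_ae : {ae mu, forall w, -1 < w.2 -> w.2 < 1 -> forall i, v w i = u i w}.
Proof.
pose T := ('rV[rat]_N * rat * nat)%type.
pose zq (t : T) : Z := (map_mx ratr t.1.1, ratr t.1.2 : measurableTypeR R).
pose Pt (t : T) w := -1 < (zq t).2 -> (zq t).2 <= 1 ->
  pcyl (zq t).1 (zq t).2 (dl ^+ t.2 * rad (zq t).2) w ->
  forall i, `|u i w - v (zq t) i| <= 3 * (q ^+ t.2 * M).
have hP t : {ae mu, forall w, Pt t w}.
  have [h1|h1] := ltP (-1) (zq t).2; last by apply: aeW => w h; move: h1; rewrite leNgt h.
  have [h2|h2] := leP (zq t).2 1; last by apply: aeW => w _ h; move: h2; rewrite ltNge h.
  by apply: filterS (uv h1 h2 t.2) => w hw _ _; exact: hw.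
have hall : {ae mu, forall w, forall j : nat, if @unpickle T j is Some t then Pt t w else True}.
  by apply: ae_foralln => j; case: (unpickle j) => [t|]; [exact: hP|exact: aeW].
apply: filterS hall => w hw w1 w2 i.
have {}hw t : Pt t w by have := hw (pickle t); rewrite pickleK.
apply/eqP; rewrite -subr_eq0 -normr_le0; apply/ler_addgt0Pr => e e0; rewrite add0r.
have [k hk] := expr_small q0 q_lt (divr_gt0 e0 (mulr_gt0 (ltr0n R 9) M0)).
pose rh := dl ^+ k * rad w.2.
have rh0 : 0 < rh by rewrite mulr_gt0 ?exprn_gt0 ?rad_gt0.
have p0 : 0 < theta * rh `^ (2 * s) by rewrite mulr_gt0 ?powR_gt0.
pose D := Num.min (rh / 4) (theta * rh `^ (2 * s) / 4).
have D0 : 0 < D by rewrite lt_min !divr_gt0.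
have D1 : D <= rh / 4 by rewrite ge_min lexx.
have D2 : D <= theta * rh `^ (2 * s) / 4 by rewrite ge_min lexx orbT.
have [tq htq] : exists tq : rat, ratr tq \in `]w.2, Num.min 1 (w.2 + D)[.
  by apply: rat_in_itvoo; rewrite lt_min w2 ltrDl.
move: htq; rewrite in_itv/= lt_min => /and3P[t1 t2 t3].
have hx j : exists x : rat, ratr x \in `]w.1 0 j - D, w.1 0 j + D[.
  by apply: rat_in_itvoo; lra.
have [xq hxq] := choice hx.
pose t : T := (\row_j xq j, tq, k).
have x1 : `|w.1 - (zq t).1| < D.
  apply/rV_norm_lt => // j; rewrite !mxE.
  by have := hxq j; rewrite in_itv/= ltr_norml => /andP[? ?]; apply/andP; split; lra.
have x2 : `|w.2 - (zq t).2 : R| <= D.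
  by rewrite /= ler_norml; apply/andP; split; lra.
have g1 : -1 < (zq t).2 by rewrite /=; lra.
have g2 : (zq t).2 <= 1 by exact: ltW.
have e1 : `|u i w - v (zq t) i| <= 3 * (q ^+ k * M).
  apply: hw => //; have rr : rh <= dl ^+ k * rad (zq t).2.
    by rewrite ler_pM2l ?exprn_gt0//; apply: rad_le => //; exact: ltW.
  apply: (pcyl_sub s01 (ltW rh0) rr); split; first by rewrite distrC; lra.
  by apply/andP; split => //=; lra.
have e2 : `|v w i - v (zq t) i| <= 6 * (q ^+ k * M).
  by apply: (@near_value w.2 w (zq t) k D i w1 (lexx _) (ltW t1) (ltW w2) g2 (ltW x1) x2); rewrite -/rh; lra.
have -> : v w i - u i w = (v w i - v (zq t) i) - (u i w - v (zq t) i) by ring.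
apply: le_trans (ler_normB _ _) _.
move: hk; rewrite ler_pdivlMr ?mulr_gt0// => hk.
have E : q ^+ k * (9 * M) = 9 * (q ^+ k * M) by ring.
lra.
Qed.

End holder.

(** * Assembly for the abstract notion of solution *)

Section abstract_regularity.
Context {R : realType} {n : nat} (s : R).
Hypothesis s01 : 0 < s < 1.
Local Notation N := n.+1.
Local Notation mu := (@leb_rVT R N).
Local Notation Z := ('rV[R]_N * measurableTypeR R)%type.

Lemma wsol_holder m (u : 'I_m.+1 -> Z -> R) (M : R) (B : Z -> R) :
  wsol s u M B -> 0 < M -> M < 1 -> (forall w, \sum_i u i w ^+ 2 <= M ^+ 2) ->
  exists2 alpha : R, 0 < alpha < 1 & exists2 v : Z -> 'I_m.+1 -> R,
    {ae mu, forall w, -1 < w.2 -> w.2 < 1 -> forall i, v w i = u i w} &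
    forall t1 : R, -1 < t1 -> exists C : R, forall (z z' : Z) (D : R) i,
      t1 <= z.2 -> t1 <= z'.2 -> z.2 <= 1 -> z'.2 <= 1 ->
      `|z.1 - z'.1| <= D -> `|z.2 - z'.2 : R| <= D ->
      `|v z i - v z' i| <= C * D `^ alpha.
Proof.
move=> W M0 M1 uM.
have s2 : 0 < 2 * s by have /andP[h _] := s01; rewrite mulr_gt0.
pose C1 := @fconst R n s * kC (n := n) s * 4 `^ (2 * s).
have C10 : 0 <= 72 * C1.
  by rewrite mulr_ge0// mulr_ge0 ?powR_ge0// mulr_ge0 ?ltW ?kC_gt0 ?fconst_gt0.
have [q [d1 [/andP[q1 q2] /andP[d10 d11] osc]]] := oscillation s01 W M0 M1 uM C10.
have q0 : 0 < q by apply: lt_le_trans q1; rewrite invr_gt0.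
(* The ratio from [oscillation] is decreased, which is harmless since cylinders only shrink, to
   obtain $\delta<1$ and the summability condition $\delta^{2s}\le q^2/2$. *)
have [dl dl0 [dle dls]] : exists2 l, 0 < l & l <= Num.min (d1 / 2) (q ^+ 2 / 2) /\
    l `^ (2 * s) <= Num.min (d1 / 2) (q ^+ 2 / 2).
  by apply: powR_small => //; rewrite lt_min !divr_gt0// exprn_gt0.
have dld : dl <= d1 / 2 by apply: le_trans dle _; rewrite ge_min lexx.
have dl1 : dl < 1 by lra.
have dlS : dl `^ (2 * s) <= q ^+ 2 / 2 by apply: le_trans dls _; rewrite ge_min lexx orbT.
have osc' x0 t0 rh d (cc : 'I_m.+1 -> R) G Dg : 0 < rh -> 0 < d <= M ->
    -1 < t0 - theta (n := n) s * rh `^ (2 * s) -> t0 <= 1 ->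
    radial_tail s (n := n) G Dg rh (72 * C1 * d ^+ 2) ->
    {ae mu, forall w, t0 - theta (n := n) s * rh `^ (2 * s) < w.2 -> w.2 < t0 ->
      \sum_i (u i w - cc i) ^+ 2 <= d ^+ 2 + G `|x0 - w.1|} ->
    exists c' : 'I_m.+1 -> R, {ae mu, forall w, pcyl s x0 t0 (dl * rh) w ->
      \sum_i (u i w - c' i) ^+ 2 <= (q * d) ^+ 2}.
  move=> rh0 dM t1 t01 tG hle; have [c' Hc'] := osc _ _ _ _ _ _ _ rh0 dM t1 t01 tG hle.
  exists c'; apply: filterS Hc' => w hw Cw; apply: hw; apply: pcyl_sub Cw => //.
    by rewrite mulr_ge0// ltW.
  by rewrite ler_pM2r//; lra.
have ex (z : Z) : exists v : 'I_m.+1 -> R, -1 < z.2 -> z.2 <= 1 -> forall k,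
    {ae mu, forall w, pcyl s z.1 z.2 (dl ^+ k * rad (n := n) s z.2) w ->
      forall i, `|u i w - v i| <= 3 * (q ^+ k * M)}.
  have [z1|z1] := ltP (-1) z.2; last by exists (fun=> 0).
  have [z2|z2] := leP z.2 1; last by exists (fun=> 0).
  have [v Hv] := limit_value s01 M0 uM q1 q2 dl0 dl1 dlS osc' z.1 (rad_gt0 s01 z1) (rad_time s01 z1) z2.
  by exists v.
have [v Hv] := choice ex.
have uMi w i : `|u i w| <= M.
  rewrite -(@ler_pXn2r _ 2)// ?nnegrE ?(ltW M0)// real_normK ?num_real//.
  by apply: le_trans (uM w); rewrite (bigD1 i)//= lerDl sumr_ge0// => j _; exact: sqr_ge0.
exists (holder_exp q dl).
  rewrite (holder_exp_gt0 q1 q2 dl0 dl1)/=; exact: (holder_exp_lt1 s01 q1 q2 dl0 dl1 dlS).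
exists v; first exact: (value_ae s01 M0 q1 q2 dl0 Hv).
exact: (holder_bound s01 M0 uMi q1 q2 dl0 dl1 Hv).
Qed.

End abstract_regularity.

(** * Null sets of space-time and their spatial slices *)

Section null_slices.
Context {R : realType} {n : nat} (s : R).
Hypothesis s01 : 0 < s < 1.
Local Notation N := n.+1.
Local Notation lam := (@lebesgue_rV R N).
Local Notation mu := (@leb_rVT R N).
Local Notation Z := ('rV[R]_N * measurableTypeR R)%type.
Implicit Types (z w : Z) (y : 'rV[R]_N).

(** Fubini with the cut kernels as integrable weights, on countably many boxes: a null set meets
    almost every slice in a set without mass for these kernels, which together charge every point
    except the origin. *)
Lemma null_slices (P : Z -> Prop) : {ae mu, forall z, P z} ->
  {ae mu, forall z, {ae lam, forall y, P (z - (y, 0 : measurableTypeR R))}}.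
Proof.
move=> aeP; have [A [mA A0 AP]] := aeP.
have inP z : ~ A z -> P z by move=> nA; apply: contrapT => nP; apply: nA; exact: AP.
have [iA EA] := ible_indic mA A0.
pose f z y : R := \1_A (z - (y, 0 : measurableTypeR R)).
have mf : measurable_fun setT (fun p : Z * 'rV[R]_N => f p.1 p.2).
  apply: (measurableT_comp (f := \1_A : Z -> R)); first exact: measurable_indic.
  apply: measurable_Z_sub => //.
  by apply: measurable_fun_pair => //; exact: measurable_snd.
have f1 z y : `|f z y| <= 1 by rewrite ger0_norm ?indic_ge0 ?indic_le1.
have ek k : 0 < k.+1%:R^-1 :> R by rewrite invr_gt0.
have ik k := ke_ible (n := n) s01 (ek k).
have key j k : {ae mu, forall z, \1_(Dbox j.+1%:R) z * \int[lam]_y (f z y * ke s k.+1%:R^-1 y) = 0 :> R}.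
  have iD := @Dbox_ible R n j.+1%:R ltac:(by rewrite ltr0n).
  have mI := meas_int2 (ik k) mf f1.
  have bI := int2_bound (ik k) mf f1.
  have i1 : ible mu (fun z => \1_(Dbox j.+1%:R) z * \int[lam]_y (f z y * ke s k.+1%:R^-1 y)).
    by apply: ible_cvt (ibleM mI bI iD) => z; rewrite mulrC.
  apply: (int_gt0_ex i1).
    move=> z; rewrite mulr_ge0 ?indic_ge0//; apply: int_ge0 => y.
    by rewrite mulr_ge0 ?indic_ge0// ke_ge0.
  rewrite (int_swap iD (ik k) mf f1) (eq_int _ (g := fun=> 0)) ?int0// => y.
  rewrite [X in _ * X](_ : _ = 0) ?mulr0//.
  have iA' := ible_shift (y, 0 : measurableTypeR R) iA.
  have EA' := int_shift (y, 0 : measurableTypeR R) iA.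
  apply/eqP; rewrite eq_le; apply/andP; split; last first.
    by apply: int_ge0 => z; rewrite mulr_ge0 ?indic_ge0.
  rewrite -EA -EA'; apply: int_le => //.
    apply: (@ible_le _ _ _ _ (fun z => \1_A (z - (y, 0 : measurableTypeR R)))) => //.
      apply: measurable_funM; [exact: ible_meas iA'|exact: ible_meas iD].
    by move=> z; rewrite ger0_norm ?mulr_ge0 ?indic_ge0// ler_piMr ?indic_ge0 ?indic_le1.
  by move=> z; rewrite ler_piMr ?indic_ge0 ?indic_le1.
have all : {ae mu, forall z, forall j k, \1_(Dbox j.+1%:R) z * \int[lam]_y (f z y * ke s k.+1%:R^-1 y) = 0 :> R}.
  by apply: ae_foralln => j; apply: ae_foralln => k; exact: key.
apply: filterS2 all aeP => z Hz Pz.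
have [j hj] : exists j : nat, Dbox j.+1%:R z.
  exists (Num.bound (`|z.1| + `|z.2 : R|)).
  have hb : `|z.1| + `|z.2 : R| < (Num.bound (`|z.1| + `|z.2 : R|)).+1%:R.
    apply: lt_trans (archi_boundP _) _; [exact: addr_ge0|by rewrite ltr_nat].
  split; first by rewrite sub0r normrN; apply: le_lt_trans hb; rewrite lerDl.
  by rewrite -ltr_norml; apply: le_lt_trans hb; rewrite lerDr.
have Hk k : \int[lam]_y (f z y * ke s k.+1%:R^-1 y) = 0.
  by have := Hz j k; rewrite indicE mem_set// mul1r.
have ay : {ae lam, forall y, forall k, f z y * ke s k.+1%:R^-1 y = 0}.
  apply: ae_foralln => k; apply: int_gt0_ex (Hk k); first exact: ible_swapl (ik k) mf f1 z.
  by move=> y; rewrite mulr_ge0 ?indic_ge0// ke_ge0.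
apply: filterS ay => y Hy.
have [->|y0] := eqVneq y 0; first by rewrite (_ : z - _ = z) ?subr0.
apply: inP => Az.
have ey : 0 < enorm y by exact: enorm_gt0.
have [k hk] : exists k : nat, k.+1%:R^-1 < enorm y.
  exists (Num.bound (enorm y)^-1).
  rewrite invf_plt ?posrE//.
  by apply: lt_trans (archi_boundP _) _; rewrite ?invr_ge0 ?(ltW ey)// ltr_nat.
have := Hy k; rewrite /f indicE mem_set// mul1r /ke hk mulr1 => /eqP.
rewrite mulf_eq0 gt_eqF ?fconst_gt0//=; apply/negP.
by rewrite /fkernel invr_eq0 gt_eqF// powR_gt0.
Qed.

Lemma ible_fine d (T : measurableType d) (nu : {measure set T -> \bar R}) (F : T -> \bar R) :
  nu.-integrable setT F -> ible nu (fun x => fine (F x)).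
Proof.
move=> iF; have mF := measurable_int nu iF.
apply: (le_integrable measurableT _ _ iF).
  by apply/measurable_EFinP; apply: (measurableT_comp (f := fine)) => //; exact: measurable_fine.
move=> x _ /=; case: (F x) => [r||] //=; first by rewrite normr0 leey.
by rewrite normr0 leey.
Qed.

End null_slices.

(** * From the weak solution to truncated data *)

Section from_weak.
Context {R : realType} {n m : nat} (s : R).
Hypothesis s01 : 0 < s < 1.
Local Notation N := n.+1.
Local Notation lam := (@lebesgue_rV R N).
Local Notation mu := (@leb_rVT R N).
Local Notation Z := ('rV[R]_N * measurableTypeR R)%type.
Local Notation c := (@fconst R n s).
Variable u : 'rV[R]_N * R -> 'rV[R]_m.+1.
Implicit Types (z w : Z).

Lemma supnorm_bound : (supnorm (strip `]-1, 1[%R) u < 1)%E ->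
  exists2 M : R, 0 < M < 1 & {ae mu, forall z, -1 < z.2 -> z.2 < 1 -> enorm (u z) <= M}.
Proof.
rewrite /supnorm unlock; set F := _ \_ _.
have T0 : (0 < lebesgue_rVT n.+1 [set: 'rV[R]_N * R])%E.
  have [mC EC] := @cyl_measure R n 0 1 0 1 ltr01 ler01.
  apply: (@lt_le_trans _ _ (mu (cyl (0 : 'rV[R]_N) 1 0 1))).
    by rewrite EC lte_fin mulr_gt0 ?exprn_gt0// subr_gt0.
  by apply: le_measure; rewrite ?inE.
rewrite T0 => h; set e := ess_sup _ _ in h.
have ae := ess_sup_ge (lebesgue_rVT n.+1) (abse \o F); rewrite -/e in ae.
(* The maximum with $1/2$ only ensures $M>0$, also when $u$ vanishes. *)
have [M M01 eM] : exists2 M : R, 0 < M < 1 & (e <= M%:E)%E.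
  case: e h {ae} => [e||] //; last by exists 2^-1; rewrite ?leNye//; apply/andP; split; lra.
  rewrite lte_fin => e1; exists (Num.max 2^-1 e); last by rewrite lee_fin le_max lexx orbT.
  by rewrite lt_max gt_max e1; apply/andP; split; [apply/orP; left|rewrite andbT]; lra.
exists M => //; apply: filterS ae => z hz z1 z2.
have := le_trans hz eM; rewrite /F /= patchT; last first.
  by rewrite inE; split => //=; rewrite in_itv/= z1.
by rewrite /= lee_fin ger0_norm ?sqrtr_ge0.
Qed.

Let stripT (I : interval R) := [set z : Z | z.2 \in I].

Lemma measurable_strip (I : interval R) : measurable (strip I : set Z).
Proof. by apply: measurableX => //; exact: measurable_itv. Qed.

Variables (M : R).
Hypothesis M0 : 0 < M.
Hypothesis uM : {ae mu, forall z, -1 < z.2 -> z.2 < 1 -> enorm (u z) <= M}.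
Hypothesis wu : weak_solution s u.

(** The components are set to $0$ off this set, so that the bound holds at every point while almost
    every value in the open strip is unchanged. *)
Let E : set Z := strip `]-1, 1[ `&` [set z | enorm (u z) <= M].

Definition utr (i : 'I_m.+1) : Z -> R := (fun z => u z 0 i) \_ E.

Let mu_strip : measurable_fun (strip `]-1, 1[ : set Z) u.
Proof.
case: wu => mu1 _ _; apply: (measurable_funS (measurable_strip `]-1, 1]) _ mu1).
move=> z [_ /=]; rewrite !in_itv/= => /andP[h1 h2]; split => //=.
by rewrite in_itv/= h1 ltW.
Qed.

Let mui i : measurable_fun (strip `]-1, 1[ : set Z) (fun z => u z 0 i).
Proof. by apply: (measurableT_comp (f := fun x : 'rV[R]_m.+1 => x 0 i)) => //; exact: measurable_coord. Qed.

Let mE : measurable E.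
Proof.
have me : measurable_fun (strip `]-1, 1[ : set Z) (fun z => enorm (u z)).
  by apply: (measurableT_comp (f := @enorm R m.+1)) => //; exact: measurable_enorm.
rewrite (_ : E = strip `]-1, 1[ `&` (fun z => enorm (u z)) @^-1` `]-oo, M]%classic).
  by apply: me => //; exact: measurable_strip.
by apply/seteqP; split => z [h1 h2]; split => //; move: h2; rewrite /= in_itv/=.
Qed.

Lemma utrE i z : E z -> utr i z = u z 0 i.
Proof. by move=> Ez; rewrite /utr patchT// inE. Qed.

Lemma utr0 i z : ~ E z -> utr i z = 0.
Proof. by move=> Ez; rewrite /utr patchC// inE. Qed.

Lemma utr_sqr z : \sum_i utr i z ^+ 2 <= M ^+ 2.
Proof.
have [Ez|Ez] := pselect (E z); last first.
  by rewrite big1 ?sqr_ge0// => i _; rewrite utr0// expr0n.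
have [_ h] := Ez; under eq_bigr do rewrite utrE//.
by rewrite -dotpE -[leLHS](sqr_sqrtr (dotp_ge0 _)) lerXn2r ?nnegrE ?sqrtr_ge0// ltW.
Qed.

Lemma utr_bmeas i : bmeas (utr i) M.
Proof.
split.
  apply/(measurable_restrict (D := E) (E := setT) _ mE measurableT); rewrite setTI.
  by apply: (measurable_funS (measurable_strip `]-1, 1[) _ (mui i)) => z [].
move=> z; rewrite -(@ler_pXn2r _ 2)// ?nnegrE ?(ltW M0)// real_normK ?num_real//.
by apply: le_trans (utr_sqr z); rewrite (bigD1 i)//= lerDl sumr_ge0// => j _; exact: sqr_ge0.
Qed.

Lemma utr_ae : {ae mu, forall z, -1 < z.2 -> z.2 < 1 -> forall i, utr i z = u z 0 i}.
Proof.
apply: filterS uM => z hz z1 z2 i; apply: utrE; split; last exact: hz.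
by split => //=; rewrite in_itv/= z1.
Qed.

Lemma calBt_ge0 z : (0 <= calBt s u z)%E.
Proof.
apply: mule_ge0; first by rewrite lee_fin divr_ge0// ltW// fconst_gt0.
by apply: integral_ge0 => y _; rewrite lee_fin mulr_ge0 ?dotp_ge0 ?fkernel_ge0.
Qed.

Definition Btr z : R := fine (calBt s u z).

Lemma Btr_ge0 z : 0 <= Btr z.
Proof. by rewrite fine_ge0// calBt_ge0. Qed.

(** The closed cylinder is a compact part of the strip even when it reaches $t=1$, which is why
    local integrability is required up to that time. *)
Lemma calBt_cyl (a : 'rV[R]_N) (r t1 t2 : R) : 0 < r -> -1 < t1 -> t2 <= 1 ->
  measurable (cyl a r t1 t2) -> mu.-integrable (cyl a r t1 t2) (calBt s u).
Proof.
move=> r0 t1l t2l mC; case: wu => _ loc _.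
pose K : set ('rV[R]_N * R) := [set x | `|a - x| <= r] `*` `[t1, t2]%classic.
have cK : compact K.
  apply: compact_setX; last exact: segment_compact.
  rewrite (_ : mkset _ = [set x : 'rV[R]_N | forall i, `[a 0 i - r, a 0 i + r]%classic (x ord0 i)]).
    by apply: (@rV_compact R N (fun i => `[a 0 i - r, a 0 i + r]%classic)) => i; exact: segment_compact.
  apply/seteqP; split => x /=.
    move=> h i; have /rV_norm_le := h => /(_ (ltW r0) i); rewrite !mxE in_itv/= ler_norml => /andP[? ?].
    by apply/andP; split; lra.
  move=> h; apply/rV_norm_le; first exact: ltW.
  move=> i; have := h i; rewrite !mxE in_itv/= ler_norml => /andP[? ?].
  by apply/andP; split; lra.
have KS : K `<=` strip `]-1, 1].
  move=> z [_ /=]; rewrite in_itv/= => /andP[h1 h2]; split => //=.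
  by rewrite in_itv/= (lt_le_trans t1l h1) (le_trans h2).
have iK := loc K cK KS.
have mK : measurable (K : set Z).
  apply: measurableX; last exact: measurable_itv.
  rewrite (_ : mkset _ = (fun x : 'rV[R]_N => `|a - x|) @^-1` `]-oo, r]%classic).
    rewrite -[X in measurable X]setTI.
    have mn : measurable_fun setT (fun x : 'rV[R]_N => `|a - x|).
      apply: (measurableT_comp (f := fun x : 'rV[R]_N => `|x|)); first exact: measurable_norm_rV.
      exact: measurable_rV_add.
    exact: mn.
  by apply/seteqP; split => x /=; rewrite in_itv/=.
apply: (@integrableS _ _ _ mu (K : set Z) _ (calBt s u) mK mC _ iK) => z [h1 /andP[h2 h3]]; split; first exact: ltW.
by rewrite /= in_itv/= !ltW.
Qed.

Lemma Btr_ible (a : 'rV[R]_N) (r t1 t2 : R) : 0 < r -> -1 < t1 -> t1 < t2 -> t2 <= 1 ->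
  ible mu (fun w => Btr w * \1_(cyl a r t1 t2) w).
Proof.
move=> r0 t1l t12 t2l; have [mC _] := cyl_measure a r0 (ltW t12).
have iC := calBt_cyl r0 t1l t2l mC.
have /integrable_mkcond iC' := iC; have {}iC' := ible_fine (iC' mC).
apply: ible_cvt iC' => w /=; congr EFin; rewrite /patch indicE /Btr.
by case: (w \in _); rewrite ?mulr1 ?mulr0.
Qed.

(** Integrability on countably many cylinders that exhaust the open strip. *)
Lemma calBt_fin_ae : {ae mu, forall z, -1 < z.2 -> z.2 < 1 -> calBt s u z = (Btr z)%:E}.
Proof.
have all : {ae mu, forall z, forall j : nat,
    cyl (0 : 'rV[R]_N) j.+1%:R (-1 + j.+1%:R^-1) 1 z -> calBt s u z \is a fin_num}.
  apply: ae_foralln => j; have j0 : 0 < j.+1%:R :> R by rewrite ltr0n.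
  have j1 : j.+1%:R^-1 <= 1 :> R by rewrite invf_le1// ler1n.
  have j2 : 0 < j.+1%:R^-1 :> R by rewrite invr_gt0.
  have h1 : -1 + j.+1%:R^-1 <= 1 :> R by move: j1; set q := _^-1 => j1; lra.
  have h2 : -1 < -1 + j.+1%:R^-1 :> R by rewrite ltrDl.
  have [mC _] := @cyl_measure R n 0 j.+1%:R (-1 + j.+1%:R^-1) 1 j0 h1.
  by apply: (integrable_ae mC); exact: calBt_cyl.
apply: filterS all => z Hz z1 z2; rewrite /Btr fineK//.
have hb : 0 < z.2 + 1 by lra.
pose j := Num.bound (`|z.1| + (z.2 + 1)^-1).
have h0 : `|z.1| + (z.2 + 1)^-1 < j.+1%:R.
  apply: lt_trans (archi_boundP _) _; last by rewrite ltr_nat.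
  by rewrite addr_ge0// invr_ge0 ltW.
apply: (Hz j); split.
  by rewrite sub0r normrN; apply: le_lt_trans h0; rewrite lerDl invr_ge0 ltW.
apply/andP; split => //.
suff : j.+1%:R^-1 < z.2 + 1 by set q := j.+1%:R^-1 => h; lra.
rewrite invf_plt ?posrE//; apply: le_lt_trans h0; by rewrite lerDr.
Qed.

End from_weak.

(** * A weak solution satisfies the abstract hypotheses *)

Section weak_wsol.
Context {R : realType} {n m : nat} (s : R).
Hypothesis s01 : 0 < s < 1.
Local Notation N := n.+1.
Local Notation lam := (@lebesgue_rV R N).
Local Notation mu := (@leb_rVT R N).
Local Notation Z := ('rV[R]_N * measurableTypeR R)%type.
Local Notation c := (@fconst R n s).
Local Notation K := (@fkernel R n s).
Variable u : 'rV[R]_N * R -> 'rV[R]_m.+1.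
Variables (M : R).
Hypothesis M0 : 0 < M.
Hypothesis uM : {ae mu, forall z, -1 < z.2 -> z.2 < 1 -> enorm (u z) <= M}.
Hypothesis wu : weak_solution s u.
Implicit Types (z w : Z) (y : 'rV[R]_N).

Local Notation ut := (utr u M).
Local Notation B := (Btr s u).
Let but := utr_bmeas M0 wu.
Let uae := utr_ae uM.
Let Bae := calBt_fin_ae wu.
Let c0 : 0 < c. Proof. exact: fconst_gt0. Qed.

Let S z y : R := \sum_i (ut i z - ut i (z - (y, 0 : measurableTypeR R))) ^+ 2.

Let S_ge0 z y : 0 <= S z y. Proof. by apply: sumr_ge0 => i _; exact: sqr_ge0. Qed.

Let mS z : measurable_fun setT (S z).
Proof.
apply: measurable_sum => i; apply: measurable_funX; apply: measurable_funB => //.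
apply: (measurableT_comp (f := ut i)); first exact: (but i).1.
by apply: measurable_Z_sub => //; exact: measurable_fun_pair.
Qed.

Let inS z : -1 < z.2 -> z.2 < 1 -> (strip `]-1, 1[ : set Z) z.
Proof. by move=> h1 h2; split => //=; rewrite in_itv/= h1. Qed.

(** Replaces $u$ by its truncation under the integral at a fixed point. This needs the two to agree
    almost everywhere on that spatial slice, which [null_slices] provides for almost every point. *)
Let calBt_S z : -1 < z.2 -> z.2 < 1 -> (forall i, ut i z = u z 0 i) ->
  {ae lam, forall y, forall i, ut i (z - (y, 0 : measurableTypeR R)) = u (z - (y, 0 : R)) 0 i} ->
  calBt s u z = ((c / 2)%:E * \int[lam]_y (S z y * K y)%:E)%E.
Proof.
move=> z1 z2 hz hy.
pose H y := (dotp (u (z.1, z.2) - u (z.1 - y, z.2)) (u (z.1, z.2) - u (z.1 - y, z.2)) * K y)%:E.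
have mH : measurable_fun setT H.
  apply/measurable_EFinP; apply: measurable_funM; last exact: measurable_fkernel.
  apply: (measurableT_comp (f := fun x : 'rV[R]_m.+1 => dotp x x)); first exact: measurable_dotp.
  apply: measurable_rV_add => //.
  have mu_strip : measurable_fun (strip `]-1, 1[ : set Z) u.
    case: wu => mu1 _ _; apply: (measurable_funS (measurable_strip `]-1, 1]) _ mu1).
    move=> w [_ /=]; rewrite !in_itv/= => /andP[h1 h2]; split => //=.
    by rewrite in_itv/= h1 ltW.
  apply: (@measurable_comp _ _ _ _ _ _ (strip `]-1, 1[ : set Z) u setT
    (fun y : 'rV[R]_N => (z.1 - y, z.2 : measurableTypeR R))) => //.
  - exact: measurable_strip.
  - by move=> _ [y _ <-]; exact: inS.
  - by apply: measurable_fun_pair => //; exact: measurable_rV_add.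
have H0 y : (0 <= H y)%E by rewrite lee_fin mulr_ge0 ?dotp_ge0 ?fkernel_ge0.
suff E1 : (\int[lam]_y (dotp (u (z.1, z.2) - u (y, z.2)) (u (z.1, z.2) - u (y, z.2)) * K (z.1 - y))%R%:E =
    \int[lam]_y (S z y * K y)%:E)%E by rewrite /calBt /calB E1.
transitivity (\int[lam]_y H (z.1 - y)%R)%E.
  by apply: eq_integral => y _; rewrite /H subKr.
rewrite (preserves_integral (lebesgue_rV_subl z.1) mH H0).
apply: ae_eq_integral => //.
  by apply/measurable_EFinP; apply: measurable_funM => //; exact: measurable_fkernel.
apply: filterS hy => y hy _; rewrite /H; congr (_ * _)%:E.
rewrite dotpE; apply: eq_bigr => i _; rewrite hz hy !mxE.
have -> : z - (y, 0 : R) = (z.1 - y, z.2) :> 'rV[R]_N * R by rewrite [LHS]surjective_pairing /= subr0.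
by rewrite -surjective_pairing.
Qed.

Let good_ae : {ae mu, forall z, -1 < z.2 -> z.2 < 1 ->
  ible lam (fun y => S z y * (c * K y)) /\ \int[lam]_y (S z y * (c * K y)) = 2 * B z}.
Proof.
apply: filterS3 uae (null_slices s01 uae) Bae => z hz hy hB z1 z2.
have E := calBt_S z1 z2 (hz z1 z2) _.
have {}E : calBt s u z = ((c / 2)%:E * \int[lam]_y (S z y * K y)%:E)%E.
  apply: E; apply: filterS hy => y hy i; apply: hy; rewrite /= subr0//.
rewrite hB// in E.
have c2 : 0 < c / 2 by rewrite divr_gt0.
have mSK : measurable_fun setT (fun y => S z y * K y).
  by apply: measurable_funM => //; exact: measurable_fkernel.
have SK0 y : 0 <= S z y * K y by rewrite mulr_ge0 ?fkernel_ge0.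
have I0 : (0 <= \int[lam]_y (S z y * K y)%:E)%E.
  by apply: integral_ge0 => y _; rewrite lee_fin.
have fin : (\int[lam]_y (S z y * K y)%:E < +oo)%E.
  rewrite ltey; apply/eqP => Iy; move: E; rewrite Iy.
  by rewrite gt0_muley// lte_fin.
have i1 : ible lam (fun y => S z y * K y) by exact: (ible_ge0 mSK SK0 (lexx _) fin).
have i2 : ible lam (fun y => S z y * (c * K y)).
  by apply: ible_cvt (ibleZ c i1) => y /=; congr EFin; ring.
split => //; rewrite (eq_int _ (g := fun y => c * (S z y * K y))); last by move=> y; ring.
rewrite intZ//; move: E; rewrite ible_fin// => -[->].
by rewrite mulrA; congr (_ * _); field.
Qed.

Let Sq_sum e z : 0 < e -> \sum_i Sq s e (ut i) z = \int[lam]_y (S z y * ke s e y).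
Proof.
move=> e0; rewrite -int_sum; last by move=> i; exact: (Sq_ible s01 z e0 (but i)).
by apply: eq_int => y; rewrite mulr_suml.
Qed.

Let ke_le e y : ke s e y <= c * K y.
Proof.
rewrite /ke ler_pM2l// ler_piMr ?fkernel_ge0//.
by case: (e < enorm y); rewrite ?ler01.
Qed.

Let ek k : 0 < k.+1%:R^-1 :> R. Proof. by rewrite invr_gt0. Qed.

Let mSke z e : measurable_fun setT (fun y => S z y * ke s e y).
Proof. by apply: measurable_funM => //; exact: measurable_ke. Qed.

Let Ske_le z e y : `|S z y * ke s e y| <= S z y * (c * K y).
Proof. by rewrite (ger0_norm (mulr_ge0 (S_ge0 _ _) (ke_ge0 s01 _ _))) ler_wpM2l. Qed.

(** The test function is the mollifier reflected about $z$, so the time derivative changes sign and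
    the adjoint operator of the weak formulation becomes [Linf]. *)
Let fraclap_derive eps eta deta C z (w : 'rV[R]_N * R) : moll eps eta deta C ->
  fraclap s (fun x => eta (z - (x, w.2 : measurableTypeR R))) w.1 -
  derive1 (fun t => eta (z - (w.1, t : measurableTypeR R))) w.2 = Linf s eta deta (z - w).
Proof.
move=> H; rewrite (fraclap_moll s01 _ _ _ (moll_gt0 H) H) -surjective_pairing.
rewrite /Linf; congr (_ + _).
have D1 := moll_derive H (z.1 - w.1) (z.2 - w.2).
have D2 : is_derive (w.2 : R) 1 (fun t : R => z.2 - t) (0 - 1 : R) by exact: is_deriveB.
have D3 := @is_derive1_comp R (fun t' : R => eta (z.1 - w.1, t' : measurableTypeR R)) (fun t : R => z.2 - t) w.2 _ _ D1 D2.
rewrite derive1E; have [_ ->] := D3.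
rewrite sub0r mulrN1 opprK; congr (deta _).
Qed.

(** The weak formulation with the test function $w\mapsto\eta(z-w)$. The remaining work replaces $u$
    and $\mathcal{B}(u,u)$ by [utr] and [Btr], almost everywhere equal to them on the open strip. *)
Let weak_conv eps eta deta C z i : moll eps eta deta C -> -1 + eps < z.2 -> z.2 <= 1 ->
  conv (ut i) (Linf s eta deta) z = \int[mu]_v (ut i v * (B v * eta (z - v))).
Proof.
move=> H z1 z2; case: (wu) => mu1 _ /(_ _ (moll_test H z1 z2) i) wk.
have e0 := moll_gt0 H.
have il := Linf_ible s01 e0 H.
rewrite (conv_comm _ (but i) il).
have mst : measurable (strip `]-1, 1[ : set Z) by exact: measurable_strip.
have mu_strip : measurable_fun (strip `]-1, 1[ : set Z) u.
  apply: (measurable_funS (measurable_strip `]-1, 1]) _ mu1).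
  move=> w [_ /=]; rewrite !in_itv/= => /andP[h1 h2]; split => //=.
  by rewrite in_itv/= h1 ltW.
have mui : measurable_fun (strip `]-1, 1[ : set Z) (fun z => u z 0 i).
  by apply: (measurableT_comp (f := fun x : 'rV[R]_m.+1 => x 0 i)) => //; exact: measurable_coord.
have utS w : ~ (strip `]-1, 1[ : set Z) w -> ut i w = 0.
  by move=> nw; apply: utr0 => -[].
have L1 : (\int[mu]_(w in strip `]-1, 1[%R) (u w 0 i * Linf s eta deta (z - w))%R%:E =
    \int[mu]_w (ut i w * Linf s eta deta (z - w))%R%:E)%E.
  have mr := ible_meas (ible_refl z il).
  transitivity (\int[mu]_(w in strip `]-1, 1[%R) (ut i w * Linf s eta deta (z - w))%R%:E)%E.
    apply: ae_eq_integral => //.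
    - by apply/measurable_EFinP; apply: measurable_funM => //; exact: measurable_funTS.
    - by apply/measurable_EFinP; apply: measurable_funM; apply: measurable_funTS => //; exact: (but i).1.
    apply: filterS uae => w hw [_ /=]; rewrite in_itv/= => /andP[w1 w2].
    by rewrite hw.
  rewrite integral_mkcond; apply: eq_integral => w _; rewrite /patch.
  by case: ifPn => // /negP; rewrite inE => nw; rewrite utS// mul0r.
pose Q := cyl z.1 eps (z.2 - eps) z.2.
have QS : Q `<=` strip `]-1, 1[.
  by move=> w [_ /andP[h1 h2]]; apply: inS; lra.
have etaQ w : eta (z - w) != 0 -> Q w.
  move=> /(moll_supp H)[/= h1 /andP[h2 h3]]; split => //; apply/andP; split; lra.
have [mQ _] := @cyl_measure R n z.1 eps (z.2 - eps) z.2 e0 ltac:(lra).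
have iQ : mu.-integrable Q (calBt s u) by apply: (calBt_cyl wu e0 _ z2 mQ); lra.
have meta : measurable_fun setT (fun w : Z => eta (z - w)).
  by apply: (measurableT_comp (f := eta)); [exact: moll_meas H|exact: measurable_Z_sub].
have BQ : measurable_fun setT (fun w => B w * eta (z - w)).
  have mB := ible_meas (@Btr_ible R n m s u wu z.1 eps (z.2 - eps) z.2 e0 ltac:(lra) ltac:(lra) z2).
  rewrite (_ : (fun w => _) = (fun w => B w * \1_Q w * eta (z - w))).
    exact: measurable_funM.
  apply/funext => w; have [->|h] := eqVneq (eta (z - w)) 0; first by rewrite !mulr0.
  by rewrite indicE mem_set ?mulr1//; exact: etaQ.
have R1 : (\int[mu]_(w in strip `]-1, 1[%R) ((u w 0 i * eta (z - w))%R%:E * calBt s u w) =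
    \int[mu]_w (ut i w * (B w * eta (z - w)))%R%:E)%E.
  transitivity (\int[mu]_(w in Q) ((u w 0 i * eta (z - w))%R%:E * calBt s u w))%E.
    rewrite integral_mkcond [RHS]integral_mkcond; apply: eq_integral => w _; rewrite /patch.
    have [wQ|wQ] := boolP (w \in Q).
      by rewrite mem_set//; apply: QS; exact: set_mem.
    have -> : eta (z - w) = 0.
      by apply/eqP; apply: contraNT wQ => h; apply: mem_set; exact: etaQ.
    by rewrite mulr0 mul0e; case: ifP.
  transitivity (\int[mu]_(w in Q) (ut i w * (B w * eta (z - w)))%R%:E)%E.
    apply: ae_eq_integral => //.
    - apply: emeasurable_funM; last exact: measurable_int iQ.
      apply/measurable_EFinP; apply: measurable_funM; last exact: measurable_funTS.
      exact: measurable_funS mst QS mui.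
    - by apply/measurable_EFinP; apply: measurable_funTS; apply: measurable_funM => //; exact: (but i).1.
    apply: filterS2 uae Bae => w hw hB wQ; have [_ /=] := QS _ wQ; rewrite in_itv/= => /andP[w1 w2].
    by rewrite hB// hw// -EFinM; congr EFin; ring.
  rewrite integral_mkcond; apply: eq_integral => w _; rewrite /patch.
  case: ifPn => // wQ; rewrite (_ : eta (z - w) = 0) ?mulr0//.
  by apply/eqP; apply: contraNT wQ => h; apply: mem_set; exact: etaQ.
rewrite /Rintegral; congr fine; rewrite -L1 -R1.
apply: etrans wk; apply: eq_integral => w _; congr (_ * _)%:E.
exact/esym/(fraclap_derive z w H).
Qed.

Lemma weak_wsol : wsol s ut M B.
Proof.
split.
- exact: but.
- exact: Btr_ge0.
- by move=> a r t1 t2; exact: Btr_ible.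
- apply: filterS good_ae => w Hw w1 w2 k; have [i1 <-] := Hw w1 w2.
  rewrite Sq_sum//; apply: int_le => //; first exact: ible_le (mSke w _) (Ske_le w _) i1.
  by move=> y; rewrite ler_wpM2l.
- apply: filterS good_ae => w Hw w1 w2; have [i1 <-] := Hw w1 w2.
  under eq_fun do rewrite Sq_sum//.
  have [||||_ C] := @dct _ _ _ lam (fun k y => S w y * ke s k.+1%:R^-1 y)
    (fun y => S w y * (c * K y)) (fun y => S w y * (c * K y)) => //.
  move=> y; apply: cvg_near_cst; have [->|y0] := eqVneq y 0.
    by apply: nearW => k; rewrite /ke fkernel0 ?mul0r ?mulr0.
  have ey : 0 < enorm y by exact: enorm_gt0.
  exists (Num.bound (enorm y)^-1) => // k /= hk.
  rewrite /ke (_ : (_ < _) = true) ?mulr1// invf_plt ?posrE//.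
  apply: lt_le_trans (archi_boundP _) _; first by rewrite invr_ge0 ltW.
  by rewrite ler_nat; exact: leqW.
- by move=> eps eta deta C z i H z1 z2; exact: weak_conv H z1 z2.
Qed.

End weak_wsol.

(** * Conclusion *)

Lemma ae_imp3 d (T : measurableType d) (R : realType) (mu : {measure set T -> \bar R})
    (P Q S U : T -> Prop) : {ae mu, forall x, P x} -> {ae mu, forall x, Q x} ->
  {ae mu, forall x, S x} -> (forall x, P x -> Q x -> S x -> U x) -> {ae mu, forall x, U x}.
Proof. by move=> hP hQ hS H; apply: filterS3 hP hQ hS. Qed.

(** The final slice $t=1$ is null, so equality on the open strip gives equality almost everywhere on
    the strip that contains it. *)
Lemma ae_neq_time (R : realType) (n : nat) (t : R) :
  {ae @leb_rVT R n, forall z, z.2 <> t}.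
Proof.
exists (setT `*` [set (t : measurableTypeR R)]); split.
- by apply: measurableX => //; exact: measurable_set1.
- transitivity (lebesgue_rV n [set: 'rV[R]_n] * @lebesgue_measure R [set t])%E.
    by rewrite -product_measure1E//; exact: measurable_set1.
  by rewrite [X in (_ * X)%E](lebesgue_measure_set1 t) mule0.
- by move=> z /= /contrapT ->.
Qed.

Theorem theorem1p2 (R : realType) (n m : nat) (s : R)
    (u : 'rV[R]_n.+1 * R -> 'rV[R]_m.+1) :
  0 < s < 1 ->
  weak_solution s u ->
  (supnorm (strip `]-1, 1[%R) u < 1)%E ->
  exists2 alpha : R, 0 < alpha < 1 &
    exists2 v : 'rV[R]_n.+1 * R -> 'rV[R]_m.+1,
      {ae lebesgue_rVT n.+1, forall z, strip `]-1, 1] z -> v z = u z} &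
      holder_loc alpha (strip `]-1, 1]) v.
Proof.
move=> s01 wu /supnorm_bound[M /andP[M0 M1] uM].
have W := weak_wsol s01 M0 uM wu.
have [alpha a01 [v va vb]] := wsol_holder s01 W M0 M1 (utr_sqr u M0).
have vu : {ae @leb_rVT R n.+1, forall z : 'rV[R]_n.+1 * measurableTypeR R,
    strip `]-1, 1] z -> \row_i v z i = u z}.
  apply: (ae_imp3 va (utr_ae uM) (@ae_neq_time R n.+1 1)) => z h1 h2 z1.
  move=> [_ /=]; rewrite in_itv/= => /andP[z2 z3].
  have z4 : z.2 < 1 by rewrite lt_neqAle z3 andbT; apply/eqP.
  by apply/rowP => i; rewrite mxE h1// h2.
exists alpha => //; exists (fun z => \row_i v z i) => //.
move=> K cK KS.
have [[z0 Kz0]|K0] := pselect (K !=set0); last first.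
  by exists 0 => z w Kz; exfalso; apply: K0; exists z.
(* The least time on the compact set is larger than $-1$; the Hölder constant is uniform from that
   time on. *)
have [||zm Kzm zmin] := @compact_EVT_min _ R (fun z : 'rV[R]_n.+1 * R => z.2) K _ cK.
- by exists z0.
- by apply: continuous_subspaceT => z; exact: cvg_snd.
have tK z : K z -> zm.2 <= z.2 /\ z.2 <= 1.
  move=> Kz; split; first by apply: zmin; exact: mem_set.
  by have [_ /=] := KS z Kz; rewrite in_itv/= => /andP[].
have tm : -1 < zm.2.
  by have [_ /=] := KS zm (set_mem Kzm); rewrite in_itv/= => /andP[].
have [C HC] := vb _ tm; exists C => z w Kz Kw.
have [z1 z2] := tK z Kz; have [w1 w2] := tK w Kw.
have n1 : `|z.1 - w.1| <= `|z - w| by rewrite [leRHS]prod_normE le_max lexx.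
have n2 : `|z.2 - w.2| <= `|z - w| by rewrite [leRHS]prod_normE le_max lexx orbT.
have H i := HC z w `|z - w| i z1 w1 z2 w2 n1 n2.
apply/rV_norm_le; first exact: le_trans (H ord0).
by move=> i; rewrite !mxE; exact: H.
Qed.
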